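(* Consider enhanced oriented site percolation on $\mathbb Z^2$ with parameters $p,q\in[0,1]$ and critical parameter $p_{\mathrm c}(q)$. For any $q\in(0,1]$, we have $p_{\mathrm c}(q)<p_{\mathrm c}(0)=p_{\mathrm c}^{\mathrm o}$.
   Context: Enhanced oriented percolation. Let $p,q\in[0,1]$. Under the law $\mathbb P_{p,q}$, each site $(x,n)\in\mathbb Z^2$ is open with probability $p$, independently of everything else. All oriented edges $((x,n),(x+1,n))$ and $((x,n),(x,n+1))$ (length one) are open. Additionally, independently for each $n\in\mathbb Z$ (and independently of the sites), the oriented length-two edges $((x,2n),(x,2n+2))$, $x\in\mathbb Z$, are all open simultaneously with probability $q$, and all closed otherwise. There are no other edges. A path is a (finite or infinite) sequence of vertices $(x_i,n_i)_{i\ge0}$ such that each $((x_{i-1},n_{i-1}),(x_i,n_i))$ is one of these oriented edges; it is open if all its edges are open and all its vertices except possibly the first one $(x_0,n_0)$ are open. Write $(0,0)\to\infty$ for the event that there is an infinite open path starting from $(0,0)$. Define \[ p_{\mathrm c}(q)=\inf\{p:\mathbb P_{p,q}((0,0)\to\infty)>0\}. \] The critical parameter of classical oriented site percolation on $\mathbb Z^2$ (the model with $q=0$) is denoted $p_{\mathrm c}^{\mathrm o}$. *)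

(* Defs.v *)
From HB Require Import structures.
From mathcomp Require Import all_boot all_order all_algebra.
From mathcomp Require Import all_classical all_reals all_analysis.
From mathcomp Require Import ring.
Set Implicit Arguments. Unset Strict Implicit. Unset Printing Implicit Defensive.
Import Order.TTheory GRing.Theory Num.Theory.
Import numFieldNormedType.Exports.
Local Open Scope classical_set_scope.
Local Open Scope ring_scope.

(* [I -> bool] with the product sigma-algebra *)
Definition config (I : Type) :=
  g_sigma_algebraType (range (fun i => [set x : I -> bool | x i])).

(* Existence of the product measure: a uniform variable [u] in [a, b[ is
   expanded into independent bits by repeatedly cutting the current interval
   in proportions [v n] (bit [true], left part) and [1 - v n]. *)
Section digit.
Context {R : realType}.
Implicit Types (v : nat -> R) (a b u : R).
Let mu := @lebesgue_measure R.

Fixpoint digit v n a b u : bool :=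
  let m := a + v 0 * (b - a) in
  if n is n'.+1 then
    if u < m then digit (v \o S) n' a m u else digit (v \o S) n' m b u
  else u < m.

Lemma measurable_lt m : measurable [set u : R | u < m].
Proof.
rewrite (_ : [set u | u < m] = `]-oo, m[%classic); first exact: measurable_itv.
by apply/seteqP; split => u /=; rewrite in_itv.
Qed.

Lemma measurable_digit v n a b : measurable [set u | digit v n a b u].
Proof.
elim: n v a b => [|n IH] v a b /=; first exact: measurable_lt.
set m := a + _.
rewrite (_ : [set _ | _] =
  ([set u | u < m] `&` [set u | digit (v \o S) n a m u]) `|`
  (~` [set u | u < m] `&` [set u | digit (v \o S) n m b u])); last first.
  apply/seteqP; split => u /=; case: (u < m).
  - by left.
  - by right.
  - by case=> [[]//|[]].
  - by case=> [[]//|[]].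
by apply: measurableU; apply: measurableI => //;
  [exact: measurable_lt | apply: measurableC; exact: measurable_lt].
Qed.

Definition block v (A : nat -> bool -> bool) n a b :=
  [set u | a <= u < b /\ forall k, (k < n)%N -> A k (digit v k a b u)].

Lemma measure_block v A n a b : (forall k, 0 <= v k <= 1) -> a <= b ->
  measurable (block v A n a b) /\
  mu (block v A n a b) = ((b - a) * \prod_(k < n)
    ((if A k true then v k else 0) + (if A k false then 1 - v k else 0)))%:E.
Proof.
elim: n v A a b => [|n IH] v A a b v01 ab.
  rewrite (_ : block _ _ _ _ _ = `[a, b[%classic); last first.
    apply/seteqP; split => u; rewrite /block /= in_itv /=; first by case.
    by move=> ->; split.
  split; first exact: measurable_itv.
  rewrite big_ord0 mulr1 /mu lebesgue_measure_itv /= lte_fin.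
  by case: ltgtP ab => // -> _; rewrite subrr.
pose m := a + v 0 * (b - a).
have /andP[v0 v1] := v01 0.
have am : a <= m by rewrite /m lerDl mulr_ge0 // subr_ge0.
have mb : m <= b.
  rewrite /m -lerBrDl -[leRHS]mul1r ler_wpM2r // subr_ge0 //.
have v01' k : 0 <= (v \o S) k <= 1 by exact: v01.
have [mL eL] := IH (v \o S) (fun k => A k.+1) a m v01' am.
have [mR eR] := IH (v \o S) (fun k => A k.+1) m b v01' mb.
pose L := if A 0 true then block (v \o S) (fun k => A k.+1) n a m else set0.
pose Q := if A 0 false then block (v \o S) (fun k => A k.+1) n m b else set0.
have mL' : measurable L by rewrite /L; case: ifP.
have mQ' : measurable Q by rewrite /Q; case: ifP.
have -> : block v A n.+1 a b = L `|` Q.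
  apply/seteqP; split => u.
    move=> [/andP[au ub] H]; have := H 0 isT => /=; rewrite -/m => A0.
    have [um|mu'] := ltP u m; rewrite ?um ?ltNge ?mu' /= in A0.
      left; rewrite /L A0; split; first by rewrite au um.
      by move=> k kn; have := H k.+1 kn; rewrite /= -/m um.
    right; rewrite /Q A0; split; first by rewrite mu' ub.
    by move=> k kn; have := H k.+1 kn; rewrite /= -/m ltNge mu'.
  case; rewrite /L /Q; case: ifP => // A0 [/andP[l r] H]; split.
  - by rewrite l (lt_le_trans r mb).
  - by move=> [|k] kn /=; rewrite -/m r //; exact: H.
  - by rewrite r (le_trans am l).
  - by move=> [|k] kn /=; rewrite -/m ltNge l //=; exact: H.
split; first exact: measurableU.
have -> : mu (L `|` Q) = (mu L + mu Q)%E.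
  apply: measureU => //; apply/seteqP; split => // u [].
  rewrite /L /Q; case: ifP => // _; case: ifP => // _.
  by move=> [/andP[_ h] _] [/andP[h' _] _]; move: (lt_le_trans h h'); rewrite ltxx.
have -> : mu L = ((if A 0 true then v 0 else 0) * (b - a) *
   \prod_(k < n) ((if A k.+1 true then (v \o S) k else 0) +
     (if A k.+1 false then 1 - (v \o S) k else 0)))%:E.
  rewrite /L; case: ifP => _; last by rewrite /mu measure0 !mul0r.
  by rewrite eL /m addrAC subrr add0r.
have -> : mu Q = ((if A 0 false then 1 - v 0 else 0) * (b - a) *
   \prod_(k < n) ((if A k.+1 true then (v \o S) k else 0) +
     (if A k.+1 false then 1 - (v \o S) k else 0)))%:E.
  rewrite /Q; case: ifP => _; last by rewrite /mu measure0 !mul0r.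
  by rewrite eR; congr (_%:E); congr (_ * _); rewrite /m; ring.
rewrite -EFinD big_ord_recl /=; congr (_%:E).
by rewrite -!mulrDl mulrCA mulrA.
Qed.

End digit.

(* Mutually independent coordinates, with coordinate [i] equal to [true] with
   probability [w i], expressed on finite cylinders.  By [bernoulli_law_exists]
   and [bernoulli_law_unique] below, this characterizes the product measure of
   the Bernoulli laws of parameters [w i] when all [w i] lie in [0, 1]. *)
Definition bernoulli_law (I : choiceType) (R : realType) (w : I -> R)
    (P : probability (config I) R) : Prop :=
  forall (J : seq I) (e : I -> bool), uniq J ->
    P [set x | forall i, i \in J -> x i = e i] =
    (\prod_(i <- J) if e i then w i else 1 - w i)%:E.

Section unif01.
Context {R : realType}.

Let m : {measure set (measurableTypeR R) -> \bar R} :=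
  mrestr lebesgue_measure (measurable_itv `[(0 : R), 1[).

Definition unif01 : set (measurableTypeR R) -> \bar R := m.

HB.instance Definition _ := isMeasure.Build _ (measurableTypeR R) R unif01
  (measure0 m) (measure_ge0 m) (@measure_semi_sigma_additive _ _ _ m).

Let unif01_setT : unif01 setT = 1%E.
Proof.
rewrite /unif01 /= /mrestr setTI.
by rewrite lebesgue_measure_itv /= lte_fin ltr01 oppr0 adde0.
Qed.

HB.instance Definition _ :=
  Measure_isProbability.Build _ _ _ unif01 unif01_setT.

End unif01.

Section existence.
Context {R : realType} {I : countType} (w : I -> R).
Hypothesis w01 : forall i, 0 <= w i <= 1.

Let v (k : nat) : R := if pickle_inv k is Some i then w i else 0.

Let v01 k : 0 <= v k <= 1.
Proof. by rewrite /v; case: pickle_inv => [i|]; rewrite ?w01// lexx ler01. Qed.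

Definition digits (u : measurableTypeR R) : config I := fun i => digit v (pickle i) 0 1 u.

Let measurable_digits : measurable_fun setT digits.
Proof.
apply: (@measurability _ _ _ _ setT digits
  (range (fun i => [set x : I -> bool | x i]))) => //.
move=> _ [_ [i _ <-] <-]; rewrite setTI; exact: measurable_digit.
Qed.

HB.instance Definition _ :=
  isMeasurableFun.Build _ _ _ _ digits measurable_digits.

Lemma bernoulli_law_exists :
  exists P : probability (config I) R, bernoulli_law w P.
Proof.
exists (distribution unif01 digits) => J e uJ.
pose A k b := if pickle_inv k is Some i then (i \in J) ==> (b == e i) else true.
have [n Jn] : exists n, forall i, i \in J -> (pickle i < n)%N.
  exists (\max_(i <- J) pickle i).+1 => i iJ.
  by rewrite ltnS (bigD1_seq i) //= leq_maxl.
set C := [set x | _].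
transitivity (lebesgue_measure ((digits @^-1` C) `&` `[(0 : R), 1[%classic)).
  by [].
rewrite (_ : _ `&` _ = block v A n 0 1); last first.
  apply/seteqP; split => u; rewrite /block /= in_itv /=.
    move=> [H ->]; split => // k _; rewrite /A.
    case E: pickle_inv => [i|//]; apply/implyP => iJ; rewrite -(H _ iJ) /digits.
    by have := pickle_invK (T := I) k; rewrite E /= => ->.
  move=> [-> H]; split => // i iJ; have := H _ (Jn _ iJ).
  by rewrite /A pickleK_inv iJ /= => /eqP.
have [_ ->] := measure_block A n v01 ler01.
rewrite subr0 mul1r; congr (_%:E).
pose f k := (if A k true then v k else 0) + (if A k false then 1 - v k else 0).
rewrite -(big_mkord xpredT f) (bigID (mem (map pickle J))) /=.
rewrite [X in _ * X]big1 ?mulr1; last first.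
  move=> k kJ; rewrite /f; suff A1 b : A k b by rewrite !A1 addrC subrK.
  rewrite /A; case E: pickle_inv => [i|//]; apply/implyP => iJ.
  case/negP: kJ; apply/mapP; exists i => //.
  by have := pickle_invK (T := I) k; rewrite E.
rewrite -big_filter (perm_big (map pickle J)) /=; last first.
  apply: uniq_perm.
  - by apply: filter_uniq; exact: iota_uniq.
  - by rewrite map_inj_uniq //; exact: (pcan_inj pickleK).
  move=> k; rewrite mem_filter mem_index_iota /=.
  by case: mapP => // -[i iJ ->]; exact: Jn.
rewrite big_map big_seq [RHS]big_seq; apply: eq_bigr => i iJ.
by rewrite /f /A /v pickleK_inv iJ /=; case: (e i); rewrite ?addr0 ?add0r.
Qed.

End existence.

Lemma bernoulli_law_unique (I : choiceType) (R : realType) (w : I -> R)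
    (P Q : probability (config I) R) : bernoulli_law w P -> bernoulli_law w Q ->
  forall A, measurable A -> P A = Q A.
Proof.
move=> hP hQ A mA.
pose cyl (J : seq I) : set (config I) := [set x | forall i, i \in J -> x i = true].
apply: (@measure_unique _ _ _ (range cyl) (fun=> setT)) => //.
- rewrite eqEsubset; split; apply: smallest_sub => //.
  + move=> _ [i _ <-]; apply: sub_sigma_algebra; exists [:: i] => //.
    apply/seteqP; split => x /=; first by apply; rewrite inE.
    by move=> xi j; rewrite inE => /eqP ->.
  + exact: sigma_algebra_measurable.
  + move=> _ [J _ <-]; elim: J => [|j J IH].
      rewrite (_ : cyl _ = setT); first exact: measurableT.
      by apply/seteqP; split => // x _ i; rewrite in_nil.
    rewrite (_ : cyl _ = [set x : config I | x j] `&` cyl J); last first.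
      apply/seteqP; split => x /=.
        move=> H; split; first by apply: H; rewrite inE eqxx.
        by move=> i iJ; apply: H; rewrite inE iJ orbT.
      by move=> [xj H] i; rewrite inE => /orP[/eqP -> //|]; exact: H.
    by apply: measurableI => //; apply: sub_sigma_algebra; exists j.
- move=> _ _ [J _ <-] [K _ <-]; exists (J ++ K) => //.
  apply/seteqP; split => x /=.
    by move=> H; split => i iJ; apply: H; rewrite mem_cat iJ ?orbT.
  by move=> [H1 H2] i; rewrite mem_cat => /orP[]; [exact: H1|exact: H2].
- by move=> _; exists [::] => //; apply/seteqP; split.
- by apply/seteqP; split => // x _; exists 0%N.
- move=> _ [J _ <-].
  have -> : cyl J = [set x | forall i, i \in undup J -> x i = (fun=> true) i].
    by apply/seteqP; split => x H i; have := H i; rewrite mem_undup.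
  exact: etrans (hP _ (fun=> true) (undup_uniq J))
                (esym (hQ _ (fun=> true) (undup_uniq J))).
- move=> _; apply: (@le_lt_trans _ _ 1%E); last by rewrite ltry.
  exact: probability_le1.
Qed.

(* When some [w i] is outside [0, 1] this is an arbitrary default value. *)
Definition bernoulli_product (I : countType) (R : realType) (w : I -> R) :
    probability (config I) R :=
  get [set P : probability (config I) R | bernoulli_law w P].

Lemma bernoulli_productP (I : countType) (R : realType) (w : I -> R) :
  (forall i, 0 <= w i <= 1) -> bernoulli_law w (bernoulli_product w).
Proof. by move=> /bernoulli_law_exists[P wP]; exact: (@getI _ _ P wP). Qed.

Definition vertex : Type := (int * int)%type.

Definition unit_edge (u v : vertex) : Prop :=
  v = (u.1 + 1, u.2) \/ v = (u.1, u.2 + 1).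

Definition long_edge (n : int) (u v : vertex) : Prop :=
  u.2 = 2 * n /\ v = (u.1, 2 * n + 2).

(* The initial vertex of the path is not required to be open. *)
Definition connected_to_infinity (open_edge : vertex -> vertex -> Prop)
    (open_vertex : vertex -> bool) (o : vertex) : Prop :=
  exists gamma : nat -> vertex, gamma 0%N = o /\
    forall i, open_edge (gamma i) (gamma i.+1) /\ open_vertex (gamma i.+1).

(* In a configuration, coordinate [inl u] is the state of the vertex [u], and
   coordinate [inr n] the common state of the edges ((x, 2n), (x, 2n+2)). *)
Definition enhanced_config := config (vertex + int).

Definition enhanced_law (R : realType) (p q : R) :
    probability enhanced_config R :=
  bernoulli_product (fun i : vertex + int => if i is inl _ then p else q).

Definition enhanced_open_edge (x : enhanced_config) (u v : vertex) : Prop :=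
  unit_edge u v \/ exists n : int, x (inr n) /\ long_edge n u v.

Definition enhanced_percolation : set enhanced_config :=
  [set x | connected_to_infinity (enhanced_open_edge x)
             (fun u => x (inl u)) (0, 0)].

Definition pc (R : realType) (q : R) : R :=
  inf [set p : R | 0 <= p <= 1 /\ (0 < enhanced_law p q enhanced_percolation)%E].

Definition oriented_law (R : realType) (p : R) :
    probability (config vertex) R :=
  bernoulli_product (fun _ : vertex => p).

Definition oriented_percolation : set (config vertex) :=
  [set x | connected_to_infinity unit_edge x (0, 0)].

Definition pc_oriented (R : realType) : R :=
  inf [set p : R | 0 <= p <= 1 /\ (0 < oriented_law p oriented_percolation)%E].

(* Main.v *)
(** The idea is that the long edges lower the asymptotic speed of the leftmost path, and that two different speeds can
be played against each other in a renormalisation argument which only reads a finite box, so that it still applies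
slightly below [pc 0].

Let [sigma] and [alpha] be the speeds at [p = pc 0] of the leftmost path started from a half line, without and with
long edges (suprema of superadditive expectations). Percolation above [pc 0], the symmetry of the two axes and continuity
give [sigma <= 2]; at a positive density of times a long edge saves one column, so [alpha < sigma].

Paths with long edges follow lines of slope [alpha]. Bypassing each bad stretch along one of many independent lines
of slope [sigma] free of long edges, a multiscale construction makes the failure probability at some length [n], for a
slope close to [alpha], smaller than any prescribed power of [n]. The lines of slope [sigma] are independent of the
environment of long edges.

A layer of [n] rows, in an environment where a line of slope near [alpha] exists with high quenched probability, is
crossed from one cell to both neighbouring cells of the next layer: the path jumps onto that line, which then moves to the
left of the cell axis, and leaves it along lines of slope [sigma]. In a bad environment one crosses along a fixed vector,
at a polynomial cost. The layers thus dominate an oriented percolation whose rows have random densities with small inverse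
moments, which survives by a second multiscale argument. *)
Require Import Defs.
From HB Require Import structures.
From mathcomp Require Import all_boot all_order ssralg ssrnum ssrint archimedean.
From mathcomp Require Import boolp classical_sets reals.
From mathcomp Require Import zify ring lra.

Set Implicit Arguments. Unset Strict Implicit. Unset Printing Implicit Defensive.
Import Order.TTheory GRing.Theory Num.Theory.
Local Open Scope ring_scope.

(** * Finite expectations over independent bits *)

Section Calculus.
Context {R : realType} {I : eqType}.
Implicit Types (w : I -> R) (s : seq I) (b x y : I -> bool) (f g : (I -> bool) -> R)
  (D : I -> Prop) (A B : (I -> bool) -> Prop).

(** The bit of a row of long edges is shared by all abscissas, so under the annealed law
    neighbouring cells are never independent. Conditioning on the bits restores independence, but a
    bad stretch of bits then spoils a whole row of cells at once; hence a percolation with random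
    row densities instead of a comparison with independent sites. Crossing a bad layer along a fixed
    vector has a probability [v] of order [n ^ -2], and the tenth inverse moment required of the
    rows turns this cost into the condition that a line with long edges fails with probability below
    a small multiple of [v ^ 21]. This is why failure probabilities must beat a power of the length,
    here 43. Percolation at [pc 0] itself is not assumed: only the mean displacements, polynomials
    in [p] at bounded length, are carried to the limit from above. Up to the last part every
    probability is a finite expectation [Ex]; the product measure enters only through cylinders and
    a compactness argument. *)

Definition upd x i c : I -> bool := fun j => if j == i then c else x j.

(** Coordinates outside [s] keep the value given by [b]. A coordinate listed twice is drawn twice
    and only the last draw counts, so repetitions in [s] are harmless. *)
Fixpoint Ex w s f b : R := if s is i :: s' then
    w i * Ex w s' f (upd b i true) + (1 - w i) * Ex w s' f (upd b i false)
  else f b.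

Definition prob_weight w := forall i, 0 <= w i <= 1.

Definition dep f D := forall x y, (forall i, D i -> x i = y i) -> f x = f y.
Definition depP A D := forall x y, (forall i, D i -> x i = y i) -> A x -> A y.

Definition ind A : (I -> bool) -> R := fun x => (`[< A x >])%:R.

Definition Pr w s A b : R := Ex w s (ind A) b.

Definition glue D x y : I -> bool := fun i => if `[< D i >] then x i else y i.

Lemma ind_ge0 A x : 0 <= ind A x. Proof. by rewrite /ind ler0n. Qed.
Lemma ind_le1 A x : ind A x <= 1. Proof. by rewrite /ind; case: asbool; rewrite ?lexx ?ler01. Qed.
Lemma ind_t A x : A x -> ind A x = 1.
Proof. by move=> h; rewrite /ind asboolT. Qed.
Lemma ind_f A x : ~ A x -> ind A x = 0.
Proof. by move=> h; rewrite /ind asboolF. Qed.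
Lemma ind_mono A B x : (A x -> B x) -> ind A x <= ind B x.
Proof.
move=> h; have [a|a] := pselect (A x); last by rewrite (ind_f a) ind_ge0.
by rewrite (ind_t a) (ind_t (h a)).
Qed.
Lemma ind_notE A x : ind (fun x => ~ A x) x = 1 - ind A x.
Proof.
have [a|a] := pselect (A x); first by rewrite ind_f ?ind_t ?subrr //; tauto.
by rewrite ind_t // ind_f // subr0.
Qed.
Lemma ind_andE A B x : ind (fun x => A x /\ B x) x = ind A x * ind B x.
Proof.
have [a|a] := pselect (A x); last by rewrite !(ind_f a) mul0r ind_f //; tauto.
have [c|c] := pselect (B x); last by rewrite !(ind_f c) mulr0 ind_f //; tauto.
by rewrite !ind_t ?mulr1.
Qed.

Lemma dep_ind A D : depP A D -> dep (ind A) D.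
Proof.
move=> h x y xy; apply/le_anti/andP; split; apply: ind_mono; first exact: h.
by apply: h => i /xy ->.
Qed.

Lemma depP_sub A D D' : (forall i, D i -> D' i) -> depP A D -> depP A D'.
Proof. by move=> h d x y xy; apply: d => i /h; apply: xy. Qed.

Lemma depP_not A D : depP A D -> depP (fun x => ~ A x) D.
Proof. by move=> h x y xy na ay; apply: na; apply: h ay => i /xy. Qed.

Lemma eq_Ex w s f g b : (forall x, f x = g x) -> Ex w s f b = Ex w s g b.
Proof. by move=> h; elim: s b => //= i s IH b; rewrite !IH. Qed.

Lemma ExD w s f g b : Ex w s (fun x => f x + g x) b = Ex w s f b + Ex w s g b.
Proof. by elim: s b => //= i s IH b; rewrite !IH; ring. Qed.

Lemma ExZ w s c f b : Ex w s (fun x => c * f x) b = c * Ex w s f b.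
Proof. by elim: s b => //= i s IH b; rewrite !IH; ring. Qed.

Lemma ExZr w s c f b : Ex w s (fun x => f x * c) b = Ex w s f b * c.
Proof. by elim: s b => //= i s IH b; rewrite !IH; ring. Qed.

Lemma Ex_cst w s c b : Ex w s (fun=> c) b = c.
Proof. by elim: s b => //= i s IH b; rewrite !IH; ring. Qed.

Lemma ExN w s f b : Ex w s (fun x => - f x) b = - Ex w s f b.
Proof. by elim: s b => //= i s IH b; rewrite !IH; ring. Qed.

Lemma ExB w s f g b : Ex w s (fun x => f x - g x) b = Ex w s f b - Ex w s g b.
Proof. by rewrite ExD ExN. Qed.

Lemma Ex_sum (J : Type) (r : seq J) w s (F : J -> (I -> bool) -> R) b :
  Ex w s (fun x => \sum_(j <- r) F j x) b = \sum_(j <- r) Ex w s (F j) b.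
Proof.
elim: r => [|j r IH]; first by rewrite big_nil -[RHS](Ex_cst w s _ b); apply: eq_Ex => x; rewrite big_nil.
by rewrite big_cons -IH -ExD; apply: eq_Ex => x; rewrite big_cons.
Qed.

Lemma Ex_le w s f g b : prob_weight w -> (forall x, f x <= g x) ->
  Ex w s f b <= Ex w s g b.
Proof.
move=> hw h; elim: s b => //= i s IH b; have /andP[a c] := hw i.
by apply: lerD; apply: ler_wpM2l => //; rewrite subr_ge0.
Qed.

Lemma Ex_ge0 w s f b : prob_weight w -> (forall x, 0 <= f x) -> 0 <= Ex w s f b.
Proof. by move=> hw h; rewrite -(Ex_cst w s 0 b); apply: Ex_le. Qed.

Lemma Pr_ge0 w s A b : prob_weight w -> 0 <= Pr w s A b.
Proof. by move=> hw; apply: Ex_ge0 => // x; apply: ind_ge0. Qed.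

Lemma Pr_le1 w s A b : prob_weight w -> Pr w s A b <= 1.
Proof. by move=> hw; rewrite -(Ex_cst w s 1 b); apply: Ex_le => // x; apply: ind_le1. Qed.

Lemma Pr_sub w s A B b : prob_weight w -> (forall x, A x -> B x) ->
  Pr w s A b <= Pr w s B b.
Proof. by move=> hw h; apply: Ex_le => // x; apply: ind_mono; apply: h. Qed.

Lemma Pr_not w s A b : Pr w s (fun x => ~ A x) b = 1 - Pr w s A b.
Proof. by rewrite -[in RHS](Ex_cst w s 1 b) -ExB; apply: eq_Ex => x; rewrite ind_notE. Qed.

Lemma PrU w s A B b : prob_weight w ->
  Pr w s (fun x => A x \/ B x) b <= Pr w s A b + Pr w s B b.
Proof.
move=> hw; rewrite -ExD; apply: Ex_le => // x.
have [a|a] := pselect (A x).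
  by rewrite (ind_t a) ind_t ?lerDl ?ind_ge0 //; left.
by rewrite (ind_f a) add0r; apply: ind_mono => -[|].
Qed.

Lemma Pr_bigU (J : eqType) (r : seq J) w s (A : J -> (I -> bool) -> Prop) b : prob_weight w ->
  Pr w s (fun x => exists2 j, j \in r & A j x) b <= \sum_(j <- r) Pr w s (A j) b.
Proof.
move=> hw; rewrite -Ex_sum; apply: Ex_le => // x.
have [[j jr a]|a] := pselect (exists2 j, j \in r & A j x).
  by rewrite ind_t; [|exists j]; rewrite // (big_rem j jr) /= (ind_t a) lerDl sumr_ge0 // => k _; apply: ind_ge0.
by rewrite ind_f // sumr_ge0 // => k _; apply: ind_ge0.
Qed.

Lemma Pr_bigU_le (J : eqType) (r : seq J) w s (A : J -> (I -> bool) -> Prop) b c : prob_weight w ->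
  (forall j, j \in r -> Pr w s (A j) b <= c) ->
  Pr w s (fun x => exists2 j, j \in r & A j x) b <= (size r)%:R * c.
Proof.
move=> hw h; apply: le_trans (Pr_bigU _ _ _ _ hw) _.
by rewrite big_seq mulr_natl; apply: le_trans (ler_sum _ h) _; rewrite -big_seq big_const_seq count_predT iter_addr_0.
Qed.

Lemma eq_Ex_base w s f D b b' : dep f D -> (forall i, D i -> i \notin s -> b i = b' i) ->
  Ex w s f b = Ex w s f b'.
Proof.
move=> d; elim: s b b' => [|i s IH] b b' h /=; first by apply: d => i Di; apply: h.
have H c : Ex w s f (upd b i c) = Ex w s f (upd b' i c).
  apply: IH => j Dj js; rewrite /upd; case: eqP => // ji.
  by apply: h => //; rewrite inE negb_or js andbT; apply/eqP.
by rewrite !H.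
Qed.

Lemma upd_comm x i j c d : i != j -> upd (upd x i c) j d = upd (upd x j d) i c.
Proof.
by move=> ij; apply: funext => k; rewrite /upd; case: (k =P j) => // ->; rewrite eq_sym (negbTE ij).
Qed.

Lemma upd_upd x i c d : upd (upd x i c) i d = upd x i d.
Proof. by apply: funext => k; rewrite /upd; case: eqP. Qed.

Lemma Ex_comm1 w i s f b : Ex w [:: i] (Ex w s f) b = Ex w s (Ex w [:: i] f) b.
Proof.
elim: s b => //= j s IH b; have [ij|ij] := eqVneq i j.
  subst i; rewrite -(IH (upd b j true)) -(IH (upd b j false)) /= !upd_upd; ring.
rewrite -(IH (upd b j true)) -(IH (upd b j false)) /= !(upd_comm _ _ _ ij); ring.
Qed.

Lemma Ex_comm w s t f b : Ex w s (Ex w t f) b = Ex w t (Ex w s f) b.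
Proof.
elim: s b => //= i s IH b; rewrite !IH.
exact: (Ex_comm1 w i t (Ex w s f) b).
Qed.

(** Integrating over [s] and then over [t] can be done in either order, and the inner integral is
    already constant because all coordinates read by [f] have been drawn. *)
Lemma eq_Ex_coord w s t f D b b' : dep f D -> (forall i, D i -> i \in s) ->
  (forall i, D i -> i \in t) -> Ex w s f b = Ex w t f b'.
Proof.
move=> d hs ht.
have e1 : Ex w t (Ex w s f) b' = Ex w s f b.
  rewrite -[RHS](Ex_cst w t _ b'); apply: eq_Ex => x.
  by apply: (eq_Ex_base _ d) => i /hs ->.
have e2 : Ex w s (Ex w t f) b' = Ex w t f b'.
  rewrite -[RHS](Ex_cst w s _ b'); apply: eq_Ex => x.
  by apply: (eq_Ex_base _ d) => i /ht ->.
by rewrite -e1 -e2 Ex_comm.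
Qed.

Lemma glue_upd D x y i c d :
  glue D (upd x i c) (upd y i d) = upd (glue D x y) i (if `[< D i >] then c else d).
Proof. by apply: funext => j; rewrite /glue /upd; case: eqP => [->|]. Qed.

Lemma Ex_fubini_base w s f D b1 b2 :
  Ex w s (fun x => Ex w s (fun y => f (glue D x y)) b2) b1 = Ex w s f (glue D b1 b2).
Proof.
elim: s b1 b2 => //= i s IH b1 b2.
rewrite !ExD !ExZ !IH !glue_upd.
case: asboolP => _; ring.
Qed.

(** The form of independence used for conditioning: what is read on [D] and what is read outside may
    come from two separate draws. Later [D] is the part of space already explored. *)
Lemma Ex_fubini w s f D b :
  Ex w s f b = Ex w s (fun x => Ex w s (fun y => f (glue D x y)) b) b.
Proof.
rewrite Ex_fubini_base; congr (Ex _ _ _ _).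
by apply: funext => i; rewrite /glue; case: ifP.
Qed.

Lemma glue_in D x y i : D i -> glue D x y i = x i.
Proof. by move=> h; rewrite /glue asboolT. Qed.
Lemma glue_out D x y i : ~ D i -> glue D x y i = y i.
Proof. by move=> h; rewrite /glue asboolF. Qed.

Lemma Ex_indep w s f g D D' b : dep f D -> dep g D' -> (forall i, D i -> D' i -> False) ->
  Ex w s (fun x => f x * g x) b = Ex w s f b * Ex w s g b.
Proof.
move=> df dg dd; rewrite (Ex_fubini _ _ _ D) -ExZr; apply: eq_Ex => x.
rewrite -ExZ; apply: eq_Ex => y; congr (_ * _).
  by apply: df => i Di; rewrite glue_in.
by apply: dg => i Di; rewrite glue_out // => /dd; apply.
Qed.

Lemma Pr_indep w s A B D D' b : depP A D -> depP B D' -> (forall i, D i -> D' i -> False) ->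
  Pr w s (fun x => A x /\ B x) b = Pr w s A b * Pr w s B b.
Proof.
move=> /dep_ind df /dep_ind dg dd; rewrite -(Ex_indep _ _ _ df dg dd).
by apply: eq_Ex => x; rewrite ind_andE.
Qed.

Lemma Pr_all_indep (J : eqType) (r : seq J) w s (A : J -> (I -> bool) -> Prop) (D : J -> I -> Prop) b c :
  prob_weight w -> uniq r -> (forall j, j \in r -> depP (A j) (D j)) ->
  (forall j k i, j \in r -> k \in r -> j <> k -> D j i -> D k i -> False) ->
  0 <= c -> (forall j, j \in r -> Pr w s (A j) b <= c) ->
  Pr w s (fun x => forall j, j \in r -> A j x) b <= c ^+ size r.
Proof.
move=> hw; elim: r => [|j r IH] /= ur d dd c0 h; first exact: Pr_le1.
have /andP[jr ur'] := ur.
have -> : Pr w s (fun x => forall k, k \in j :: r -> A k x) b =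
  Pr w s (fun x => A j x /\ forall k, k \in r -> A k x) b.
  apply: eq_Ex => x; congr ((nat_of_bool _)%:R); apply/asboolP/asboolP => [H|[a H] k].
    by split=> [|k kr]; apply: H; rewrite inE ?eqxx ?kr ?orbT.
  by rewrite inE => /orP[/eqP ->|/H].
rewrite (Pr_indep _ _ (D := D j) (D' := fun i => exists2 k, k \in r & D k i)); last 1 first.
- move=> i Di [k kr Dk]; apply: dd (Di) (Dk); rewrite ?inE ?eqxx ?kr ?orbT //.
  by move=> jk; rewrite jk kr in jr.
- rewrite exprS; apply: ler_pM; rewrite ?Pr_ge0 //; first by apply: h; rewrite inE eqxx.
  apply: IH => //.
  + by move=> k kr; apply: d; rewrite inE kr orbT.
  + by move=> k l i kr lr; apply: dd; rewrite inE ?kr ?lr orbT.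
  + by move=> k kr; apply: h; rewrite inE kr orbT.
- by apply: d; rewrite inE eqxx.
- move=> x y xy H k kr; have kr' : k \in j :: r by rewrite inE kr orbT.
  by apply: d kr' _ _ _ (H k kr) => i Di; apply: xy; exists k.
Qed.


Definition incr f := forall x y, (forall i, x i -> y i) -> f x <= f y.
Definition incrP A := forall x y, (forall i, x i -> y i) -> A x -> A y.

Lemma incr_ind A : incrP A -> incr (ind A).
Proof. by move=> h x y xy; apply: ind_mono; apply: h. Qed.

Lemma upd_le x y i c : (forall j, x j -> y j) -> forall j, upd x i c j -> upd y i c j.
Proof. by move=> h j; rewrite /upd; case: eqP => // _; apply: h. Qed.

(** No coupling is built: at each coordinate the weight moved from [false] to [true] meets a larger
    conditional expectation ([FT]). *)
Lemma Ex_incr w w' s f b b' : prob_weight w -> prob_weight w' -> incr f ->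
  (forall i, i \in s -> w i <= w' i) -> (forall i, b i -> b' i) ->
  Ex w s f b <= Ex w' s f b'.
Proof.
move=> hw hw' fi; elim: s b b' => [|i s IH] b b' ww bb /=; first exact: fi.
have ww' j : j \in s -> w j <= w' j by move=> js; apply: ww; rewrite inE js orbT.
have T := IH _ _ ww' (upd_le (i := i) (c := true) bb).
have F := IH _ _ ww' (upd_le (i := i) (c := false) bb).
have FT : Ex w' s f (upd b' i false) <= Ex w' s f (upd b' i true).
  have : forall b1 b2, (forall j, b1 j -> b2 j) -> Ex w' s f b1 <= Ex w' s f b2.
    elim: (s) => [|j s' IH'] b1 b2 h /=; first exact: fi.
    have /andP[a c] := hw' j.
    by apply: lerD; apply: ler_wpM2l; rewrite ?subr_ge0 //; apply: IH'; apply: upd_le.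
  by apply=> j; rewrite /upd; case: eqP.
have /andP[a c] := hw i; have wi : w i <= w' i by apply: ww; rewrite inE eqxx.
set P := Ex w s f _ in T *; set Q := Ex w s f _ in F *.
set P' := Ex w' s f _ in T FT *; set Q' := Ex w' s f _ in F FT *.
apply: (@le_trans _ _ (w i * P' + (1 - w i) * Q')).
  by apply: lerD; apply: ler_wpM2l; rewrite ?subr_ge0.
by rewrite -subr_ge0 (_ : _ - _ = (w' i - w i) * (P' - Q')) ?mulr_ge0 ?subr_ge0 //; ring.
Qed.

(** For an increasing [f], a coordinate frozen at [false] is the worst case. An upper bound
    therefore holds for every list [s], even one that omits sites. *)
Lemma Ex_active w s t f b : prob_weight w -> incr f ->
  (forall i, i \in t -> b i = false) -> Ex w s f b <= Ex w (t ++ s) f b.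
Proof.
move=> hw fi; elim: t => //= i t IH h.
have bi : b i = false by apply: h; rewrite inE eqxx.
apply: (@le_trans _ _ (Ex w (t ++ s) f b)).
  by apply: IH => j jt; apply: h; rewrite inE jt orbT.
have H c : Ex w (t ++ s) f b <= Ex w (t ++ s) f (upd b i c).
  by apply: Ex_incr => // j; rewrite /upd; case: eqP => // ->; rewrite bi.
have /andP[a c] := hw i.
set X := Ex _ _ _ _ in H *.
rewrite (_ : X = w i * X + (1 - w i) * X); last by ring.
by apply: lerD; apply: ler_wpM2l; rewrite ?subr_ge0.
Qed.

Lemma Ex_cont w w' s f b (M d : R) : prob_weight w -> prob_weight w' -> 0 <= M ->
  (forall x, `|f x| <= M) -> (forall i, i \in s -> `|w i - w' i| <= d) ->
  `|Ex w s f b - Ex w' s f b| <= (size s)%:R * (2 * M * d).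
Proof.
move=> hw hw' M0 fM; elim: s b => [|i s IH] b h /=; first by rewrite subrr normr0 mul0r.
have h' j : j \in s -> `|w j - w' j| <= d by move=> js; apply: h; rewrite inE js orbT.
have T := IH (upd b i true) h'; have F := IH (upd b i false) h'.
have di : `|w i - w' i| <= d by apply: h; rewrite inE eqxx.
have B v c : prob_weight v -> `|Ex v s f c| <= M.
  move=> hv; rewrite ler_norml -{1}(Ex_cst v s (- M) c) -{2}(Ex_cst v s M c).
  by apply/andP; split; apply: Ex_le => // x; have := fM x; rewrite ler_norml => /andP[].
have BT := B w' (upd b i true) hw'; have BF := B w' (upd b i false) hw'.
move: T F BT BF; set P := Ex w s f _; set Q := Ex w s f _; set P' := Ex w' s f _; set Q' := Ex w' s f _.
move=> T F BT BF; have /andP[a c] := hw i.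
rewrite (_ : _ - _ = w i * (P - P') + (1 - w i) * (Q - Q') + (w i - w' i) * (P' - Q')); last by ring.
apply: le_trans (ler_normD _ _) _; rewrite -[(size s).+1]addn1 natrD [X in _ <= X]mulrDl mul1r.
apply: lerD.
  apply: le_trans (ler_normD _ _) _; rewrite !normrM (ger0_norm a) (ger0_norm (x := 1 - w i)) ?subr_ge0 //.
  set c0 := _ * _ in T F *.
  by apply: (@le_trans _ _ (w i * c0 + (1 - w i) * c0)); [apply: lerD; apply: ler_wpM2l; rewrite ?subr_ge0 | lra].
rewrite normrM mulrC; apply: ler_pM => //.
by apply: le_trans (ler_normB _ _) _; lra.
Qed.

End Calculus.

Lemma Ex_shift (R : realType) (I J : eqType) (h : I -> J) (w : J -> R) (s : seq I)
    (f : (I -> bool) -> R) (b : J -> bool) : injective h ->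
  Ex w (map h s) (fun x => f (x \o h)) b = Ex (w \o h) s f (b \o h).
Proof.
move=> hi; have U c i d : upd c (h i) d \o h = upd (c \o h) i d.
  by apply: funext => j; rewrite /upd /= (inj_eq hi).
by elim: s b => //= i s IH b; rewrite !IH !U.
Qed.
(** * Oriented percolation with inhomogeneous rows *)

Section Lattice.
Context {R : realType}.

Definition xfalse {I : Type} : I -> bool := fun=> false.

Definition mono (F : seq int -> R) := forall Y Z, {subset Y <= Z} -> F Y <= F Z.

Definition Bn (a : R) (Y : seq int) (F : seq int -> R) : R :=
  Ex (fun=> a) Y (fun x => F [seq k <- Y | x k]) xfalse.

(** The two oriented edges are drawn as staying and moving by one, to the right from even rows and
    to the left from odd rows, so that clusters have no drift. *)
Definition spr (i : nat) (k : int) : seq int := if odd i then [:: k; k - 1] else [:: k; k + 1].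

Definition spread i (Z : seq int) := flatten (map (spr i) Z).

(* Survival probability over [n] rows from [Y], row [i] being open with density [rho i] independently for each site. *)
Fixpoint QS (rho : nat -> R) (n i : nat) (Y : seq int) : R :=
  if n is n'.+1 then Bn (rho i) Y (fun Z => QS rho n' i.+1 (spread i Z))
  else (Y != [::])%:R.

Definition unit_par (rho : nat -> R) := forall i, 0 <= rho i <= 1.

Lemma spread_sub i Y Z : {subset Y <= Z} -> {subset spread i Y <= spread i Z}.
Proof.
by move=> h l /flatten_mapP[k kY lk]; apply/flatten_mapP; exists k => //; apply: h.
Qed.

Lemma Bn_mono a Y Z F : 0 <= a <= 1 -> mono F -> {subset Y <= Z} -> Bn a Y F <= Bn a Z F.
Proof.
move=> ha hF YZ; have hw : prob_weight (fun _ : int => a) by [].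
rewrite /Bn (@eq_Ex_coord _ _ _ _ Z _ (fun k => k \in Y) xfalse xfalse) //.
  by apply: Ex_le => // x; apply: hF => k; rewrite !mem_filter => /andP[-> /YZ].
by move=> x y xy; congr F; apply: eq_in_filter.
Qed.

Lemma Bn_le a Y F G : 0 <= a <= 1 -> (forall Z, F Z <= G Z) -> Bn a Y F <= Bn a Y G.
Proof. by move=> ha h; apply: Ex_le. Qed.

Lemma Bn_cons a k Y F : k \notin Y -> Bn a (k :: Y) F =
  a * Bn a Y (fun Z => F (k :: Z)) + (1 - a) * Bn a Y F.
Proof.
move=> kY; rewrite /Bn /=; congr (_ * _ + _ * _).
  rewrite (@eq_Ex_base _ _ _ _ _ (fun i => i \in k :: Y) _ (upd xfalse k true)) //; last first.
    by move=> x y xy; congr F; rewrite /= !xy ?inE ?eqxx //; congr (if _ then _ :: _ else _);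
      apply: eq_in_filter => j jY; apply: xy; rewrite inE jY orbT.
  have H : forall s b, k \notin s -> b k = true -> Ex (fun=> a) s (fun x => F (if x k then k :: [seq j <- Y | x j] else [seq j <- Y | x j])) b
     = Ex (fun=> a) s (fun x => F (k :: [seq j <- Y | x j])) b.
    elim=> [|i s IH] b /=; first by move=> _ ->.
    rewrite inE negb_or => /andP[ki ks] bk; rewrite !IH // /upd (negbTE ki) //.
  rewrite H //; last by rewrite /upd eqxx.
  apply: (@eq_Ex_base _ _ _ _ _ (fun i => i \in Y)).
    by move=> x y xy; congr (F (_ :: _)); apply: eq_in_filter.
  by move=> i ->.
have H : forall s b, k \notin s -> b k = false -> Ex (fun=> a) s (fun x => F (if x k then k :: [seq j <- Y | x j] else [seq j <- Y | x j])) b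
   = Ex (fun=> a) s (fun x => F [seq j <- Y | x j]) b.
  elim=> [|i s IH] b /=; first by move=> _ ->.
  rewrite inE negb_or => /andP[ki ks] bk; rewrite !IH // /upd (negbTE ki) //.
rewrite H //; last by rewrite /upd eqxx.
apply: (@eq_Ex_base _ _ _ _ _ (fun i => i \in Y)).
  by move=> x y xy; congr F; apply: eq_in_filter.
by move=> i ->.
Qed.

Lemma Bn_undup a Y F : 0 <= a <= 1 -> mono F -> Bn a Y F = Bn a (undup Y) F.
Proof.
by move=> ha hF; apply/le_anti/andP; split; apply: Bn_mono => // k; rewrite mem_undup.
Qed.

Lemma QS_mono rho n i : unit_par rho -> mono (QS rho n i).
Proof.
move=> hr; elim: n i => [|n IH] i Y Z YZ /=.
  case: Y YZ => [|k Y] YZ /=; first exact: ler0n.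
  have := YZ k; rewrite inE eqxx => /(_ isT); case: Z {YZ} => //.
apply: (@le_trans _ _ (Bn (rho i) Z (fun Y => QS rho n i.+1 (spread i Y)))) => //.
by apply: Bn_mono => // Y' Z' h; apply: IH; apply: spread_sub.
Qed.

Lemma QS_ge0 rho n i Y : unit_par rho -> 0 <= QS rho n i Y.
Proof.
move=> hr; elim: n i Y => [|n IH] i Y /=; first exact: ler0n.
by apply: Ex_ge0 => [k|x]; [exact: hr|exact: IH].
Qed.

(** One point is revealed at a time. The gain [e1 - e0] from keeping [k] is nonnegative since [F] is
    increasing, and independent of [A k] since the supports are disjoint; replacing the probability
    of [A k] by the smaller [a] can only lower the value. *)
Lemma domination (I : eqType) (w : I -> R) s b (a : R) (Y : seq int) (F : seq int -> R)
    (A : int -> (I -> bool) -> Prop) (C : int -> I -> Prop) :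
  prob_weight w -> 0 <= a <= 1 -> mono F ->
  (forall k, k \in Y -> depP (A k) (C k)) ->
  (forall k l i, k \in Y -> l \in Y -> k <> l -> C k i -> C l i -> False) ->
  (forall k, k \in Y -> a <= Pr w s (A k) b) ->
  Bn a Y F <= Ex w s (fun x => F [seq k <- Y | `[< A k x >]]) b.
Proof.
move=> hw ha; wlog uY : Y / uniq Y => [H hF d dd h|].
  apply: (@le_trans _ _ (Ex w s (fun x => F [seq k <- undup Y | `[< A k x >]]) b)).
    rewrite Bn_undup //; apply: H => //; first exact: undup_uniq.
    - by move=> k; rewrite mem_undup; apply: d.
    - by move=> k l i; rewrite !mem_undup; apply: dd.
    - by move=> k; rewrite mem_undup; apply: h.
  by apply: Ex_le => // x; apply: hF => k; rewrite !mem_filter mem_undup.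
elim: Y F uY => [|k Y IH] F /=; first by move=> *; rewrite Ex_cst.
move=> /andP[kY uY] hF d dd h.
have [pk dk] := (h k (mem_head _ _), d k (mem_head _ _)).
have hF' : mono (fun Z => F (k :: Z)).
  by move=> Z Z' ZZ; apply: hF => l; rewrite !inE => /orP[-> //|/ZZ ->]; rewrite orbT.
have sY l : l \in Y -> l \in k :: Y by rewrite inE => ->; rewrite orbT.
have IH1 : Bn a Y (fun Z => F (k :: Z)) <= Ex w s (fun x => F (k :: [seq l <- Y | `[< A l x >]])) b.
  apply: IH => //; [by move=> l /sY; apply: d|by move=> l m i /sY ? /sY ?; apply: dd|by move=> l /sY; apply: h].
have IH0 : Bn a Y F <= Ex w s (fun x => F [seq l <- Y | `[< A l x >]]) b.
  apply: IH => //; [by move=> l /sY; apply: d|by move=> l m i /sY ? /sY ?; apply: dd|by move=> l /sY; apply: h].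
rewrite Bn_cons //.
pose G1 (x : I -> bool) := F (k :: [seq l <- Y | `[< A l x >]]).
pose G0 (x : I -> bool) := F [seq l <- Y | `[< A l x >]].
have -> : Ex w s (fun x => F (if `[< A k x >] then k :: [seq l <- Y | `[< A l x >]] else [seq l <- Y | `[< A l x >]])) b
   = Ex w s (fun x => ind (A k) x * (G1 x - G0 x) + G0 x) b.
  by apply: eq_Ex => x; rewrite /ind /G1 /G0; case: asboolP => _; [rewrite mul1r subrK|rewrite mul0r add0r].
have dG : dep (fun x => G1 x - G0 x) (fun i => exists2 l, l \in Y & C l i).
  move=> x y xy; rewrite /G1 /G0.
  have -> : [seq l <- Y | `[< A l x >]] = [seq l <- Y | `[< A l y >]]; last by [].
  apply: eq_in_filter => l lY; apply/asboolP/asboolP; apply: (d l (sY _ lY)) => i Ci; first by apply: xy; exists l.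
  by rewrite xy //; exists l.
rewrite ExD (Ex_indep _ _ _ (dep_ind dk) dG); last first.
  by move=> i Ck [l lY Cl]; apply: dd Ck Cl; rewrite ?mem_head ?sY // => kl; rewrite kl lY in kY.
rewrite ExB -/(Pr w s (A k) b).
set P := Pr _ _ _ _ in pk *; pose e1 := Ex w s G1 b; pose e0 := Ex w s G0 b.
rewrite -/e1 -/e0; rewrite -/e1 in IH1; rewrite -/e0 in IH0.
have e01 : e0 <= e1.
  by apply: Ex_le => // x; apply: hF => l lY; rewrite inE lY orbT.
have /andP[a0 a1] := ha.
apply: (@le_trans _ _ (a * e1 + (1 - a) * e0)).
  by apply: lerD; apply: ler_wpM2l; rewrite ?subr_ge0.
rewrite -subr_ge0 (_ : _ - _ = (P - a) * (e1 - e0)); last by ring.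
by rewrite mulr_ge0 // subr_ge0.
Qed.

End Lattice.

(** * From processes built slab by slab to oriented percolation *)

Section Transfer.
Context {R : realType} {I : eqType} (w : I -> R) (s : seq I) (b : I -> bool).
Context (D : nat -> I -> Prop) (St : Type) (next : nat -> (I -> bool) -> St -> St).
Context (occ : nat -> St -> int -> Prop) (fin : St -> Prop) (rho : nat -> R).

Fixpoint run i n x X := if n is n'.+1 then run i.+1 n' x (next i x X) else X.

Lemma run_dep i n x y X : (forall j X x y, (forall k, D j k -> x k = y k) -> next j x X = next j y X) ->
  (forall j k, (i <= j)%N -> D j k -> x k = y k) -> run i n x X = run i n y X.
Proof.
move=> nd; elim: n i X => //= n IH i X h; rewrite (nd _ _ _ y) => [|k]; last exact: h.
by apply: IH => j k ij; apply: h; apply: ltnW.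
Qed.

(** The cell events may depend on the state [X] produced by the earlier slabs. In slab [i] they are
    replaced by bits of density [rho i] through [domination]; [Ex_fubini] then freezes that slab, so
    that the induction applies to a state that is no longer random. *)
Lemma transfer N n i X (Y : seq int) : prob_weight w -> unit_par rho ->
  (forall j k l, j <> k -> D j l -> D k l -> False) ->
  (forall j X x y, (forall k, D j k -> x k = y k) -> next j x X = next j y X) ->
  (i + n = N)%N ->
  (forall j X (Y : seq int), (j < N)%N -> (forall k, k \in Y -> occ j X k) ->
     exists (A : int -> (I -> bool) -> Prop) (C : int -> I -> Prop),
     [/\ forall k, k \in Y -> depP (A k) (C k),
         forall k l i, k \in Y -> l \in Y -> k <> l -> C k i -> C l i -> False,
         forall k, k \in Y -> rho j <= Pr w s (A k) b &
         forall x k l, k \in Y -> A k x -> l \in spr j k -> occ j.+1 (next j x X) l]) ->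
  (forall X k, occ N X k -> fin X) ->
  (forall k, k \in Y -> occ i X k) ->
  QS rho n i Y <= Pr w s (fun x => fin (run i n x X)) b.
Proof.
move=> hw hr Dd nd + step hfin; elim: n i X Y => [|n IH] i X Y iN hY /=.
  rewrite addn0 in iN; case: Y hY => [|k Y] hY /=; first exact: Pr_ge0.
  rewrite /Pr -[X in _ <= Ex _ _ X _]/(ind (fun _ : I -> bool => fin X)).
  have fX : fin X by apply: (hfin _ k); rewrite -iN; apply: hY; rewrite mem_head.
  by rewrite (@eq_Ex _ _ _ _ _ (fun=> 1)) ?Ex_cst // => x; rewrite ind_t.
have [|A [C [d dd h st]]] := step i X Y _ hY; first by lia.
rewrite /Pr (Ex_fubini _ _ _ (D i)).
apply: le_trans (domination hw (hr i) _ d dd h) _.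
  by move=> Z Z' ZZ; apply: QS_mono => //; apply: spread_sub.
apply: Ex_le => // x.
apply: (le_trans (IH i.+1 (next i x X) _ _ _)); first by lia.
  move=> l /flatten_mapP[k]; rewrite mem_filter => /andP[/asboolP Ak kY] lk.
  exact: st Ak lk.
apply: Pr_sub => // y.
rewrite (nd i X x (glue (D i) x y)) => [|k Dk]; last by rewrite glue_in.
rewrite (@run_dep _ _ y (glue (D i) x y)) // => j k ij Dk.
by rewrite glue_out // => Dik; apply: (Dd j i k) => //; lia.
Qed.

End Transfer.

Section Joint.
Context {R : realType}.
Implicit Types (x : nat * int -> bool) (X : int -> Prop).

Definition rowst x i X : int -> Prop := fun l => exists k, [/\ X k, x (i, k) & l \in spr i k].
Fixpoint ev x i n X := if n is n'.+1 then ev x i.+1 n' (rowst x i X) else X.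

Lemma ev_add x i n m X : ev x i (n + m) X = ev x (i + n) m (ev x i n X).
Proof. by elim: n i X => [|n IH] i X; rewrite ?addn0 //= IH addSnnS. Qed.

Lemma rowst_sub x i X X' : (forall k, X k -> X' k) -> forall k, rowst x i X k -> rowst x i X' k.
Proof. by move=> h k [l [/h Xl a c]]; exists l. Qed.

Lemma ev_sub x i n X X' : (forall k, X k -> X' k) -> forall k, ev x i n X k -> ev x i n X' k.
Proof. by elim: n i X X' => //= n IH i X X' h; apply: IH; apply: rowst_sub. Qed.

Lemma ev_dep x y i n X : (forall j k, (i <= j < i + n)%N -> x (j, k) = y (j, k)) -> ev x i n X = ev y i n X.
Proof.
elim: n i X => //= n IH i X h.
have -> : rowst x i X = rowst y i X.
  by apply: funext => l; apply: propext; split=> -[k [a c e]]; exists k; split=> //;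
    move: c; rewrite h //; lia.
by apply: IH => j k hj; apply: h; lia.
Qed.

(** All rows drawn at once, against the row by row recursion of [QS]. Only an upper bound is needed,
    so the sites missing from [s] may remain closed and [Y] may be larger than [X]. *)
Lemma joint_le_QS (w : nat * int -> R) s rho n i X (Y : seq int) : unit_par rho ->
  (forall j k, w (j, k) = rho j) -> (forall k, X k -> k \in Y) ->
  Pr w s (fun x => exists l, ev x i n X l) xfalse <= QS rho n i Y.
Proof.
move=> hr hw; have pw : prob_weight w by move=> [j k]; rewrite hw.
elim: n i X Y => [|n IH] i X Y XY /=.
  case: Y XY => [|k Y] XY /=; last exact: Pr_le1.
  by rewrite /Pr (@eq_Ex _ _ _ _ _ (fun=> 0)) ?Ex_cst // => x; rewrite ind_f // => -[l /XY].
pose g (Z : seq int) := QS rho n i.+1 (spread i Z).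
pose f x := g [seq k <- Y | x (i, k)].
have fi : incr f.
  move=> x y xy; apply: QS_mono => //; apply: spread_sub => k.
  by rewrite !mem_filter => /andP[/xy -> ->].
rewrite /Pr (Ex_fubini _ _ _ (fun z => z.1 = i)).
apply: (@le_trans _ _ (Ex w s f xfalse)).
  apply: Ex_le => // x; rewrite /f /g; apply: (le_trans _ (IH i.+1 (rowst x i X) _ _)).
    apply: Pr_sub => // y [l hl]; exists l; rewrite (@ev_dep y (glue (fun z => z.1 = i) x y)).
      move: hl; apply: ev_sub => {}l [k [a c e]]; exists k; split=> //.
      by move: c; rewrite glue_in.
    by move=> j k hj; rewrite glue_out //=; lia.
  move=> l [k [Xk xk lk]]; apply/flatten_mapP; exists k => //.
  by rewrite mem_filter xk XY.
apply: le_trans (Ex_active (t := map (pair i) Y) _ _ fi _) _ => //.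
rewrite (@eq_Ex_coord _ _ _ _ (map (pair i) Y) _ (fun z => z \in map (pair i) Y) _ xfalse); last 3 first.
- by move=> x y xy; rewrite /f; congr g; apply: eq_in_filter => k kY; apply: xy; apply: map_f.
- by move=> z hz; rewrite mem_cat hz.
- by [].
rewrite (@Ex_shift _ _ _ (pair i) w Y (fun z => g [seq k <- Y | z k])) => [|k l []] //.
rewrite /Bn le_eqVlt; apply/orP; left; apply/eqP.
congr (Ex _ _ _ _); apply: funext => k; exact: hw.
Qed.

End Joint.

(** * Oriented percolation confined to a cell *)

Section Cell.
Implicit Types (x : nat * int -> bool) (X : int -> Prop) (lo hi a b c : int).

Definition rowc lo hi x i X : int -> Prop := fun l => rowst x i X l /\ lo <= l <= hi.
Fixpoint cev lo hi x i n X := if n is n'.+1 then cev lo hi x i.+1 n' (rowc lo hi x i X) else X.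

Definition within a b X := forall k, a <= k <= b -> X k.

Lemma rowc_sub lo hi x i X X' : (forall k, X k -> X' k) -> forall k, rowc lo hi x i X k -> rowc lo hi x i X' k.
Proof. by move=> h k [H c]; split=> //; apply: rowst_sub H. Qed.

Lemma cev_sub lo hi x i n X X' : (forall k, X k -> X' k) -> forall k, cev lo hi x i n X k -> cev lo hi x i n X' k.
Proof. by elim: n i X X' => //= n IH i X X' h; apply: IH; apply: rowc_sub. Qed.

Lemma cev_ev lo hi x i n X k : cev lo hi x i n X k -> ev x i n X k.
Proof.
by elim: n i X => //= n IH i X /IH; apply: ev_sub => l [].
Qed.

Lemma cev_add lo hi x i n m X : cev lo hi x i (n + m) X = cev lo hi x (i + n) m (cev lo hi x i n X).
Proof. by elim: n i X => [|n IH] i X; rewrite ?addn0 //= IH addSnnS. Qed.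

Lemma cev_dep lo hi x y i n X : (forall k, X k -> lo <= k <= hi) ->
  (forall j k, (i <= j < i + n)%N -> lo <= k <= hi -> x (j, k) = y (j, k)) -> cev lo hi x i n X = cev lo hi y i n X.
Proof.
elim: n i X => //= n IH i X Xc h.
have -> : rowc lo hi x i X = rowc lo hi y i X.
  apply: funext => l; apply: propext; split=> -[[k [a c e]] d]; split=> //; exists k; split=> //;
    by move: c; rewrite h //; [lia|exact: Xc].
by apply: IH => [k []//|j k hj hk]; apply: h => //; lia.
Qed.

Lemma in_spr i k l : (l \in spr i k) = (l == k) || (l == if odd i then k - 1 else k + 1).
Proof. by rewrite /spr; case: (odd i); rewrite !inE. Qed.

Definition evens i n := ((n + ~~ odd i)./2)%N.
Definition odds i n := ((n + odd i)./2)%N.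

(* A closed site of an interval of length at least 2 is covered by the neighbour,
   so one closed site costs at most one unit at an end of the interval. *)
Lemma cev_interval lo hi x i n (c : bool) a b X : lo <= a -> a <= b -> (c -> a < b) -> b <= hi ->
  (forall j k, (i <= j < i + n)%N -> lo <= k <= hi -> ~~ x (j, k) -> c) ->
  (forall j k j' k', (i <= j < i + n)%N -> lo <= k <= hi -> (i <= j' < i + n)%N -> lo <= k' <= hi ->
     ~~ x (j, k) -> ~~ x (j', k') -> j = j' /\ k = k') ->
  within a b X -> exists a' b', [/\ within a' b' (cev lo hi x i n X), lo <= a' /\ b' <= hi,
     b - a - c%:Z <= b' - a',
     hi - b' <= Num.max 0 (hi - b - (evens i n)%:Z) + c%:Z &
     a' - lo <= Num.max 0 (a - lo - (odds i n)%:Z) + c%:Z].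
Proof.
elim: n i c a b X => [|n IH] i c a b X la ab cab bh H0 H1 hX /=.
  by exists a, b; split; rewrite //= /evens /odds; case: (odd i); lia.
have [[k [hk xk]]|none] := pselect (exists k, a <= k <= b /\ ~~ x (i, k)).
  have ct : c by apply: (H0 i k) xk; lia.
  have ab' := cab ct.
  have U k' : a <= k' <= b -> k' <> k -> x (i, k').
    move=> hk' kk; apply/negPn/negP => nx; apply: kk.
    by have [] := H1 i k' i k _ _ _ _ nx xk; lia.
  have N0 j l : (i.+1 <= j < i.+1 + n)%N -> lo <= l <= hi -> ~~ x (j, l) -> false.
    move=> hj hl nx; have [|||| e _] := H1 i k j l _ _ _ _ xk nx; lia.
  have H1' j l j' l' : (i.+1 <= j < i.+1 + n)%N -> lo <= l <= hi -> (i.+1 <= j' < i.+1 + n)%N -> lo <= l' <= hi ->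
     ~~ x (j, l) -> ~~ x (j', l') -> j = j' /\ l = l'.
    by move=> hj hl _ _ nx; have := N0 j l hj hl nx.
  have [oi|ei] := boolP (odd i).
    (* A closed site [k] of an odd row is covered from its right neighbour, so what is lost is only
       the right end. No closed site can follow, whence the flag [false] in the recursive call. *)
    have W : within a (b - 1) (rowc lo hi x i X).
      move=> l hl; split; last by lia.
      have [lk|lk] := eqVneq l k.
        by exists (l + 1); split; [apply: hX; lia|apply: U; lia|rewrite in_spr oi; lia].
      by exists l; split; [apply: hX; lia|apply: U; [lia|exact/eqP]|rewrite in_spr eqxx].
    have [| | | |a' [b' [h1 h2 h3 h4 h5]]] := IH i.+1 false a (b - 1) _ _ _ _ _ N0 H1' W; try lia.
    by exists a', b'; split=> //; move: h4 h5; rewrite /evens /odds /= oi ct /= ?addn0; lia.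
  have W : within (a + 1) b (rowc lo hi x i X).
    move=> l hl; split; last by lia.
    have [lk|lk] := eqVneq l k.
      by exists (l - 1); split; [apply: hX; lia|apply: U; lia|rewrite in_spr (negbTE ei); lia].
    by exists l; split; [apply: hX; lia|apply: U; [lia|exact/eqP]|rewrite in_spr eqxx].
  have [| | | |a' [b' [h1 h2 h3 h4 h5]]] := IH i.+1 false (a + 1) b _ _ _ _ _ N0 H1' W; try lia.
  by exists a', b'; split=> //; move: h4 h5; rewrite /evens /odds /= (negbTE ei) ct /= ?addn0; lia.
have U k : a <= k <= b -> x (i, k).
  by move=> hk; apply/negPn/negP => nx; apply: none; exists k.
have H0' j k : (i.+1 <= j < i.+1 + n)%N -> lo <= k <= hi -> ~~ x (j, k) -> c.
  by move=> hj; apply: H0; lia.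
have H1' j l j' l' : (i.+1 <= j < i.+1 + n)%N -> lo <= l <= hi -> (i.+1 <= j' < i.+1 + n)%N -> lo <= l' <= hi ->
     ~~ x (j, l) -> ~~ x (j', l') -> j = j' /\ l = l'.
  by move=> hj hl hj' hl'; apply: H1; lia.
have [oi|ei] := boolP (odd i).
  have W : within (Num.max lo (a - 1)) b (rowc lo hi x i X).
    move=> l hl; split; last by lia.
    have [lk|lk] := eqVneq l (a - 1).
      by exists (l + 1); split; [apply: hX; lia|apply: U; lia|rewrite in_spr oi; lia].
    by exists l; split; [apply: hX; lia|apply: U; lia|rewrite in_spr eqxx].
  have [| | | |a' [b' [h1 h2 h3 h4 h5]]] := IH i.+1 c _ b _ _ _ _ _ H0' H1' W; try lia.
  by exists a', b'; split=> //; move: h4 h5; rewrite /evens /odds /= oi /= ?addn0; lia.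
have W : within a (Num.min hi (b + 1)) (rowc lo hi x i X).
  move=> l hl; split; last by lia.
  have [lk|lk] := eqVneq l (b + 1).
    by exists (l - 1); split; [apply: hX; lia|apply: U; lia|rewrite in_spr (negbTE ei); lia].
  by exists l; split; [apply: hX; lia|apply: U; lia|rewrite in_spr eqxx].
have [| | | |a' [b' [h1 h2 h3 h4 h5]]] := IH i.+1 c a _ _ _ _ _ _ H0' H1' W; try lia.
by exists a', b'; split=> //; move: h4 h5; rewrite /evens /odds /= (negbTE ei) /= ?addn0; lia.
Qed.

End Cell.

(** * Success probability of one cell *)

Section Success.
Context {R : realType} {I : eqType} (w : I -> R) (s : seq I).
Hypothesis hw : prob_weight w.
Notation Prf A := (Pr w s A xfalse).

Lemma Pr_eq A B : (forall x, A x <-> B x) -> Prf A = Prf B.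
Proof. by move=> h; apply/le_anti/andP; split; apply: Pr_sub => // x /h. Qed.

Lemma Pr_all_open (r : seq I) : uniq r -> {subset r <= s} ->
  Prf (fun x => forall i, i \in r -> x i) = \prod_(i <- r) w i.
Proof.
elim: r => [|i r IH] /=; first by move=> _ _; rewrite big_nil -[RHS](Ex_cst w s 1 xfalse); apply: eq_Ex => x; rewrite ind_t.
move=> /andP[ir ur] rs; rewrite big_cons -IH // => [|j jr]; last by apply: rs; rewrite inE jr orbT.
have -> : w i = Prf (fun x => x i).
  rewrite /Pr (@eq_Ex_coord _ _ _ _ [:: i] _ (fun j => j = i) xfalse xfalse) //.
  - by rewrite /= ind_t ?ind_f /upd ?eqxx //; ring.
  - by apply: dep_ind => x y xy; rewrite xy.
  - by move=> j ->; apply: rs; rewrite mem_head.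
  - by move=> j ->; rewrite mem_head.
rewrite -(@Pr_indep _ _ _ _ _ _ (fun j => j = i) (fun j => j \in r)).
- apply: Pr_eq => x; split=> [h|[xi h] j]; last by rewrite inE => /orP[/eqP ->|/h].
  by split=> [|j jr]; apply: h; rewrite inE ?eqxx ?jr ?orbT.
- by move=> x y xy; rewrite xy.
- by move=> x y xy h j jr; rewrite -xy //; apply: h.
- by move=> j ->; rewrite (negbTE ir).
Qed.

Lemma Pr_open i : i \in s -> Prf (fun x => x i) = w i.
Proof.
move=> si; have := @Pr_all_open [:: i]; rewrite big_seq1 => <- //; last by move=> j; rewrite inE => /eqP ->.
by apply: Pr_eq => x; split=> [h j|]; [rewrite inE => /eqP ->|apply; rewrite inE].
Qed.

Lemma Pr_closed i : i \in s -> Prf (fun x => ~~ x i) = 1 - w i.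
Proof.
move=> si; rewrite -Pr_open // -Pr_not; apply: Pr_eq => x.
by split=> [/negP//|/negP].
Qed.

Lemma Pr_closed1 (N : seq I) (tau : R) : {subset N <= s} -> (forall i, i \in N -> 1 - tau <= w i) ->
  Prf (fun x => exists2 i, i \in N & ~~ x i) <= (size N)%:R * tau.
Proof.
move=> Ns hN; apply: Pr_bigU_le => // i iN; rewrite Pr_closed ?Ns //.
by have := hN i iN; lra.
Qed.

Lemma Pr_closed2 (N : seq I) (tau : R) : 0 <= tau -> {subset N <= s} -> (forall i, i \in N -> 1 - tau <= w i) ->
  Prf (fun x => exists i j, [/\ i \in N, j \in N, i <> j, ~~ x i & ~~ x j]) <= ((size N)%:R * tau) ^+ 2.
Proof.
move=> t0 Ns hN; rewrite exprMn -natrX -[(size N ^ 2)%N]mulnn -(@size_allpairs _ _ _ (fun i j => (i, j)) N N).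
have := @Pr_bigU_le _ _ _ [seq (i, j) | i <- N, j <- N] w s (fun z x => [/\ z.1 <> z.2, ~~ x z.1 & ~~ x z.2]) xfalse (tau ^+ 2) hw.
set E := Pr _ _ _ _ => h; apply: (@le_trans _ _ E).
  apply: Pr_sub => // x [i [j [iN jN ij xi xj]]]; exists (i, j); last by [].
  by apply/allpairsP; exists (i, j).
apply: h => -[i j] /allpairsP[[i' j'] /= [iN jN [-> ->]]].
have [e|ij] := pselect (i' = j').
  rewrite /Pr (@eq_Ex _ _ _ _ _ (fun=> 0)) ?Ex_cst ?exprn_ge0 // => x; rewrite ind_f //.
  by case=> /=.
apply: (@le_trans _ _ (Prf (fun x => ~~ x i' /\ ~~ x j'))); first by apply: Pr_sub => // x [].
rewrite (@Pr_indep _ _ _ _ _ _ (fun k => k = i') (fun k => k = j')).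
- rewrite !Pr_closed ?Ns // expr2; have := hN _ iN; have := hN _ jN; have := hw i'; have := hw j'.
  by move=> ? ? ? ?; apply: ler_pM; lra.
- by move=> x y xy; rewrite xy.
- by move=> x y xy; rewrite xy.
- by move=> k -> /ij.
Qed.

Lemma Pr_all_closed (N : seq I) (p : R) : uniq N -> {subset N <= s} -> (forall i, i \in N -> p <= w i) -> p <= 1 ->
  Prf (fun x => forall i, i \in N -> ~~ x i) <= (1 - p) ^+ size N.
Proof.
move=> uN Ns hN p1; apply: (@Pr_all_indep _ _ _ _ _ _ _ (fun i j => j = i)) => //.
- by move=> i _ x y xy; rewrite xy.
- by move=> i j k _ _ ij -> /ij.
- by lra.
- by move=> i iN; rewrite Pr_closed ?Ns //; have := hN i iN; lra.
Qed.

Lemma Pr_ge_compl A B (e : R) : (forall x, ~ A x -> B x) -> Prf B <= e -> 1 - e <= Prf A.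
Proof.
move=> h Be; have := Pr_sub (A := fun x => ~ A x) (B := B) s xfalse hw h.
by rewrite Pr_not; lra.
Qed.

End Success.

Section CellSuccess.
Context {R : realType} (rho : nat -> R) (s : seq (nat * int)) (t T W : nat) (lo : int) (tau : R).
Hypothesis hr : unit_par rho.
Let w := fun z : nat * int => rho z.1.
Let hi := lo + W%:Z - 1.
Definition reg (A : pred nat) : seq (nat * int) :=
  [seq (j, lo + k%:Z) | j <- [seq j <- iota t T | A j], k <- iota 0 W].
Hypothesis hs : {subset reg predT <= s}.
Hypothesis tau0 : 0 <= tau.
Implicit Types (x : nat * int -> bool) (X : int -> Prop) (a b : int).

Let hw : prob_weight w. Proof. by move=> z; apply: hr. Qed.
Notation Prf A := (Pr w s A xfalse).

Lemma mem_reg (A : pred nat) j k : ((j, k) \in reg A) = [&& A j, (t <= j < t + T)%N & lo <= k <= hi].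
Proof.
apply/allpairsP/and3P => [[[j' k'] /= [hj hk [-> ->]]]|[Aj hj hk]].
  by move: hj hk; rewrite mem_filter !mem_iota => /andP[-> ->] hk; split=> //; rewrite /hi; lia.
exists (j, `|k - lo|%N); split=> /=.
- by rewrite mem_filter Aj mem_iota.
- by rewrite mem_iota; move: hk; rewrite /hi; lia.
- by congr (_, _); lia.
Qed.

Lemma reg_sub A : {subset reg A <= s}.
Proof. by move=> [j k]; rewrite mem_reg => /and3P[_ h1 h2]; apply: hs; rewrite mem_reg h1 h2. Qed.

Lemma size_reg A : (size (reg A) <= T * W)%N.
Proof.
rewrite size_allpairs size_iota leq_mul2r size_filter; apply/orP; right.
by apply: leq_trans (count_size _ _) _; rewrite size_iota.
Qed.

(** The extreme columns [lo] and [hi] are left out because a closed site late in the slab may remove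
    one point at an end. *)
Definition succ_ev a b x := within (lo + 1) (hi - 1) (cev lo hi x t T (fun k => a <= k <= b)).

Let nrm : pred nat := fun j => 1 - tau <= rho j.

Lemma Pr_two (A : pred nat) : (forall j, A j -> 1 - tau <= rho j) ->
  Prf (fun x => exists i j, [/\ i \in reg A, j \in reg A, i <> j, ~~ x i & ~~ x j]) <= ((T * W)%:R * tau) ^+ 2.
Proof.
move=> hA; apply: le_trans (Pr_closed2 hw tau0 (@reg_sub A) _) _.
  by move=> [j k]; rewrite mem_reg => /and3P[/hA].
by rewrite lerXn2r ?nnegrE ?mulr_ge0 ?ler0n // ler_wpM2r // ler_nat size_reg.
Qed.

Lemma Pr_none (A : pred nat) m : (forall j, A j -> 1 - tau <= rho j) -> (size (reg A) <= m)%N ->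
  1 - m%:R * tau <= Prf (fun x => forall i, i \in reg A -> x i).
Proof.
move=> hA hm; apply: (Pr_ge_compl hw (B := fun x => exists2 i, i \in reg A & ~~ x i)).
  move=> x; apply: contra_notP => h i iA; apply/negPn/negP => nx; apply: h; by exists i.
apply: le_trans (Pr_closed1 hw (@reg_sub A) (tau := tau) _) _.
  by move=> [j k]; rewrite mem_reg => /and3P[/hA].
by rewrite ler_wpM2r // ler_nat.
Qed.

Lemma one_closed_region x (A : pred nat) : ~ (exists i j, [/\ i \in reg A, j \in reg A, i <> j, ~~ x i & ~~ x j]) ->
  forall j k j' k', A j -> A j' -> (t <= j < t + T)%N -> lo <= k <= hi -> (t <= j' < t + T)%N -> lo <= k' <= hi ->
     ~~ x (j, k) -> ~~ x (j', k') -> j = j' /\ k = k'.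
Proof.
move=> h j k j' k' Aj Aj' hj hk hj' hk' nx nx'.
have [[-> ->]//|e] := pselect ((j, k) = (j', k')); exfalso; apply: h; exists (j, k), (j', k').
by rewrite !mem_reg Aj Aj' hj hk hj' hk'.
Qed.

(** A single closed site never stops an interval of two points: it keeps growing at both ends, by
    one every two rows, and fills the cell in about [2 * W] rows. Failure requires two closed sites,
    which gives the square. *)
Lemma succ_normal a b : (forall j, (t <= j < t + T)%N -> 1 - tau <= rho j) -> ~~ odd t -> (2 * W + 2 <= T)%N ->
  lo <= a -> a < b -> b <= hi -> 1 - ((T * W)%:R * tau) ^+ 2 <= Prf (succ_ev a b).
Proof.
move=> hn te hT la ab bh.
apply: (Pr_ge_compl hw (B := fun x => exists i j, [/\ i \in reg nrm, j \in reg nrm, i <> j, ~~ x i & ~~ x j])); last exact: Pr_two.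
move=> x; apply: contra_notP => h k hk.
have O := one_closed_region h.
have [| | | | | | |a' [b' [h1 _ _ h2 h3]]] := @cev_interval lo hi x t T true a b (fun k => a <= k <= b).
- by [].
- lia.
- by [].
- by [].
- by [].
- by move=> j l j' l' hj hl hj' hl'; apply: O => //; apply: hn.
- by [].
apply: h1; move: h2 h3; rewrite /evens /odds te (negbTE te) /hi; move: hk; rewrite /hi; lia.
Qed.


Lemma cev_split r x X : (t <= r < t + T)%N ->
  cev lo hi x t T X = cev lo hi x r.+1 (t + T - r.+1) (rowc lo hi x r (cev lo hi x t (r - t) X)).
Proof.
move=> hr'; rewrite (_ : T = (r - t) + (t + T - r.+1).+1)%N; last by lia.
rewrite cev_add (_ : t + (r - t) = r)%N; last by lia.
by rewrite /= (_ : (t + (r - t + (t + T - r.+1).+1) - r.+1 = t + T - r.+1)%N) //; lia.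
Qed.

(** The rows after [r] refill the cell from what has crossed row [r]: from two neighbouring points
    if one closed site is tolerated ([c]), from one point if there is none. *)
Lemma succ_tail r x (c : bool) (k k' : int) X : (t <= r < t + T)%N -> (2 * W + 2 <= t + T - r.+1)%N ->
  lo <= k -> k <= k' -> k' <= hi -> (c -> k < k') ->
  (forall j k, (r < j < t + T)%N -> lo <= k <= hi -> ~~ x (j, k) -> c) ->
  (forall j k j' k', (r < j < t + T)%N -> lo <= k <= hi -> (r < j' < t + T)%N -> lo <= k' <= hi ->
     ~~ x (j, k) -> ~~ x (j', k') -> j = j' /\ k = k') ->
  within k k' X -> within (lo + 1) (hi - 1) (cev lo hi x r.+1 (t + T - r.+1) X).
Proof.
move=> hr' hT lk kk kh ck H0 H1 hX l hl.
have [| | | | | |a' [b' [h1 _ _ h2 h3]]] := @cev_interval lo hi x r.+1 (t + T - r.+1) c k k' X _ _ _ _ _ _ hX => //.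
- by move=> j l0 hj; apply: H0; lia.
- by move=> j l1 j' l2 hj hl1 hj' hl2; apply: H1 => //; lia.
apply: h1; move: h2 h3; rewrite /evens /odds /hi; move: hl; rewrite /hi; case: (odd _) => /=; case: (c); lia.
Qed.

Lemma row_open_next x r (k : int) X : X k -> x (r, k) -> lo < k < hi ->
  exists2 k0, lo <= k0 /\ k0 + 1 <= hi & within k0 (k0 + 1) (rowc lo hi x r X).
Proof.
move=> Xk xk hk; exists (if odd r then k - 1 else k); first by case: (odd r); lia.
move=> l hl; split; last by case: (odd r) hl; lia.
by exists k; split=> //; rewrite in_spr; case: (odd r) hl => /=; lia.
Qed.

(** Failure requires two closed sites outside row [r], or [m] consecutive closed sites in row [r],
    since any open site of row [r] met by the interval is enough to start again. *)
Lemma succ_one_bad r a b (m : nat) : (t <= r < t + T)%N -> (forall j, (t <= j < t + T)%N -> j != r -> 1 - tau <= rho j) ->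
  (2 * W + 2 <= t + T - r.+1)%N ->
  lo <= a -> a + m%:Z + 3 <= b -> b <= hi -> (0 < m)%N ->
  1 - (((T * W)%:R * tau) ^+ 2 + W%:R * (1 - rho r) ^+ m) <= Prf (succ_ev a b).
Proof.
move=> hr' hn hT la ab bh m0.
pose A0 : pred nat := fun j => (j != r) && (t <= j < t + T)%N.
pose K := [seq i <- iota 0 W | (i + m <= W)%N].
pose B1 (x : nat * int -> bool) := exists i j, [/\ i \in reg A0, j \in reg A0, i <> j, ~~ x i & ~~ x j].
pose B2 (x : nat * int -> bool) := exists2 i, i \in K & forall z, z \in [seq (r, lo + i%:Z + k%:Z) | k <- iota 0 m] -> ~~ x z.
apply: (Pr_ge_compl hw (B := fun x => B1 x \/ B2 x)); last first.
  apply: le_trans (PrU _ _ _ _ hw) _; apply: lerD.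
    by apply: Pr_two => j /andP[h1 h2]; apply: hn.
  have r0 : 0 <= 1 - rho r by have := hr r; lra.
  apply: (@le_trans _ _ ((size K)%:R * (1 - rho r) ^+ m)); last first.
    by rewrite ler_wpM2r ?exprn_ge0 // ler_nat size_filter; apply: leq_trans (count_size _ _) _; rewrite size_iota.
  apply: Pr_bigU_le => // i; rewrite mem_filter mem_iota => /andP[iW _].
  rewrite -[m in leRHS](size_iota 0) -(size_map (fun k => (r, lo + i%:Z + k%:Z))).
  apply: Pr_all_closed => //.
  - by rewrite map_inj_uniq ?iota_uniq // => k k' [] /addrI [].
  - move=> z /mapP[k]; rewrite mem_iota => hk ->; apply: (@reg_sub predT).
    by rewrite mem_reg /hi /=; lia.
  - by move=> z /mapP[k _ ->].
  - by have := hr r; lra.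
move=> x; apply: contra_notP => h.
have h1 : ~ B1 x by tauto.
have h2 : ~ B2 x by tauto.
have O := one_closed_region h1.
have O' j k j' k' : j != r -> j' != r -> (t <= j < t + T)%N -> lo <= k <= hi -> (t <= j' < t + T)%N -> lo <= k' <= hi ->
     ~~ x (j, k) -> ~~ x (j', k') -> j = j' /\ k = k'.
  by move=> jr jr' hj hk hj' hk'; apply: O => //; rewrite /A0 ?jr ?jr' ?hj ?hj'.
rewrite /succ_ev (cev_split _ _ hr').
have [| | | | | | |a' [b' [w1 [w2 w3] w4 _ _]]] := @cev_interval lo hi x t (r - t) true a b (fun k => a <= k <= b).
- by [].
- lia.
- lia.
- by [].
- by [].
- by move=> j l j' l' hj hl hj' hl'; apply: O' => //; lia.
- by [].
have [k hk xk] : exists2 k, Num.max a' (lo + 1) <= k < Num.max a' (lo + 1) + m%:Z & x (r, k).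
  apply: contrapT => nk; apply: h2; exists (absz (Num.max a' (lo + 1) - lo)%R).
    by rewrite mem_filter mem_iota; move: w3 w4 bh; rewrite /hi; lia.
  move=> z /mapP[k]; rewrite mem_iota => hk ->; apply/negP => xz; apply: nk.
  by exists (lo + (absz (Num.max a' (lo + 1) - lo)%R)%:Z + k%:Z) => //; lia.
have kk : a' <= k <= b' by move: w4; lia.
have kk' : lo < k < hi by move: w3 w4; lia.
have [k0 hk0 W0] := row_open_next (w1 k kk) xk kk'.
apply: (succ_tail hr' (c := true) (k := k0) (k' := k0 + 1)) => //; try lia.
by move=> j l j' l' hj hl hj' hl'; apply: O' => //; lia.
Qed.

Lemma within_stay x a b n : (n <= T)%N -> lo <= a -> b <= hi -> (forall j k, (t <= j < t + n)%N -> a <= k <= b -> x (j, k)) ->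
  within a b (cev lo hi x t n (fun k => a <= k <= b)).
Proof.
move=> _ la bh; elim: n => [|n IH] h; first by move=> k.
rewrite -addn1 cev_add /= => k hk; split; last by lia.
exists k; split; last by rewrite in_spr eqxx.
  by apply: IH => // j l hj; apply: h; lia.
by apply: h => //; lia.
Qed.

(** When row [r] is very sparse one only asks for a single open site of it in the interval, every
    other row of the cell being fully open with probability at least one half. The bound is then
    linear in the length of the interval for small [rho r]. *)
Lemma succ_small r a b : (t <= r < t + T)%N -> (forall j, (t <= j < t + T)%N -> j != r -> 1 - tau <= rho j) ->
  (2 * W + 2 <= t + T - r.+1)%N -> (T * W)%:R * tau <= 1 / 2 ->
  lo <= a -> a <= b -> b <= hi ->
  1 / 2 * (1 - (1 - rho r) ^+ `|b - a|) <= Prf (succ_ev a b).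
Proof.
move=> hr' hn hT htau la ab bh.
pose A0 : pred nat := fun j => (j != r) && (t <= j < t + T)%N.
pose V := [seq (r, a + k%:Z) | k <- iota 0 `|b - a|].
pose E1 x := forall i, i \in reg A0 -> x i.
pose E2 (x : nat * int -> bool) := exists2 i, i \in V & x i.
have V_r z : z \in V -> z.1 = r by move=> /mapP[k _ ->].
apply: (@le_trans _ _ (Prf E1 * Prf E2)).
  have r1 : 0 <= rho r <= 1 by apply: hr.
  apply: ler_pM; first by lra.
  - by rewrite subr_ge0 exprn_ile1 //; lra.
  - by apply: le_trans (Pr_none (A := A0) _ (size_reg _)); [lra|move=> j /andP[h1 h2]; apply: hn].
  rewrite -[`|b - a|%N in leLHS](size_iota 0) -(size_map (fun k => (r, a + k%:Z))).
  apply: (Pr_ge_compl hw (B := fun x => forall i, i \in V -> ~~ x i)).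
    by move=> x nx i iV; apply/negP => xi; apply: nx; exists i.
  apply: Pr_all_closed => //.
  - by rewrite map_inj_uniq ?iota_uniq // => k k' [] /addrI [].
  - move=> z /mapP[k]; rewrite mem_iota => hk ->; apply: (@reg_sub predT).
    by rewrite mem_reg /hi /=; move: bh; rewrite /hi; lia.
  - by move=> z /V_r; rewrite /w => ->.
  - by lra.
rewrite -(@Pr_indep _ _ _ _ _ _ (fun i => i \in reg A0) (fun i => i \in V)); last 1 first.
- by move=> [j k]; rewrite mem_reg => /and3P[/andP[/eqP jr _] _ _] /V_r.
- apply: Pr_sub => // x [e1 [z /mapP[k0 hk0 ->] xk]].
  have e1' j k : j != r -> (t <= j < t + T)%N -> lo <= k <= hi -> x (j, k).
    by move=> jr hj hk; apply: e1; rewrite mem_reg /A0 jr hj hk.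
  move: hk0; rewrite mem_iota => hk0; set k := a + k0%:Z in xk.
  rewrite /succ_ev (cev_split _ _ hr').
  have S : within a b (cev lo hi x t (r - t) (fun k => a <= k <= b)).
    by apply: within_stay => //; [lia|move=> j l hj hl; apply: e1'; lia].
  apply: (succ_tail hr' (c := false) (k := k) (k' := k)) => //; rewrite /k; try lia.
  - by move=> j l hj hl; rewrite e1' //; lia.
  - by move=> j l j' l' hj hl _ _; rewrite e1' //; lia.
  move=> l hl; have -> : l = k by rewrite /k; lia.
  split; last by rewrite /k; lia.
  by exists k; split; [apply: S; rewrite /k; lia|exact: xk|rewrite in_spr eqxx].
- by move=> x y xy h i iA; rewrite -xy //; apply: h.
- by move=> x y xy [i iV xi]; exists i; rewrite -?xy.
Qed.

(** The crude strategy for arbitrarily many bad rows: follow the column [a] through row [r], then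
    refill the cell in rows without closed sites. *)
Lemma succ_any r a : (t <= r < t + T)%N -> (forall j, (r < j < t + T)%N -> 1 - tau <= rho j) ->
  (2 * W + 2 <= t + T - r.+1)%N -> ((t + T - r.+1) * W)%:R * tau <= 1 / 2 ->
  lo <= a -> a <= hi ->
  1 / 2 * \prod_(t <= j < r.+1) rho j <= Prf (succ_ev a a).
Proof.
move=> hr' hn hT htau la ah.
pose A0 : pred nat := fun j => (r < j < t + T)%N.
pose V := [seq (j, a) | j <- index_iota t r.+1].
pose E1 x := forall i, i \in reg A0 -> x i.
pose E2 (x : nat * int -> bool) := forall i, i \in V -> x i.
have mV j : (j, a) \in V = (t <= j < r.+1)%N.
  apply/mapP/idP => [[j' hj' [->]]|hj]; first by rewrite -mem_index_iota.
  by exists j; rewrite // mem_index_iota.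
apply: (@le_trans _ _ (Prf E1 * Prf E2)).
  apply: ler_pM; rewrite ?divr_ge0 //.
  - by apply: prodr_ge0 => j _; have /andP[] := hr j.
  - have sA : (size (reg A0) <= (t + T - r.+1) * W)%N.
      rewrite size_allpairs size_iota leq_mul2r; apply/orP; right.
      rewrite -[X in (_ <= X)%N](size_iota r.+1); apply: uniq_leq_size; first by rewrite filter_uniq ?iota_uniq.
      by move=> j; rewrite mem_filter !mem_iota /A0; lia.
    by apply: le_trans (Pr_none (A := A0) _ sA); [lra|].
  rewrite Pr_all_open //; last 2 first.
  - by rewrite map_inj_uniq ?iota_uniq // => k k' [].
  - move=> z /mapP[k]; rewrite mem_index_iota => hk ->; apply: (@reg_sub predT).
    by rewrite mem_reg /=; lia.
  by rewrite big_map.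
rewrite -(@Pr_indep _ _ _ _ _ _ (fun i => i \in reg A0) (fun i => i \in V)); last 1 first.
- by move=> [j k]; rewrite mem_reg => /and3P[h1 _ _] /mapP[j' + [jj _]]; rewrite mem_index_iota -jj; move: h1; rewrite /A0; lia.
- apply: Pr_sub => // x [e1 e2].
  have e1' j k : (r < j < t + T)%N -> lo <= k <= hi -> x (j, k).
    by move=> hj hk; apply: e1; rewrite mem_reg /A0 hj hk; lia.
  rewrite /succ_ev (cev_split _ _ hr').
  have S : within a a (cev lo hi x t (r.+1 - t) (fun k => a <= k <= a)).
    apply: within_stay => //; [lia|move=> j l hj hl; have -> : l = a by lia].
    by apply: e2; rewrite mV; lia.
  rewrite subSn in S; last by lia.
  rewrite -addn1 cev_add (_ : t + (r - t) = r)%N /= in S; last by lia.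
  apply: (succ_tail hr' (c := false) (k := a) (k' := a)) => //; try lia.
  - by move=> j l hj hl; rewrite e1' //; lia.
  - by move=> j l j' l' hj hl _ _; rewrite e1' //; lia.
- by move=> x y xy h i iA; rewrite -xy //; apply: h.
- by move=> x y xy h i iA; rewrite -xy //; apply: h.
Qed.

End CellSuccess.

(** * Renormalisation of the rows *)

Section Coarse.
Context {R : realType}.
Implicit Types (rho : nat -> R).

Lemma QS_le rho n i Y m : unit_par rho -> QS rho (n + m) i Y <= QS rho n i Y.
Proof.
move=> hr; elim: n i Y => [|n IH] i Y /=; last by apply: Bn_le => // Z; apply: IH.
case: Y => [|k Y] /=; last first.
  elim: m i (k :: Y) => [|m IH] i Z /=; first by case: (Z).
  rewrite -(Ex_cst (fun=> rho i) Z 1 xfalse); apply: Ex_le => [j|x]; [exact: hr|exact: IH].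
have H j : QS rho m j [::] = 0 by elim: m j => //= m IH j; rewrite /Bn /= IH.
by rewrite add0n H.
Qed.

(** Cells have width [2 * H] and are shifted by [H] on odd levels, in step with [spr]: a full cell
    covers half of each of its two successors. *)
Definition cell_lo (H : nat) (j : nat) (k : int) : int := (2 * k - (odd j)%:Z) * H%:Z.

(** The bound on [k] keeps the cells in a window known in advance, so that a finite list of sites
    contains all of them. *)
Definition occupied (H D M : nat) (j : nat) (X : int -> Prop) (k : int) : Prop :=
  `|k| <= (M + j)%:Z /\ exists a, [/\ cell_lo H j k <= a, a + D%:Z <= cell_lo H j k + (2 * H)%:Z &
    within a (a + D%:Z - 1) X].

Lemma occupied_next H D M j X k l x t T a : (D + 1 <= H)%N -> (0 < D)%N ->
  `|k| <= (M + j)%:Z -> l \in spr j k ->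
  within a (a + D%:Z - 1) X ->
  succ_ev t T (2 * H) (cell_lo H j k) a (a + D%:Z - 1) x ->
  occupied H D M j.+1 (ev x t T X) l.
Proof.
move=> DH D0 kM lk hX hs.
have hs' i : cell_lo H j k + 1 <= i <= cell_lo H j k + (2 * H)%:Z - 2 -> ev x t T X i.
  move=> hi; apply: ev_sub (cev_ev (hs i _)); first by move=> i0; apply: hX.
  by move: hi; lia.
split; first by move: lk; rewrite in_spr; case: (odd j); lia.
move: lk hs'; rewrite in_spr /cell_lo /=; case: (odd j) => /= /orP[/eqP ->|/eqP ->] hs'.
- exists ((2 * k) * H%:Z); split; [lia|lia|move=> i hi; apply: hs'; lia].
- exists ((2 * k - 1) * H%:Z + 1); split; [lia|lia|move=> i hi; apply: hs'; lia].
- exists ((2 * k) * H%:Z + 1); split; [lia|lia|move=> i hi; apply: hs'; lia].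
- exists ((2 * k + 1) * H%:Z); split; [lia|lia|move=> i hi; apply: hs'; lia].
Qed.

Lemma succ_ev_dep t T W lo a b : lo <= a -> b <= lo + W%:Z - 1 ->
  depP (succ_ev t T W lo a b) (fun z => (t <= z.1 < t + T)%N && (lo <= z.2 <= lo + W%:Z - 1)).
Proof.
move=> la bh x y xy h k hk; rewrite (@cev_dep _ _ _ x); first exact: h.
  by move=> i; lia.
by move=> j i hj hi; rewrite xy //= hj.
Qed.

(** Two comparisons meet in the joint law of the fine rows: [transfer] bounds the coarse survival by
    the survival of the joint process, and [joint_le_QS] bounds the latter by the fine survival. *)
Lemma QS_coarse rho rho' (t : nat -> nat) N H D (Y Y' : seq int) : unit_par rho -> unit_par rho' ->
  t 0%N = 0%N -> (forall j, t j <= t j.+1)%N ->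
  (forall j lo a s, (j < N)%N -> {subset reg (t j) (t j.+1 - t j) (2 * H) lo predT <= s} -> lo <= a ->
     a + D%:Z <= lo + (2 * H)%:Z ->
     rho' j <= Pr (fun z : nat * int => rho z.1) s (succ_ev (t j) (t j.+1 - t j) (2 * H) lo a (a + D%:Z - 1)) xfalse) ->
  (D + 1 <= H)%N -> (0 < D)%N ->
  (forall k, k \in Y' -> exists a, [/\ cell_lo H 0 k <= a, a + D%:Z <= cell_lo H 0 k + (2 * H)%:Z &
     forall i, a <= i <= a + D%:Z - 1 -> i \in Y]) ->
  QS rho' N 0 Y' <= QS rho (t N) 0 Y.
Proof.
move=> hr hr' t0 tm hs DH D0 hY.
pose M := (\max_(k <- Y') `|k|)%N.
have kM k : k \in Y' -> (`|k| <= M)%N by move=> kY; rewrite /M (big_rem k) //= leq_maxl.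
pose s := flatten [seq reg (t j) (t j.+1 - t j) (2 * H) (cell_lo H j (i%:Z - (M + N)%:Z)) predT
   | j <- iota 0 N, i <- iota 0 (2 * (M + N)).+1].
have sP j k : (j < N)%N -> `|k| <= (M + j)%:Z ->
  {subset reg (t j) (t j.+1 - t j) (2 * H) (cell_lo H j k) predT <= s}.
  move=> jN hk z hz; apply/flattenP; exists (reg (t j) (t j.+1 - t j) (2 * H) (cell_lo H j k) predT) => //.
  apply/allpairsP; exists (j, absz (k + (M + N)%:Z)%R); split; rewrite /fst /snd.
  - by rewrite mem_iota.
  - by rewrite mem_iota; lia.
  - by congr (reg _ _ _ (cell_lo _ _ _) _); lia.
have tm' i j : (i <= j)%N -> (t i <= t j)%N.
  elim: j => [|j IH]; first by rewrite leqn0 => /eqP ->.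
  by rewrite leq_eqVlt => /orP[/eqP -> //|/IH/leq_trans]; apply.
pose w := fun z : nat * int => rho z.1.
have hw : prob_weight w by move=> z; apply: hr.
pose D' (j : nat) (z : nat * int) := (t j <= z.1 < t j.+1)%N : Prop.
have dis j k (l : nat * int) : j <> k -> D' j l -> D' k l -> False.
  rewrite /D'; move=> jk; have [h|h] : (j < k)%N \/ (k < j)%N by lia.
    by have := tm' _ _ h; lia.
  by have := tm' _ _ h; lia.
apply: le_trans (_ : Pr w s (fun x => exists l, ev x 0 (t N) (fun k => k \in Y) l) xfalse <= _); last first.
  by apply: joint_le_QS.
apply: le_trans (transfer (D := D') (next := fun j x X => ev x (t j) (t j.+1 - t j) X)
   (occ := occupied H D M) (fin := fun X => exists l, X l) (N := N) (n := N) (i := 0%N) (X := fun k => k \in Y)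
   hw hr' dis _ (add0n N) _ _ _) _.
- move=> j X x y xy; apply: ev_dep => i k hi; apply: xy; rewrite /D' /=; have := tm j; lia.
- move=> j X Z jN hZ.
  have hZ' k : exists a, k \in Z -> [/\ cell_lo H j k <= a, a + D%:Z <= cell_lo H j k + (2 * H)%:Z &
      within a (a + D%:Z - 1) X].
    have [kZ|kZ] := boolP (k \in Z); last by exists 0.
    by have [_ [a ha]] := hZ k kZ; exists a.
  have [f fP] := choice hZ'.
  exists (fun k => succ_ev (t j) (t j.+1 - t j) (2 * H) (cell_lo H j k) (f k) (f k + D%:Z - 1)).
  exists (fun k z => (t j <= z.1 < t j + (t j.+1 - t j))%N && (cell_lo H j k <= z.2 <= cell_lo H j k + (2 * H)%:Z - 1)).
  split.
  + by move=> k /fP[h1 h2 _]; apply: succ_ev_dep => //; lia.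
  + move=> k l [i z] kZ lZ kl /= /andP[_ h1] /andP[_ h2]; apply: kl.
    move: h1 h2; rewrite /cell_lo; case: (odd j) => /= h1 h2; nia.
  + by move=> k kZ; have [h1 h2 _] := fP k kZ; apply: hs => //; apply: sP => //; have [] := hZ k kZ.
  + move=> x k l kZ hk lk; have [h1 h2 h3] := fP k kZ.
    have [kM' _] := hZ k kZ; exact: (occupied_next DH D0 kM' lk h3 hk).
- by move=> X k [_ [a [_ _ h]]]; exists a; apply: h; lia.
- move=> k kY; split; first by have := kM k kY; lia.
  by have [a [h1 h2 h3]] := hY k kY; exists a; split.
apply: Pr_sub => // x [l hl]; exists l.
have H' n j X : run (fun j x X => ev x (t j) (t j.+1 - t j) X) j n x X = ev x (t j) (t (j + n)%N - t j) X.
  elim: n j X => [|n IH] j X /=; first by rewrite addn0 subnn.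
  rewrite IH addSnnS.
  have h1 := tm' j j.+1 (leqnSn _); have h2 : (t j.+1 <= t (j + n.+1)%N)%N by apply: tm'; lia.
  rewrite (_ : t (j + n.+1)%N - t j = (t j.+1 - t j) + (t (j + n.+1)%N - t j.+1))%N; last by lia.
  by rewrite ev_add (_ : t j + (t j.+1 - t j) = t j.+1)%N //; lia.
by move: hl; rewrite H' t0 subn0 add0n.
Qed.

End Coarse.

(** * Finite laws of row densities *)

Section Laws.
Context {R : realType}.

Section AE.
Context {T : Type}.
Implicit Types (L : seq (R * T)) (f g : seq T -> R).

(** Laws are finite weighted lists whose mass may be below 1. Truncating a run of random length then
    costs mass, and no infinite list is needed. *)
Fixpoint AE L n f : R :=
  if n is n'.+1 then \sum_(p <- L) p.1 * AE L n' (fun es => f (p.2 :: es)) else f [::].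

Definition mass L : R := \sum_(p <- L) p.1.
Definition nneg L := all (fun p => 0 <= p.1) L.

Lemma ler_sum_nneg L (F G : T -> R) : nneg L -> (forall e, F e <= G e) ->
  \sum_(p <- L) p.1 * F p.2 <= \sum_(p <- L) p.1 * G p.2.
Proof.
move=> + h; elim: L => [|p L IH]; first by rewrite !big_nil.
by move=> /andP[h1 h2]; rewrite !big_cons lerD ?ler_wpM2l ?IH.
Qed.

Lemma ler_sum_supp L (Q : pred T) (F G : T -> R) : nneg L -> all (fun p => Q p.2) L ->
  (forall e, Q e -> F e <= G e) -> \sum_(p <- L) p.1 * F p.2 <= \sum_(p <- L) p.1 * G p.2.
Proof.
move=> + + h; elim: L => [|p L IH]; first by rewrite !big_nil.
by move=> /andP[h1 h2] /andP[h3 h4]; rewrite !big_cons lerD ?ler_wpM2l ?IH ?h.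
Qed.

Lemma AE_le_supp L (Q : pred T) n f g : nneg L -> all (fun p => Q p.2) L ->
  (forall es, size es = n -> all Q es -> f es <= g es) -> AE L n f <= AE L n g.
Proof.
move=> hL hQ; elim: n f g => [|n IH] f g h /=; first exact: h.
apply: (ler_sum_supp (F := fun e => AE L n (fun es => f (e :: es))) (G := fun e => AE L n (fun es => g (e :: es))) hL hQ) => e Qe.
by apply: IH => es hes hq; apply: h; rewrite /= ?hes ?Qe.
Qed.

Lemma AE_le L n f g : nneg L -> (forall es, size es = n -> f es <= g es) -> AE L n f <= AE L n g.
Proof. by move=> hL h; apply: (@AE_le_supp _ xpredT) => // [|es /h //]; exact: all_predT. Qed.

Lemma AE_ge0 L n f : nneg L -> (forall es, 0 <= f es) -> 0 <= AE L n f.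
Proof.
move=> hL; elim: n f => [|n IH] f h /=; first exact: h.
rewrite -[leLHS](_ : \sum_(p <- L) p.1 * (fun=> 0) p.2 = 0); last by apply: big1 => p _; rewrite mulr0.
by apply: (ler_sum_nneg (F := fun=> 0) (G := fun e => AE L n (fun es => f (e :: es)))) => // e; apply: IH.
Qed.

Lemma AE_cst L n c : AE L n (fun=> c) = mass L ^+ n * c.
Proof.
elim: n => [|n IH] /=; first by rewrite expr0 mul1r.
by rewrite IH -mulr_suml exprS -mulrA.
Qed.

Lemma AEZ L n c f : AE L n (fun es => c * f es) = c * AE L n f.
Proof.
elim: n f => //= n IH f; rewrite mulr_sumr; apply: eq_bigr => p _; rewrite IH; ring.
Qed.

Lemma mass_ge0 L : nneg L -> 0 <= mass L.
Proof.
elim: L => [|p L IH]; first by rewrite /mass big_nil.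
by move=> /andP[h1 h2]; rewrite /mass big_cons addr_ge0 //; apply: IH.
Qed.


Lemma eq_AE L n f g : (forall es, f es = g es) -> AE L n f = AE L n g.
Proof. by move=> h; congr (AE L n); apply: funext. Qed.

End AE.

Lemma AE_map (T T' : Type) (h : T -> T') (L : seq (R * T)) n (f : seq T' -> R) :
  AE [seq (p.1, h p.2) | p <- L] n f = AE L n (fun es => f (map h es)).
Proof. by elim: n f => //= n IH f; rewrite big_map; apply: eq_bigr => p _; rewrite IH. Qed.

Fixpoint pow_law (T : Type) (L : seq (R * T)) S : seq (R * seq T) :=
  if S is S'.+1 then [seq (p.1 * q.1, p.2 :: q.2) | p <- L, q <- pow_law L S'] else [:: (1, [::])].

Lemma sum_pow (T : Type) (L : seq (R * T)) S (F : seq T -> R) :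
  \sum_(q <- pow_law L S) q.1 * F q.2 = AE L S F.
Proof.
elim: S F => [|S IH] F /=; first by rewrite big_seq1 mul1r.
rewrite big_allpairs_dep; apply: eq_bigr => p _; rewrite -IH mulr_sumr.
by apply: eq_bigr => q _; rewrite mulrA.
Qed.

Lemma AE_add (T : Type) (L : seq (R * T)) m n (F : seq T -> R) :
  AE L (m + n) F = AE L m (fun es => AE L n (fun es' => F (es ++ es'))).
Proof. by elim: m F => //= m IH F; apply: eq_bigr => p _; rewrite IH. Qed.

Lemma AE_pow (T : Type) (L : seq (R * T)) S n (F : seq T -> R) :
  AE (pow_law L S) n (fun ess => F (flatten ess)) = AE L (S * n) F.
Proof.
elim: n F => [|n IH] F; first by rewrite muln0.
rewrite mulnS AE_add -(sum_pow L S (fun es => AE L (S * n) (fun es' => F (es ++ es')))) /=.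
by apply: eq_bigr => q _; rewrite -IH.
Qed.

Lemma all_allpairs (A B C : Type) (g : A -> B -> C) (P : pred C) (P1 : pred A) (P2 : pred B) s t :
  all P1 s -> all P2 t -> (forall a b, P1 a -> P2 b -> P (g a b)) ->
  all P [seq g a b | a <- s, b <- t].
Proof.
move=> h1 h2 h; elim: s h1 => //= a s IH /andP[Pa /IH h1]; rewrite all_cat h1 andbT all_map.
by elim: t h2 {IH h1} => //= b t IH /andP[Pb /IH ->]; rewrite h.
Qed.

Lemma nneg_pow (T : Type) (L : seq (R * T)) S : nneg L -> nneg (pow_law L S).
Proof.
move=> hL; elim: S => [|S IH] /=; first by rewrite /nneg /= ler01.
by apply: all_allpairs hL IH _ => p q; apply: mulr_ge0.
Qed.

Lemma mass_pow (T : Type) (L : seq (R * T)) S : mass (pow_law L S) = mass L ^+ S.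
Proof.
rewrite -[RHS]mulr1 -AE_cst -sum_pow /mass; apply: eq_bigr => *; by rewrite mulr1.
Qed.

Lemma supp_pow (T : Type) (L : seq (R * T)) S (Q : pred T) : all (fun p => Q p.2) L ->
  all (fun p => (size p.2 == S) && all Q p.2) (pow_law L S).
Proof.
move=> hL; elim: S => [|S IH] //=; apply: all_allpairs hL IH _ => p q /= h1 /andP[h2 h3].
by rewrite h1 h3 eqSS h2.
Qed.

Section SuperRow.
Context {T : Type} (N : pred T).
Implicit Types (L : seq (R * T)).

(* The law of a run of bad letters closed by a good one, restricted to the runs of length at most [J]. *)
Fixpoint SR L J : seq (R * seq T) :=
  if J is J'.+1 then [seq (p.1, [:: p.2]) | p <- L & N p.2] ++
     [seq (p.1 * q.1, p.2 :: q.2) | p <- [seq p <- L | ~~ N p.2], q <- SR L J']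
  else [::].

Lemma sum_SR L J (F : seq T -> R) :
  \sum_(q <- SR L J.+1) q.1 * F q.2 = \sum_(p <- L) p.1 *
    (if N p.2 then F [:: p.2] else \sum_(q <- SR L J) q.1 * F (p.2 :: q.2)).
Proof.
rewrite /= big_cat /= big_map big_filter big_allpairs_dep big_filter.
rewrite (big_mkcond (fun i => N i.2)) (big_mkcond (fun i => ~~ N i.2)) -big_split /=.
apply: eq_bigr => p _; case: (N p.2) => /=; rewrite ?addr0 ?add0r //.
by rewrite mulr_sumr; apply: eq_bigr => q _; rewrite mulrA.
Qed.

Lemma mass_SR L J : mass (SR L J.+1) = \sum_(p <- L) p.1 * (if N p.2 then 1 else mass (SR L J)).
Proof.
have E1 (T' : Type) (M : seq (R * T')) : mass M = \sum_(q <- M) q.1 * (fun=> 1) q.2.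
  by apply: eq_bigr => q _; rewrite mulr1.
rewrite E1 (sum_SR L J (fun=> 1)); apply: eq_bigr => p _.
by case: (N p.2) => //; rewrite E1.
Qed.

Lemma nneg_SR L J : nneg L -> nneg (SR L J).
Proof.
move=> hL; elim: J => //= J IH; rewrite /nneg all_cat all_map all_filter.
apply/andP; split; first by apply: sub_all hL => p h /=; apply/implyP.
apply: (all_allpairs (P1 := fun p => 0 <= p.1) (P2 := fun p => 0 <= p.1)) IH _ => [|p q]; last exact: mulr_ge0.
by rewrite all_filter; apply: sub_all hL => p h /=; apply/implyP.
Qed.

(** If [d] is the deficit at level [J] and [be] the mass of the bad letters, the deficit at level
    [J + 1] is [1 - mass L + be * d]. *)
Lemma SR_deficit L J (beta eta : R) : nneg L -> mass L <= 1 -> 1 - eta <= mass L -> 0 <= eta ->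
  \sum_(p <- L | ~~ N p.2) p.1 <= beta -> 0 <= beta <= 1 ->
  0 <= 1 - mass (SR L J) <= J%:R * eta + beta ^+ J.
Proof.
move=> hL mL mL' e0 hb /andP[b0 b1]; elim: J => [|J /andP[IH1 IH2]].
  by rewrite /mass big_nil subr0 mul0r add0r expr0 lexx ler01.
have -> : mass (SR L J.+1) = mass L - (1 - mass (SR L J)) * \sum_(p <- L | ~~ N p.2) p.1.
  rewrite mass_SR [X in _ - _ * X]big_mkcond mulr_sumr -sumrB; apply: eq_bigr => p _.
  by case: (N p.2) => /=; ring.
move: IH1 IH2; set d := 1 - mass (SR L J) => IH1 IH2.
have be0 : 0 <= \sum_(p <- L | ~~ N p.2) p.1.
  rewrite big_mkcond; elim: (L) hL => [|p L' IH]; first by rewrite big_nil.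
  by move=> /andP[h1 h2]; rewrite big_cons addr_ge0 ?IH //; case: ifP.
move: hb be0; set be := \sum_(p <- L | _) _ => hb be0.
have bJ : 0 <= beta ^+ J by apply: exprn_ge0.
apply/andP; split; first by have := mulr_ge0 IH1 be0; lra.
rewrite -addn1 natrD exprD expr1 mulrDl mul1r.
have := ler_pM IH1 be0 IH2 hb.
have h2 : J%:R * eta * beta <= J%:R * eta by rewrite ler_piMr // mulr_ge0.
by rewrite mulrDl => h3; lra.
Qed.

(** Independent runs put end to end form a stream of independent letters, and truncation only
    discards mass. Each run holds at least one letter, so [K] runs provide the [K] letters read. *)
Lemma AE_read L J K n (f : seq T -> R) : nneg L -> mass L <= 1 -> (forall es, 0 <= f es) -> (K <= n)%N ->
  AE (SR L J) n (fun ess => f (take K (flatten ess))) <= AE L K f.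
Proof.
move=> hL mL; have m0 := mass_ge0 hL.
have M1 J' : mass (SR L J') <= 1.
  have b1 : \sum_(p <- L | ~~ N p.2) p.1 <= 1.
    rewrite big_mkcond; apply: le_trans mL; rewrite /mass; elim: (L) hL => [|p L' IH]; first by rewrite !big_nil.
    by move=> /andP[h1 h2]; rewrite !big_cons lerD ?IH //; case: ifP.
  have h1 : 1 - (1 - mass L) <= mass L by lra.
  have h2 : 0 <= 1 - mass L by lra.
  have h3 : 0 <= (1 : R) <= 1 by rewrite ler01 lexx.
  by have /andP[] := SR_deficit J' hL mL h1 h2 b1 h3; lra.
have M0 J' : 0 <= mass (SR L J') by apply: mass_ge0; apply: nneg_SR.
have TT g m : AE (SR L J) m (fun ess => g (take 0 (flatten ess) : seq T)) = mass (SR L J) ^+ m * g [::].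
  by rewrite -AE_cst; apply: eq_AE => es; rewrite take0.
(* Reading goes on from inside a run, so the second statement carries the rest of a run, of length
   at most [J'], along with the runs to come. *)
suff [H _] : (forall n f, (forall es, 0 <= f es) -> (K <= n)%N ->
    AE (SR L J) n (fun ess => f (take K (flatten ess))) <= AE L K f) /\
  (forall J' n f, (forall es, 0 <= f es) -> (K <= n.+1)%N ->
    \sum_(q <- SR L J') q.1 * AE (SR L J) n (fun ess => f (take K (q.2 ++ flatten ess))) <= AE L K f).
  exact: H.
elim: K {n f} => [|K [IH1 IH2]].
  split=> [n f f0 _|J' n f f0 _] /=; first by rewrite TT ler_piMl // exprn_ile1.
  rewrite (eq_bigr (fun q => q.1 * (mass (SR L J) ^+ n * f [::]))) => [|q _]; last first.
    by congr (_ * _); rewrite -AE_cst; apply: eq_AE => es; rewrite take0.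
  rewrite -mulr_suml mulrA ler_piMl // mulr_ile1 ?exprn_ge0 ?exprn_ile1 //; [exact: M0|exact: M1].
have H2 J' n f : (forall es, 0 <= f es) -> (K.+1 <= n.+1)%N ->
    \sum_(q <- SR L J') q.1 * AE (SR L J) n (fun ess => f (take K.+1 (q.2 ++ flatten ess))) <= AE L K.+1 f.
  move=> f0 Kn; case: J' => [|J']; first by rewrite big_nil AE_ge0.
  rewrite (sum_SR L J' (fun es => AE (SR L J) n (fun ess => f (take K.+1 (es ++ flatten ess))))) /=.
  apply: (ler_sum_nneg (F := fun e => if N e then AE (SR L J) n (fun ess => f (take K.+1 ([:: e] ++ flatten ess)))
    else \sum_(q <- SR L J') q.1 * AE (SR L J) n (fun ess => f (take K.+1 ((e :: q.2) ++ flatten ess))))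
    (G := fun e => AE L K (fun es => f (e :: es)))) => // e.
  by case: ifP => _; [apply: IH1|apply: IH2] => //; lia.
split=> // n f f0; case: n => // n Kn /=.
exact: H2.
Qed.

End SuperRow.
End Laws.

(** * Success rate of a run of segments *)

Section SuperSuccess.
Context {R : realType} (tau tau' : R) (S H D n : nat).
Let W := (2 * H)%N.
Hypotheses (tau0 : 0 <= tau) (tau'1 : 0 <= tau' <= 1 / 2) (SE : ~~ odd S) (SW : (2 * W + 2 <= S)%N) (D4 : (4 < D)%N)
  (n0 : (0 < n)%N)
  (hA : ((S * W)%:R * tau) ^+ 2 <= tau')
  (hB : ((S * 2 * W)%:R * tau) ^+ 2 + W%:R * (1 - n%:R^-1) ^+ (D - 4) <= tau')
  (htau : (S * 2 * W)%:R * tau <= 1 / 2)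
  (hC : forall p : R, 0 <= p <= 1 -> p <= n%:R^-1 -> n%:R * p / 4 <= 1 / 2 * (1 - (1 - p) ^+ (D - 1))).

Definition nrm (p : R) := 1 - tau <= p.
Definition bad_prod (e : seq R) : R := \prod_(p <- e | ~~ nrm p) p.
Definition nbad (e : seq R) := count (fun p => ~~ nrm p) e.

(** A run is a sequence of bad segments closed by a normal one; [rev (behead (rev es))] removes the
    latter. The middle case is the profitable one: a lone bad row of density [p] is forgotten if [p]
    is at least [1 / n], and otherwise improved to [n * p / 4]. In all other cases the full product
    of the densities is paid. *)
Definition coarse_val (es : seq (seq R)) : R :=
  if size es == 1%N then 1 - tau'
  else if (size es == 2%N) && (nbad (head [::] es) == 1%N) then
    (if n%:R^-1 <= bad_prod (head [::] es) then 1 - tau' else n%:R * bad_prod (head [::] es) / 4)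
  else 1 / 2 * \prod_(e <- rev (behead (rev es))) \prod_(p <- e) p.

Definition superrow (es : seq (seq R)) : Prop :=
  exists es0 e, [/\ es = rcons es0 e, all (fun e => (size e == S) && all (fun p => 0 < p <= 1) e) es,
    all nrm e & all (fun e => ~~ all nrm e) es0].

Lemma nbad1 (e : seq R) : nbad e = 1%N -> exists r, [/\ (r < size e)%N, nth 0 e r = bad_prod e &
  forall j, (j < size e)%N -> j != r -> nrm (nth 0 e j)].
Proof.
rewrite /nbad /bad_prod; elim: e => [|p e IH] //=; rewrite big_cons.
case: (boolP (nrm p)) => np /=.
  rewrite add0n => /IH[r [h1 h2 h3]]; exists r.+1; split=> // -[|j] //= h; apply: h3 => //.
rewrite add1n => -[/eqP]; rewrite -leqn0 leqNgt -has_count => /hasPn h.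
exists 0%N; split=> //=.
  by rewrite big_seq_cond big_pred0 ?mulr1 // => q; apply/negbTE; rewrite negb_and; have [/h ->|//] := boolP (q \in e); rewrite orbT.
by move=> [|j] //= hj _; have := h _ (mem_nth 0 hj); rewrite negbK.
Qed.

Lemma coarse_val_gt0 es : superrow es -> 0 < coarse_val es <= 1.
Proof.
move=> [es0 [e [-> hs _ _]]]; have /andP[t2 t3] := tau'1; have t1 : 0 < 1 - tau' <= 1 by clear hA hB htau hC; apply/andP; split; lra.
rewrite /coarse_val; case: ifP => // _; case: ifP => h.
  case: ifP => h1 //.
  have : all (fun p => 0 < p <= 1) (head [::] (rcons es0 e)).
    by case: es0 hs {h h1} => [|e0 es0] /= /andP[/andP[_ ->]].
  set e0 := head _ _ in h1 *; move=> he.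
  have p0 : 0 < bad_prod e0.
    rewrite /bad_prod; elim: (e0) he => [|p e1 IH] /=; first by rewrite big_nil ltr01.
    by move=> /andP[hp /IH h2]; rewrite big_cons; case: ifP => // _; rewrite mulr_gt0 //; case/andP: hp.
  have h2 : bad_prod e0 < n%:R^-1 by rewrite ltNge h1.
  have n0' : 0 < n%:R :> R by rewrite ltr0n.
  have h3 : n%:R * bad_prod e0 < 1 by rewrite mulrC -ltr_pdivlMr // div1r.
  have := mulr_gt0 n0' p0; move: h3; set y := n%:R * _ => h3 h4; apply/andP; split; lra.
have : 0 < \prod_(e1 <- rev (behead (rev (rcons es0 e)))) \prod_(p <- e1) p <= 1.
  rewrite rev_rcons /= revK; move: hs; rewrite all_rcons => /andP[_].
  elim: es0 {h} => [|e1 es1 IH] /=; first by rewrite big_nil ltr01 lexx.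
  move=> /andP[/andP[_ h1] /IH h2]; rewrite big_cons.
  have h3 : 0 < \prod_(p <- e1) p <= 1.
    elim: e1 h1 => [|p e2 IH2] /=; first by rewrite big_nil ltr01 lexx.
    move=> /andP[/andP[h3 h4] /IH2/andP[h5 h6]]; rewrite big_cons mulr_gt0 //=.
    by rewrite mulr_ile1 // ltW.
  by case/andP: h2 => h4 h5; case/andP: h3 => h6 h7; rewrite mulr_gt0 //= mulr_ile1 // ltW.
set P := \prod_(_ <- _) _ => /andP[h1 h2]; apply/andP; split; lra.
Qed.

Lemma size_flat es : superrow es -> size (flatten es) = (S * size es)%N.
Proof.
move=> [es0 [e [_ + _ _]]]; elim: es => [|e1 es IH] /=; first by rewrite muln0.
by move=> /andP[/andP[/eqP h _] /IH h2]; rewrite size_cat h h2 mulnS.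
Qed.

Lemma nth_all (P : pred R) e j : all P e -> (j < size e)%N -> P (nth 0 e j).
Proof. by move=> /(all_nthP 0) h /h. Qed.

Lemma superrow_success es (rho : nat -> R) t lo a s : superrow es -> unit_par rho -> ~~ odd t ->
  (forall j, (j < size (flatten es))%N -> rho (t + j)%N = nth 0 (flatten es) j) ->
  {subset reg t (size (flatten es)) W lo predT <= s} -> lo <= a -> a + D%:Z <= lo + W%:Z ->
  coarse_val es <= Pr (fun z : nat * int => rho z.1) s
    (succ_ev t (size (flatten es)) W lo a (a + D%:Z - 1)) xfalse.
Proof.
move=> hes hr te hrho hs la ab; have sz := size_flat hes.
move: hes => [es0 [e [ees hall ne nes0]]].
have hw : prob_weight (fun z : nat * int => rho z.1) by move=> z; apply: hr.
have se : size e = S by move: hall; rewrite ees all_rcons => /andP[/andP[/eqP]].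
have fl : flatten es = flatten es0 ++ e by rewrite ees -cats1 flatten_cat /= cats0.
have sf : size (flatten es) = (size (flatten es0) + S)%N by rewrite fl size_cat se.
have last_n j : (t + size (flatten es0) <= j < t + size (flatten es))%N -> 1 - tau <= rho j.
  move=> hj; have -> : j = (t + (j - t))%N by clear -hj; lia.
  rewrite hrho; last by clear -hj; lia.
  have h0 : (j - t < size (flatten es0))%N = false by apply/negbTE; rewrite -leqNgt; clear -hj; lia.
  rewrite fl nth_cat h0.
  apply: (nth_all (P := nrm)) => //; case/andP: hj => h1 h2.
  by rewrite se -subnDA ltn_subLR // -addnA -sf.
rewrite /coarse_val; case: ifP => [/eqP s1|s1].
  have e0 : es0 = [::] by move: s1; rewrite ees size_rcons => -[/size0nil].
  apply: (@le_trans _ _ (1 - ((size (flatten es) * W)%:R * tau) ^+ 2)).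
    by rewrite sz s1 muln1 lerD2l lerN2.
  apply: succ_normal => //.
  - by move=> j hj; apply: last_n; rewrite e0 /= addn0.
  - by rewrite sz s1 muln1.
  - by clear -D4; lia.
  - by clear -ab; lia.
case: ifP => [/andP[/eqP s2 nb]|s2].
  have s3 : size es0 = 1%N by move: s2; rewrite ees size_rcons => -[].
  case: es0 s3 fl sf last_n {nes0} ees => [|e0 [|//]] // _ fl sf last_n ees.
  have he0 : head [::] es = e0 by rewrite ees.
  rewrite he0 in nb *; move: nb => /eqP/nbad1[r [h1 h2 h3]].
  have se0 : size e0 = S by move: hall; rewrite ees /= => /andP[/andP[/eqP]].
  have sf2 : size (flatten es) = (S * 2)%N by rewrite sz ees.
  rewrite /= cats0 se0 in fl sf last_n.
  have rr : (t <= t + r < t + size (flatten es))%N by rewrite se0 in h1; clear -h1 sf2 SW; lia.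
  have hn j : (t <= j < t + size (flatten es))%N -> j != (t + r)%N -> 1 - tau <= rho j.
    move=> hj jr; have [h|h] := ltnP j (t + S)%N; last by apply: last_n; clear -hj h; lia.
    have -> : j = (t + (j - t))%N by clear -hj; lia.
    rewrite hrho; last by clear -hj; lia.
    rewrite fl nth_cat se0 ifT; last by clear -hj h; lia.
    by apply: h3; rewrite ?se0; clear -hj h jr; lia.
  have er : rho (t + r)%N = bad_prod e0.
    rewrite se0 in h1; rewrite hrho; last by clear -h1 sf2; lia.
    by rewrite fl nth_cat se0 h1.
  have tl : (2 * W + 2 <= t + size (flatten es) - (t + r).+1)%N by rewrite se0 in h1; clear -h1 sf2 SW; lia.
  have p01 : 0 <= bad_prod e0 <= 1 by rewrite -er; apply: hr.
  case: ifP => hp.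
    apply: (@le_trans _ _ (1 - (((size (flatten es) * W)%:R * tau) ^+ 2 + W%:R * (1 - rho (t + r)%N) ^+ (D - 4)))).
      rewrite sf2 er lerD2l lerN2; apply: le_trans hB; rewrite lerD2l; apply: ler_wpM2l => //.
      have /andP[p0 p1] := p01.
      by rewrite lerXn2r ?nnegrE ?subr_ge0 ?lerD2l ?lerN2 // (le_trans hp).
    have := @succ_one_bad R rho s t (size (flatten es)) W lo tau hr hs tau0 (t + r)%N a (a + D%:Z - 1) (D - 4)%N.
    by apply=> //; clear -la ab D4; lia.
  have hp' : bad_prod e0 <= n%:R^-1 by rewrite ltW // ltNge hp.
  apply: le_trans (hC p01 hp') _; rewrite -er.
  rewrite (_ : (D - 1)%N = absz (a + D%:Z - 1 - a)%R); last by clear -D4; lia.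
  apply: (succ_small (tau := tau)) => //.
  - by rewrite sf2.
  - by clear -D4; lia.
  - by clear -ab; lia.
have -> : rev (behead (rev es)) = es0 by rewrite ees rev_rcons /= revK.
have -> : \prod_(e1 <- es0) \prod_(p <- e1) p = \prod_(p <- flatten es0) p.
  by elim: (es0) => [|e1 es1 IH]; rewrite ?big_nil // big_cons IH /= big_cat.
have es0n : (0 < size (flatten es0))%N.
  have h : size (flatten es0) = (S * (size es).-1)%N by move: sz; rewrite fl size_cat se ees size_rcons /= mulnS; clear; lia.
  by rewrite h ees size_rcons /=; move: s1; rewrite ees size_rcons eqSS; clear -SW; nia.
have -> : \prod_(p <- flatten es0) p = \prod_(t <= j < (t + (size (flatten es0)).-1).+1) rho j.
  rewrite (big_nth 0) -{1}(add0n t) big_addn (_ : (_.+1 - t = size (flatten es0))%N); last by rewrite -addnS prednK // addKn.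
  rewrite !big_nat; apply: eq_bigr => j hj; rewrite addnC hrho; last by rewrite sf ltn_addr.
  by rewrite fl nth_cat ifT.
(* Row [r] is the last row before the closing segment, wherever the bad rows are: everything up to
   it is paid by the product, everything after it is normal. *)
apply: le_trans (@succ_any R rho s t (size (flatten es)) W lo tau hr hs tau0 (t + (size (flatten es0)).-1) a _ _ _ _ la _) _.
- by clear -es0n sf SW; lia.
- by move=> j hj; apply: last_n; clear -es0n hj; lia.
- by clear -es0n sf SW; lia.
- have -> : (t + size (flatten es) - (t + (size (flatten es0)).-1).+1 = S)%N by clear -es0n sf; lia.
  apply: le_trans htau; apply: ler_wpM2r => //; rewrite ler_nat; clear; nia.
- by clear -la ab D4; lia.
by apply: Pr_sub => // x h k /h hk; apply: (cev_sub _ hk) => i; clear -D4; lia.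
Qed.

End SuperSuccess.

(** * Inverse moments of the coarse densities *)

Lemma sum_square_aux {R : realType} (z1 z2 z3 z4 z5 : R) : z1 <= z3 -> z2 <= z4 -> 0 <= z5 -> 0 <= z4 ->
  z1 + z2 <= z3 + 2 * z4 + z5.
Proof. lra. Qed.

Section Moments.
Context {R : realType} (tau tau' : R) (n : nat).
Hypotheses (tau01 : 0 <= tau <= 1) (n0 : (0 < n)%N).
Notation nrm := (nrm tau).
Notation nbad := (nbad tau).

(** The weight of a segment in the tenth inverse moment when all its rows are paid for. *)
Definition gw (e : seq R) : R := \prod_(p <- e) (p^-1) ^+ 10.
Definition row01 (e : seq R) := all (fun p => 0 < p <= 1) e.

Lemma inv10_ge1 (p : R) : 0 < p <= 1 -> 1 <= (p^-1) ^+ 10.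
Proof. by move=> /andP[h1 h2]; rewrite exprn_ege1 // invf_ge1. Qed.

Lemma gw_ge1 e : row01 e -> 1 <= gw e.
Proof.
elim: e => [|p e IH] /=; first by rewrite /gw big_nil.
by move=> /andP[hp /IH h]; rewrite /gw big_cons -[leLHS]mulr1 ler_pM // inv10_ge1.
Qed.

Lemma gw_bad e : row01 e -> 0 < bad_prod tau e /\ ((bad_prod tau e)^-1) ^+ 10 <= gw e.
Proof.
rewrite /bad_prod /gw; elim: e => [|p e IH] /=; first by rewrite !big_nil invr1 expr1n ltr01.
move=> /andP[hp /IH[h1 h2]]; rewrite !big_cons; have := inv10_ge1 hp; move: (hp) => /andP[p0 _].
case: (boolP (nrm p)) => _ /= hq.
  split=> //; rewrite -[leLHS]mul1r ler_pM // exprn_ge0 // invr_ge0 ltW //.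
by rewrite mulr_gt0 //; split=> //; rewrite invfM exprMn ler_pM // exprn_ge0 // invr_ge0 ltW.
Qed.

Section RowSums.
Variables (L : seq (R * R)) (Ga B : R).
Hypotheses (hL : nneg L) (h01 : all (fun p => 0 < p.2 <= 1) L) (Ga1 : 1 <= Ga) (B0 : 0 <= B).
Let xs := \sum_(p <- L | nrm p.2) p.1 * (p.2^-1) ^+ 10.
Let ys := \sum_(p <- L | ~~ nrm p.2) p.1 * (p.2^-1) ^+ 10.
Hypotheses (hxy : xs + ys <= Ga) (hy : ys <= B).

Let pos (P : pred R) : 0 <= \sum_(p <- L | P p.2) p.1 * (p.2^-1) ^+ 10.
Proof.
rewrite big_mkcond; elim: (L) hL h01 => [|p L' IH] /=; first by rewrite big_nil.
move=> /andP[h1 h2] /andP[/andP[h3 _] h4]; rewrite big_cons addr_ge0 ?IH //.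
by case: ifP => // _; rewrite mulr_ge0 // exprn_ge0 // invr_ge0 ltW.
Qed.

Lemma AE_gw_rec k (P Q1 Q2 : seq R -> R) :
  (forall p e, P (p :: e) = if nrm p then Q1 e else Q2 e) ->
  AE L k.+1 (fun e => P e * gw e) = xs * AE L k (fun e => Q1 e * gw e) + ys * AE L k (fun e => Q2 e * gw e).
Proof.
move=> h /=; rewrite /xs /ys (big_mkcond (fun p => nrm p.2)) (big_mkcond (fun p => ~~ nrm p.2)) !mulr_suml -big_split /=.
apply: eq_bigr => p _.
have -> : AE L k (fun es => P (p.2 :: es) * gw (p.2 :: es)) =
    (p.2^-1) ^+ 10 * AE L k (fun es => (if nrm p.2 then Q1 es else Q2 es) * gw es).
  by rewrite -AEZ; apply: eq_AE => es; rewrite h /gw big_cons mulrCA.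
by case: (nrm p.2) => /=; rewrite ?mul0r ?addr0 ?add0r mulrA.
Qed.

(** Every bad row asked for brings a factor [k * B], for the choice of its place and for its weight;
    the other rows contribute at most [Ga] each. *)
Lemma row_sums k : [/\ AE L k gw <= Ga ^+ k,
  AE L k (fun e => (0 < nbad e)%N%:R * gw e) <= k%:R * B * Ga ^+ k &
  AE L k (fun e => (1 < nbad e)%N%:R * gw e) <= (k%:R * B) ^+ 2 * Ga ^+ k].
Proof.
have x0 : 0 <= xs by apply: pos. have y0 : 0 <= ys by apply: (pos (fun p => ~~ nrm p)).
have G0 j : 0 <= Ga ^+ j by rewrite exprn_ge0 // (le_trans ler01).
elim: k => [|k [IH1 IH2 IH3]].
  by rewrite /= /gw big_nil !mul0r expr0n /= !mul0r; split=> //; rewrite expr0.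
have E0 := @AE_gw_rec k (fun=> 1) (fun=> 1) (fun=> 1) (fun p e => esym (if_same _ _)).
have E1 := @AE_gw_rec k (fun e => (0 < nbad e)%N%:R) (fun e => (0 < nbad e)%N%:R) (fun=> 1) _.
have E2 := @AE_gw_rec k (fun e => (1 < nbad e)%N%:R) (fun e => (1 < nbad e)%N%:R) (fun e => (0 < nbad e)%N%:R) _.
have one j : AE L j (fun e => 1 * gw e) = AE L j gw by apply: eq_AE => e; rewrite mul1r.
rewrite one one in E0; rewrite E0 E1 ?E2 ?one; last 2 first.
- by move=> p e; rewrite /nbad /=; case: (nrm p).
- by move=> p e; rewrite /nbad /=; case: (nrm p).
move: IH1 IH2 IH3; set a0 := AE L k gw; set a1 := AE L k _; set a2 := AE L k _ => IH1 IH2 IH3.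
have a00 : 0 <= a0.
  apply: AE_ge0 => // e.
  by rewrite /gw prodr_ge0 // => p _; rewrite exprn_even_ge0.
have kB : 0 <= k%:R * B by rewrite mulr_ge0.
have nf (e : seq R) b : 0 <= (b : bool)%:R * gw e.
  by rewrite mulr_ge0 // /gw prodr_ge0 // => p _; rewrite exprn_even_ge0.
have a10 : 0 <= a1 by apply: AE_ge0 => // e.
have a20 : 0 <= a2 by apply: AE_ge0 => // e.
have xG : xs <= Ga by apply: le_trans hxy; rewrite lerDl.
have GG : Ga ^+ k <= Ga ^+ k.+1 by rewrite exprS ler_peMl.
split.
- by rewrite -mulrDl exprS ler_pM // addr_ge0.
- rewrite -[k.+1]addn1 natrD mulrDl mul1r mulrDl addn1; apply: lerD.
    by rewrite exprS mulrCA; apply: ler_pM.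
  by apply: (le_trans (ler_pM _ _ hy IH1)) => //; rewrite ler_wpM2l.
have e1 : xs * a2 <= (k%:R * B) ^+ 2 * Ga ^+ k.+1.
  by rewrite [Ga ^+ k.+1]exprS mulrCA; apply: ler_pM.
have e2 : ys * a1 <= B * (k%:R * B) * Ga ^+ k.+1.
  apply: (le_trans (ler_pM _ _ hy IH2)) => //.
  have -> : B * (k%:R * B * Ga ^+ k) = B * (k%:R * B) * Ga ^+ k by ring.
  by apply: ler_wpM2l => //; rewrite mulr_ge0.
have e3 : (k.+1%:R * B) ^+ 2 * Ga ^+ k.+1 = (k%:R * B) ^+ 2 * Ga ^+ k.+1 + 2 * (B * (k%:R * B) * Ga ^+ k.+1) + B ^+ 2 * Ga ^+ k.+1.
  by rewrite -[k.+1]addn1 natrD addn1; ring.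
have e4 : 0 <= B ^+ 2 * Ga ^+ k.+1 by rewrite mulr_ge0 // exprn_ge0.
have e5 : 0 <= B * (k%:R * B) * Ga ^+ k.+1 by rewrite !mulr_ge0.
by rewrite e3; apply: sum_square_aux.
Qed.

End RowSums.

Section SuperSums.
Variables (M : seq (R * seq R)) (A A2 : R).
Hypotheses (hM : nneg M) (h01 : all (fun p => row01 p.2) M) (mM : mass M <= 1) (A0 : 0 <= A <= 1 / 2) (A20 : 0 <= A2)
  (hA : \sum_(p <- M) p.1 * (if all nrm p.2 then 0 else gw p.2) <= A)
  (hA2 : \sum_(p <- M) p.1 * (if (1 < nbad p.2)%N then gw p.2 else 0) <= A2).

(** The last segment carries no weight: in a run it is normal and is not paid for by the column
    strategy. *)
Fixpoint Gw (es : seq (seq R)) : R := if es is e :: es' then (if es' is [::] then 1 else gw e * Gw es') else 1.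

Lemma Gw_ge0 es : 0 <= Gw es.
Proof.
elim: es => [|e [|e' es] IH] //=; rewrite mulr_ge0 //.
by rewrite /gw prodr_ge0 // => p _; rewrite exprn_even_ge0.
Qed.

Lemma Gw_cons e es : row01 e -> Gw (e :: es) <= gw e * Gw es.
Proof. by case: es => //= h; rewrite mulr1; apply: gw_ge1. Qed.

Notation SRM := (SR (all nrm) M).

(** A geometric series: each further bad segment brings a factor [A], and the bound 2 reproduces
    itself because [1 + 2 * A <= 2]. *)
Lemma Gw_sums J : [/\ mass (SRM J) <= 1, \sum_(q <- SRM J) q.1 * Gw q.2 <= 2 &
  \sum_(q <- SRM J) q.1 * ((1 < size q.2)%N%:R * Gw q.2) <= 2 * A].
Proof.
have /andP[A1 A3] := A0.
elim: J => [|J [IH1 IH2 IH3]]; first by rewrite /mass !big_nil ler01 ler0n mulr_ge0.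
have nSR := nneg_SR (all nrm) J hM.
have p0 : 0 <= \sum_(q <- SRM J) q.1 * Gw q.2.
  rewrite -[leLHS](_ : \sum_(q <- SRM J) q.1 * (fun=> 0) q.2 = 0); last by rewrite big1 // => q _; rewrite mulr0.
  by apply: (ler_sum_nneg (F := fun=> 0)) => // e; apply: Gw_ge0.
have g0 e : 0 <= gw e by rewrite /gw prodr_ge0 // => p _; rewrite exprn_even_ge0.
have H (c : R) : 0 <= c -> \sum_(p <- M) p.1 * (if all nrm p.2 then c else gw p.2 * \sum_(q <- SRM J) q.1 * Gw q.2) <= c + A * 2.
  move=> c0; apply: (@le_trans _ _ (mass M * c + A * \sum_(q <- SRM J) q.1 * Gw q.2)); last first.
    by apply: lerD; [rewrite ler_piMl|rewrite ler_wpM2l].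
  rewrite /mass mulr_suml.
  apply: (@le_trans _ _ (\sum_(p <- M) p.1 * c + (\sum_(p <- M) p.1 * (if all nrm p.2 then 0 else gw p.2)) * \sum_(q <- SRM J) q.1 * Gw q.2)).
    rewrite [X in _ + X]mulr_suml -big_split /=.
    have -> : \sum_(i <- M) (i.1 * c + i.1 * (if all nrm i.2 then 0 else gw i.2) * (\sum_(q <- SRM J) q.1 * Gw q.2))
       = \sum_(i <- M) i.1 * (c + (if all nrm i.2 then 0 else gw i.2) * (\sum_(q <- SRM J) q.1 * Gw q.2)).
      by apply: eq_bigr => i _; rewrite mulrDr mulrA.
    apply: (ler_sum_nneg (F := fun e => if all nrm e then c else gw e * \sum_(q <- SRM J) q.1 * Gw q.2)
      (G := fun e => c + (if all nrm e then 0 else gw e) * \sum_(q <- SRM J) q.1 * Gw q.2)) => // e.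
    by case: ifP => _; rewrite ?mul0r ?addr0 // lerDr.
  by rewrite lerD2l ler_wpM2r.
have K (b : bool) (F : seq (seq R) -> R) : (forall e es, row01 e -> F (e :: es) <= gw e * Gw es) ->
   (forall e, F [:: e] <= b%:R) -> \sum_(q <- SRM J.+1) q.1 * F q.2 <= b%:R + A * 2.
  move=> hF hF1; apply: le_trans (H b%:R (ler0n _ _)); rewrite sum_SR.
  apply: (ler_sum_supp (Q := row01) (F := fun e => if all nrm e then F [:: e] else \sum_(q <- SRM J) q.1 * F (e :: q.2))
     (G := fun e => if all nrm e then b%:R else gw e * \sum_(q <- SRM J) q.1 * Gw q.2)) => // e he.
  case: ifP => _ //; rewrite mulr_sumr.
  have -> : \sum_(i <- SRM J) gw e * (i.1 * Gw i.2) = \sum_(i <- SRM J) i.1 * (gw e * Gw i.2).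
    by apply: eq_bigr => i _; rewrite mulrCA.
  by apply: (ler_sum_nneg (F := fun es => F (e :: es)) (G := fun es => gw e * Gw es)) => // es; apply: hF.
split.
- rewrite mass_SR; apply: le_trans mM; rewrite /mass.
  rewrite [leRHS](_ : _ = \sum_(p <- M) p.1 * (fun=> 1) p.2); last by apply: eq_bigr => p _; rewrite mulr1.
  apply: (ler_sum_nneg (F := fun e => if all nrm e then 1 else mass (SRM J)) (G := fun=> 1)) => // e.
  by case: ifP.
- have := K true Gw Gw_cons (fun e => lexx _); rewrite /=; lra.
rewrite (_ : 2 * A = false%:R + A * 2); last by rewrite add0r mulrC.
  apply: (K false (fun es => (1 < size es)%N%:R * Gw es)).
- move=> e es he; apply: le_trans (Gw_cons es he).
  by rewrite ler_piMl ?Gw_ge0 //; case: (_ < _)%N.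
- by move=> e /=; rewrite mul0r.
Qed.

(** Contribution of a run to the inverse moment at the next scale, where only rates below the new
    threshold are counted. *)
Definition Phi (es : seq (seq R)) : R :=
  if 1 - tau' <= coarse_val tau tau' n es then 0 else ((coarse_val tau tau' n es)^-1) ^+ 10.

(** Either there is one bad row in all, and the factor [n / 4] of [coarse_val] yields
    [(4 / n) ^ 10]; or two bad rows share a segment; or there are two bad segments. The last two
    cases have no gain but are of second order on average. *)
Lemma Phi_le e es : row01 e -> ~~ all nrm e -> all row01 es ->
  Phi (e :: es) <= (4 / n%:R) ^+ 10 * gw e + 2 ^+ 10 * (if (1 < nbad e)%N then gw e else 0) * Gw es
    + 2 ^+ 10 * gw e * ((1 < size es)%N%:R * Gw es).
Proof.
move=> he ne hes; have g1 := gw_ge1 he; have G0 := Gw_ge0 es.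
have n0' : 0 < n%:R :> R by rewrite ltr0n.
have c1 : 0 <= (4 / n%:R) ^+ 10 * gw e.
  by rewrite mulr_ge0 ?exprn_ge0 ?divr_ge0 //; lra.
have c2 : 0 <= 2 ^+ 10 * (if (1 < nbad e)%N then gw e else 0) * Gw es.
  by rewrite !mulr_ge0 ?exprn_ge0 //; case: ifP => _; lra.
have c3 : 0 <= 2 ^+ 10 * gw e * ((1 < size es)%N%:R * Gw es).
  by rewrite !mulr_ge0 ?exprn_ge0 //; lra.
rewrite /Phi; case: ifP => [_|]; first by lra.
have nb : (0 < nbad e)%N by rewrite -has_count has_predC.
case: es hes c2 c3 {G0} => [|e1 es] hes c2 c3; first by rewrite /coarse_val /= lexx.
have main : coarse_val tau tau' n [:: e, e1 & es] = 1 / 2 * \prod_(e0 <- belast e (e1 :: es)) \prod_(p <- e0) p ->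
   ((coarse_val tau tau' n [:: e, e1 & es])^-1) ^+ 10 = 2 ^+ 10 * gw e * Gw (e1 :: es).
  move=> ->; rewrite invfM exprMn div1r invrK -mulrA; congr (_ * _).
  have Gp (l : seq R) : ((\prod_(p <- l) p)^-1) ^+ 10 = gw l.
    by rewrite /gw; elim: l => [|p l IH]; rewrite ?big_nil ?invr1 ?expr1n // !big_cons invfM exprMn IH.
  rewrite /= big_cons invfM exprMn Gp; congr (_ * _).
  elim: es e1 {c2 c3 hes} => [|e2 es IH] e1 /=; first by rewrite big_nil invr1 expr1n.
  by rewrite big_cons invfM exprMn Gp IH.
have rb : rev (behead (rev [:: e, e1 & es])) = belast e (e1 :: es).
  by rewrite (lastI e (e1 :: es)) rev_rcons /= revK.
have [s2|s2] := boolP ((size [:: e, e1 & es] == 2%N) && (nbad e == 1%N)).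
  have := s2 => /andP[/eqP s3 /eqP nb1]; case: es s3 hes c2 c3 {main rb} s2 => // _ _ c2 c3 s2.
  rewrite /coarse_val /= nb1 /=; case: ifP => h; first by rewrite lexx.
  move=> _; have [b0 b1] := gw_bad he.
  apply: (@le_trans _ _ ((4 / n%:R) ^+ 10 * gw e)); last by rewrite nb1 /= in c2 c3 *; lra.
  have -> : (n%:R * bad_prod tau e / 4)^-1 = (4 / n%:R) * (bad_prod tau e)^-1.
    by rewrite !invfM invrK; ring.
  by rewrite exprMn ler_wpM2l // exprn_ge0 // divr_ge0.
move=> _; rewrite main; last by rewrite /coarse_val (negbTE s2) /= rb.
case: es {rb main} s2 c2 c3 hes => [|e2 es] s2 c2 c3 hes; last by rewrite [(1 < _)%N]/= mul1r; lra.
have -> : (1 < nbad e)%N by move: s2 => /= s2; rewrite ltn_neqAle eq_sym s2.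
by rewrite /= mulr1 mul0r mulr0 addr0 lerDr.
Qed.

Lemma Phi_sum J : \sum_(q <- SRM J) q.1 * Phi q.2 <= (4 / n%:R) ^+ 10 * A + 2 ^+ 11 * A2 + 2 ^+ 11 * A ^+ 2.
Proof.
have /andP[A1 A3] := A0.
have n0' : 0 < n%:R :> R by rewrite ltr0n.
have d0 : 0 <= (4 / n%:R) ^+ 10 :> R by rewrite exprn_ge0 // divr_ge0.
case: J => [|J].
  rewrite big_nil.
  have u1 : 0 <= (4 / n%:R) ^+ 10 * A by apply: mulr_ge0.
  have u2 : 0 <= 2 ^+ 11 * A2 by apply: mulr_ge0 => //; apply: exprn_ge0.
  have u3 : 0 <= 2 ^+ 11 * A ^+ 2 by apply: mulr_ge0; apply: exprn_ge0.
  by rewrite !addr_ge0.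
have [I1 I2 I3] := Gw_sums J.
have nSR := nneg_SR (all nrm) J hM.
have sSR : all (fun q => all row01 q.2) (SRM J).
  elim: J {I1 I2 I3 nSR} => //= J IH; rewrite all_cat all_map all_filter; apply/andP; split.
    by apply: sub_all h01 => p h /=; rewrite h /= implybT.
  apply: (all_allpairs (P1 := fun p => row01 p.2)) IH _ => [|p q /= -> //].
  by rewrite all_filter; apply: sub_all h01 => p h /=; rewrite h implybT.
rewrite sum_SR.
pose m1 := mass (SRM J); pose m2 := \sum_(q <- SRM J) q.1 * Gw q.2.
pose m3 := \sum_(q <- SRM J) q.1 * ((1 < size q.2)%N%:R * Gw q.2).
pose G1 e := if all nrm e then 0 else gw e.
pose G2 (e : seq R) := if (1 < nbad e)%N then gw e else 0.
have g0 e : 0 <= gw e by rewrite /gw prodr_ge0 // => p _; rewrite exprn_even_ge0.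
have G10 e : 0 <= G1 e by rewrite /G1; case: ifP.
have G20 e : 0 <= G2 e by rewrite /G2; case: ifP.
have pos (F : seq (seq R) -> R) : (forall es, 0 <= F es) -> 0 <= \sum_(q <- SRM J) q.1 * F q.2.
  move=> hF; rewrite -[leLHS](_ : \sum_(q <- SRM J) q.1 * (fun=> 0) q.2 = 0); last by rewrite big1 // => q _; rewrite mulr0.
  by apply: (ler_sum_nneg (F := fun=> 0)).
have m20 : 0 <= m2 by apply: pos => e; apply: Gw_ge0.
have m30 : 0 <= m3 by apply: (pos (fun es => (1 < size es)%N%:R * Gw es)) => e; rewrite mulr_ge0 ?Gw_ge0.
have m10 : 0 <= m1 by apply: mass_ge0.
apply: (@le_trans _ _ (\sum_(p <- M) p.1 * ((4 / n%:R) ^+ 10 * m1 * G1 p.2 + 2 ^+ 10 * m2 * G2 p.2 + 2 ^+ 10 * m3 * G1 p.2))).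
  apply: (ler_sum_supp (Q := row01) (F := fun e => if all nrm e then Phi [:: e] else \sum_(q <- SRM J) q.1 * Phi (e :: q.2))
     (G := fun e => (4 / n%:R) ^+ 10 * m1 * G1 e + 2 ^+ 10 * m2 * G2 e + 2 ^+ 10 * m3 * G1 e)) => // e he.
  case: ifP => ne.
    have v1 : 0 <= (4 / n%:R) ^+ 10 * m1 * G1 e by apply: mulr_ge0 => //; apply: mulr_ge0.
    have v2 : 0 <= 2 ^+ 10 * m2 * G2 e by apply: mulr_ge0 => //; apply: mulr_ge0 => //; apply: exprn_ge0.
    have v3 : 0 <= 2 ^+ 10 * m3 * G1 e by apply: mulr_ge0 => //; apply: mulr_ge0 => //; apply: exprn_ge0.
    by rewrite /Phi /coarse_val /= lexx !addr_ge0.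
  apply: (@le_trans _ _ (\sum_(q <- SRM J) q.1 * ((4 / n%:R) ^+ 10 * G1 e + 2 ^+ 10 * G2 e * Gw q.2 + 2 ^+ 10 * G1 e * ((1 < size q.2)%N%:R * Gw q.2)))).
    pose F es := Phi (e :: es).
    pose G es := (4 / n%:R) ^+ 10 * G1 e + 2 ^+ 10 * G2 e * Gw es + 2 ^+ 10 * G1 e * ((1 < size es)%N%:R * Gw es).
    have FG es : all row01 es -> F es <= G es.
      by move=> hes; have := Phi_le he (negbT ne) hes; rewrite /F /G /G1 /G2 ne.
    exact: (ler_sum_supp nSR sSR FG).
  rewrite /m1 /m2 /m3 /mass !mulr_sumr !mulr_suml -!big_split /= le_eqVlt; apply/orP; left; apply/eqP.
  by apply: eq_bigr => q _; ring.
have -> : \sum_(p <- M) p.1 * ((4 / n%:R) ^+ 10 * m1 * G1 p.2 + 2 ^+ 10 * m2 * G2 p.2 + 2 ^+ 10 * m3 * G1 p.2)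
  = ((4 / n%:R) ^+ 10 * m1) * (\sum_(p <- M) p.1 * G1 p.2) + (2 ^+ 10 * m2) * (\sum_(p <- M) p.1 * G2 p.2)
    + 2 ^+ 10 * m3 * (\sum_(p <- M) p.1 * G1 p.2).
  rewrite !mulr_sumr -!big_split /=; apply: eq_bigr => p _; ring.
have posM (F : seq R -> R) : (forall es, 0 <= F es) -> 0 <= \sum_(q <- M) q.1 * F q.2.
  move=> hF; rewrite -[leLHS](_ : \sum_(q <- M) q.1 * (fun=> 0) q.2 = 0); last by rewrite big1 // => q _; rewrite mulr0.
  by apply: (ler_sum_nneg (F := fun=> 0)).
have s1 : 0 <= \sum_(p <- M) p.1 * G1 p.2 by apply: posM.
have s2 : 0 <= \sum_(p <- M) p.1 * G2 p.2 by apply: posM.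
rewrite -/m1 -/m2 -/m3 in I1 I2 I3.
have q0 : 0 <= 2 ^+ 10 :> R by rewrite exprn_ge0.
apply: lerD; first apply: lerD.
- apply: ler_pM => //; first by rewrite mulr_ge0.
  by rewrite ler_piMr.
- rewrite [2 ^+ 11]exprSr; apply: ler_pM => //; first by rewrite mulr_ge0.
  by rewrite ler_wpM2l.
rewrite [2 ^+ 11]exprSr expr2 (mulrA _ A A); apply: ler_pM => //; first by rewrite mulr_ge0.
by rewrite -mulrA ler_wpM2l.
Qed.

End SuperSums.
End Moments.

(** * Choice of the scales *)

Section FinalLattice.
Context {R : realType}.

Lemma pow_lin (p : R) m : 0 <= p <= 1 -> (1 - p) ^+ m * (1 + m%:R * p) <= 1.
Proof.
move=> hp; elim: m => [|m IH]; first by rewrite expr0 mul0r addr0 mulr1.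
apply: le_trans IH; rewrite exprS -mulrA mulrCA; apply: ler_wpM2l; first by rewrite exprn_ge0 //; lra.
rewrite -[m.+1]addn1 natrD mulrDl mul1r.
have : 0 <= m%:R * (p * p) by rewrite !mulr_ge0 //; lra.
have : 0 <= p * p by rewrite mulr_ge0 //; lra.
by nra.
Qed.

Lemma pow_small (n k m : nat) : (0 < n)%N -> (n * k <= m)%N -> (1 - n%:R^-1 : R) ^+ m <= 2^-1 ^+ k.
Proof.
move=> n0 nk; have n0' : 0 < n%:R :> R by rewrite ltr0n.
have hp : 0 <= (n%:R^-1 : R) <= 1 by rewrite invr_ge0 ltW //= invf_le1 // ler1n.
have h0 : 0 <= 1 - (n%:R^-1 : R) <= 1 by apply/andP; split; lra.
apply: (@le_trans _ _ ((1 - n%:R^-1) ^+ (n * k))); first by have /andP[e1 e2] := h0; apply: ler_wiXn2l.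
rewrite exprM; apply: lerXn2r; rewrite ?nnegrE ?exprn_ge0 ?invr_ge0 //; first by case/andP: h0.
have := @pow_lin n%:R^-1 n hp; rewrite divff ?gt_eqF //; lra.
Qed.

Variable a : nat.
Hypothesis a10 : (10 <= a)%N.
(** At scale [a], with [n = 2 ^ a] and [z = 1 / n], the threshold is [z ^ 20]. Segments of
    [5 * n ^ 4] rows exceed the [4 * H + 2] rows needed to refill a cell of width [2 * H],
    [H = n ^ 4]; intervals of [n ^ 3] points fit in a cell and are long enough to meet an open site
    of a row of density [1 / n]. *)
Definition zz (a : nat) : R := 2^-1 ^+ a.
Definition tauL (a : nat) : R := zz a ^+ 20.
Notation z := (zz a).
Let n := (2 ^ a)%N.
Let D := (n ^ 3)%N.
Let H := (n ^ 4)%N.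
Let S := (5 * n ^ 4)%N.

Lemma z_small : 0 < z <= 1024^-1.
Proof.
apply/andP; split; first by rewrite exprn_gt0 ?invr_gt0.
apply: (@le_trans _ _ (2^-1 ^+ 10)); last by rewrite exprVn -natrX.
by apply: ler_wiXn2l => //; lra.
Qed.

Lemma nz : n%:R * z = 1.
Proof. by rewrite /n /zz natrX -exprMn mulfV ?expr1n // pnatr_eq0. Qed.

Lemma n_inv : (n%:R^-1 : R) = z.
Proof.
have h : n%:R != 0 :> R by rewrite pnatr_eq0 /n expn_eq0.
by apply: (mulfI h); rewrite nz divff.
Qed.

Lemma two10 : (2 : R) ^+ 10 = 1024. Proof. by rewrite -natrX. Qed.
Lemma two20 : (2^-1 : R) ^+ 20 = (1024 * 1024)^-1.
Proof. by rewrite exprVn (exprM 2 10 2) two10 expr2. Qed.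
Lemma two22 : (2^-1 : R) ^+ 22 = (1024 * 1024 * 4)^-1.
Proof. by rewrite (exprD _ 20 2) two20; field. Qed.

Lemma tauS : tauL a.+1 = tauL a / (1024 * 1024).
Proof. by rewrite /tauL /zz [2^-1 ^+ a.+1]exprS exprMn mulrC; congr (_ * _); rewrite two20. Qed.

Lemma n_big : (1024 <= n)%N. Proof. by rewrite /n (leq_pexp2l (m := 2) (n1 := 10)). Qed.

Lemma zpow k : 0 <= z ^+ k. Proof. by rewrite exprn_ge0 //; have := z_small; lra. Qed.

Lemma zpow_le k : z ^+ k <= 1024^-1 ^+ k.
Proof. have := z_small; move=> /andP[h1 h2]; by apply: lerXn2r => //; rewrite nnegrE; lra. Qed.

Lemma Sz : S%:R * z ^+ 4 = 5.
Proof. by rewrite /S natrM natrX -mulrA -exprMn nz expr1n mulr1. Qed.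

Lemma SWz c : (S * c * (2 * H))%:R * tauL a = 10 * c%:R * z ^+ 12.
Proof.
rewrite /tauL (_ : z ^+ 20 = z ^+ 4 * z ^+ 4 * z ^+ 12); last by rewrite -!exprD.
have -> : (S * c * (2 * H))%:R = S%:R * c%:R * (2%:R * H%:R) :> R by rewrite -!natrM.
have hH : H%:R * z ^+ 4 = 1 by rewrite /H natrX -exprMn nz expr1n.
transitivity (2 * c%:R * (S%:R * z ^+ 4) * (H%:R * z ^+ 4) * z ^+ 12); first by ring.
by rewrite Sz hH; ring.
Qed.

(** The left side is [100 * z ^ 24]; the spare factor [z ^ 4 <= 2 ^ -40] pays for the ratio [2 ^ 20]
    between consecutive thresholds. *)
Lemma num_A : ((S * (2 * H))%:R * tauL a) ^+ 2 <= tauL a.+1.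
Proof.
have := SWz 1; rewrite muln1 => ->; rewrite tauS /tauL.
have := zpow_le 4; rewrite (_ : (10 * 1%:R * z ^+ 12) ^+ 2 = 100 * (z ^+ 4 * z ^+ 20)); last by rewrite -exprD; ring.
move=> h; have : z ^+ 4 * z ^+ 20 <= 1024^-1 ^+ 4 * z ^+ 20 by rewrite ler_wpM2r // zpow.
have := zpow 20; set q := z ^+ 20; set y := _ * q; lra.
Qed.

Lemma num_B : ((S * 2 * (2 * H))%:R * tauL a) ^+ 2 + (2 * H)%:R * (1 - n%:R^-1) ^+ (D - 4) <= tauL a.+1.
Proof.
have hz : (1 - n%:R^-1 : R) ^+ (D - 4) <= z ^+ 24 / (1024 * 1024 * 4).
  apply: le_trans (@pow_small n (24 * a + 22) (D - 4) _ _) _.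
  - exact: leq_trans n_big.
  - have h : (a < n)%N by apply: ltn_expl.
    by have := n_big; rewrite /D !expnS expn0 muln1; nia.
  - rewrite exprD /zz -exprM (mulnC 24); apply: ler_wpM2l; first by rewrite exprn_ge0 // invr_ge0.
    by rewrite two22.
have hH : H%:R * z ^+ 4 = 1 by rewrite /H natrX -exprMn nz expr1n.
rewrite SWz tauS /tauL.
have h1 : (2 * H)%:R * (1 - n%:R^-1) ^+ (D - 4) <= 2 * z ^+ 20 / (1024 * 1024 * 4).
  apply: (le_trans (ler_wpM2l (ler0n _ _) hz)).
  have -> : (2 * H)%:R * (z ^+ 24 / (1024 * 1024 * 4)) = 2%:R * (H%:R * z ^+ 4) * z ^+ 20 / (1024 * 1024 * 4).
    by rewrite natrM (_ : z ^+ 24 = z ^+ 4 * z ^+ 20) -?exprD // !mulrA.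
  by rewrite hH mulr1.
have := zpow_le 4; rewrite (_ : (10 * 2%:R * z ^+ 12) ^+ 2 = 400 * (z ^+ 4 * z ^+ 20)); last by rewrite -exprD; ring.
move=> h; have : z ^+ 4 * z ^+ 20 <= 1024^-1 ^+ 4 * z ^+ 20 by rewrite ler_wpM2r // zpow.
have := zpow 20; move: h1; set q := z ^+ 20; set y := z ^+ 4 * q; set x := (2 * H)%:R * _; lra.
Qed.

Lemma num_tau : (S * 2 * (2 * H))%:R * tauL a <= 1 / 2.
Proof.
rewrite SWz; have := zpow_le 12; have : (1024^-1 : R) ^+ 12 <= 1024^-1.
  by rewrite -[leRHS]expr1 ler_wiXn2l ?invr_ge0 ?invf_le1 ?ler1n.
set x := 1024^-1 ^+ _; lra.
Qed.

(** With [u = n * p <= 1], [pow_lin] gives [(1 - p) ^ (n ^ 2) <= 1 / (1 + n * u)], which is at most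
    [1 - u / 2]; and [D - 1] exceeds [n ^ 2]. *)
Lemma num_C (p : R) : 0 <= p <= 1 -> p <= n%:R^-1 -> n%:R * p / 4 <= 1 / 2 * (1 - (1 - p) ^+ (D - 1)).
Proof.
move=> hp pn; have n1 : 1 <= n%:R :> R by rewrite ler1n /n expn_gt0.
have u1 : n%:R * p <= 1 by rewrite mulrC -ler_pdivlMr ?div1r // (lt_le_trans ltr01).
have u0 : 0 <= n%:R * p by rewrite mulr_ge0 //; lra.
have h1 : (1 - p) ^+ (D - 1) <= (1 - p) ^+ (n ^ 2).
  apply: ler_wiXn2l; [lra|lra|].
  by have := n_big; rewrite /D !expnS expn0 muln1; nia.
have := @pow_lin p (n ^ 2) hp; set y := (1 - p) ^+ (n ^ 2) in h1 *.
rewrite natrX expr2 -mulrA; set u := n%:R * p in u0 u1 *.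
set x := (1 - p) ^+ (D - 1) in h1 *; set m : R := n%:R in n1 *.
move=> h2; have h3 : y <= 1 - u / 2.
  have m0 : 0 <= m by apply: le_trans n1.
  have f0 : 0 <= m * u by apply: mulr_ge0.
  have f1 : 0 <= m * u * (1 - u) by apply: mulr_ge0 => //; lra.
  have f2 : 0 <= (m - 1) * u by apply: mulr_ge0 => //; lra.
  rewrite -(@ler_pM2r _ (1 + m * u)); last by lra.
  by apply: (le_trans h2); lra.
lra.
Qed.

(* Rows of density below [1 - tauL a] are rare enough to have a small inverse moment. The exponent 10 absorbs the
   entropy lost when [clL] merges a block of rows around the bad ones into one row of the next scale. *)
Definition cls (a : nat) (L : seq (R * R)) : Prop :=
  [/\ nneg L, all (fun p => 0 < p.2 <= 1) L, mass L <= 1 &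
   \sum_(p <- L | ~~ nrm (tauL a) p.2) p.1 * (p.2^-1) ^+ 10 <= tauL a].

Definition clL J (L : seq (R * R)) : seq (R * R) :=
  [seq (q.1, coarse_val (tauL a) (tauL a.+1) n q.2) | q <- SR (all (nrm (tauL a))) (pow_law L S) J].

Variable L : seq (R * R).
Hypothesis hL : cls a L.

Let tau01 : 0 <= tauL a <= 1024^-1.
Proof.
rewrite zpow /tauL (le_trans (zpow_le 20)) // -[leRHS]expr1.
by apply: ler_wiXn2l => //; lra.
Qed.

(** A segment has [S * tauL a = 5 * z ^ 16] weighted bad rows on average, and the normal rows
    contribute at most the factor [Ga ^ S <= 2]. *)
Lemma seg_sums : \sum_(p <- pow_law L S) p.1 * (if all (nrm (tauL a)) p.2 then 0 else gw p.2) <= 10 * z ^+ 16 /\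
  \sum_(p <- pow_law L S) p.1 * (if (1 < nbad (tauL a) p.2)%N then gw p.2 else 0) <= 50 * z ^+ 32.
Proof.
have [h1 h2 h3 h4] := hL; have /andP[t0 t1] := tau01.
(* Twenty units of [tauL a] cover the normal rows, since [(1 - tau) ^ -10 <= 1 + 20 * tau]; one more
   covers the bad rows. *)
pose Ga : R := 1 + 21 * tauL a.
have xs : \sum_(p <- L | nrm (tauL a) p.2) p.1 * (p.2^-1) ^+ 10 <= 1 + 20 * tauL a.
  have b : forall p : R, nrm (tauL a) p -> (p^-1) ^+ 10 <= 1 + 20 * tauL a.
    rewrite /nrm => p hp; have p0 : 0 < p by apply: lt_le_trans hp; lra.
    rewrite exprVn -div1r ler_pdivrMr ?exprn_gt0 //.
    have c1 : (1 - tauL a) ^+ 10 <= p ^+ 10 by apply: lerXn2r; rewrite ?nnegrE; lra.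
    have c2 : forall k, 1 - k%:R * tauL a <= (1 - tauL a) ^+ k.
      elim=> [|k IH]; first by rewrite mul0r subr0 expr0.
      rewrite exprS -[k.+1]addn1 natrD mulrDl mul1r.
      have k0 : 0 <= k%:R * tauL a by rewrite mulr_ge0.
      have : (1 - tauL a) * (1 - k%:R * tauL a) <= (1 - tauL a) * (1 - tauL a) ^+ k by apply: ler_wpM2l => //; lra.
      have : 0 <= tauL a * (k%:R * tauL a) by rewrite mulr_ge0.
      set y := (1 - tauL a) ^+ k; lra.
    have := c2 10%N; move: c1; set y := (1 - tauL a) ^+ 10; set x := p ^+ 10 => c1 c3.
    have c4 : (1 + 20 * tauL a) * (1 - 10 * tauL a) <= (1 + 20 * tauL a) * x by apply: ler_wpM2l; lra.
    have : 0 <= tauL a * (10 - 200 * tauL a) by rewrite mulr_ge0 //; lra.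
    lra.
  apply: (@le_trans _ _ (mass L * (1 + 20 * tauL a))); last by rewrite ler_piMl //; lra.
  rewrite /mass mulr_suml big_mkcond; elim: (L) h1 h2 => [|p L' IH] /=; first by rewrite !big_nil.
  move=> /andP[g1 g2] /andP[g3 g4]; rewrite !big_cons lerD //; last exact: IH.
  case: ifP => hp; first by rewrite ler_wpM2l // b.
  by rewrite mulr_ge0 //; lra.
have GaS : Ga ^+ S <= 2.
  have Sx : S%:R * (21 * tauL a) <= 1 / 2.
    rewrite /tauL (_ : z ^+ 20 = z ^+ 4 * z ^+ 16); last by rewrite -exprD.
    rewrite (_ : _ * _ = 21 * (S%:R * z ^+ 4) * z ^+ 16); last by ring.
    rewrite Sz; have := zpow_le 16; have : (1024^-1 : R) ^+ 16 <= 1024^-1.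
      by rewrite -[leRHS]expr1 ler_wiXn2l ?invr_ge0 ?invf_le1 ?ler1n.
    set x := 1024^-1 ^+ _; lra.
  have c2 : forall k, (k%:R * (21 * tauL a)) <= 1 / 2 -> Ga ^+ k * (1 - k%:R * (21 * tauL a)) <= 1.
    elim=> [|k IH] hk; first by rewrite mul0r subr0 expr0 mulr1.
    move: hk; rewrite -addn1 natrD mulrDl mul1r => hk.
    have v0 : 0 <= 21 * tauL a by lra.
    have k0 : 0 <= k%:R * (21 * tauL a) by apply: mulr_ge0.
    have hk1 : k%:R * (21 * tauL a) <= 1 / 2 by lra.
    have {}IH := IH hk1.
    have y0 : 0 <= Ga ^+ k by rewrite exprn_ge0 // /Ga; lra.
    have f1 : 0 <= Ga ^+ k * (21 * tauL a * (k%:R * (21 * tauL a) + 21 * tauL a)).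
      by apply: mulr_ge0 => //; apply: mulr_ge0 => //; lra.
    rewrite addn1 exprS (_ : Ga * _ * _ = Ga ^+ k * (1 - k%:R * (21 * tauL a))
      - Ga ^+ k * (21 * tauL a * (k%:R * (21 * tauL a) + 21 * tauL a))); last by rewrite {1}/Ga; ring.
    by apply: le_trans IH; rewrite lerBlDr lerDl.
  have := c2 S Sx; have : 0 <= Ga ^+ S by rewrite exprn_ge0 // /Ga; lra.
  move: Sx; set v := S%:R * _; set y := Ga ^+ S => v1 y0 h.
  have f : 0 <= y * (1 / 2 - v) by apply: mulr_ge0 => //; lra.
  lra.
have [||r1 r2 r3] := @row_sums R (tauL a) L Ga (tauL a) h1 h2 _ t0 _ h4 S.
- by rewrite /Ga; lra.
- by apply: le_trans (lerD xs h4) _; rewrite /Ga; lra.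
have St : S%:R * tauL a = 5 * z ^+ 16.
  by rewrite /tauL -Sz -mulrA -exprD.
split.
  rewrite (sum_pow L S (fun e => if all (nrm (tauL a)) e then 0 else gw e)).
  apply: (@le_trans _ _ (S%:R * tauL a * 2)); last by rewrite St; lra.
  apply: le_trans (ler_wpM2l _ GaS); last by rewrite mulr_ge0.
  apply: le_trans r2; apply: AE_le => // e _; rewrite /nbad -has_count has_predC.
  by case: ifP => /=; rewrite ?mul0r ?mul1r.
rewrite (sum_pow L S (fun e => if (1 < nbad (tauL a) e)%N then gw e else 0)).
apply: (@le_trans _ _ ((S%:R * tauL a) ^+ 2 * 2)); last by rewrite St (_ : z ^+ 32 = z ^+ 16 * z ^+ 16) -?exprD //; lra.
apply: le_trans (ler_wpM2l _ GaS); last by rewrite exprn_ge0 // mulr_ge0.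
apply: le_trans r3; apply: AE_le => // e _.
by case: ifP => /=; rewrite ?mul0r ?mul1r.
Qed.

End FinalLattice.

(** * One step of the multiscale argument *)

Section Survival.
Context {R : realType}.
Notation cls := (@cls R).

Definition surv (L : seq (R * R)) (K : nat) (Y : seq int) : R :=
  AE L K (fun es => QS (nth 0 es) K 0 Y).

Lemma unit_nth (es : seq R) : all (fun p => 0 < p <= 1) es -> unit_par (nth 0 es).
Proof.
move=> /all_nthP h i; have [hi|hi] := ltnP i (size es); last by rewrite nth_default // lexx ler01.
by have /andP[h1 h2] := h 0 i hi; rewrite ltW.
Qed.

Lemma QS_ext (r1 r2 : nat -> R) n i Y : (forall j, (i <= j < i + n)%N -> r1 j = r2 j) -> QS r1 n i Y = QS r2 n i Y.
Proof.
elim: n i Y => //= n IH i Y h; rewrite h; last by lia.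
by congr (Bn _ _ _); apply: funext => Z; apply: IH => j hj; apply: h; lia.
Qed.

Lemma superrow_SR (tau : R) S (L : seq (R * seq R)) J : all (fun p => (size p.2 == S) && all (fun p => 0 < p <= 1) p.2) L ->
  all (fun q => `[< superrow tau S q.2 >]) (SR (all (nrm tau)) L J).
Proof.
move=> hL; elim: J => //= J IH; rewrite all_cat all_map all_filter; apply/andP; split.
  apply: sub_all hL => p h /=; apply/implyP => hn; apply/asboolP; exists [::], p.2.
  by rewrite /= h hn.
apply: (all_allpairs (P1 := fun p => (~~ all (nrm tau) p.2) && ((size p.2 == S) && all (fun p => 0 < p <= 1) p.2))) IH _.
  by rewrite all_filter; apply: sub_all hL => p h /=; apply/implyP => ->.
move=> p q /andP[h1 h2] /asboolP[es0 [e [e1 e2 e3 e4]]]; apply/asboolP; exists (p.2 :: es0), e.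
by rewrite /= e1 h2 h1 -e1.
Qed.

(** The terms of [Phi_sum] are of order [z ^ 26], [z ^ 32] and [z ^ 32], all below
    [z ^ 20 / 2 ^ 20]. The first is the mean number of bad rows in a segment, of order [z ^ 16],
    times the gain [n ^ -10]. *)
Lemma cls_coarse a J L : (10 <= a)%N -> cls a L -> cls a.+1 (clL a J L).
Proof.
move=> a10 hL; have [h1 h2 h3 h4] := hL.
have [A1 A2] := seg_sums a10 hL.
set S := (5 * (2 ^ a) ^ 4)%N in A1 A2; set z := zz a in A1 A2.
have /andP[z0 z1] := z_small (R := R) a10; rewrite -/z in z0 z1.
have t0 : 0 <= tauL (R := R) a by apply: zpow.
have hM := nneg_pow S h1.
have hsupp := supp_pow S (Q := fun p => 0 < p <= 1) h2.
have h01 : all (fun p => row01 p.2) (pow_law L S) by apply: sub_all hsupp => p /andP[].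
have mM : mass (pow_law L S) <= 1 by rewrite mass_pow exprn_ile1 // mass_ge0.
have zk k : (0 < k)%N -> 0 <= z ^+ k <= 1024^-1.
  move=> k0; rewrite zpow // (le_trans (zpow_le a10 k)) //.
  by rewrite -[leRHS]expr1 ler_wiXn2l ?invr_ge0 ?invf_le1 ?ler1n.
have A10 : 0 <= 10 * z ^+ 16 <= 1 / 2.
  have /andP[] := zk 16%N isT; move: (z ^+ 16) => u u1 u2; clear -u1 u2; apply/andP; split; lra.
have A20 : 0 <= 50 * z ^+ 32 by have /andP[] := zk 32%N isT; lra.
have n0 : (0 < 2 ^ a)%N by rewrite expn_gt0.
have hsr := superrow_SR (tauL a) J hsupp.
have nS := nneg_SR (all (nrm (tauL a))) J hM.
have tt : 0 <= tauL (R := R) a.+1 <= 1 / 2.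
  rewrite tauS; have /andP[] := zk 20%N isT; rewrite -/(tauL a) -/z => u1 u2.
  move: u1 u2; set u := tauL a; move: u => u u1 u2; clear -u1 u2; apply/andP; split; lra.
split.
- rewrite /nneg all_map; exact: nS.
- rewrite all_map; apply: sub_all hsr => q /asboolP; exact: coarse_val_gt0.
- rewrite /mass big_map; have [] := Gw_sums hM h01 mM A10 A1 J; by [].
rewrite big_map.
apply: (@le_trans _ _ (\sum_(q <- SR (all (nrm (tauL a))) (pow_law L S) J) q.1 * Phi (tauL a) (tauL a.+1) (2 ^ a) q.2)).
  rewrite big_mkcond le_eqVlt; apply/orP; left; apply/eqP; apply: eq_bigr => q _ /=.
  by rewrite /Phi /nrm; case: (1 - _ <= _) => /=; rewrite ?mulr0.
have PS := Phi_sum (tauL a.+1) n0 hM h01 mM A10 A20 A1 A2 J.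
apply: (le_trans PS).
rewrite n_inv // -/z tauS.
have zz4 k j : z ^+ (k + j) <= 1024^-1 ^+ k * z ^+ j.
  by rewrite exprD ler_wpM2r ?zpow // zpow_le.
have q0 : 0 <= z ^+ 20 by apply: zpow.
rewrite (_ : (4 * z) ^+ 10 * (10 * z ^+ 16) = 1024 * 1024 * 10 * z ^+ 26); last first.
  rewrite exprMn (_ : z ^+ 26 = z ^+ 10 * z ^+ 16) -?exprD //.
  by rewrite (_ : 4 ^+ 10 = 1024 * 1024) ?(exprM 2 2 10) -?[RHS]/(_ * _); [ring|rewrite -two10; ring].
rewrite (_ : 2 ^+ 11 * (10 * z ^+ 16) ^+ 2 = 2048 * 100 * z ^+ 32); last by ring.
rewrite (_ : 2 ^+ 11 * (50 * z ^+ 32) = 2048 * 50 * z ^+ 32); last by ring.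
have := zz4 6%N 20%N; have := zz4 12%N 20%N; rewrite -[(6 + 20)%N]/26%N -[(12 + 20)%N]/32%N /tauL -/z.
set x1 := z ^+ 26; set x2 := z ^+ 32; set q := z ^+ 20 in q0 *.
have e6 : (1024^-1 : R) ^+ 6 = 1024^-1 ^+ 2 * 1024^-1 ^+ 4 by rewrite -exprD.
have e12 : (1024^-1 : R) ^+ 12 <= 1024^-1 ^+ 6 by rewrite ler_wiXn2l ?invr_ge0 ?invf_le1 ?ler1n.
move=> v1 v2; have v3 : x2 <= 1024^-1 ^+ 6 * q by apply: (le_trans v1); rewrite ler_wpM2r.
clearbody x1 x2 q; clear -v2 v3 q0 e6; lra.
Qed.

(** [AE_read] turns the letters of the coarse law back into rows, and [QS_coarse] compares survivals
    for each sample. The [K] runs contain at least [S * K] rows; surviving through the surplus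
    implies surviving through the first ones. *)
Lemma surv_coarse a J L K Y : (10 <= a)%N -> cls a L ->
  (exists b, [/\ 0 <= b, b + ((2 ^ a) ^ 3)%N%:Z <= (2 * (2 ^ a) ^ 4)%N%:Z &
     forall i, b <= i <= b + ((2 ^ a) ^ 3)%N%:Z - 1 -> i \in Y]) ->
  surv (clL a J L) K [:: 0] <= surv L (5 * (2 ^ a) ^ 4 * K) Y.
Proof.
move=> a10 hL hY; have [h1 h2 h3 h4] := hL.
set S := (5 * (2 ^ a) ^ 4)%N; set D := ((2 ^ a) ^ 3)%N in hY; set H := ((2 ^ a) ^ 4)%N in hY.
have nb := n_big a10.
have S0 : (0 < S)%N by rewrite /S muln_gt0 !expn_gt0.
have SE : ~~ odd S by rewrite /S oddM oddX /= oddX /=; case: (a) a10.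
have hsupp := supp_pow S (Q := fun p => 0 < p <= 1) h2.
have hM := nneg_pow S h1.
have mM : mass (pow_law L S) <= 1 by rewrite mass_pow exprn_ile1 // mass_ge0.
have hsr := superrow_SR (tauL a) J hsupp.
have nS := nneg_SR (all (nrm (tauL a))) J hM.
rewrite /surv -AE_pow AE_map.
have Q01 K' (es : seq R) : all (fun p => 0 < p <= 1) es -> 0 <= QS (nth 0 es) K' 0 Y by move=> h; apply: QS_ge0; exact: (unit_nth h).
(* [AE_read] wants a function that is nonnegative on all lists, while [QS] is known to be so for
   densities in [0, 1] only; hence the maximum with 0. *)
pose f (segs : seq (seq R)) := Num.max 0 (QS (nth 0 (flatten segs)) (S * K) 0 Y).
apply: (@le_trans _ _ (AE (pow_law L S) K f)); last first.
  apply: (AE_le_supp (Q := fun e => (size e == S) && all (fun p => 0 < p <= 1) e)) => // es _ hes.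
  rewrite /f ge_max lexx andbT; apply: Q01; elim: es hes => //= e es IH /andP[/andP[_ u1] /IH u2].
  by rewrite all_cat u1.
have f0 segs : 0 <= f segs by rewrite /f le_max lexx.
apply: le_trans (AE_read (all (nrm (tauL a))) J hM mM f0 (leqnn K)).
apply: (AE_le_supp (Q := fun e => `[< superrow (tauL a) S e >])) => // ess sess hess.
rewrite /f le_max; apply/orP; right.
pose rows := flatten (flatten ess).
pose rho := nth 0 rows.
pose t j := size (flatten (flatten (take j ess))).
have hs j : (j < K)%N -> superrow (tauL a) S (nth [::] ess j).
  by move=> jK; have /(all_nthP [::])/(_ j) := hess; rewrite sess jK => /(_ isT)/asboolP.
have row_ok : all (fun p => 0 < p <= 1) rows.
  rewrite /rows; elim: (ess) hess => //= es l IH /andP[/asboolP[es0 [e [_ u _ _]]] /IH u2].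
  rewrite flatten_cat all_cat u2 andbT; elim: (es) u => //= e1 l1 IH1 /andP[/andP[_ u3] /IH1 u4].
  by rewrite all_cat u3.
have hr : unit_par rho by apply: unit_nth.
have seg_ok : all (fun e : seq R => size e == S) (flatten ess).
  elim: (ess) hess => //= es l IH /andP[/asboolP[es0 [e [_ u _ _]]] /IH u2].
  by rewrite all_cat u2 andbT; apply: sub_all u => p /andP[].
have sz_flat (l : seq (seq R)) : all (fun e : seq R => size e == S) l -> size (flatten l) = (S * size l)%N.
  by elim: l => [|e l IH] /=; [rewrite muln0|move=> /andP[/eqP u /IH v]; rewrite size_cat u v mulnS].
have tS j : (j < K)%N -> t j.+1 = (t j + size (flatten (nth [::] ess j)))%N.
  by move=> jK; rewrite /t (take_nth [::]) ?sess // -cats1 !flatten_cat size_cat /= cats0.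
have tmono j : (t j <= t j.+1)%N.
  have [jK|jK] := ltnP j K; first by rewrite tS // leq_addr.
  by rewrite /t !take_oversize ?sess // ltnW.
have todd j : ~~ odd (t j).
  rewrite /t sz_flat; first by rewrite oddM (negbTE SE).
  by move: seg_ok; rewrite -{1}(cat_take_drop j ess) flatten_cat all_cat => /andP[].
have rows_split j : (j < K)%N -> rows = flatten (flatten (take j ess)) ++ flatten (nth [::] ess j) ++ flatten (flatten (drop j.+1 ess)).
  move=> jK; rewrite /rows -{1}(cat_take_drop j ess) (drop_nth [::]) ?sess //.
  by rewrite flatten_cat /= flatten_cat flatten_cat.
have tK : t K = size rows by rewrite /t -sess take_size.
have KS : (S * K <= size rows)%N.
  rewrite /rows sz_flat // leq_mul2l; apply/orP; right; rewrite -sess.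
  elim: (ess) hess => //= es l IH /andP[/asboolP[es0 [e [-> _ _ _]]] /IH u].
  by rewrite size_cat size_rcons addSn ltnS (leq_trans u) // leq_addl.
have Hcv : QS (nth 0 (map (coarse_val (tauL a) (tauL a.+1) (2 ^ a)) ess)) K 0 [:: 0] <= QS rho (t K) 0 Y.
  apply: (@QS_coarse _ rho _ t K H D) => //.
  - apply: unit_nth; rewrite all_map; apply: sub_all hess => es /asboolP u /=.
    have /andP[z0 z1] := z_small (R := R) a10.
    apply: (coarse_val_gt0 (S := S) _ _ u); last by rewrite expn_gt0.
    have /andP[u1 u2] : 0 <= tauL (R := R) a <= 1024^-1.
      rewrite zpow // /tauL (le_trans (zpow_le a10 20)) // -[leRHS]expr1.
      by rewrite ler_wiXn2l ?invr_ge0 ?invf_le1 ?ler1n.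
    by rewrite tauS //; move: u1 u2; move: (tauL a) => uu u1 u2; clear -u1 u2; apply/andP; split; lra.
  - by rewrite /t take0.
  - move=> j lo b s jK hs' lob bD.
    rewrite (nth_map [::]) ?sess //.
    have e1 : (t j.+1 - t j = size (flatten (nth [::] ess j)))%N by rewrite tS // addKn.
    rewrite e1 in hs' *.
    have /andP[z0 z1] := z_small (R := R) a10.
    have /andP[u1 u2] : 0 <= tauL (R := R) a <= 1024^-1.
      rewrite zpow // /tauL (le_trans (zpow_le a10 20)) // -[leRHS]expr1.
      by rewrite ler_wiXn2l ?invr_ge0 ?invf_le1 ?ler1n.
    apply: (@superrow_success _ (tauL a) (tauL a.+1) S H D (2 ^ a)) => //.
    + have y2 : (2 <= (2 ^ a) ^ 4)%N by rewrite !expnS expn0 muln1; clear -nb; nia.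
      by rewrite /S /H; clear -y2; lia.
    + by rewrite /D !expnS expn0 muln1; clear -nb; nia.
    + exact: num_A.
    + exact: num_B.
    + exact: num_tau.
    + by move=> p; apply: num_C.
    + exact: hs.
    + move=> i hi; rewrite /rho (rows_split j) // nth_cat ifF; last by apply/negbTE; rewrite -leqNgt leq_addr.
      by rewrite nth_cat addKn hi.
  - by rewrite /H /D !expnS expn0 muln1; clear -nb; nia.
  - by rewrite /D !expn_gt0.
  move=> k; rewrite inE => /eqP ->; have [b [b1 b2 b3]] := hY.
  by exists b; rewrite /cell_lo /= !mulr0 subr0 mul0r add0r; split.
apply: (le_trans Hcv); rewrite tK -(subnKC KS).
apply: (le_trans (QS_le _ _ _ _ hr)).
rewrite (@QS_ext _ (nth 0 (flatten (take K (flatten ess))))) // => j; rewrite add0n => /andP[_ hj].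
rewrite /rho /rows -{1}(cat_take_drop K (flatten ess)) flatten_cat nth_cat sz_flat.
  rewrite size_takel ?hj //.
  by move: KS; rewrite /rows sz_flat // leq_pmul2l.
by move: seg_ok; rewrite -{1}(cat_take_drop K (flatten ess)) all_cat => /andP[].
Qed.

End Survival.

(** * Survival in random rows *)

Section SurvivalBound.
Context {R : realType}.
Notation cls := (@cls R).
Implicit Types (rho : nat -> R) (L : seq (R * R)).

Definition ival (b : int) (l : nat) : seq int := [seq b + k%:Z | k <- iota 0 l].

Lemma mem_ival b l i : (i \in ival b l) = (b <= i < b + l%:Z).
Proof.
apply/mapP/idP => [[k]|hi]; first by rewrite mem_iota => hk ->; lia.
by exists (absz (i - b)%R); [rewrite mem_iota; lia|lia].
Qed.

Lemma Bn_ge (p tau : R) Y F : 0 <= p <= 1 -> 0 <= tau -> 1 - tau <= p -> mono F -> (forall Z, 0 <= F Z) ->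
  (1 - (size Y)%:R * tau) * F Y <= Bn p Y F.
Proof.
move=> hp t0 hq mF F0; have hw : prob_weight (fun _ : int => p) by [].
have h : 1 - (size Y)%:R * tau <= Pr (fun _ : int => p) Y (fun x => forall i, i \in Y -> x i) xfalse.
  apply: (Pr_ge_compl hw (B := fun x => exists2 i, i \in Y & ~~ x i)).
    move=> x; apply: contra_notP => h i iY; apply/negPn/negP => nx; apply: h; by exists i.
  by apply: Pr_closed1.
apply: (@le_trans _ _ (Pr (fun _ : int => p) Y (fun x => forall i, i \in Y -> x i) xfalse * F Y)).
  by apply: ler_wpM2r.
rewrite /Pr -ExZr; apply: Ex_le => // x.
have [hx|hx] := pselect (forall i, i \in Y -> x i); last by rewrite ind_f // mul0r.
by rewrite ind_t // mul1r (_ : [seq k <- Y | x k] = Y) //; apply/all_filterP/allP.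
Qed.


(** While no site is closed the interval gains a point per row, on the side fixed by the parity. The
    new end [b'] is thus chosen before the densities [rho], as needed to average over them. *)
Lemma QS_grow (tau : R) d M i b l : 0 <= tau -> (0 < l)%N -> exists b', [/\ b - d%:Z <= b', b' <= b &
  forall rho, unit_par rho -> (forall j, (i <= j < i + d)%N -> 1 - tau <= rho j) -> (l + d)%:R * tau <= 1 ->
  (1 - (d * (l + d))%:R * tau) * QS rho M (i + d) (ival b' (l + d)) <= QS rho (d + M) i (ival b l)].
Proof.
move=> t0; elim: d i b l => [|d IH] i b l l0.
  exists b; split=> // [|rho _ _ _]; first by rewrite subr0.
  by rewrite mul0n mul0r subr0 mul1r !addn0.
pose b1 := if odd i then b - 1 else b.
have [b' [h1 h2 h3]] := IH i.+1 b1 l.+1 isT.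
exists b'; split; [by move: h1; rewrite /b1; case: (odd i); lia|by move: h2; rewrite /b1; case: (odd i); lia|].
move=> rho hr hn hl.
have hn1 j : (i.+1 <= j < i.+1 + d)%N -> 1 - tau <= rho j by move=> hj; apply: hn; lia.
have hl1 : (l.+1 + d)%:R * tau <= 1 by rewrite addSnnS.
have {h3} H := h3 rho hr hn1 hl1.
pose F Z := QS rho (d + M) i.+1 (spread i Z).
have mF : mono F by move=> Z Z' h; apply: QS_mono => //; apply: spread_sub.
have F0 Z : 0 <= F Z by apply: QS_ge0.
have hi : 1 - tau <= rho i by apply: hn; lia.
have HB := @Bn_ge (rho i) tau (ival b l) F (hr i) t0 hi mF F0.
rewrite size_map size_iota in HB.
apply: (le_trans _ HB).
have F1 : QS rho (d + M) i.+1 (ival b1 l.+1) <= F (ival b l).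
  apply: QS_mono => // k; rewrite mem_ival => hk; apply/flatten_mapP.
  have [hk'|hk'] := boolP (b <= k < b + l%:Z).
    by exists k; rewrite ?mem_ival // in_spr eqxx.
  exists (if odd i then k + 1 else k - 1).
    by rewrite mem_ival; move: hk hk'; rewrite /b1; case: (odd i); lia.
  by rewrite in_spr; case: (odd i); lia.
have e1 : (i + d.+1 = i.+1 + d)%N by rewrite addSnnS.
have e2 : (l + d.+1 = l.+1 + d)%N by rewrite addSnnS.
rewrite e1 e2; set Q := QS rho M _ _ in H *.
have Q0 : 0 <= Q by apply: QS_ge0.
have A0 : 0 <= l%:R * tau by rewrite mulr_ge0.
have A1 : l%:R * tau <= 1.
  by apply: le_trans hl1; apply: ler_wpM2r => //; rewrite ler_nat; lia.
have B0 : 0 <= (d * (l.+1 + d))%:R * tau by rewrite mulr_ge0.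
have C0 : 0 <= (l.+1 + d)%:R * tau - l%:R * tau by rewrite subr_ge0 ler_wpM2r // ler_nat addSnnS leq_addr.
have -> : (d.+1 * (l.+1 + d))%:R * tau = (d * (l.+1 + d))%:R * tau + (l.+1 + d)%:R * tau.
  by rewrite mulSn natrD mulrDl addrC.
apply: (@le_trans _ _ ((1 - l%:R * tau) * ((1 - (d * (l.+1 + d))%:R * tau) * Q))); last first.
  by apply: ler_wpM2l; [lra|apply: le_trans H F1].
move: A0 A1 B0 C0; set A := l%:R * tau; set B := (d * _)%:R * tau; set C := (l.+1 + d)%:R * tau => A0 A1 B0 C0.
rewrite mulrA; apply: ler_wpM2r => //.
have : 0 <= A * B by apply: mulr_ge0.
lra.
Qed.

Lemma spread_trans i Z (c : int) : spread i [seq k + c | k <- Z] = [seq k + c | k <- spread i Z].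
Proof.
elim: Z => //= k Z IH; rewrite /spread /= -/(spread i _) IH map_cat; congr (_ ++ _).
by rewrite /spr; case: (odd i) => /=; rewrite -!addrA (addrC c).
Qed.

Lemma QS_trans rho n i Y (c : int) : QS rho n i [seq k + c | k <- Y] = QS rho n i Y.
Proof.
have hi : injective (fun k : int => k + c) by apply: addIr.
elim: n i Y => [|n IH] i Y /=; first by case: Y.
rewrite /Bn -[RHS](@Ex_shift _ _ _ (fun k => k + c) (fun=> rho i) Y _ xfalse hi).
by apply: eq_Ex => x; rewrite filter_map spread_trans IH.
Qed.

Lemma QS_shift rho d n i Y : ~~ odd d -> QS rho n (d + i) Y = QS (fun j => rho (d + j)%N) n i Y.
Proof.
move=> dE; elim: n i Y => //= n IH i Y; congr (Bn _ _ _); apply: funext => Z.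
by rewrite -addnS IH; congr (QS _ _ _ (flatten _)); apply: eq_map => k; rewrite /spr oddD (negbTE dE).
Qed.

Lemma AE_ge0_supp (T : Type) (L : seq (R * T)) (Q : pred T) n (f : seq T -> R) : nneg L -> all (fun p => Q p.2) L ->
  (forall es, size es = n -> all Q es -> 0 <= f es) -> 0 <= AE L n f.
Proof.
move=> hL hQ h; rewrite -(_ : AE L n (fun=> 0) = 0); last by rewrite AE_cst mulr0.
exact: (AE_le_supp hL hQ).
Qed.

(** Forcing the first [d] letters into [N] costs their mass to the power [d] and leaves the
    remaining letters untouched. *)
Lemma AE_first_supp (T : Type) (L : seq (R * T)) (N Q : pred T) d n (f g : seq T -> R) : nneg L ->
  all (fun p => Q p.2) L -> (forall es, size es = (d + n)%N -> all Q es -> 0 <= f es) ->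
  (forall es es', size es = d -> all N es -> all Q es -> size es' = n -> all Q es' -> g es' <= f (es ++ es')) ->
  (\sum_(p <- L | N p.2) p.1) ^+ d * AE L n g <= AE L (d + n) f.
Proof.
move=> hL hQ; elim: d f => [|d IH] f f0 h /=.
  by rewrite expr0 mul1r; apply: (AE_le_supp hL hQ) => es hes hq; apply: (h [::]).
rewrite exprS -mulrA mulr_suml.
pose c := (\sum_(p <- L | N p.2) p.1) ^+ d * AE L n g.
have -> : \sum_(i <- L | N i.2) i.1 * ((\sum_(p <- L | N p.2) p.1) ^+ d * AE L n g)
  = \sum_(p <- L) p.1 * (if N p.2 then c else 0).
  by rewrite big_mkcond; apply: eq_bigr => p _; case: ifP; rewrite ?mulr0.
apply: (ler_sum_supp (F := fun e => if N e then c else 0) (G := fun e => AE L (d + n) (fun es => f (e :: es))) hL hQ) => e Qe.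
case: ifP => Ne; last first.
  by apply: (AE_ge0_supp hL hQ) => es hes hq; apply: f0; rewrite /= ?hes ?Qe.
apply: IH => [es hes hq|es es' h1 h2 h3 h4 h5]; first by apply: f0; rewrite /= ?hes ?Qe.
by apply: (h (e :: es)); rewrite /= ?h1 ?Ne ?Qe.
Qed.

Lemma surv_le L K m Y : nneg L -> all (fun p => 0 < p.2 <= 1) L -> mass L <= 1 -> surv L (K + m) Y <= surv L K Y.
Proof.
move=> h1 h2 h3; rewrite /surv AE_add; apply: (AE_le_supp (Q := fun p => 0 < p <= 1) h1 h2) => es hes hu.
apply: (@le_trans _ _ (AE L m (fun=> QS (nth 0 es) K 0 Y))).
  apply: (AE_le_supp (Q := fun p => 0 < p <= 1) h1 h2) => es' hes' hu'.
  have hr : unit_par (nth 0 (es ++ es')) by apply: unit_nth; rewrite all_cat; apply/andP; split.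
  apply: (le_trans (QS_le K 0 Y m hr)).
  rewrite (@QS_ext _ _ (nth 0 es)) // => j; rewrite add0n => /andP[_ hj].
  by rewrite nth_cat hes hj.
rewrite AE_cst ler_piMl ?QS_ge0 //; first exact: unit_nth.
by rewrite exprn_ile1 // mass_ge0.
Qed.

Lemma bernoulli_ge (x : R) d : 0 <= x <= 1 -> 1 - d%:R * x <= (1 - x) ^+ d.
Proof.
move=> /andP[x0 x1]; elim: d => [|d IH]; first by rewrite mul0r subr0 expr0.
rewrite exprS -[d.+1]addn1 natrD mulrDl mul1r.
have k0 : 0 <= d%:R * x by rewrite mulr_ge0.
have h : (1 - x) * (1 - d%:R * x) <= (1 - x) * (1 - x) ^+ d by apply: ler_wpM2l => //; lra.
have h' : 0 <= x * (d%:R * x) by rewrite mulr_ge0.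
by apply: le_trans h; move: h'; set y := d%:R * x; lra.
Qed.

Lemma num_D a : (10 <= a)%N -> (((2 ^ a) ^ 3) * (1 + (2 ^ a) ^ 3))%N%:R * tauL a <= 2 * zz a ^+ 14 :> R.
Proof.
move=> a10; have /andP[z0 z1] := z_small (R := R) a10.
have hD : ((2 ^ a) ^ 3)%N%:R * zz a ^+ 3 = 1 :> R by rewrite natrX -exprMn nz expr1n.
set D := ((2 ^ a) ^ 3)%N in hD *; rewrite /tauL natrM natrD.
rewrite (_ : _ * _ * _ = (D%:R * zz a ^+ 3) * zz a ^+ 17 + (D%:R * zz a ^+ 3) * (D%:R * zz a ^+ 3) * zz a ^+ 14); last by rewrite !exprS; ring.
rewrite hD !mul1r mulr2n mulrDl !mul1r; apply: lerD => //.
by apply: ler_wiXn2l => //; lra.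
Qed.

(** Ignition: [n ^ 3] normal rows without a closed site turn the origin into an interval long enough
    to occupy a cell. A non normal row, a closed site or missing mass costs at most about
    [z ^ 14 + D * eta], up to constants. *)
Lemma surv_start a L M (eta : R) : (10 <= a)%N -> cls a L -> 0 <= eta -> 1 - eta <= mass L ->
  ((2 ^ a) ^ 3)%N%:R * (tauL a + eta) <= 1 ->
  exists b, [/\ 0 <= b, b + ((2 ^ a) ^ 3)%N%:Z <= (2 * (2 ^ a) ^ 4)%N%:Z &
  (1 - ((2 ^ a) ^ 3)%N%:R * (tauL a + eta)) * ((1 - (((2 ^ a) ^ 3) * (1 + (2 ^ a) ^ 3))%N%:R * tauL a) * surv L M (ival b ((2 ^ a) ^ 3)%N.+1))
   <= surv L ((2 ^ a) ^ 3 + M) [:: 0]].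
Proof.
move=> a10 hL e0 hm; have [h1 h2 h3 h4] := hL; have nb := n_big a10.
set D := ((2 ^ a) ^ 3)%N; set H := ((2 ^ a) ^ 4)%N => hD.
have HD : (D + 1 <= H)%N by rewrite /H /D !expnS expn0 muln1; clear -nb; nia.
have DE : ~~ odd D by rewrite /D !oddX /=; case: (a) a10.
have t0 : 0 <= tauL (R := R) a by apply: zpow.
have [b' [b1 b2 hb]] := QS_grow (tau := tauL a) D M 0 0 t0 (isT : (0 < 1)%N).
(* The interval lies within distance [D] of the origin; a translation by [H], which does not change
   survival, brings it inside the cell number 0. *)
exists (b' + H%:Z); split; [by clear -b1 HD; lia|by clear -b2 HD; lia|].
have -> : ival (b' + H%:Z) D.+1 = [seq k + H%:Z | k <- ival b' (1 + D)].
  by rewrite /ival -map_comp; apply: eq_map => k /=; ring.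
have g1 : 1 - (tauL a + eta) <= \sum_(p <- L | nrm (tauL a) p.2) p.1.
  have e : mass L = \sum_(p <- L | nrm (tauL a) p.2) p.1 + \sum_(p <- L | ~~ nrm (tauL a) p.2) p.1.
    by rewrite /mass (bigID (fun p => nrm (tauL a) p.2)).
  have : \sum_(p <- L | ~~ nrm (tauL a) p.2) p.1 <= tauL a.
    apply: le_trans h4; rewrite big_mkcond [leRHS]big_mkcond.
    elim: (L) h1 h2 => [|p L' IH] /=; first by rewrite !big_nil.
    move=> /andP[g1 g2] /andP[g3 g4]; rewrite !big_cons lerD //; last exact: IH.
    by case: ifP => // _; rewrite ler_peMr // inv10_ge1.
  by move: e hm; set u := \sum_(_ <- _ | _) _; set v := \sum_(_ <- _ | _) _; lra.
have D1 : (1 : R) <= D%:R by rewrite ler1n /D !expn_gt0.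
have x1 : 0 <= tauL a + eta <= 1.
  apply/andP; split; first by lra.
  by apply: le_trans hD; rewrite ler_peMl //; lra.
have := bernoulli_ge D x1 => hber.
have ND := num_D a10; rewrite -/D in ND.
have /andP[z0 z1] := z_small (R := R) a10.
have z14 : zz a ^+ 14 <= 1024^-1 :> R.
  by rewrite (le_trans (zpow_le a10 14)) // -[leRHS]expr1 ler_wiXn2l ?invr_ge0 ?invf_le1 ?ler1n.
set c2 := 1 - (D * (1 + D))%:R * tauL a in hb *.
have c20 : 0 <= c2 by rewrite /c2; clear -ND z14; lra.
have c1p : 0 <= 1 - D%:R * (tauL a + eta) by rewrite subr_ge0.
have S0 : 0 <= AE L M (fun es => c2 * QS (nth 0 es) M 0 (ival b' (1 + D))).
  by apply: (AE_ge0_supp (Q := fun p => 0 < p <= 1) h1 h2) => es _ hu; rewrite mulr_ge0 ?le_max ?lexx // QS_ge0 //; apply: unit_nth.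
apply: (@le_trans _ _ ((1 - D%:R * (tauL a + eta)) * AE L M (fun es => c2 * QS (nth 0 es) M 0 (ival b' (1 + D))))).
  apply: ler_wpM2l => //; rewrite /surv -AEZ; apply: (AE_le_supp (Q := fun p => 0 < p <= 1) h1 h2) => es _ hu.
  by rewrite QS_trans.
apply: (@le_trans _ _ ((\sum_(p <- L | nrm (tauL a) p.2) p.1) ^+ D * AE L M (fun es => c2 * QS (nth 0 es) M 0 (ival b' (1 + D))))).
  case/andP: x1 => _ x1; apply: ler_wpM2r => //; apply: (le_trans hber).
  have y0 : 0 <= 1 - (tauL a + eta) by rewrite subr_ge0.
  by rewrite lerXn2r // nnegrE; apply: le_trans g1.
apply: (AE_first_supp (Q := fun p => 0 < p <= 1) h1 h2) => [es _ hu|es es' s1 n1 u1 s2 u2].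
  by apply: QS_ge0; apply: unit_nth.
have hr : unit_par (nth 0 (es ++ es')) by apply: unit_nth; rewrite all_cat u1.
have hn j : (0 <= j < 0 + D)%N -> 1 - tauL a <= nth 0 (es ++ es') j.
  rewrite add0n => /andP[_ hj]; rewrite nth_cat s1 hj.
  by apply: (nth_all (P := nrm (tauL a))); rewrite ?s1.
have hl : (1 + D)%:R * tauL a <= 1 :> R.
  apply: (@le_trans _ _ ((D * (1 + D))%:R * tauL (R := R) a)); last by rewrite -subr_ge0.
  by apply: ler_wpM2r => //; rewrite ler_nat leq_pmull // /D !expn_gt0.
have := hb _ hr hn hl.
have -> : QS (nth 0 (es ++ es')) M (0 + D) (ival b' (1 + D)) = QS (nth 0 es') M 0 (ival b' (1 + D)).
  rewrite add0n -[D in QS _ _ D]addn0 QS_shift //; apply: QS_ext => j hj.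
  by rewrite nth_cat s1 ifF ?addKn //; apply/negbTE; rewrite -leqNgt leq_addr.
by have -> : ival 0 1 = [:: 0] by rewrite /ival /= addr0.
Qed.

Lemma surv_arith (x y u v z d : R) : 0 < z -> z <= 1024^-1 -> 0 < d -> x <= y -> 1 - 2 * (z / 2) - d / 2 <= x ->
  u <= z / 1024 + d / 4 -> u <= 1 -> 0 <= u -> 0 <= v -> v <= 2 * (z / 1024) -> 1 - 2 * z - d <= (1 - u) * ((1 - v) * y).
Proof.
move=> z0 z1 d0 xy hx u1 u2 u0 v0 v1; have y1 : 1 - z - d / 2 <= y by lra.
have v2 : v <= 1 by lra.
have w0 : 0 <= (1 - u) * (1 - v) by rewrite mulr_ge0 // subr_ge0.
have w1 : (1 - u) * (1 - v) <= 1 by rewrite mulr_ile1 ?subr_ge0 // lerBlDr lerDl.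
have uv : 1 - u - v <= (1 - u) * (1 - v) by have := mulr_ge0 u0 v0; lra.
rewrite mulrA; apply: le_trans (ler_wpM2l w0 y1).
have wz : (1 - u) * (1 - v) * (z + d / 2) <= z + d / 2 by rewrite ler_piMl //; lra.
by move: w0 w1 uv wz; move: ((1 - u) * (1 - v)) => w; lra.
Qed.

(** Strong induction on the number of rows: after ignition, [K] rows at scale [a] amount to fewer
    than [K] rows at scale [a + 1]. The bound reproduces itself because [2 * zz a.+1 = zz a], which
    leaves [zz a + d / 2] for ignition. Since coarse laws have mass below 1, a deficit [eta],
    depending on [K], must be tolerated. *)
Theorem surv_bound K a (d : R) : (10 <= a)%N -> 0 < d -> exists2 eta : R, 0 < eta &
  forall L, cls a L -> 1 - eta <= mass L -> 1 - 2 * zz a - d <= surv L K [:: 0].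
Proof.
have num1 : 1024^-1 + 1 / 4 <= 1 :> R by lra.
have num3 : 10 * 1024^-1 <= 2^-1 :> R by lra.
have num2 : 1 / 4 <= 1 :> R by lra.
have aux (u v u' e : R) : 1 - u <= u' + v -> v <= e / 2 -> u' <= e / 2 -> 1 - e <= u by lra.
elim/ltn_ind: K a d => K IH a d a10 d0.
have /andP[z0 z1] := z_small (R := R) a10.
case: K IH => [|K] IH.
  exists 1 => // L _ _; rewrite /surv /=; lra.
set D := ((2 ^ a) ^ 3)%N; set S := (5 * (2 ^ a) ^ 4)%N.
have S0 : (0 < S)%N by rewrite /S muln_gt0 !expn_gt0.
have D0 : (0 < D)%N by rewrite /D !expn_gt0.
have D0R : 0 < D%:R :> R by rewrite ltr0n.
have [K' K'K KK'] : exists2 K', (K' < K.+1)%N & (K.+1 <= D + S * K')%N.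
  have [h|h] := leqP K.+1 D; first by exists 0%N; rewrite ?muln0 ?addn0.
  by exists (K.+1 - D)%N; [clear -h D0; lia|clear -h S0; nia].
have d2 : 0 < d / 2 by lra.
have [eta' e0' IH'] := IH K' K'K a.+1 (d / 2) (leqW a10) d2.
have [J hJ] : exists J, 2^-1 ^+ J <= eta' / 2.
  have [J hJ] : exists J, 2 / eta' <= J%:R.
    by exists (Num.truncn (2 / eta')).+1; rewrite ltW // truncnS_gt.
  exists J; rewrite exprVn -[leRHS]invrK lef_pV2 ?posrE ?invr_gt0 ?divr_gt0 ?exprn_gt0 //.
  by rewrite invf_div (le_trans hJ) // -natrX ler_nat ltnW // ltn_expl.
(* The three terms control, in turn, the loss at ignition ([E1]), its being at most 1 ([E2]) and the
   mass deficit passed on to the next scale ([E3]). *)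
pose eta := Num.min (d / (4 * D%:R)) (Num.min (1 / (4 * D%:R)) (eta' / (2 * J.+1%:R * S%:R))).
have SR0 : 0 < S%:R :> R by rewrite ltr0n.
have eta0 : 0 < eta by rewrite !lt_min !divr_gt0 ?mulr_gt0.
have E1 : D%:R * eta <= d / 4.
  have h : eta <= d / (4 * D%:R) by rewrite ge_min lexx.
  by rewrite mulrC -ler_pdivlMr // (le_trans h) // invfM mulrA.
have E2 : D%:R * eta <= 1 / 4.
  have h : eta <= 1 / (4 * D%:R) by rewrite !ge_min lexx ?orbT.
  by rewrite mulrC -ler_pdivlMr // (le_trans h) // invfM mulrA.
have E3 : J%:R * (S%:R * eta) <= eta' / 2.
  have h : eta <= eta' / (2 * J.+1%:R * S%:R) by rewrite !ge_min lexx ?orbT.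
  apply: (@le_trans _ _ (J.+1%:R * S%:R * eta)).
    have e : J%:R * (S%:R * eta) = J%:R * S%:R * eta by rewrite mulrA.
    by rewrite e; apply: ler_wpM2r; [exact: ltW|apply: ler_wpM2r; [exact: ltW|rewrite ler_nat]].
  by rewrite mulrC -ler_pdivlMr ?mulr_gt0 // (le_trans h) // -mulrA invfM mulrA.
exists eta => // L hL hm; have [h1 h2 h3 h4] := hL.
have t0 : 0 <= tauL (R := R) a by apply: zpow.
have zk k : (0 < k)%N -> zz a ^+ k <= 1024^-1 :> R.
  by move=> k0; rewrite (le_trans (zpow_le a10 k)) // -[leRHS]expr1 ler_wiXn2l ?invr_ge0 ?invf_le1 ?ler1n.
have Dt : D%:R * tauL a = zz a ^+ 17 :> R.
  have hD : D%:R * zz a ^+ 3 = 1 :> R by rewrite /D natrX -exprMn nz expr1n.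
  by rewrite /tauL (exprD _ 3 17) mulrA hD mul1r.
have z17 : zz a ^+ 17 <= zz a * 1024^-1 :> R.
  by rewrite exprS; apply: ler_wpM2l; [exact: ltW|exact: zk].
have z14 : zz a ^+ 14 <= zz a * 1024^-1 :> R.
  by rewrite exprS; apply: ler_wpM2l; [exact: ltW|exact: zk].
have c1 : D%:R * (tauL a + eta) <= zz a / 1024 + d / 4 by rewrite mulrDr Dt; apply: lerD.
have c1' : D%:R * (tauL a + eta) <= 1.
  by rewrite mulrDr Dt; apply: le_trans (lerD (zk 17%N isT) E2) num1.
have [b [b1 b2 b3]] := @surv_start a L (S * K') eta a10 hL (ltW eta0) hm c1'.
apply: (@le_trans _ _ (surv L (D + S * K') [:: 0])); last first.
  by rewrite -(subnKC KK'); apply: surv_le.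
apply: (le_trans _ b3); have ND := num_D a10; rewrite -/D in b2 b3 ND *.
have hY : exists b0, [/\ 0 <= b0, b0 + ((2 ^ a) ^ 3)%N%:Z <= (2 * (2 ^ a) ^ 4)%N%:Z &
     forall i, b0 <= i <= b0 + ((2 ^ a) ^ 3)%N%:Z - 1 -> i \in ival b D.+1].
  by exists b; split=> // i hi; rewrite mem_ival /D; clear -hi; lia.
have C := surv_coarse J K' a10 hL hY; rewrite -/S in C.
have hc := cls_coarse J a10 hL.
have mc : 1 - eta' <= mass (clL a J L).
  have -> : mass (clL a J L) = mass (SR (all (nrm (tauL a))) (pow_law L S) J) by rewrite /mass /clL big_map.
  have hM := nneg_pow S h1.
  have mM : mass (pow_law L S) <= 1 by rewrite mass_pow exprn_ile1 // mass_ge0.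
  have mM' : 1 - S%:R * eta <= mass (pow_law L S).
    have eta1 : eta <= 1.
      by apply: le_trans (le_trans E2 _); [rewrite ler_peMl ?ler1n // ltW|exact: num2].
    have he : 0 <= eta <= 1 by rewrite ltW.
    by rewrite mass_pow (le_trans (bernoulli_ge S he)) // lerXn2r ?nnegrE ?subr_ge0 // mass_ge0.
  have [A1 _] := seg_sums a10 hL; rewrite -/S in A1.
  have hsupp := supp_pow S (Q := fun p => 0 < p <= 1) h2.
  have hb : \sum_(p <- pow_law L S | ~~ all (nrm (tauL a)) p.2) p.1 <= 2^-1.
    have A2 : 10 * zz a ^+ 16 <= 2^-1 :> R by exact: le_trans (ler_wpM2l (ler0n R 10) (zk 16%N isT)) num3.
    apply: le_trans A2; apply: le_trans A1; rewrite big_mkcond.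
    elim: (pow_law L S) hM hsupp => [|p M IHM] /=; first by rewrite !big_nil.
    move=> /andP[g1 g2] /andP[/andP[_ g3] g4]; rewrite !big_cons lerD //; last exact: IHM.
    by case: (all (nrm (tauL a)) p.2) => /=; rewrite ?mulr0 // ler_peMr // gw_ge1.
  have := @SR_deficit _ _ (all (nrm (tauL a))) _ J 2^-1 (S%:R * eta) hM mM mM' _ hb _.
  have q1 : 0 <= S%:R * eta by rewrite mulr_ge0 // ltW.
  have q2 : 0 <= (2^-1 : R) <= 1 by rewrite invr_ge0 ler0n invf_le1 ?ler1n.
  by move=> /(_ q1 q2)/andP[_] h; exact: aux h hJ E3.
have {IH' hc mc} I1 := IH' _ hc mc.
have zS : zz a.+1 = zz a / 2 :> R by rewrite /zz exprS mulrC.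
rewrite zS in I1.
move: C I1 c1 c1' ND; set x := surv (clL _ _ _) _ _; set y := surv L _ (ival _ _).
set u := D%:R * _; set v := (D * _)%:R * _ => C I1 c1 c1' ND.
have u0 : 0 <= u by rewrite /u mulr_ge0 // addr_ge0 // ltW.
have v0 : 0 <= v by rewrite /v mulr_ge0.
exact: surv_arith z0 z1 d0 C I1 c1 c1' u0 v0 (le_trans ND (ler_wpM2l (ler0n R 2) z14)).
Qed.

Corollary surv_half L a K : (10 <= a)%N -> cls a L -> mass L = 1 -> 1 / 2 <= surv L K [:: 0].
Proof.
move=> a10 hL mL; have /andP[z0 z1] := z_small (R := R) a10.
have d0 : 0 < (4^-1 : R) by lra.
have [eta e0 h] := surv_bound K a10 d0.
by apply: le_trans (h L hL _); rewrite ?mL; lra.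
Qed.

End SurvivalBound.

(** * Events of finite range in the plane *)

Section FiniteRange.
Context {R : realType}.

Definition coord : Type := (int * int + int)%type.
HB.instance Definition _ := Choice.on coord.
Implicit Types (x : coord -> bool) (w : coord -> R) (f g : (coord -> bool) -> R) (A B : (coord -> bool) -> Prop).

Definition inbox (M : nat) (i : coord) : bool :=
  match i with inl v => (`|v.1| <= M%:Z) && (`|v.2| <= M%:Z) | inr t => `|t| <= M%:Z end.

Definition cover (s : seq coord) M := forall i, inbox M i -> i \in s.

Definition boxl (M : nat) : seq coord :=
  [seq inl (k%:Z - M%:Z, y%:Z - M%:Z) | k <- iota 0 (2 * M).+1, y <- iota 0 (2 * M).+1]
  ++ [seq inr (k%:Z - M%:Z) | k <- iota 0 (2 * M).+1].

Lemma cover_boxl M : cover (boxl M) M.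
Proof.
move=> [[k y]|t] /= h; rewrite mem_cat; apply/orP; [left|right].
  apply/allpairsP; exists (absz (k + M%:Z)%R, absz (y + M%:Z)%R); split; rewrite /fst /snd ?mem_iota; [lia|lia|].
  by congr (inl (_, _)); lia.
by apply/mapP; exists (absz (t + M%:Z)%R); [rewrite mem_iota; lia|congr inr; lia].
Qed.

Lemma inbox_le M N i : (M <= N)%N -> inbox M i -> inbox N i.
Proof. by case: i => [[k y]|t] /=; lia. Qed.

Lemma cover_le s N M : cover s N -> (M <= N)%N -> cover s M.
Proof. by move=> h MN i hi; apply: h; apply: inbox_le hi. Qed.

Definition fin f := exists M, dep f (inbox M).
Definition finP A := exists M, depP A (inbox M).

(** Chosen by [get]: for a function of infinite range it is an arbitrary number and [E] has no
    meaning, hence the hypotheses [fin] in what follows. *)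
Definition rad f : nat := get [set M | dep f (inbox M)]%classic.

Lemma radP f : fin f -> dep f (inbox (rad f)).
Proof. by move=> [M hM]; exact: (@getI _ [set M | dep f (inbox M)]%classic M). Qed.

Definition E w f : R := Ex w (boxl (rad f)) f xfalse.
Definition P w A : R := E w (ind A).

Lemma E_Ex w f s b : fin f -> cover s (rad f) -> Ex w s f b = E w f.
Proof. by move=> /radP h cs; apply: (eq_Ex_coord _ _ _ h cs); apply: cover_boxl. Qed.

Lemma finP_dep A D : depP A D -> (exists M, forall i, D i -> inbox M i) -> finP A.
Proof. by move=> d [M h]; exists M; apply: depP_sub d. Qed.

Lemma fin_ind A : finP A -> fin (ind A).
Proof. by move=> [M h]; exists M; apply: dep_ind. Qed.

Lemma fin_cst c : fin (fun=> c). Proof. by exists 0%N. Qed.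

Lemma fin2 (h : R -> R -> R) f g : fin f -> fin g -> fin (fun x => h (f x) (g x)).
Proof.
move=> [M hM] [N hN]; exists (maxn M N) => x y xy; congr h.
  by apply: hM => i hi; apply: xy; apply: inbox_le hi; rewrite leq_maxl.
by apply: hN => i hi; apply: xy; apply: inbox_le hi; rewrite leq_maxr.
Qed.

Lemma fin_sum (J : eqType) (r : seq J) (F : J -> (coord -> bool) -> R) :
  (forall j, j \in r -> fin (F j)) -> fin (fun x => \sum_(j <- r) F j x).
Proof.
elim: r => [|j r IH] h; first by exists 0%N => x y _; rewrite !big_nil.
have h' k : k \in r -> fin (F k) by move=> kr; apply: h; rewrite inE kr orbT.
have [M hM] := fin2 +%R (h j (mem_head _ _)) (IH h').
by exists M => x y xy; rewrite !big_cons; apply: hM.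
Qed.

Lemma finP2 (h : Prop -> Prop -> Prop) A B : finP A -> finP B -> finP (fun x => h (A x) (B x)).
Proof.
move=> [M hM] [N hN]; exists (maxn M N) => x y xy.
have -> : A x = A y.
  by apply: propext; split; apply: hM => i hi; [|symmetry]; apply: xy; apply: inbox_le hi; rewrite leq_maxl.
have -> // : B x = B y.
by apply: propext; split; apply: hN => i hi; [|symmetry]; apply: xy; apply: inbox_le hi; rewrite leq_maxr.
Qed.
Lemma finP_and A B : finP A -> finP B -> finP (fun x => A x /\ B x). Proof. exact: (finP2 and). Qed.
Lemma finP_or A B : finP A -> finP B -> finP (fun x => A x \/ B x). Proof. exact: (finP2 or). Qed.
Lemma finP_not A : finP A -> finP (fun x => ~ A x).
Proof. by move=> [M h]; exists M; apply: depP_not. Qed.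
Lemma finP_cst (Q : Prop) : finP (fun=> Q). Proof. by exists 0%N. Qed.

Lemma finP_bigU (J : eqType) (r : seq J) (A : J -> (coord -> bool) -> Prop) :
  (forall j, j \in r -> finP (A j)) -> finP (fun x => exists2 j, j \in r & A j x).
Proof.
elim: r => [|j r IH] h; first by exists 0%N => x y _ [].
have [M hM] : finP (fun x => A j x \/ exists2 k, k \in r & A k x).
  apply: finP_or; first by apply: h; rewrite mem_head.
  by apply: IH => k kr; apply: h; rewrite inE kr orbT.
exists M => x y xy.
have H : (A j x \/ exists2 k, k \in r & A k x) -> exists2 k, k \in j :: r & A k y.
  by move=> hx; case: (hM x y xy hx) => [a|[l lr b]]; [exists j; rewrite ?mem_head|exists l; rewrite // inE lr orbT].
by move=> [k]; rewrite inE => /orP[/eqP -> Ax|kr Ax]; apply: H; [left|right; exists k].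
Qed.

Lemma finP_bigI (J : eqType) (r : seq J) (A : J -> (coord -> bool) -> Prop) :
  (forall j, j \in r -> finP (A j)) -> finP (fun x => forall j, j \in r -> A j x).
Proof.
move=> h; have [M hM] : finP (fun x => ~ exists2 j, j \in r & ~ A j x).
  by apply: finP_not; apply: finP_bigU => j jr; apply: finP_not; apply: h.
exists M => x y xy H j jr; apply: contrapT => nA; apply: (hM x y xy); last by exists j.
by move=> [k kr]; apply; apply: H.
Qed.

Section Rules.
Variable w : coord -> R.
Hypothesis hw : prob_weight w.

Lemma E_common f g : fin f -> fin g -> exists s, [/\ Ex w s f xfalse = E w f, Ex w s g xfalse = E w g,
  cover s (rad f) & cover s (rad g)].
Proof.
move=> hf hg; pose M := maxn (rad f) (rad g).
have c1 : cover (boxl M) (rad f) by apply: (cover_le (@cover_boxl M)); rewrite leq_maxl.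
have c2 : cover (boxl M) (rad g) by apply: (cover_le (@cover_boxl M)); rewrite leq_maxr.
by exists (boxl M); split=> //; apply: E_Ex.
Qed.

Lemma E_le f g : fin f -> fin g -> (forall x, f x <= g x) -> E w f <= E w g.
Proof. by move=> hf hg h; have [s [<- <- _ _]] := E_common hf hg; apply: Ex_le. Qed.

Lemma E_eq f g : (forall x, f x = g x) -> E w f = E w g.
Proof. by move=> h; congr (E w); apply: funext. Qed.

Lemma E_cst c : E w (fun=> c) = c. Proof. by rewrite /E Ex_cst. Qed.

Lemma E_lin a f g : fin f -> fin g -> E w (fun x => a * f x + g x) = a * E w f + E w g.
Proof.
move=> hf hg; have hh : fin (fun x => a * f x + g x) by apply: (fin2 (fun u v => a * u + v)).
pose M := maxn (maxn (rad f) (rad g)) (rad (fun x => a * f x + g x)).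
have c := @cover_boxl M.
rewrite -(E_Ex w (s := boxl M) xfalse hh); last by apply: (cover_le c); rewrite /M leq_maxr.
rewrite -(E_Ex w (s := boxl M) xfalse hf); last by apply: (cover_le c); rewrite /M -maxnA leq_maxl.
rewrite -(E_Ex w (s := boxl M) xfalse hg); last by apply: (cover_le c); rewrite /M (maxnC (rad f)) -maxnA leq_maxl.
by rewrite ExD ExZ.
Qed.

Lemma ED f g : fin f -> fin g -> E w (fun x => f x + g x) = E w f + E w g.
Proof. by move=> hf hg; rewrite -[E w f]mul1r -E_lin //; apply: E_eq => x; rewrite mul1r. Qed.
Lemma EZ a f : fin f -> E w (fun x => a * f x) = a * E w f.
Proof.
move=> hf; have := E_lin a hf (fin_cst 0); rewrite E_cst addr0 => <-.
by apply: E_eq => x; rewrite addr0.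
Qed.
Lemma EB f g : fin f -> fin g -> E w (fun x => f x - g x) = E w f - E w g.
Proof.
move=> hf hg; rewrite addrC -mulN1r -E_lin //; apply: E_eq => x; by rewrite mulN1r addrC.
Qed.

Lemma E_sum (J : eqType) (r : seq J) (F : J -> (coord -> bool) -> R) :
  (forall j, j \in r -> fin (F j)) -> E w (fun x => \sum_(j <- r) F j x) = \sum_(j <- r) E w (F j).
Proof.
elim: r => [|j r IH] h; first by rewrite big_nil -[RHS]E_cst; apply: E_eq => x; rewrite big_nil.
have h' k : k \in r -> fin (F k) by move=> kr; apply: h; rewrite inE kr orbT.
rewrite big_cons -IH // -ED //; last 2 first.
- by apply: h; rewrite mem_head.
- exact: fin_sum.
by apply: E_eq => x; rewrite big_cons.
Qed.

Lemma E_indep f g D D' : fin f -> fin g -> dep f D -> dep g D' -> (forall i, D i -> D' i -> False) ->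
  E w (fun x => f x * g x) = E w f * E w g.
Proof.
move=> hf hg df dg dd; have hh : fin (fun x => f x * g x) by apply: fin2.
pose M := maxn (maxn (rad f) (rad g)) (rad (fun x => f x * g x)).
have c := @cover_boxl M.
rewrite -(E_Ex w (s := boxl M) xfalse hh); last by apply: (cover_le c); rewrite /M leq_maxr.
rewrite -(E_Ex w (s := boxl M) xfalse hf); last by apply: (cover_le c); rewrite /M -maxnA leq_maxl.
rewrite -(E_Ex w (s := boxl M) xfalse hg); last by apply: (cover_le c); rewrite /M (maxnC (rad f)) -maxnA leq_maxl.
exact: Ex_indep df dg dd.
Qed.

Lemma P_sub A B : finP A -> finP B -> (forall x, A x -> B x) -> P w A <= P w B.
Proof. by move=> hA hB h; apply: E_le; try exact: fin_ind; move=> x; apply: ind_mono; apply: h. Qed.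

Lemma P_eq A B : (forall x, A x <-> B x) -> P w A = P w B.
Proof. by move=> h; congr (P w); apply: funext => x; apply: propext. Qed.

Lemma P_ge0 A : 0 <= P w A. Proof. by apply: Ex_ge0 => // x; apply: ind_ge0. Qed.
Lemma P_le1 A : P w A <= 1.
Proof. by rewrite /P /E -(Ex_cst w (boxl (rad (ind A))) 1 xfalse); apply: Ex_le => // x; apply: ind_le1. Qed.

Lemma P_not A : finP A -> P w (fun x => ~ A x) = 1 - P w A.
Proof.
move=> hA; rewrite -[1](E_cst 1) -EB //; [|exact: fin_cst|exact: fin_ind].
by apply: E_eq => x; rewrite ind_notE.
Qed.

Lemma P_or A B : finP A -> finP B -> P w (fun x => A x \/ B x) <= P w A + P w B.
Proof.
move=> hA hB; rewrite -ED; try exact: fin_ind.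
apply: E_le; [exact/fin_ind/finP_or|apply: fin2; exact: fin_ind|move=> x].
have [a|a] := pselect (A x).
  by rewrite (ind_t (R := R) a) ind_t ?lerDl ?ind_ge0 //; left.
by rewrite (ind_f (R := R) a) add0r; apply: ind_mono => -[|].
Qed.

Lemma P_bigU (J : eqType) (r : seq J) (A : J -> (coord -> bool) -> Prop) c :
  (forall j, j \in r -> finP (A j)) -> (forall j, j \in r -> P w (A j) <= c) ->
  P w (fun x => exists2 j, j \in r & A j x) <= (size r)%:R * c.
Proof.
move=> hA hc; apply: (@le_trans _ _ (\sum_(j <- r) P w (A j))); last first.
  rewrite big_seq mulr_natl; apply: le_trans (ler_sum _ hc) _.
  by rewrite -big_seq big_const_seq count_predT iter_addr_0.
rewrite -E_sum; last by move=> j jr; apply: fin_ind; apply: hA.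
apply: E_le; [exact/fin_ind/finP_bigU|by apply: fin_sum => j jr; apply/fin_ind/hA|move=> x].
have [[j jr a]|a] := pselect (exists2 j, j \in r & A j x).
  by rewrite ind_t; [|exists j]; rewrite // (big_rem j jr) /= (ind_t (R := R) a) lerDl sumr_ge0 // => k _; apply: ind_ge0.
by rewrite ind_f // sumr_ge0 // => k _; apply: ind_ge0.
Qed.

Lemma P_indep A B D D' : finP A -> finP B -> depP A D -> depP B D' -> (forall i, D i -> D' i -> False) ->
  P w (fun x => A x /\ B x) = P w A * P w B.
Proof.
move=> hA hB dA dB dd; rewrite -(E_indep _ _ (dep_ind dA) (dep_ind dB)); try exact: fin_ind; last by [].
by apply: E_eq => x; rewrite ind_andE.
Qed.

Lemma P_all_indep (J : eqType) (r : seq J) (A : J -> (coord -> bool) -> Prop) (D : J -> coord -> Prop) c :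
  uniq r -> (forall j, j \in r -> finP (A j)) -> (forall j, j \in r -> depP (A j) (D j)) ->
  (forall j k i, j \in r -> k \in r -> j <> k -> D j i -> D k i -> False) ->
  0 <= c -> (forall j, j \in r -> P w (A j) <= c) ->
  P w (fun x => forall j, j \in r -> A j x) <= c ^+ size r.
Proof.
elim: r => [|j r IH] /=; first by move=> *; rewrite expr0 P_le1.
move=> /andP[jr ur] hA d dd c0 h.
have s k : k \in r -> k \in j :: r by rewrite inE => ->; rewrite orbT.
have -> : P w (fun x => forall k, k \in j :: r -> A k x) =
  P w (fun x => A j x /\ forall k, k \in r -> A k x).
  apply: P_eq => x; split=> [H|[a H] k]; last by rewrite inE => /orP[/eqP ->|/H].
  by split=> [|k kr]; apply: H; rewrite inE ?eqxx ?kr ?orbT.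
rewrite (P_indep (D := D j) (D' := fun i => exists2 k, k \in r & D k i)).
- rewrite exprS; apply: ler_pM; rewrite ?P_ge0 //; first by apply: h; rewrite mem_head.
  by apply: IH => // [k /s|k /s|k l i /s kr /s lr|k /s]; [apply: hA|apply: d|apply: dd|apply: h].
- by apply: hA; rewrite mem_head.
- by apply: finP_bigI => k /s; apply: hA.
- by apply: d; rewrite mem_head.
- move=> x y xy H k kr; apply: d (s _ kr) _ _ _ (H k kr) => i Di; apply: xy; by exists k.
move=> i Di [k kr Dk]; apply: dd (Di) (Dk); rewrite ?inE ?eqxx ?kr ?orbT //.
by move=> jk; rewrite jk kr in jr.
Qed.

End Rules.

(* One unit of time is two rows, so that the long edges start at the integer times. *)
Definition sh (dz dt : int) (i : coord) : coord :=
  match i with inl v => inl (v.1 + dz, v.2 + 2 * dt) | inr t => inr (t + dt) end.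

Definition hom (p q : R) (i : coord) : R := if i is inl _ then p else q.

Lemma hom_prob p q : 0 <= p <= 1 -> 0 <= q <= 1 -> prob_weight (hom p q).
Proof. by move=> hp hq [v|t]. Qed.

Lemma sh_inj dz dt : injective (sh dz dt).
Proof. by move=> [[a b]|t] [[c d]|u] //= [] => [/addIr -> /addIr ->|/addIr ->]. Qed.

Lemma shK dz dt i : sh dz dt (sh (- dz) (- dt) i) = i.
Proof. by case: i => [[a b]|t] /=; rewrite ?mulrN !addrNK. Qed.

Lemma fin_shift f dz dt : fin f -> fin (fun x => f (x \o sh dz dt)).
Proof.
move=> [M h]; exists (M + `|dz| + 2 * `|dt|)%N => x y xy; apply: h => i hi /=; apply: xy.
by case: i hi => [[a b]|t] /=; lia.
Qed.

Lemma finP_shift A dz dt : finP A -> finP (fun x => A (x \o sh dz dt)).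
Proof.
move=> [M h]; exists (M + `|dz| + 2 * `|dt|)%N => x y xy; apply: h => i hi /=; apply: xy.
by case: i hi => [[a b]|t] /=; lia.
Qed.

Lemma E_shift p q f dz dt : fin f -> E (hom p q) (fun x => f (x \o sh dz dt)) = E (hom p q) f.
Proof.
move=> hf; set g := fun x => _; have hg : fin g by apply: fin_shift.
pose M := (maxn (rad f) (rad g) + `|dz| + 2 * `|dt|)%N.
have c := @cover_boxl M.
rewrite -(E_Ex (hom p q) (s := map (sh dz dt) (boxl M)) xfalse hg); last first.
  move=> i hi; rewrite -(shK dz dt i) (mem_map (@sh_inj dz dt)); apply: c.
  by move: hi; rewrite /M; case: i => [[a b]|t] /=; lia.
rewrite Ex_shift; last exact: sh_inj.
have -> : hom p q \o sh dz dt = hom p q by apply: funext => -[[a b]|t].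
by apply: E_Ex => //; apply: (cover_le c); rewrite /M; lia.
Qed.

Lemma P_shift p q A dz dt : finP A -> P (hom p q) (fun x => A (x \o sh dz dt)) = P (hom p q) A.
Proof. by move=> hA; rewrite /P -(E_shift p q dz dt (fin_ind hA)). Qed.

(** Only finitely many sites are read, so the probability is Lipschitz in [p]. This is what later
    allows going below the critical value. *)
Lemma P_cont q p A (e : R) : 0 <= p <= 1 -> 0 <= q <= 1 -> finP A -> 0 < e ->
  exists2 d, 0 < d & forall p', 0 <= p' <= 1 -> `|p - p'| <= d -> `|P (hom p q) A - P (hom p' q) A| <= e.
Proof.
move=> hp hq hA e0; pose s := boxl (rad (ind A)).
exists (e / ((size s).+1%:R * 2)) => [|p' hp' hd]; first by rewrite divr_gt0 // mulr_gt0.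
apply: le_trans (@Ex_cont _ _ (hom p q) (hom p' q) s (ind A) xfalse 1 (e / ((size s).+1%:R * 2)) _ _ _ _ _) _.
- exact: hom_prob.
- exact: hom_prob.
- exact: ler01.
- by move=> x; rewrite ger0_norm ?ind_ge0 // ind_le1.
- by move=> [v|t] _ //=; rewrite subrr normr0 ltW // divr_gt0 // mulr_gt0.
rewrite mulr1 mulrA mulrC -mulrA -ler_pdivlMl //; 
rewrite mulVf ?gt_eqF // invfM -mulrA mulrCA.
have S0 : 0 < (size s).+1%:R :> R by [].
rewrite (_ : _ * _ = (size s)%:R / (size s).+1%:R); last by field; rewrite gt_eqF.
by rewrite ler_pdivrMr // mul1r ler_nat.
Qed.

Lemma P_incr w w' A : prob_weight w -> prob_weight w' -> (forall i, w i <= w' i) -> incrP A ->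
  P w A <= P w' A.
Proof. by move=> hw hw' h iA; apply: Ex_incr => //; apply: incr_ind. Qed.

End FiniteRange.
(** * Paths as sequences of abscissas *)

Section Tracks.
Implicit Types (x y : coord -> bool) (e : bool) (t u v n : nat) (a b c k z : int) (g h : nat -> int).

(* [step e x t a b]: a path leaving the vertex (a, 2t) upwards reaches (b, 2t+2);
   long edges are allowed iff [e]. *)
Definition step e x t a b : Prop :=
  (exists c, [/\ a <= c <= b, forall k, a <= k <= c -> x (inl (k, 2 * t%:Z + 1)) &
      forall k, c <= k <= b -> x (inl (k, 2 * t%:Z + 2))]) \/
  (e /\ x (inr t%:Z) /\ a <= b /\ forall k, a <= k <= b -> x (inl (k, 2 * t%:Z + 2))).

Definition track e x t0 t1 g := forall t, (t0 <= t < t1)%N -> step e x t (g t) (g t.+1).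

Lemma step_le e x t a b : step e x t a b -> a <= b.
Proof. by case=> [[c [h _ _]]|[_ [_ []]]] //; lia. Qed.

Lemma step_on e x t a b : step e x t a b -> step true x t a b.
Proof. by case=> [?|[_ ?]]; [left|right]. Qed.

Lemma step_open_end e x t a b : step e x t a b -> x (inl (b, 2 * t%:Z + 2)).
Proof. by case=> [[c [h1 h2 h3]]|[_ [_ [h h3]]]]; apply: h3; lia. Qed.

(** Long edges do not destroy planarity. A path can only pass under the long edge at [a'] along row
    [2t+1], hence through its midpoint, which is then open: the other path may go through that
    midpoint with unit edges and meet the first one. *)
Lemma step_planar e x t a a' b b' : a <= a' -> b' <= b -> step e x t a b -> step e x t a' b' ->
  step e x t a b' /\ step e x t a' b.
Proof.
move=> aa bb [[c [h1 h2 h3]]|[he [h1 [h2 h3]]]] [[c' [k1 k2 k3]]|[ke [k1 [k2 k3]]]].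
- have [cc|cc] : c' <= c \/ c < c' by lia.
    have H1 : step e x t a b'.
      by left; exists c'; split; [lia|move=> k hk; apply: h2; lia|exact: k3].
    split=> //; have [bc|bc] : c <= b' \/ b' < c by lia.
      left; exists c'; split; [lia|exact: k2|move=> k hk].
      have [kb|kb] : k <= b' \/ b' < k by lia.
        by apply: k3; lia.
      by apply: h3; lia.
    by left; exists c; split; [lia|move=> k hk; apply: h2; lia|move=> k hk; apply: h3; lia].
  split; last by left; exists c'; split; [lia|exact: k2|move=> k hk; apply: h3; lia].
  have [ac|ac] : a' <= c \/ c < a' by lia.
    left; exists c'; split; [lia| |exact: k3].
    move=> k hk; have [ka|ka] : k < a' \/ a' <= k by lia.
      by apply: h2; lia.
    by apply: k2; lia.
  by left; exists c; split; [lia|exact: h2|move=> k hk; apply: h3; lia].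
- have [cc|cc] : c <= a' \/ a' < c by lia.
    split; first by left; exists c; split; [lia|exact: h2|move=> k hk; apply: h3; lia].
    by right; do !split=> //; [lia|move=> k hk; apply: h3; lia].
  have [bc|bc] : b' < c \/ c <= b' by lia.
    split; first by left; exists b'; split; [lia|move=> k hk; apply: h2; lia|move=> k hk; apply: k3; lia].
    by left; exists c; split; [lia|move=> k hk; apply: h2; lia|exact: h3].
  split; first by left; exists c; split; [lia|exact: h2|move=> k hk; apply: h3; lia].
  by left; exists c; split; [lia|move=> k hk; apply: h2; lia|exact: h3].
- split; first by right; do !split=> //; [lia|move=> k hk; apply: h3; lia].
  by left; exists c'; split; [lia|exact: k2|move=> k hk; apply: h3; lia].
- split; first by right; do !split=> //; [lia|move=> k hk; apply: h3; lia].
  by right; do !split=> //; [lia|move=> k hk; apply: h3; lia].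
Qed.

Lemma track_sub e x t0 t1 u0 u1 g : track e x t0 t1 g -> (t0 <= u0)%N -> (u1 <= t1)%N -> track e x u0 u1 g.
Proof. by move=> h a b t ht; apply: h; lia. Qed.

Lemma track_on e x t0 t1 g : track e x t0 t1 g -> track true x t0 t1 g.
Proof. by move=> h t /h/step_on. Qed.

Lemma track_le e x t0 t1 g u v : track e x t0 t1 g -> (t0 <= u)%N -> (u <= v)%N -> (v <= t1)%N -> g u <= g v.
Proof.
move=> h h0; elim: v => [|v IH]; first by rewrite leqn0 => /eqP ->.
rewrite leq_eqVlt => /orP[/eqP -> //|uv] v1.
by apply: le_trans (IH _ _) (step_le (h v _)); lia.
Qed.

Lemma track_eq e x t0 t1 g h : (forall t, (t0 <= t <= t1)%N -> g t = h t) -> track e x t0 t1 g -> track e x t0 t1 h.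
Proof. by move=> gh H t ht; rewrite -!gh; [apply: H|lia|lia]. Qed.

Definition splice u g h : nat -> int := fun t => if (t <= u)%N then g t else h t.

Lemma track_cat e x t0 u t1 g h : track e x t0 u g -> track e x u t1 h -> g u = h u -> track e x t0 t1 (splice u g h).
Proof.
move=> hg hh e0 t ht; rewrite /splice; have [tu|tu] := leqP t u.
  have [tu'|tu'] := ltnP t u; first by apply: hg; lia.
  have -> : t = u by lia.
  by rewrite e0; apply: hh; lia.
by rewrite ifF; [apply: hh; lia|lia].
Qed.

Lemma step_dep e x y t a b :
  (forall k, a <= k <= b -> x (inl (k, 2 * t%:Z + 1)) = y (inl (k, 2 * t%:Z + 1))) ->
  (forall k, a <= k <= b -> x (inl (k, 2 * t%:Z + 2)) = y (inl (k, 2 * t%:Z + 2))) ->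
  (e -> x (inr t%:Z) = y (inr t%:Z)) -> step e x t a b -> step e y t a b.
Proof.
move=> h1 h2 h3 [[c [k1 k2 k3]]|[he [k1 [k2 k3]]]].
  left; exists c; split=> // k hk; [rewrite -h1; [apply: k2|]|rewrite -h2; [apply: k3|]]; lia.
right; rewrite he -h3 //; do !split=> //; move=> k hk; rewrite -h2 //; exact: k3.
Qed.

(** Between times [t] and [t + 1] a track runs from [g t] to [g t.+1], so the sites it reads lie
    between [lo t] and [hi t.+1]. *)
Definition zone e t0 t1 (lo hi : nat -> int) (i : coord) : Prop :=
  match i with
  | inl v => exists t, [/\ (t0 <= t < t1)%N, v.2 = 2 * t%:Z + 1 \/ v.2 = 2 * t%:Z + 2 & lo t <= v.1 <= hi t.+1]
  | inr u => e /\ exists t, (t0 <= t < t1)%N /\ u = t%:Z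
  end.

Definition in_tube t0 t1 (lo hi : nat -> int) g := forall t, (t0 <= t <= t1)%N -> lo t <= g t <= hi t.

Lemma track_dep e x y t0 t1 lo hi g : (forall i, zone e t0 t1 lo hi i -> x i = y i) -> in_tube t0 t1 lo hi g ->
  track e x t0 t1 g -> track e y t0 t1 g.
Proof.
move=> xy tg hg t ht; have h1 := tg t _; have h2 := tg t.+1 _.
apply: step_dep (hg t ht) => [k hk|k hk|he]; apply: xy => /=.
- by exists t; split=> //; [left|have := h1 _; have := h2 _; lia].
- by exists t; split=> //; [right|have := h1 _; have := h2 _; lia].
- by split=> //; exists t.
Qed.

Definition tube_ev e t0 t1 lo hi x := exists g, track e x t0 t1 g /\ in_tube t0 t1 lo hi g.

Lemma tube_ev_dep e t0 t1 lo hi : depP (tube_ev e t0 t1 lo hi) (zone e t0 t1 lo hi).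
Proof. by move=> x y xy [g [h1 h2]]; exists g; split=> //; apply: track_dep xy h2 h1. Qed.

Lemma bounded_nat (f : nat -> int) n : exists M : nat, forall t, (t <= n)%N -> `|f t| <= M%:Z.
Proof.
elim: n => [|n [M IH]]; first by exists (absz (f 0%N)) => t; rewrite leqn0 => /eqP ->; rewrite abszE.
exists (M + absz (f n.+1))%N => t; rewrite leq_eqVlt => /orP[/eqP ->|/IH h].
  by rewrite PoszD abszE lerDr.
by rewrite PoszD; apply: le_trans h _; rewrite lerDl.
Qed.

Lemma zone_fin e t0 t1 lo hi : exists M, forall i, zone e t0 t1 lo hi i -> inbox M i.
Proof.
have [M1 h1] := bounded_nat lo t1; have [M2 h2] := bounded_nat hi t1.
exists (M1 + M2 + 2 * t1 + 2)%N => -[[k y]|u] /=.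
  move=> [t [ht hy hk]]; have := h1 t _; have := h2 t.+1 _; lia.
by move=> [_ [t [ht ->]]]; lia.
Qed.

Lemma tube_ev_fin e t0 t1 lo hi : finP (tube_ev e t0 t1 lo hi).
Proof. exact: finP_dep (@tube_ev_dep _ _ _ _ _) (zone_fin _ _ _ _ _). Qed.

Lemma step_shift e x t a b dz dt : step e (x \o sh dz dt%:Z) t a b <-> step e x (t + dt) (a + dz) (b + dz).
Proof.
rewrite /step /=; have e1 : 2 * (t + dt)%N%:Z + 1 = 2 * t%:Z + 1 + 2 * dt%:Z by lia.
have e2 : 2 * (t + dt)%N%:Z + 2 = 2 * t%:Z + 2 + 2 * dt%:Z by lia.
rewrite e1 e2 PoszD; split=> -[[c [h1 h2 h3]]|[he [h1 [h2 h3]]]].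
- left; exists (c + dz); split; first by lia.
    by move=> k hk; rewrite -(subrK dz k); apply: h2; lia.
  by move=> k hk; rewrite -(subrK dz k); apply: h3; lia.
- right; do !split=> //; first by lia.
  by move=> k hk; rewrite -(subrK dz k); apply: h3; lia.
- left; exists (c - dz); split; first by lia.
    by move=> k hk; apply: h2; lia.
  by move=> k hk; apply: h3; lia.
right; do !split=> //; first by lia.
by move=> k hk; apply: h3; lia.
Qed.

Lemma track_shift e x t0 t1 g dz dt : track e (x \o sh dz dt%:Z) t0 t1 g <->
  track e x (t0 + dt) (t1 + dt) (fun t => g (t - dt)%N + dz).
Proof.
split=> h t ht.
  have := h (t - dt)%N; rewrite step_shift subnK; last by lia.
  by rewrite -subSn; [apply; lia|lia].
by rewrite step_shift; have := h (t + dt)%N; rewrite addnK -addSn addnK; apply; lia.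
Qed.

End Tracks.

(** * Vertex paths and the reflection of the axes *)

Section VertexPaths.
Implicit Types (x y : coord -> bool) (b : bool) (v : int * int) (n : nat).

(* [vp b n x v]: an open path of [n] edges joins (0, 0) to [v]; long edges are allowed iff [b]. *)
Fixpoint vp b n x v : Prop :=
  if n is n'.+1 then x (inl v) /\
    [\/ vp b n' x (v.1 - 1, v.2), vp b n' x (v.1, v.2 - 1) |
        [/\ b, vp b n' x (v.1, v.2 - 2) & exists u, v.2 = 2 * u + 2 /\ x (inr u)]]
  else v = (0, 0).

Definition perc b n x := exists v, vp b n x v.

Lemma vp_bound b n x v : vp b n x v -> [/\ 0 <= v.1, 0 <= v.2 & n%:Z <= v.1 + v.2 <= 2 * n%:Z].
Proof.
elim: n v => [|n IH] [k l] /=; first by move=> [-> ->]; split; lia.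
by move=> [_ [/IH|/IH|[_ /IH h _]]] /=; [| |move: h => /=]; move=> [h1 h2 h3]; split; lia.
Qed.

Lemma vp_off n x v : vp false n x v -> v.1 + v.2 = n%:Z.
Proof.
elim: n v => [|n IH] [k l] /=; first by move=> [-> ->].
by move=> [_ [/IH|/IH|[]]] //=; lia.
Qed.

Lemma vp_dep b n x y v : (forall i, inbox (2 * n) i -> x i = y i) -> vp b n x v -> vp b n y v.
Proof.
move=> xy; have [m mn] : exists m, (m <= n)%N by exists n.
suff H k : (k <= n)%N -> forall v, vp b k x v -> vp b k y v by apply: H.
elim: k => [|k IH] kn [l r] // hv; have := vp_bound hv; move: hv => /= [h1 h2] [b1 b2 b3].
split; first by rewrite -xy //=; lia.
case: h2 => [h|h|[hb h [u [hu xu]]]]; [constructor 1|constructor 2|constructor 3]; try by apply: IH => //; lia.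
split=> //; first by apply: IH => //; lia.
by exists u; split=> //; rewrite -xy //=; lia.
Qed.

Lemma perc_fin b n : finP (perc b n).
Proof. by exists (2 * n)%N => x y xy [v h]; exists v; apply: vp_dep h. Qed.

Lemma perc_incr b n : incrP (perc b n).
Proof.
move=> x y xy [v h]; exists v; elim: n v h => [|n IH] v //= [h1 h2]; split; first exact: xy.
case: h2 => [/IH h|/IH h|[hb /IH h [u [hu xu]]]]; [by constructor 1|by constructor 2|constructor 3].
by split=> //; exists u; split=> //; apply: xy.
Qed.

Definition swapc (i : coord) : coord := match i with inl v => inl (v.2, v.1) | inr t => inr t end.

Lemma swapcK : involutive swapc. Proof. by case=> [[]|]. Qed.

Lemma vp_swap n x v : vp false n (x \o swapc) v -> vp false n x (v.2, v.1).
Proof.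
elim: n v => [|n IH] [k l] /=; first by move=> [-> ->].
by move=> [h [/IH h1|/IH h1|[]//]]; split=> //; [constructor 2|constructor 1].
Qed.

(** The last clause keeps track of the unfinished step. On row [2t] the track ends where the path
    stands, except on row 0 where nothing is committed yet; on row [2t+1] the sites run through
    since row [2t] was left are open. *)
Lemma vp_track n x v t : vp false n x v -> v.2 = 2 * t%:Z \/ v.2 = 2 * t%:Z + 1 ->
  exists g, [/\ track false x 0 t g, 0 <= g 0%N & g t <= v.1 /\
    (if v.2 == 2 * t%:Z then (t = 0%N \/ g t = v.1) else forall k, g t <= k <= v.1 -> x (inl (k, 2 * t%:Z + 1)))].
Proof.
elim: n v t => [|n IH] [k l] t /=.
  move=> [-> ->] /= h; have -> : t = 0%N by lia.
  by exists (fun=> 0); split=> //; split=> //; rewrite eqxx; left.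
move=> [xv hv] hl; case: hv => [h|h|[]//].
  have [g [g1 g2 [g3 g4]]] := IH _ t h hl; move: g3 g4 => /=; case: eqP => e g3 g4.
    case: t g1 g3 g4 e hl => [|t] g1 g3 g4 e hl.
      by exists g; split=> //; split; [lia|left].
    exists (fun u => if (u == t.+1)%N then k else g u); split=> //; last by rewrite eqxx; split; [lia|right].
    move=> u hu; rewrite ifF; last by lia.
    have [eu|eu] := eqVneq u t; last by rewrite ifF; [apply: g1|lia].
    rewrite eu eqxx; have := g1 u hu; rewrite eu; case: g4 => // -> [[c [c1 c2 c3]]|[]//].
    left; exists c; split=> //; first by lia.
    move=> z hz; have [zk|zk] := eqVneq z k; last by apply: c3; lia.
    by rewrite zk -(_ : l = 2 * t%:Z + 2) //; lia.
  exists g; split=> //; split; [lia|].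
  move=> z hz; have [zk|zk] := eqVneq z k; last by apply: g4; lia.
  by rewrite zk -(_ : l = 2 * t%:Z + 1) //; lia.
case: hl => hl.
  case: t hl => [|t] hl; first by have := vp_bound h => /= -[]; lia.
  have hl' : l - 1 = 2 * t%:Z + 1 by lia.
  have [g [g1 g2 [g3 g4]]] := IH _ t h (or_intror hl').
  move: g3 g4 => /=; rewrite ifF; last by lia.
  move=> g3 g4; exists (fun u => if (u <= t)%N then g u else k); split=> //.
    move=> u hu; have [eu|eu] := eqVneq u t; last by rewrite !ifT; [apply: g1|..]; lia.
    rewrite eu leqnn ltnn; left; exists k; split; [lia|by []|].
    by move=> z hz; have -> : z = k by [lia]; rewrite -(_ : l = 2 * t%:Z + 2) //; lia.
  by rewrite ltnn /=; split=> //; rewrite hl eqxx; right.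
have hl' : l - 1 = 2 * t%:Z by lia.
have [g [g1 g2 [g3 g4]]] := IH _ t h (or_introl hl').
move: g3 g4 => /=; rewrite ifT; last by lia.
move=> g3 g4; have -> : (l == 2 * t%:Z) = false by lia.
have [t0|t0] := eqVneq t 0%N.
  exists (fun=> k); rewrite t0; have := vp_bound h => /= -[? ? ?]; split=> //; split=> // z hz.
  have -> : z = k by lia.
  by have -> : 2 * 0%N%:Z + 1 = l by lia.
exists g; split=> //; split=> // z hz; have -> : z = k by lia.
by rewrite -(_ : l = 2 * t%:Z + 1) //; lia.
Qed.

Definition reach e n (j : int) x := exists g, [/\ track e x 0 n g, 0 <= g 0%N & g n <= j].

Lemma reach_tube e n j x : reach e n j x <-> tube_ev e 0 n (fun=> 0) (fun=> j) x.
Proof.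
split=> [[g [h1 h2 h3]]|[g [h1 h2]]]; exists g.
  split=> // t ht; have := track_le h1 (leqnn _) (leq0n t) _; have := track_le h1 (leq0n t) _ (leqnn _); lia.
by split=> //; [have := h2 0%N isT|have := h2 n _]; lia.
Qed.

Lemma reach_fin e n j : finP (reach e n j).
Proof.
have [M h] := tube_ev_fin e 0 n (fun=> 0) (fun=> j).
by exists M => x y xy /reach_tube H; apply/reach_tube; apply: h H.
Qed.

Lemma vp_reach n x v : vp false (4 * n) x v -> v.1 <= v.2 -> reach false n (2 * n%:Z) x.
Proof.
move=> h hv; have := vp_off h; have [b1 b2 b3] := vp_bound h; move=> hs.
have [t ht] : exists t : nat, v.2 = 2 * t%:Z \/ v.2 = 2 * t%:Z + 1.
  by exists (absz v.2 %/ 2)%N; lia.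
have [g [g1 g2 [g3 _]]] := vp_track h ht.
have nt : (n <= t)%N by lia.
exists g; split=> //; first by apply: track_sub g1 _ _.
by have := track_le g1 (leq0n _) nt (leqnn _); lia.
Qed.

End VertexPaths.

Lemma P_swap (R : realType) (p q : R) A : finP A -> P (hom p q) (fun x => A (x \o swapc)) = P (hom p q) A.
Proof.
move=> hA; have fA := @fin_ind R _ hA; have hg : finP (fun x => A (x \o swapc)).
  case: hA => M hA; exists M => x y xy; apply: hA => i hi; apply: xy.
  by case: i hi => [[a b]|t] //=; rewrite andbC.
have fg := @fin_ind R _ hg; rewrite /P.
pose M := (maxn (rad (@ind R _ A)) (rad (ind (R := R) (fun x => A (x \o swapc))))).
have c := @cover_boxl M.
rewrite -(E_Ex (hom p q) (s := map swapc (boxl M)) xfalse fg); last first.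
  move=> i hi; rewrite -(swapcK i) mem_map; last exact: inv_inj swapcK.
  by apply: c; move: hi; rewrite /M; case: i => [[a b]|t] /=; lia.
rewrite (@Ex_shift _ _ _ swapc (hom p q) (boxl M) (ind A) xfalse (inv_inj swapcK)).
have -> : hom p q \o swapc = hom p q by apply: funext => -[[a b]|t].
by apply: E_Ex => //; apply: (cover_le c); rewrite /M; lia.
Qed.

(** By reflection in the diagonal, a path of [4n] edges ends on or above the diagonal with at least
    half of the probability. It has then climbed [2n] rows, which are [n] units of time, at an
    abscissa at most [2n]: the diagonal has slope 2 in these units. *)
Lemma reach_perc (R : realType) (p q : R) n : 0 <= p <= 1 -> 0 <= q <= 1 ->
  P (hom p q) (perc false (4 * n)) / 2 <= P (hom p q) (reach false n (2 * n%:Z)).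
Proof.
move=> hp hq; have hw := hom_prob hp hq.
pose U x := exists v, vp false (4 * n) x v /\ v.1 <= v.2.
have fU : finP U.
  by exists (2 * (4 * n))%N => x y xy [v [h hv]]; exists v; split=> //; apply: vp_dep h.
have fr : finP (reach false n (2 * n%:Z)) by exact: reach_fin.
have : P (hom p q) U <= P (hom p q) (reach false n (2 * n%:Z)).
  by apply: P_sub => // x [v [h1 h2]]; apply: vp_reach h1 h2.
have fU' : finP (fun x => U (x \o swapc)).
  case: fU => M hU; exists M => x y xy; apply: hU => i hi; apply: xy.
  by case: i hi => [[a b]|t] //=; rewrite andbC.
have : P (hom p q) (perc false (4 * n)) <= P (hom p q) (fun x => U x \/ U (x \o swapc)).
  apply: P_sub => //; [exact: perc_fin|exact: finP_or|].
  move=> x [v h]; have [vv|vv] := leP v.1 v.2; [left; by exists v|right].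
  exists (v.2, v.1); split=> /=; last by lia.
  by apply: vp_swap; rewrite -compA (_ : swapc \o swapc = id) //; apply: funext; apply: swapcK.
have := P_or hw fU fU'; rewrite P_swap //; lra.
Qed.

(** * The leftmost track and its lower deviations *)

Definition slab (t0 t1 : nat) (i : coord) : Prop :=
  match i with
  | inl v => 2 * t0%:Z < v.2 <= 2 * t1%:Z
  | inr u => t0%:Z <= u < t1%:Z
  end.

Lemma zone_slab e t0 t1 lo hi i : zone e t0 t1 lo hi i -> slab t0 t1 i.
Proof. by case: i => [v|u] /=; [move=> [t [h1 h2 h3]]|move=> [_ [t [h1 h2]]]]; lia. Qed.

Lemma reach_dep e n j : depP (reach e n j) (slab 0 n).
Proof.
move=> x y xy /reach_tube h; apply/reach_tube; apply: tube_ev_dep h => i hi.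
by apply: xy; apply: zone_slab hi.
Qed.

Lemma reach_box e n (j : int) : depP (reach e n j) (inbox (absz j + 2 * n)).
Proof.
move=> x y xy /reach_tube h; apply/reach_tube; apply: tube_ev_dep h => i hi; apply: xy.
by case: i hi => [v|u] /=; [move=> [t [h1 h2 h3]]|move=> [_ [t [h1 h2]]]]; lia.
Qed.

Lemma slab_shift A n dz dt : depP A (slab 0 n) -> depP (fun x => A (x \o sh dz dt%:Z)) (slab dt (dt + n)).
Proof.
move=> h x y xy; apply: h => i hi; apply: xy.
by case: i hi => [v|u] /=; lia.
Qed.

Lemma reach_le e n (j k : int) x : j <= k -> reach e n j x -> reach e n k x.
Proof. by move=> jk [g [h1 h2 h3]]; exists g; split=> //; lia. Qed.

Lemma reach_short e m n j x : (m <= n)%N -> reach e n j x -> reach e m j x.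
Proof.
move=> mn [g [h1 h2 h3]]; exists g; split=> //; first by apply: track_sub h1 _ _.
by have := track_le h1 (leq0n _) mn (leqnn _); lia.
Qed.

Lemma reach_neg e n (j : int) x : j < 0 -> ~ reach e n j x.
Proof. by move=> j0 [g [h1 h2 h3]]; have := track_le h1 (leqnn _) (leq0n _) (leqnn _); lia. Qed.

Lemma reach_on e n j x : reach e n j x -> reach true n j x.
Proof. by move=> [g [h1 h2 h3]]; exists g; split=> //; apply: track_on h1. Qed.

Definition lead e n (i : nat) x := reach e n i x /\ ~ reach e n (i%:Z - 1) x.

Lemma lead_fin e n i : finP (lead e n i).
Proof. by apply: finP_and; [|apply: finP_not]; apply: reach_fin. Qed.

Lemma lead_dep e n i : depP (lead e n i) (slab 0 n).
Proof.
move=> x y xy [h1 h2]; split; first exact: reach_dep h1.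
by move=> h; apply: h2; apply: reach_dep h => k hk; rewrite xy.
Qed.

Lemma lead_ex e n (j : nat) x : reach e n j x -> exists2 i, (i <= j)%N & lead e n i x.
Proof.
elim: j => [|j IH] h; first by exists 0%N => //; split=> //; apply: reach_neg.
have [h'|h'] := pselect (reach e n j x); first by have [i ij hi] := IH h'; exists i => //; lia.
by exists j.+1 => //; split=> //; rewrite -addn1 PoszD addrK.
Qed.

Lemma lead_exists e n g x : track e x 0 n g -> 0 <= g 0%N -> exists2 i : nat, i%:Z <= g n & lead e n i x.
Proof.
move=> hg g0; have gn : 0 <= g n by have := track_le hg (leqnn _) (leq0n _) (leqnn _); lia.
have [|i ij hi] := @lead_ex e n (absz (g n)) x; last by exists i => //; lia.
by exists g; split=> //; rewrite gez0_abs.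
Qed.

(** At time [m] every track is at or to the right of the leftmost end [i], so its continuation
    starts in the half line from [i] and reads only a fresh slab. This is superadditivity. *)
Lemma reach_split e m n (j : int) x : reach e (m + n) j x ->
  exists i : nat, [/\ i%:Z <= j, lead e m i x & reach e n (j - i%:Z) (x \o sh i%:Z m%:Z)].
Proof.
move=> [g [h1 h2 h3]]; have h0 := track_sub h1 (leqnn 0) (leq_addr n m).
have [i im hi] := lead_exists h0 h2; exists i; split=> //.
  by have := track_le h1 (leq0n _) (leq_addr n m) (leqnn _); lia.
exists (fun t => g (t + m)%N - i%:Z); split.
- apply/track_shift; apply: track_eq (track_sub h1 (leq0n _) _); last by lia.
  by move=> t ht; rewrite subrK subnK; lia.
- by rewrite add0n; lia.
by rewrite addnC; lia.
Qed.

(* The leftmost end, truncated at [K], of the tracks of length [n] started in [0, oo). *)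
Definition lam e K n x : nat := \sum_(j < K) `[< ~ reach e n j%:Z x >].

Lemma lam_fin (R : realType) (h : nat -> R) e K n : fin (fun x => h (lam e K n x)).
Proof.
exists (K + 2 * n)%N => x y xy; congr h; apply: eq_bigr => j _; congr (nat_of_bool _).
have xy' i : inbox (absz j%:Z + 2 * n) i -> x i = y i.
  by move=> hi; apply: xy; apply: inbox_le hi; have := ltn_ord j; lia.
apply/asboolP/asboolP => H1 H2; apply: H1; apply: (reach_box _ H2) => // i /xy' //.
Qed.

Lemma lam_le e K n x : (lam e K n x <= K)%N.
Proof.
rewrite -[leqRHS](card_ord K) -sum1_card; apply: leq_sum => j _; by case: asbool.
Qed.

Lemma lam_lead e K n i x : lead e n i x -> (lam e K n x <= i)%N.
Proof.
move=> [h _]; rewrite /lam -(big_mkord xpredT (fun j => nat_of_bool `[< ~ reach e n j%:Z x >])).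
have [Ki|iK] := leqP K i.
  apply: leq_trans Ki; rewrite -[leqRHS](subn0 K) -[leqRHS]muln1 -sum_nat_const_nat.
  by apply: leq_sum => j _; case: asbool.
rewrite (big_cat_nat (leq0n i) (ltnW iK)) /= [X in (_ + X)%N]big_nat [X in (_ + X)%N]big1 ?addn0; last first.
  by move=> j /andP[ij _]; rewrite asboolF // => H; apply: H; apply: reach_le h; lia.
rewrite -[leqRHS](subn0 i) -[leqRHS]muln1 -sum_nat_const_nat.
by apply: leq_sum => j _; case: asbool.
Qed.

Section LowTail.
Context {R : realType}.
Variables (p q : R).
Hypotheses (hp : 0 <= p <= 1) (hq : 0 <= q <= 1).
Notation w := (hom p q).
Let hw : prob_weight w := hom_prob hp hq.

Lemma lead_sum e n x J : \sum_(i < J) ind (R := R) (lead e n i) x = ind (reach e n (J%:Z - 1)) x.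
Proof.
elim: J => [|J IH]; first by rewrite big_ord0 ind_f //; apply: reach_neg; lia.
rewrite big_ord_recr /= IH (_ : J.+1%:Z - 1 = J%:Z); last by lia.
have [h|h] := pselect (reach e n J%:Z x); last first.
  have h1 : ~ reach e n (J%:Z - 1) x by move=> H; apply: h; apply: reach_le H; lia.
  have h2 : ~ lead e n J x by case.
  by rewrite (ind_f (R := R) h) (ind_f (R := R) h1) (ind_f (R := R) h2) addr0.
have [h'|h'] := pselect (reach e n (J%:Z - 1) x).
  have h2 : ~ lead e n J x by case.
  by rewrite (ind_t (R := R) h) (ind_t (R := R) h') (ind_f (R := R) h2) addr0.
have h2 : lead e n J x by [].
by rewrite (ind_t (R := R) h) (ind_f (R := R) h') (ind_t (R := R) h2) add0r.
Qed.

Lemma lead_pow e n K J (z : R) x : 0 <= z <= 1 ->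
  \sum_(i < J) ind (R := R) (lead e n i) x * z ^+ i <= z ^+ (lam e K n x).
Proof.
move=> /andP[z0 z1]; apply: (@le_trans _ _ (\sum_(i < J) ind (R := R) (lead e n i) x * z ^+ (lam e K n x))).
  apply: ler_sum => i _; have [h|h] := pselect (lead e n i x); last by rewrite ind_f // !mul0r.
  by rewrite ind_t // !mul1r ler_wiXn2l // lam_lead.
rewrite -mulr_suml lead_sum -[leRHS]mul1r ler_wpM2r ?exprn_ge0 ?ind_le1 //.
Qed.

Lemma reach_conv e m n (j : nat) :
  P w (reach e (m + n) j) <= \sum_(i < j.+1) P w (lead e m i) * P w (reach e n (j%:Z - i%:Z)).
Proof.
have e1 (i : nat) : P w (lead e m i) * P w (reach e n (j%:Z - i%:Z)) =
    E w (fun x => ind (lead e m i) x * ind (reach e n (j%:Z - i%:Z)) (x \o sh i%:Z m%:Z)).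
  rewrite -(P_shift p q i%:Z m%:Z (reach_fin e n (j%:Z - i%:Z))).
  rewrite -(E_indep w _ _ (dep_ind (@lead_dep e m i)) (dep_ind (@slab_shift _ n i%:Z m (@reach_dep e n _)))).
  - by [].
  - exact: fin_ind (lead_fin _ _ _).
  - exact: fin_ind (finP_shift _ _ (reach_fin _ _ _)).
  by case=> [v|u] /=; lia.
rewrite (eq_bigr (fun i : 'I_j.+1 => E w (fun x => ind (lead e m i) x * ind (reach e n (j%:Z - i%:Z)) (x \o sh i%:Z m%:Z))));
  last by move=> i _; exact: e1.
have ff (i : nat) : fin (fun x => ind (R := R) (lead e m i) x * ind (reach e n (j%:Z - i%:Z)) (x \o sh i%:Z m%:Z)).
  apply: fin2; first exact: fin_ind (lead_fin _ _ _).
  exact: fin_ind (finP_shift i%:Z m%:Z (reach_fin e n (j%:Z - i%:Z))).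
rewrite -(@E_sum _ w); last by move=> i _; apply: ff.
apply: (E_le hw); [exact: fin_ind (reach_fin _ _ _)|by apply: fin_sum => i _; apply: ff|move=> x].
have [h|h] := pselect (reach e (m + n) j x); last first.
  by rewrite ind_f // sumr_ge0 // => i _; apply: mulr_ge0; apply: ind_ge0.
have [i [ij h1 h2]] := reach_split h; have ij' : (i < j.+1)%N by lia.
rewrite (bigD1 (Ordinal ij')) //= (ind_t (R := R) h) (ind_t (R := R) h1) (ind_t (R := R) h2) mul1r lerDl.
by apply: sumr_ge0 => k _; apply: mulr_ge0; apply: ind_ge0.
Qed.

(** Exponential Markov inequality: by [reach_conv] the displacement over [k] blocks is bounded below
    by [k] independent copies of the displacement over one block, and truncation at [K] only
    decreases the latter. *)
Lemma reach_chernoff e K N (z : R) k (j : nat) : 0 < z <= 1 ->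
  P w (reach e (k * N) j) <= (E w (fun x => z ^+ (lam e K N x))) ^+ k / z ^+ j.
Proof.
move=> /andP[z0 z1]; set Phi := E w _; elim: k j => [|k IH] j.
  rewrite expr0 mul1r; apply: le_trans (P_le1 hw _) _.
  by rewrite invf_ge1 ?exprn_gt0 // exprn_ile1 // ltW.
rewrite mulSn; apply: le_trans (reach_conv _ _ _ _) _.
have Phi0 : 0 <= Phi by apply: Ex_ge0 => // x; rewrite exprn_ge0 // ltW.
apply: (@le_trans _ _ (\sum_(i < j.+1) Phi ^+ k / z ^+ j * (P w (lead e N i) * z ^+ i))).
  apply: ler_sum => i _; rewrite [leRHS]mulrCA ler_wpM2l ?P_ge0 //.
  have ij := ltn_ord i; have -> : j%:Z - (i : nat)%:Z = (j - i)%N%:Z by lia.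
  apply: le_trans (IH _) _; rewrite -mulrA ler_wpM2l ?exprn_ge0 //.
  have ij' : (i <= j)%N by rewrite -ltnS.
  by rewrite exprB ?unitfE ?gt_eqF // invf_div mulrC.
rewrite -mulr_sumr exprSr [leRHS]mulrAC; apply: ler_wpM2l; first by rewrite divr_ge0 // exprn_ge0 // ltW.
rewrite (eq_bigr (fun i : 'I_j.+1 => E w (fun x => z ^+ i * ind (lead e N i) x))); last first.
  by move=> i _; rewrite EZ 1?mulrC //; exact: fin_ind (lead_fin _ _ _).
have ff (i : nat) : fin (fun x => z ^+ i * ind (R := R) (lead e N i) x).
  by apply: (@fin2 _ (fun a b => a * b)); [exact: fin_cst|exact: fin_ind (lead_fin _ _ _)].
rewrite -(@E_sum _ w); last by move=> i _; apply: ff.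
apply: (E_le hw); [by apply: fin_sum => i _; apply: ff|exact: (lam_fin (fun a => z ^+ a))|move=> x].
have /(_ x) := @lead_pow e N K j.+1 z _; rewrite (ltW z0) z1 => /(_ isT).
by under eq_bigr do rewrite mulrC.
Qed.

Definition mu e K N : R := E w (fun x => (lam e K N x)%:R).

Lemma pow_quad (s : R) n : 0 <= s <= 1 -> (1 - s) ^+ n <= 1 - s * n%:R + s ^+ 2 * n%:R ^+ 2.
Proof.
move=> /andP[s0 s1]; elim: n => [|n IH]; first by rewrite expr0 mulr0 expr0n /= mulr0; lra.
rewrite exprSr; apply: le_trans (ler_wpM2r _ IH) _; first by lra.
rewrite -[n.+1%:R]natr1; have n0 : 0 <= n%:R :> R by [].
have : 0 <= s ^+ 2 * n%:R by rewrite mulr_ge0 ?sqr_ge0.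
have : 0 <= s ^+ 2 by rewrite sqr_ge0.
have : 0 <= s ^+ 3 * n%:R ^+ 2 by rewrite mulr_ge0 ?exprn_ge0.
nra.
Qed.

(** If [M] blocks move on average by more than [c], a displacement [c] for each group of [M] blocks
    is exponentially unlikely. The spare unit in [c + 1] leaves room for the quadratic errors of
    [pow_quad]. *)
Lemma low_tail e (c M N K : nat) : c%:R + 1 <= M%:R * mu e K N ->
  exists rho : R, 0 <= rho < 1 /\ forall k, P w (reach e (k * (M * N)) (k * c)%N) <= rho ^+ k.
Proof.
move=> hc; pose L : R := M%:R * K%:R + 1.
have M0 : 0 <= M%:R :> R by []. have K0 : 0 <= K%:R :> R by []. have c0 : 0 <= c%:R :> R by [].
have MK0 : 0 <= M%:R * K%:R :> R by apply: mulr_ge0.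
have L1 : 1 <= L by rewrite /L; lra.
have mK : mu e K N <= K%:R.
  rewrite -(E_cst w K%:R); apply: (E_le hw); [exact: (lam_fin (fun a => a%:R))|exact: fin_cst|move=> x].
  by rewrite ler_nat lam_le.
have m0 : 0 <= mu e K N by apply: Ex_ge0 => // x.
have M1 : 1 <= M%:R :> R.
  have [M00|M00] := posnP M; last by rewrite ler1n.
  by move: hc; rewrite M00 mul0r; lra.
have cL : c%:R + 1 <= L by apply: le_trans hc _; rewrite /L; have := ler_wpM2l M0 mK; lra.
(* Each of the two quadratic errors is then at most [s ^ 2 * L ^ 2 = s / 8], against a first order
   gain of [s]. *)
pose s : R := (8 * L ^+ 2)^-1.
have L2 : 1 <= L ^+ 2 by rewrite exprn_ege1.
have s0 : 0 < s by rewrite invr_gt0 mulr_gt0 // (lt_le_trans ltr01).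
have sE : s * (8 * L ^+ 2) = 1 by rewrite mulVf // gt_eqF // mulr_gt0 // (lt_le_trans ltr01).
have s8 : s <= 1 / 8 by nra.
have sL : s * L <= 1 / 8 by nra.
have z0 : 0 < 1 - s <= 1 by apply/andP; split; lra.
set y := s * mu e K N - s ^+ 2 * K%:R ^+ 2.
have Phi : E w (fun x => (1 - s) ^+ (lam e K N x)) <= 1 - y.
  have fl : fin (fun x => (lam e K N x)%:R : R) by exact: (lam_fin (fun a => a%:R)).
  have -> : 1 - y = E w (fun x => - s * (lam e K N x)%:R + (1 + s ^+ 2 * K%:R ^+ 2)).
    rewrite (E_lin w (- s) fl (fin_cst (1 + s ^+ 2 * K%:R ^+ 2))) E_cst /y /mu; ring.
  apply: (E_le hw); [exact: (lam_fin (fun a => (1 - s) ^+ a))|exact: (@lam_fin _ (fun a => - s * a%:R + _))|move=> x].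
  apply: le_trans (pow_quad _ _) _; first by apply/andP; split; lra.
  have : s ^+ 2 * (lam e K N x)%:R ^+ 2 <= s ^+ 2 * K%:R ^+ 2.
    by rewrite ler_wpM2l ?sqr_ge0 // ler_sqr ?nnegrE // ler_nat lam_le.
  lra.
have KL : s * K%:R <= 1 / 8 by apply: le_trans sL; rewrite ler_wpM2l ?(ltW s0) // /L; nra.
have y1 : y <= 1.
  have : s * mu e K N <= s * K%:R by rewrite ler_wpM2l // (ltW s0).
  have : 0 <= s ^+ 2 * K%:R ^+ 2 by rewrite mulr_ge0 ?sqr_ge0.
  rewrite /y; lra.
have y0 : 0 <= y.
  have : s * (M%:R * K%:R) ^+ 2 <= 1 / 8.
    apply: le_trans (_ : s * L ^+ 2 <= _); last by nra.
    by rewrite ler_wpM2l ?(ltW s0) // ler_sqr ?nnegrE; rewrite /L ?lerDl ?addr_ge0.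
  move=> h1; have h2 : s * K%:R ^+ 2 * M%:R <= 1 / 8.
    have : 0 <= s * (K%:R ^+ 2 * (M%:R * (M%:R - 1))).
      by rewrite !mulr_ge0 ?sqr_ge0 ?(ltW s0) //; lra.
    lra.
  have h3 : 0 <= M%:R * (mu e K N - s * K%:R ^+ 2) by rewrite mulrBr [M%:R * (s * _)]mulrC; lra.
  have h4 : 0 <= mu e K N - s * K%:R ^+ 2 by rewrite -(pmulr_rge0 _ (lt_le_trans ltr01 M1)).
  have -> : y = s * (mu e K N - s * K%:R ^+ 2) by rewrite /y; ring.
  by rewrite mulr_ge0 // ltW.
exists (1 - s / 2); split; first by apply/andP; split; lra.
move=> k; rewrite mulnA; apply: le_trans (reach_chernoff e K N (k * M) (k * c)%N z0) _.
set A := E w _ in Phi *.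
have A0 : 0 <= A by apply: Ex_ge0 => // x; rewrite exprn_ge0 //; lra.
have -> : A ^+ (k * M) / (1 - s) ^+ (k * c) = (A ^+ M / (1 - s) ^+ c) ^+ k.
  by rewrite exprMn exprVn -!exprM ![(_ * k)%N]mulnC.
have zc : 0 < (1 - s) ^+ c by rewrite exprn_gt0 //; lra.
apply: lerXn2r; rewrite ?nnegrE; [by apply: divr_ge0; [apply: exprn_ge0|exact: ltW]|lra|].
rewrite ler_pdivrMr //; apply: le_trans (_ : (1 - y) ^+ M <= _).
  by apply: lerXn2r; rewrite ?nnegrE //; lra.
apply: le_trans (pow_quad _ _) _; first by apply/andP.
have zc' : 1 - s * c%:R <= (1 - s) ^+ c by rewrite mulrC; apply: bernoulli_ge; apply/andP; split; lra.
have h5 : y ^+ 2 * M%:R ^+ 2 <= s ^+ 2 * L ^+ 2.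
  rewrite -!exprMn ler_sqr ?nnegrE; [|by rewrite mulr_ge0|by rewrite mulr_ge0 ?(ltW s0) ?(le_trans ler01 L1)].
  have : y <= s * K%:R.
    have : s * mu e K N <= s * K%:R by rewrite ler_wpM2l // (ltW s0).
    have : 0 <= s ^+ 2 * K%:R ^+ 2 by rewrite mulr_ge0 ?sqr_ge0.
    rewrite /y; lra.
  move=> h; apply: le_trans (ler_wpM2r M0 h) _; rewrite -mulrA ler_wpM2l ?(ltW s0) // /L [K%:R * _]mulrC; lra.
have h6 : s ^+ 2 * K%:R ^+ 2 * M%:R <= s ^+ 2 * L ^+ 2.
  rewrite -mulrA ler_wpM2l ?sqr_ge0 //; apply: le_trans (_ : (M%:R * K%:R) ^+ 2 <= _).
    by rewrite -subr_ge0 (_ : _ - _ = K%:R ^+ 2 * (M%:R * (M%:R - 1))) ?mulr_ge0 ?sqr_ge0 ?subr_ge0 //; ring.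
  by rewrite ler_sqr ?nnegrE; rewrite /L ?lerDl ?addr_ge0.
have h7 : s ^+ 2 * L ^+ 2 = s / 8.
  have e8 : s * L ^+ 2 = 1 / 8 by lra.
  by rewrite expr2 -mulrA e8 mulrC mul1r mulrC.
have h8 : s * (c%:R + 1) <= s * (M%:R * mu e K N) by rewrite ler_wpM2l // (ltW s0).
have -> : y * M%:R = s * (M%:R * mu e K N) - s ^+ 2 * K%:R ^+ 2 * M%:R by rewrite /y; ring.
apply: le_trans (_ : (1 - s / 2) * (1 - s * c%:R) <= _); last by rewrite ler_wpM2l //; lra.
have : 0 <= s * (s * c%:R) by rewrite !mulr_ge0 // ltW.
lra.
Qed.

End LowTail.

(** * The strict gain from long edges *)

Lemma finP_coord (i : coord) : finP (fun x => x i).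
Proof.
exists (match i with inl v => absz v.1 + absz v.2 | inr u => absz u end)%N => x y xy.
by rewrite xy //; case: (i) => [v|u] /=; lia.
Qed.

Section Gain.
Context {R : realType}.
Implicit Types (x : coord -> bool) (t m n i : nat) (j : int).

(* Interpolates between no long edge ([t = 0]) and all of them. *)
Definition cut t x : coord -> bool :=
  fun k => match k with inl _ => x k | inr u => (u < t%:Z) && x k end.

Lemma step_cut x t s a b : step true (cut t x) s a b <-> step (s < t)%N x s a b.
Proof.
rewrite /step /= ltz_nat; split=> -[h|h]; [by left|right|by left|right].
  by move: h => [_ [/andP[-> ->] [h1 h2]]].
by move: h => [-> [-> [h1 h2]]].
Qed.

Lemma cut_fin A t : finP A -> finP (fun x => A (cut t x)).
Proof.
move=> [M h]; exists M => x y xy; apply: h => i hi.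
by case: i hi => [v|u] hi /=; rewrite xy.
Qed.

(** The long edges at time [t] are pivotal: the closed site above [i] forces a track without them to
    be at [i + 1] or beyond at time [t + 1], from where the target is out of reach, while the long
    edge at [i] keeps the abscissa [i]. *)
Lemma gain_point x t m i j : lead true t i x -> x (inr t%:Z) -> ~ x (inl (i%:Z, 2 * t%:Z + 1)) ->
  x (inl (i%:Z, 2 * t%:Z + 2)) -> reach false m (j - i%:Z) (x \o sh i%:Z t.+1%:Z) ->
  ~ reach false m (j - (i%:Z + 1)) (x \o sh (i%:Z + 1) t.+1%:Z) ->
  reach true (t.+1 + m) j (cut t.+1 x) /\ ~ reach true (t.+1 + m) j (cut t x).
Proof.
move=> [l1 l2] xt x1 x2 [h0 [h1 h2 h3]] nr; split.
  case: l1 => g [g1 g2 g3].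
  have gt : g t = i%:Z.
    apply/le_anti/andP; split=> //; rewrite leNgt; apply/negP => gi; apply: l2.
    by exists g; split=> //; lia.
  have h00 : h0 0%N = 0.
    apply/le_anti/andP; split=> //; rewrite leNgt; apply/negP => gi; apply: nr.
    exists (fun s => h0 s - 1); split; [|lia|lia].
    apply/track_shift; have /track_shift := h1; apply: track_eq => s hs; lia.
  move/track_shift: h1 => h1.
  exists (fun s => if (s <= t)%N then g s else h0 (s - t.+1)%N + i%:Z); split.
  - move=> s hs; apply/step_cut; have [st|st] := ltnP s t.
      rewrite (ltnW st) ltnW ?ltnS //; apply: step_on; exact: step_on (g1 s _).
    have [->|st'] := eqVneq s t.
      rewrite !leqnn subnn h00 gt add0r; right; do !split=> //.
      by move=> k hk; have -> : k = i%:Z by lia.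
    rewrite !ifF; [|lia..].
    by have -> : (s < t.+1)%N = false; [lia|apply: h1; lia].
  - by rewrite leq0n.
  - rewrite ifF; last by lia.
    by rewrite addKn; lia.
move=> [g [g1 g2 g3]].
have gi : i%:Z <= g t.
  rewrite leNgt; apply/negP => gi; apply: l2; exists g; split=> //; last by lia.
  move=> s hs; have hs' : (s < t.+1 + m)%N by lia.
  by have /step_cut := g1 s hs'; have -> : (s < t)%N by lia.
have ht' : (t < t.+1 + m)%N by lia.
have /step_cut := g1 t ht'; rewrite ltnn => -[[c [c1 c2 c3]]|[]//].
have [gi'|gi'] : i%:Z + 1 <= g t.+1 \/ g t.+1 = i%:Z by lia.
  apply: nr; exists (fun s => g (s + t.+1)%N - (i%:Z + 1)); split.
  - apply/track_shift => s hs; have hs' : (s < t.+1 + m)%N by lia.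
    have /step_cut := g1 s hs'; have -> : (s < t)%N = false by lia.
    have -> : (s - t.+1 + t.+1)%N = s by lia.
    have -> : (s.+1 - t.+1 + t.+1)%N = s.+1 by lia.
    by rewrite !subrK.
  - by rewrite add0n; lia.
  - by rewrite addnC; lia.
by apply: x1; apply: c2; lia.
Qed.

Variables (p q : R).
Hypotheses (hp : 0 <= p <= 1) (hq : 0 <= q <= 1).
Notation w := (hom p q).
Let hw : prob_weight w := hom_prob hp hq.

Lemma P_coord (i : coord) : P w (fun x => x i) = w i.
Proof.
have fi := finP_coord i.
have [M hM] : exists M, inbox M i.
  exists (match i with inl v => absz v.1 + absz v.2 | inr u => absz u end)%N.
  by case: (i) => [v|u] /=; lia.
set N := maxn M (rad (ind (R := R) (fun x => x i))).
rewrite /P -(E_Ex w (s := boxl N) xfalse (fin_ind fi)); last first.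
  by apply: (cover_le (@cover_boxl N)); rewrite leq_maxr.
rewrite -/(Pr w (boxl N) (fun x => x i) xfalse) Pr_open //; apply: cover_boxl; apply: inbox_le hM; exact: leq_maxl.
Qed.

Definition hole t i x : Prop :=
  x (inr t%:Z) /\ (~ x (inl (i%:Z, 2 * t%:Z + 1)) /\ x (inl (i%:Z, 2 * t%:Z + 2))).

Lemma hole_fin t i : finP (hole t i).
Proof.
by apply: finP_and (finP_coord _) _; apply: finP_and (finP_coord _); apply: finP_not; apply: finP_coord.
Qed.

Lemma P_hole t i : P w (hole t i) = q * ((1 - p) * p).
Proof.
have d (k : coord) : depP (fun x => x k) (eq k) by move=> x y -> //.
rewrite (P_indep w (finP_coord (inr t%:Z)) _ (d _) (D' := fun k => if k is inl _ then True else False)).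
- rewrite P_coord; congr (_ * _); rewrite (P_indep w _ (finP_coord _) (depP_not (d _)) (d _)).
  + by rewrite P_not ?P_coord //; apply: finP_coord.
  + by apply: finP_not; apply: finP_coord.
  + by move=> k <- [] ; lia.
- by apply: finP_and (finP_coord _); apply: finP_not; apply: finP_coord.
- by move=> x y xy; rewrite !xy.
- by move=> k <-.
Qed.

Let F m j := P w (reach false m j).

Lemma F_le m j k : j <= k -> F m j <= F m k.
Proof. by move=> jk; apply: (P_sub hw) => [||x]; try exact: reach_fin; apply: reach_le. Qed.

(** Past, hole and future read three disjoint slabs, whence the product; the positions [i] of the
    leftmost track exclude each other, so at most one term is nonzero for each configuration. *)
Lemma gain_row t m j (K : nat) :
  \sum_(i < K) P w (lead true t i) * (q * ((1 - p) * p) * (F m (j - (i : nat)%:Z) - F m (j - ((i : nat)%:Z + 1)))) <=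
  P w (fun x => reach true (t.+1 + m) j (cut t.+1 x)) - P w (fun x => reach true (t.+1 + m) j (cut t x)).
Proof.
set n := (t.+1 + m)%N.
have fc s : finP (fun x => reach true n j (cut s x)) by apply: cut_fin; apply: reach_fin.
pose r1 i x := ind (R := R) (fun x => reach false m (j - i%:Z) (x \o sh i%:Z t.+1%:Z)) x.
pose r2 i x := ind (R := R) (fun x => reach false m (j - (i%:Z + 1)) (x \o sh (i%:Z + 1) t.+1%:Z)) x.
have f1 i : fin (r1 i) by apply: fin_ind (finP_shift _ _ (reach_fin _ _ _)).
have f2 i : fin (r2 i) by apply: fin_ind (finP_shift _ _ (reach_fin _ _ _)).
have f12 i : fin (fun x => r1 i x - r2 i x) by apply: (fin2 (fun a b => a - b)).
have fh i := fin_ind (R := R) (hole_fin t i); have fl i := fin_ind (R := R) (lead_fin true t i).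
have fhr i : fin (fun x => ind (hole t i) x * (r1 i x - r2 i x)).
  by apply: (fin2 (fun a b => a * b)).
have d12 i : dep (fun x => r1 i x - r2 i x) (slab t.+1 (t.+1 + m)).
  move=> x y xy; congr (_ - _).
    exact: (dep_ind (@slab_shift _ m i%:Z t.+1 (@reach_dep false m _))).
  exact: (dep_ind (@slab_shift _ m (i%:Z + 1) t.+1 (@reach_dep false m _))).
have dh i : depP (hole t i) (slab t t.+1).
  by move=> x y xy [h1 [h2 h3]]; split; [|split; [move=> h; apply: h2|]];
    [rewrite -xy|rewrite xy|rewrite -xy] => //=; lia.
have dhr i : dep (fun x => ind (R := R) (hole t i) x * (r1 i x - r2 i x)) (slab t (t.+1 + m)).
  move=> x y xy; congr (_ * _); [apply: (dep_ind (dh i))|apply: d12] => k hk; apply: xy;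
    by case: k hk => [v|u] /=; lia.
have e1 i : P w (lead true t i) * (q * ((1 - p) * p) * (F m (j - i%:Z) - F m (j - (i%:Z + 1)))) =
  E w (fun x => ind (lead true t i) x * (ind (hole t i) x * (r1 i x - r2 i x))).
  rewrite (E_indep w (fl i) (fhr i) (dep_ind (@lead_dep true t i)) (dhr i)); last first.
    by case=> [v|u] /=; lia.
  rewrite (E_indep w (fh i) (f12 i) (dep_ind (dh i)) (d12 i)); last first.
    by case=> [v|u] /=; lia.
  rewrite (EB w (f1 i) (f2 i)) -(P_hole t i) /F.
  by rewrite -(P_shift p q i%:Z t.+1%:Z (reach_fin _ _ _)) -[P w (reach false m (j - (_ + 1)))](P_shift p q (i%:Z + 1) t.+1%:Z (reach_fin _ _ _)).
rewrite (eq_bigr (fun i : 'I_K => E w (fun x => ind (lead true t i) x * (ind (hole t i) x * (r1 i x - r2 i x)))));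
  last by move=> i _; exact: e1.
have ff i : fin (fun x => ind (R := R) (lead true t i) x * (ind (hole t i) x * (r1 i x - r2 i x))).
  by apply: (fin2 (fun a b => a * b)).
rewrite -(@E_sum _ w); last by move=> i _; apply: ff.
rewrite -(EB w (fin_ind (fc _)) (fin_ind (fc _))).
apply: (E_le hw).
- by apply: fin_sum => i _; apply: ff.
- by apply: (@fin2 _ (fun a b => a - b)); apply: fin_ind; apply: fc.
move=> x.
have mono : 0 <= ind (R := R) (fun x => reach true n j (cut t.+1 x)) x - ind (fun x => reach true n j (cut t x)) x.
  rewrite subr_ge0; apply: ind_mono => -[g [g1 g2 g3]]; exists g; split=> // s hs.
  apply/step_cut; have /step_cut := g1 s hs; have [st|st] := ltnP s t; first by rewrite ltnW.
  by case=> [h|[]//]; left.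
have r12 i : 0 <= r1 i x - r2 i x.
  rewrite subr_ge0; apply: ind_mono => -[g [g1 g2 g3]]; exists (fun s => g s + 1); split; [|lia|lia].
  apply/track_shift; have /track_shift := g1; apply: track_eq => s hs; lia.
have r12' i : r1 i x - r2 i x <= 1.
  have h1 : r1 i x <= 1 by exact: ind_le1.
  have h2 : 0 <= r2 i x by exact: ind_ge0.
  lra.
have [[i iK [l1 l2 l3]]|nn] := pselect (exists2 i : 'I_K, true & [/\ lead true t i x, hole t i x & r1 i x - r2 i x <> 0]); last first.
  rewrite big1 // => i _; have [l1|l1] := pselect (lead true t i x); last by rewrite ind_f // mul0r.
  have [l2|l2] := pselect (hole t i x); last by rewrite (ind_f (R := R) l2) mul0r mulr0.
  by have [->|l3] := eqVneq (r1 i x - r2 i x) 0; [rewrite !mulr0|case: nn; exists i => //; split=> //; apply/eqP].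
rewrite (bigD1 i) //= big1 ?addr0 => [|k ki]; last first.
  rewrite ind_f ?mul0r // => -[k1 k2]; case: l1 => l11 l12.
  have [ik|ik] : (i < k)%N \/ (k < i)%N by move: ki; rewrite -val_eqE /=; lia.
    by apply: k2; apply: reach_le l11; lia.
  by apply: l12; apply: reach_le k1; lia.
have q1 : reach false m (j - i%:Z) (x \o sh i%:Z t.+1%:Z).
  apply: contrapT => h; apply: l3; apply/le_anti; rewrite r12 andbT /r1 ind_f // sub0r oppr_le0; exact: ind_ge0.
have q2 : ~ reach false m (j - (i%:Z + 1)) (x \o sh (i%:Z + 1) t.+1%:Z).
  by move=> h; apply: l3; apply/le_anti; rewrite r12 andbT (_ : r2 i x = 1) ?subr_le0; [exact: ind_le1|exact: ind_t].
have [h1 [h2 h3]] := l2; have [b1 b2] := gain_point l1 h1 h2 h3 q1 q2.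
rewrite (ind_t (R := R) l1) (ind_t (R := R) l2) !mul1r (_ : ind _ x = 1); last exact: ind_t.
by rewrite (_ : ind _ x = 0) ?subr0 //; exact: ind_f.
Qed.

End Gain.
Section GainMean.
Context {R : realType}.

Lemma geo_small (rho e : R) : 0 <= rho < 1 -> 0 < e -> exists K, forall k, (K <= k)%N -> rho ^+ k <= e.
Proof.
move=> /andP[r0 r1] e0; have d0 : 0 < 1 - rho by lra.
have [K hK] : exists K : nat, 1 <= K%:R * (e * (1 - rho)).
  exists (Num.truncn (e * (1 - rho))^-1).+1.
  by rewrite -ler_pdivrMr ?mulr_gt0 // div1r ltW // truncnS_gt.
exists K => k Kk; have := @pow_lin R (1 - rho) k; rewrite (_ : 1 - (1 - rho) = rho); last by ring.
move=> h; have {h} h : rho ^+ k * (1 + k%:R * (1 - rho)) <= 1 by apply: h; apply/andP; split; lra.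
have x0 : 0 <= rho ^+ k by apply: exprn_ge0.
have hk : 1 <= k%:R * (e * (1 - rho)).
  by apply: le_trans hK _; rewrite ler_wpM2r ?ler_nat // mulr_ge0 // ltW.
rewrite leNgt; apply/negP => ex.
have : e * (k%:R * (1 - rho)) < rho ^+ k * (1 + k%:R * (1 - rho)).
  have h1 : 0 < k%:R * (1 - rho) by rewrite -(pmulr_rgt0 _ e0); apply: lt_le_trans ltr01 _; rewrite mulrCA.
  by rewrite mulrDr mulr1; have := ltr_pM2r h1 e (rho ^+ k); rewrite ex; lra.
rewrite mulrCA; lra.
Qed.

Variables (p q : R).
Hypotheses (hp : 0 <= p <= 1) (hq : 0 <= q <= 1).
Notation w := (hom p q).
Let hw : prob_weight w := hom_prob hp hq.

Lemma P_all_open (r : seq coord) : uniq r -> P w (fun x => forall i, i \in r -> x i) = \prod_(i <- r) w i.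
Proof.
move=> ur; have fi : finP (fun x : coord -> bool => forall i, i \in r -> x i).
  apply: (@finP_bigI _ r (fun i x => x i)) => i _; exact: finP_coord.
have [M hM] : exists M, forall i, i \in r -> inbox M i.
  elim: (r) => [|i s [M h]]; first by exists 0%N.
  exists (M + match i with inl v => absz v.1 + absz v.2 | inr u => absz u end)%N => j.
  rewrite inE => /orP[/eqP ->|/h hj]; first by case: (i) => [v|u] /=; lia.
  by apply: inbox_le hj; rewrite leq_addr.
set N := maxn M (rad (ind (R := R) (fun x => forall i, i \in r -> x i))).
rewrite /P -(E_Ex w (s := boxl N) xfalse (fin_ind fi)); last first.
  by apply: (cover_le (@cover_boxl N)); rewrite leq_maxr.
rewrite -/(Pr w (boxl N) (fun x => forall i, i \in r -> x i) xfalse) Pr_all_open // => i /hM hi; apply: cover_boxl; apply: inbox_le hi; exact: leq_maxl.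
Qed.

(** Among enough disjoint columns of height [2n], one is entirely open with high probability. *)
Lemma reach_half n (e : R) : 0 < p -> 0 < e -> exists K : nat, 1 - e <= P w (reach false n K%:Z).
Proof.
move=> p0 e0; pose col (i : nat) : seq coord := [seq inl (i%:Z, y%:Z) | y <- iota 1 (2 * n)].
pose A (i : nat) (x : coord -> bool) := forall k, k \in col i -> x k.
have fA i : finP (A i) by apply: (finP_bigI (A := fun i x => x i)) => k _; apply: finP_coord.
have pA i : P w (A i) = p ^+ (2 * n).
  rewrite P_all_open; last by rewrite map_inj_uniq ?iota_uniq // => y z [].
  by rewrite big_map /= big_const_seq count_predT size_iota; elim: (2 * n)%N => //= m ->; rewrite exprS.
have pp : 0 < p ^+ (2 * n) <= 1 by rewrite exprn_gt0 //= exprn_ile1 //; case/andP: hp.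
have [|K hK] := @geo_small (1 - p ^+ (2 * n)) e _ e0; first by apply/andP; split; lra.
exists K; have {hK} hK := hK _ (leqnn K).
have f1 : finP (fun x => forall i, i \in iota 0 K -> ~ A i x).
  by apply: (finP_bigI (A := fun i x => ~ A i x)) => i _; apply: finP_not.
have h : P w (fun x => forall i, i \in iota 0 K -> ~ A i x) <= (1 - p ^+ (2 * n)) ^+ size (iota 0 K).
  apply: (P_all_indep hw (A := fun i x => ~ A i x) (D := fun i k => k \in col i)).
  - exact: iota_uniq.
  - by move=> i _; apply: finP_not.
  - by move=> i _ x y xy na a; apply: na => k kc; rewrite xy //; apply: a.
  - move=> i j k _ _ ij /mapP[y _ ->] /mapP[z _ [e1 _]]; exact: ij.
  - lra.
  - by move=> i _; rewrite P_not // pA.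
rewrite size_iota in h; have := P_not w f1.
have : P w (fun x => ~ (forall i, i \in iota 0 K -> ~ A i x)) <= P w (reach false n K%:Z).
  apply: (P_sub hw); [exact: finP_not|exact: reach_fin|move=> x hx].
  have [i iK a] : exists2 i, i \in iota 0 K & A i x.
    apply: contrapT => H; apply: hx => i iK a; apply: H; by exists i.
  move: iK; rewrite mem_iota => /andP[_ iK]; exists (fun=> i%:Z); split=> //; last by lia.
  move=> t tn; left; exists i%:Z; split; [by rewrite !lexx| |] => k hk; have -> : k = i%:Z by [lia| lia].
    by apply: a; apply/mapP; exists (2 * t + 1)%N => //; rewrite mem_iota; lia.
  by apply: a; apply/mapP; exists (2 * t + 2)%N => //; rewrite mem_iota; lia.
move=> h1 h2; lra.
Qed.

Lemma mu_sum e K n : mu p q e K n = \sum_(j < K) (1 - P w (reach e n (j : nat)%:Z)).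
Proof.
have ff (j : nat) : finP (fun x => ~ reach e n j%:Z x) by apply: finP_not; apply: reach_fin.
rewrite (eq_bigr (fun j : 'I_K => E w (ind (fun x => ~ reach e n (j : nat)%:Z x)))); last first.
  by move=> j _; rewrite -P_not //; apply: reach_fin.
rewrite -(@E_sum _ w); last by move=> j _; apply: fin_ind.
by apply: E_eq => x; rewrite /lam natr_sum; apply: eq_bigr.
Qed.

(** Long edges are switched on one time after the other. Summed over the target [j], the differences
    of [gain_row] telescope ([tel]); what remains is that the leftmost track lies within [K1] and
    that its future also moves by at most [K1], each with probability at least one half. The
    truncation level leaves room for both. *)
Lemma gain_mu n (K1 : nat) : 1 / 2 <= P w (reach false n K1%:Z) ->
  mu p q true (K1 + K1).+1 n + n%:R * (q * ((1 - p) * p) / 4) <= mu p q false (K1 + K1).+1 n.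
Proof.
move=> hK; set K := (K1 + K1).+1; set c := q * _; have KZ : K%:Z = K1%:Z + K1%:Z + 1 by rewrite /K; lia.

have c0 : 0 <= c by have /andP[p0 p1] := hp; have /andP[q0 q1] := hq; rewrite /c !mulr_ge0 //; lra.
pose G t (j : nat) := P w (fun x => reach true n j%:Z (cut t x)).
have fc t j : finP (fun x => reach true n j (cut t x)) by apply: cut_fin; apply: reach_fin.
have row t : (t < n)%N -> c / 4 <= \sum_(j < K) (G t.+1 j - G t j).
  move=> tn; have [m nm] : exists m, n = (t.+1 + m)%N by exists (n - t.+1)%N; lia.
  pose F j := P w (reach false m j).
  apply: (@le_trans _ _ (\sum_(j < K) \sum_(i < K) P w (lead true t i) * (c * (F ((j : nat)%:Z - (i : nat)%:Z) - F ((j : nat)%:Z - ((i : nat)%:Z + 1))))));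
    last first.
    by apply: ler_sum => j _; rewrite /G nm; apply: gain_row.
  rewrite exchange_big /=.
  have tel (i : 'I_K) : \sum_(j < K) P w (lead true t i) * (c * (F ((j : nat)%:Z - (i : nat)%:Z) - F ((j : nat)%:Z - ((i : nat)%:Z + 1)))) =
     P w (lead true t i) * (c * F (K%:Z - 1 - (i : nat)%:Z)).
    rewrite -!mulr_sumr; congr (_ * (_ * _)).
    have F0 : F (- 1 - (i : nat)%:Z) = 0.
      rewrite /F -(E_cst w 0); apply: E_eq => x; rewrite ind_f //; apply: reach_neg; lia.
    rewrite -(big_mkord xpredT (fun j => F (j%:Z - (i : nat)%:Z) - F (j%:Z - ((i : nat)%:Z + 1)))).
    rewrite (eq_bigr (fun j => F (j.+1%:Z - 1 - (i : nat)%:Z) - F (j%:Z - 1 - (i : nat)%:Z))); last first.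
      by move=> j _; congr (F _ - F _); lia.
    by rewrite telescope_sumr // sub0r F0 subr0.
  rewrite (eq_bigr _ (fun i _ => tel i)).
  have F1 : 1 / 2 <= F K1%:Z.
    apply: le_trans hK _; apply: (P_sub hw); [exact: reach_fin|exact: reach_fin|move=> x].
    by apply: reach_short; lia.
  apply: (@le_trans _ _ (\sum_(i < K1.+1) P w (lead true t i) * (c * F K1%:Z))); last first.
    have KK : (K1.+1 <= K)%N by rewrite /K; lia.
    rewrite (big_ord_widen K (fun i => P w (lead true t i) * (c * F K1%:Z)) KK) big_mkcond /=.
    apply: ler_sum => i _; case: ltnP => iK; last first.
      by apply: mulr_ge0; [exact: P_ge0|apply: mulr_ge0 => //; exact: P_ge0].
    by rewrite ler_wpM2l ?P_ge0 // ler_wpM2l //; apply: (F_le hp hq); lia.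
  rewrite -mulr_suml (_ : \sum_(i < K1.+1) _ = P w (reach true t K1%:Z)); last first.
    rewrite -(@E_sum _ w); last by move=> i _; apply: fin_ind (lead_fin _ _ _).
    have K1E : K1.+1%:Z - 1 = K1%:Z by lia.
    apply: E_eq => x; by rewrite (lead_sum p q) K1E.
  have P1 : 1 / 2 <= P w (reach true t K1%:Z).
    apply: le_trans hK _; apply: (P_sub hw); [exact: reach_fin|exact: reach_fin|move=> x /reach_on].
    by apply: reach_short; lia.
  apply: (@le_trans _ _ (1 / 2 * (c * (1 / 2)))); first by lra.
  apply: ler_pM => //; [lra|by rewrite mulr_ge0 //; lra|by rewrite ler_wpM2l].
have tot : n%:R * (c / 4) <= \sum_(j < K) (G n j - G 0%N j).
  apply: (@le_trans _ _ (\sum_(0 <= t < n) \sum_(j < K) (G t.+1 j - G t j))).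
    rewrite big_nat -[n in n%:R]subn0 mulr_natl -sumr_const_nat big_nat.
    by apply: ler_sum => t /andP[_ tn]; apply: row.
  rewrite exchange_big /=; apply: ler_sum => j _.
  by rewrite telescope_sumr.
have e1 (j : nat) : G n j = P w (reach true n j%:Z).
  apply: P_eq => x; split=> -[g [g1 g2 g3]]; exists g; split=> // s hs; have := g1 s hs.
    by move/step_cut/step_on.
  by move=> h; apply/step_cut; case/andP: hs => _ ->.
have e0 (j : nat) : G 0%N j = P w (reach false n j%:Z).
  apply: P_eq => x; split=> -[g [g1 g2 g3]]; exists g; split=> // s hs; have := g1 s hs.
    by move/step_cut.
  by move=> h; apply/step_cut.
rewrite -lerBrDl; apply: le_trans tot _; rewrite !mu_sum -sumrB; apply: ler_sum => j _.
by rewrite e1 e0; lra.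
Qed.

End GainMean.
(** * Paths along lines *)

Section LineEvents.
Context {R : realType}.
Implicit Types (x : coord -> bool) (e : bool) (z : int) (s r : R).

Definition Ln e z t0 n s r x := exists g, track e x t0 (t0 + n) g /\
  forall t, (t <= n)%N -> `|(g (t0 + t)%N)%:~R - (z%:~R + s * t%:R)| <= r.

Definition lnlo z t0 s r (u : nat) : int := Num.ceil (z%:~R + s * (u - t0)%N%:R - r).
Definition lnhi z t0 s r (u : nat) : int := Num.floor (z%:~R + s * (u - t0)%N%:R + r).

Lemma Ln_tube e z t0 n s r x : Ln e z t0 n s r x <-> tube_ev e t0 (t0 + n) (lnlo z t0 s r) (lnhi z t0 s r) x.
Proof.
split=> -[g [h1 h2]]; exists g; split=> // t ht.
  have := h2 (t - t0)%N; rewrite subnKC; last by lia.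
  move=> /(_ _)/[!ler_distl]; rewrite /lnlo /lnhi ceil_le_int floor_ge_int; apply; lia.
by have := h2 (t0 + t)%N; rewrite /lnlo /lnhi ceil_le_int floor_ge_int addKn ler_distl; apply; lia.
Qed.

Lemma Ln_fin e z t0 n s r : finP (Ln e z t0 n s r).
Proof.
have [M h] := tube_ev_fin e t0 (t0 + n) (lnlo z t0 s r) (lnhi z t0 s r).
by exists M => x y xy /Ln_tube H; apply/Ln_tube; apply: h H.
Qed.

Definition lnzone e z t0 n s r (i : coord) : Prop :=
  match i with
  | inl v => exists t, [/\ (t < n)%N, v.2 = 2 * (t0 + t)%N%:Z + 1 \/ v.2 = 2 * (t0 + t)%N%:Z + 2 &
      z%:~R + s * t%:R - r <= v.1%:~R <= z%:~R + s * t.+1%:R + r]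
  | inr u => e /\ t0%:Z <= u < (t0 + n)%N%:Z
  end.

Lemma Ln_dep e z t0 n s r : depP (Ln e z t0 n s r) (lnzone e z t0 n s r).
Proof.
move=> x y xy /Ln_tube h; apply/Ln_tube; apply: tube_ev_dep h => -[v|u] h; apply: xy; move: h => /=.
  move=> [t [ht hv]]; rewrite /lnlo /lnhi ceil_le_int floor_ge_int => h.
  exists (t - t0)%N; rewrite subnKC; last by lia.
  by split=> //; [lia|rewrite -subSn //; lia].
by move=> [he [t [ht ->]]]; split=> //; lia.
Qed.

Lemma Ln_slab e z t0 n s r : depP (Ln e z t0 n s r) (slab t0 (t0 + n)).
Proof.
move=> x y xy; apply: Ln_dep => -[v|u] h; apply: xy; move: h => /=; last by case.
by move=> [t [h1 h2 _]]; lia.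
Qed.

Lemma Ln_shift e z t0 n s r x : Ln e 0 0 n s r (x \o sh z t0%:Z) <-> Ln e z t0 n s r x.
Proof.
split=> -[g [h1 h2]].
  exists (fun t => g (t - t0)%N + z); split; first by move/track_shift: h1; rewrite !add0n [(n + t0)%N]addnC.
  by move=> t tn; have := h2 t tn; rewrite addKn intrD !add0n; congr (`|_| <= _); ring.
exists (fun t => g (t0 + t)%N - z); split.
  apply/track_shift; rewrite !add0n [(n + t0)%N]addnC; apply: track_eq h1 => t ht; rewrite subrK; congr g; lia.
by move=> t tn; have := h2 t tn; rewrite intrB !add0n; congr (`|_| <= _); ring.
Qed.

Lemma P_Ln (p q : R) e z t0 n s r : P (hom p q) (Ln e z t0 n s r) = P (hom p q) (Ln e 0 0 n s r).
Proof.
by rewrite -(P_shift p q z t0%:Z (Ln_fin e 0 0 n s r)); apply: P_eq => x; rewrite Ln_shift.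
Qed.

Lemma Ln_le e z t0 n s r s' r' x : (forall t, (t <= n)%N -> `|(s - s') * t%:R| <= r' - r) ->
  Ln e z t0 n s r x -> Ln e z t0 n s' r' x.
Proof.
move=> h [g [h1 h2]]; exists g; split=> // t tn; have := h t tn; have := h2 t tn.
rewrite !ler_norml => /andP[a b] /andP[c d]; apply/andP; split; nra.
Qed.

End LineEvents.

(** * Concentration around the asymptotic slope *)

Section LineLimit.
Context {R : realType}.
Variables (p q : R).
Hypotheses (hp : 0 <= p <= 1) (hq : 0 <= q <= 1).
Notation w := (hom p q).
Let hw : prob_weight w := hom_prob hp hq.
Variables (e : bool) (s : R).
Hypotheses (mu_le : forall K N, mu p q e K N <= s * N%:R)
  (mu_sup : forall eta, 0 < eta -> exists K N, (s - eta) * N%:R < mu p q e K N).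

Lemma slope_ge0 : 0 <= s.
Proof.
by have := mu_le 0 1; rewrite mulr1; apply: le_trans; apply: Ex_ge0 => // x.
Qed.

Lemma ex_nat_gt (a : R) : exists n : nat, forall m, (n <= m)%N -> a <= m%:R.
Proof.
exists (Num.truncn a).+1 => m hm; apply: le_trans (ltW (truncnS_gt a)) _; by rewrite ler_nat.
Qed.

(** The supremum [s] is nearly attained by some block length [N]; [low_tail] is applied to groups of
    [M] such blocks, with [M] so large that rounding and the spare unit cost less than [eta]. *)
Lemma low_lim (eta d : R) : 0 < eta -> 0 < d -> exists n0, forall n, (n0 <= n)%N ->
  forall j : int, j%:~R <= (s - eta) * n%:R -> P w (reach e n j) <= d.
Proof.
move=> eta0 d0; have s0 := slope_ge0.
have P0 n (j : int) : j < 0 -> P w (reach e n j) = 0.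
  by move=> j0; rewrite -(E_cst w 0); apply: E_eq => x; rewrite ind_f //; apply: reach_neg.
have [se|se] := ltP s eta.
  exists 1%N => n n1 j hj; rewrite P0 ?(ltW d0) // -(ltrz0 R).
  apply: le_lt_trans hj _; rewrite nmulr_rlt0; [by rewrite ltr0n|lra].
have [|K [N hKN]] := @mu_sup (eta / 4); first by lra.
have N0 : (0 < N)%N.
  case: (N) hKN => // h; have := mu_le K 0; rewrite !mulr0 in h *; lra.
have N0' : 1 <= N%:R :> R by rewrite ler1n.
have [M hM] := ex_nat_gt (8 / eta + 1); have {hM} hM := hM M (leqnn M).
have M8 : 8 <= M%:R * eta by rewrite -ler_pdivrMr //; lra.
have M1 : 1 <= M%:R :> R by apply: le_trans hM; rewrite lerDr divr_ge0 // ltW.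
set m := mu p q e K N in hKN.
have hm : M%:R * N%:R * (s - eta / 4) <= M%:R * m by rewrite -mulrA ler_wpM2l // mulrC ltW.
have MN8 : 8 <= M%:R * N%:R * eta.
  apply: le_trans M8 _; rewrite mulrAC ler_peMr // mulr_ge0 //; lra.
have mm : 0 <= M%:R * m - 1.
  have : M%:R * N%:R * eta <= M%:R * N%:R * s by rewrite ler_wpM2l // mulr_ge0 //; lra.
  lra.
set c := Num.truncn (M%:R * m - 1).
have /andP[c1 c2] := truncn_itv mm; rewrite -/c in c1 c2.
have [|rho [rho01 hrho]] := @low_tail R p q hp hq e c M N K; first by rewrite -/m; lra.
have [k0 hk0] := geo_small rho01 d0.
have [n1 hn1] := ex_nat_gt (2 / eta * ((M * N)%:R * s)).
exists (n1 + k0.+1 * (M * N))%N => n hn j hj.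
have MNp : (0 < M * N)%N by rewrite muln_gt0 N0 andbT -(ltr0n R); lra.
set k := (n %/ (M * N))%N.
have kn : (k * (M * N) <= n)%N by rewrite leq_divM.
have kn' : (n < k.+1 * (M * N))%N by rewrite ltn_ceil.
have kk : (k0 <= k)%N.
  rewrite leq_divRL //; apply: leq_trans hn; apply: leq_trans (leq_addl _ _); by rewrite leq_mul2r leqnSn orbT.
apply: le_trans (hk0 k kk); apply: le_trans (hrho k).
apply: (P_sub hw); [exact: reach_fin|exact: reach_fin|move=> x /(reach_short kn)].
apply: reach_le; rewrite -(ler_int R); apply: le_trans hj _.
have kn2 : n%:R <= k%:R * (M%:R * N%:R) + M%:R * N%:R :> R.
  by rewrite -!natrM -natrD ler_nat; rewrite mulSn in kn'; rewrite addnC ltnW.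
have kn1 : k%:R * (M%:R * N%:R) <= n%:R :> R by rewrite -!natrM ler_nat.
have hn1' := hn1 n (leq_trans (leq_addr _ _) hn).
have hn2 : 2 * (M%:R * N%:R * s) <= eta * n%:R.
  have := ler_wpM2l (ltW eta0) hn1'; rewrite natrM !mulrA (mulrC eta 2) mulfK ?gt_eqF //; lra.
rewrite PoszM intrM mulrC.
have c3 : M%:R * N%:R * (s - eta / 2) <= c%:R by rewrite -natr1 in c2; lra.
have k0' : 0 <= k%:R :> R by [].
have := ler_wpM2l k0' c3.
have : 0 <= (s - eta / 2) * (k%:R * (M%:R * N%:R) + M%:R * N%:R - n%:R) by rewrite mulr_ge0 //; lra.
have : 0 <= M%:R * N%:R * eta :> R by lra.
rewrite -!pmulrn; lra.
Qed.

Lemma low_lim_unif (eta d : R) : 0 < eta -> 0 < d -> exists n0, forall n, (n0 <= n)%N ->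
  forall u (j : int), (u <= n)%N -> j%:~R <= s * u%:R - eta * n%:R -> P w (reach e u j) <= d.
Proof.
move=> eta0 d0; have s0 := slope_ge0; have [n0 h] := low_lim eta0 d0.
have [n1 hn1] := ex_nat_gt ((s * n0%:R + 1) / eta).
exists n1 => n nn u j un hj; have {}hn1 := hn1 n nn; rewrite ler_pdivrMr // in hn1.
have [u0|u0] := leqP n0 u.
  apply: (h u u0); apply: le_trans hj _; rewrite mulrBl lerD2l lerN2 ler_wpM2l ?ler_nat //; exact: ltW.
rewrite (_ : P w _ = 0) ?(ltW d0) // -(E_cst w 0); apply: E_eq => x; rewrite ind_f //.
apply: reach_neg; rewrite -(ltrz0 R); apply: le_lt_trans hj _.
have : s * u%:R <= s * n0%:R by rewrite ler_wpM2l // ler_nat ltnW.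
lra.
Qed.

Lemma lam_ge K n (k : nat) x : (k <= K)%N -> ~ reach e n (k%:Z - 1) x -> (k <= lam e K n x)%N.
Proof.
move=> kK nr; rewrite /lam -(big_mkord xpredT (fun j => nat_of_bool `[< ~ reach e n j%:Z x >])).
rewrite (big_cat_nat (leq0n k) kK) /= -[leqLHS]addn0 leq_add // -[leqLHS](subn0 k) -[leqLHS]muln1 -sum_nat_const_nat.
rewrite big_nat [leqRHS]big_nat; apply: leq_sum => j /andP[_ jk]; rewrite asboolT // => h; apply: nr; apply: reach_le h; lia.
Qed.

(** A first moment argument: the displacement is almost always at least about [s * n] by [low_lim],
    and its mean is at most [s * n], so it can rarely exceed [(s + eta) * n]. *)
Lemma up_lim (eta d : R) : 0 < eta -> 0 < d -> exists n0, forall n, (n0 <= n)%N ->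
  forall j : int, (s + eta) * n%:R <= j%:~R -> 1 - d <= P w (reach e n j).
Proof.
move=> eta0 d0; have s0 := slope_ge0.
pose xi := eta * d / 2; pose d1 := eta * d / (2 * (s + 1)).
have xi0 : 0 < xi by rewrite /xi divr_gt0 // mulr_gt0.
have d10 : 0 < d1 by rewrite /d1 divr_gt0 ?mulr_gt0 //; lra.
have [n0 hn0] := low_lim xi0 d10.
exists n0.+1 => n nn j hj; have {}hn0 := hn0 n (ltnW nn).
have n1 : 1 <= n%:R :> R by rewrite ler1n; lia.
pose a := Num.max 0 (s - xi).
have a0 : 0 <= a by rewrite le_max lexx.
have as1 : s - xi <= a by rewrite le_max lexx orbT.
have as2 : a <= s by rewrite ge_max s0 /=; lra.
pose k := absz (Num.ceil (a * n%:R)).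
have an0 : 0 <= a * n%:R by rewrite mulr_ge0 //; lra.
have kE : k%:Z = Num.ceil (a * n%:R) by rewrite gez0_abs // -(ler0z R); apply: le_trans an0 (ceil_ge _).
have k1 : a * n%:R <= k%:R by rewrite -[k%:R]/(k%:Z%:~R) kE ceil_ge.
have kneg : P w (reach e n (k%:Z - 1)) <= d1.
  have k2 : (k%:Z - 1)%:~R < a * n%:R by rewrite kE; exact: ceilB1_lt.
  have [sx|sx] := ltP s xi.
    have a00 : a = 0 by rewrite /a max_l //; lra.
    rewrite (_ : P w _ = 0) ?(ltW d10) // -(E_cst w 0); apply: E_eq => x; rewrite ind_f //; apply: reach_neg.
    by rewrite -(ltrz0 R) (lt_le_trans k2) // a00 mul0r.
  by apply: hn0; apply: le_trans (ltW k2) _; rewrite /a max_r //; lra.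
have j0 : 0 <= j by rewrite -(ler0z R); apply: le_trans hj; rewrite mulr_ge0 //; lra.
pose K := (absz j).+1.
have KE : K%:R = j%:~R + 1 :> R by rewrite -natr1 pmulrn gez0_abs.
have kK : (k <= K)%N.
  rewrite -lez_nat kE ceil_le_int -pmulrn KE.
  have : a * n%:R <= (s + eta) * n%:R by rewrite ler_wpM2r //; lra.
  lra.
have f1 : finP (fun x => ~ reach e n (k%:Z - 1) x) by apply: finP_not; apply: reach_fin.
have f2 : finP (fun x => ~ reach e n j x) by apply: finP_not; apply: reach_fin.
have key : a * n%:R * (1 - P w (reach e n (k%:Z - 1))) + eta * n%:R * (1 - P w (reach e n j)) <= mu p q e K n.
  rewrite -!P_not; try exact: reach_fin.
  have fg := fin_ind (R := R) f2.
  have fg' : fin (fun x => eta * n%:R * ind (R := R) (fun x => ~ reach e n j x) x).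
    by apply: (@fin2 _ (fun a b => a * b)) fg; exact: fin_cst.
  rewrite /P -(EZ w (eta * n%:R) fg) -(E_lin w (a * n%:R) (fin_ind f1) fg').
  apply: (E_le hw).
  - by apply: (@fin2 _ (fun u v => a * n%:R * u + eta * n%:R * v)); apply: fin_ind.
  - exact: (lam_fin (fun a => a%:R)).
  move=> x; have [h2|h2] := pselect (~ reach e n j x).
    rewrite (ind_t (R := R) h2) mulr1; have := ind_le1 (R := R) (fun x => ~ reach e n (k%:Z - 1) x) x => h.
    have : (K <= lam e K n x)%N.
      by apply: lam_ge => // h3; apply: h2; apply: reach_le h3; rewrite /K; clear -j0; lia.
    rewrite -(ler_nat R) KE => h4; apply: le_trans h4; have := ler_wpM2l an0 h; rewrite mulr1 => h5.
    have : (a + eta) * n%:R <= (s + eta) * n%:R by rewrite ler_wpM2r //; lra.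
    lra.
  rewrite (ind_f (R := R) h2) mulr0 addr0; have [h1|h1] := pselect (~ reach e n (k%:Z - 1) x); last by rewrite (ind_f (R := R) h1) mulr0.
  by rewrite (ind_t (R := R) h1) mulr1; apply: le_trans k1 _; rewrite ler_nat; apply: lam_ge.
have := mu_le K n; set pi := P w (reach e n j) in key *.
have h1 : a * n%:R * d1 <= s * n%:R * d1 by rewrite ler_wpM2r ?(ltW d10) // ler_wpM2r //; lra.
have h2 : a * n%:R * P w (reach e n (k%:Z - 1)) <= a * n%:R * d1 by rewrite ler_wpM2l.
have h3 : s * d1 <= eta * d / 2.
  have : (s + 1) * d1 = eta * d / 2 by rewrite /d1; field; lra.
  lra.
have h4 : s * n%:R * d1 <= eta * d / 2 * n%:R by rewrite mulrAC ler_wpM2r //; lra.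
have h5 : (s - xi) * n%:R <= a * n%:R by rewrite ler_wpM2r //; lra.
move=> h6; have h7 : eta * n%:R * (1 - pi) <= eta * n%:R * d.
  rewrite /xi in h5; lra.
have en0 : 0 < eta * n%:R by rewrite mulr_gt0 //; lra.
by have := h7; rewrite ler_pM2l //; lra.
Qed.

End LineLimit.
Section LineExists.
Context {R : realType}.
Variables (p q : R).
Hypotheses (hp : 0 <= p <= 1) (hq : 0 <= q <= 1).
Notation w := (hom p q).
Let hw : prob_weight w := hom_prob hp hq.
Variables (e : bool) (s : R).
Hypotheses (mu_le : forall K N, mu p q e K N <= s * N%:R)
  (mu_sup : forall eta, 0 < eta -> exists K N, (s - eta) * N%:R < mu p q e K N).

(* The two kinds of slow tracks, over [0, u] and over [u, n]: a track from the right of the grid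
   point [l * d] at time [u] is too slow. *)
Definition slow eta n v d (kl : nat * nat) x : Prop :=
  let u := minn n (kl.1 * v) in
  reach e u (Num.floor (s * u%:R - eta * n%:R)) x \/
  reach e (n - u) (Num.floor (s * (n - u)%:R - eta * n%:R)) (x \o sh (kl.2 * d)%N%:Z u%:Z).

Lemma slow_fin eta n v d kl : finP (slow eta n v d kl).
Proof. by apply: finP_or; [|apply: finP_shift]; apply: reach_fin. Qed.

(** Being too far left at time [u] is slowness of the first kind. Being too far right leaves too
    little displacement until the end, which is not far right itself: slowness of the second kind,
    seen from the grid point just to the left. Between the tested times monotonicity suffices, as
    [s * v] is small. *)
Lemma slow_line eta n m v d L x : 0 < eta -> (0 < v)%N -> (n <= m * v)%N ->
  v%:R * s <= eta * n%:R -> (0 < d)%N -> d%:R <= eta * n%:R + 1 -> 1 <= eta * n%:R -> (s + 2 * eta) * n%:R < L%:R * d%:R ->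
  reach e n (Num.floor ((s + 2 * eta) * n%:R)) x ->
  (forall k l, (k <= m)%N -> (l < L)%N -> ~ slow eta n v d (k, l) x) -> Ln e 0 0 n s (8 * eta * n%:R) x.
Proof.
move=> eta0 v0 nmv vs d0 dn en Ld [g [g1 g2 g3]] H; have s0 := slope_ge0 hp hq mu_le.
have s00 : 0 <= s by [].
have gn : (g n)%:~R <= (s + 2 * eta) * n%:R by rewrite -floor_ge_int.
have g0 t : (t <= n)%N -> 0 <= g t.
  by move=> tn; apply: le_trans g2 _; apply: track_le g1 _ _ _.
exists g; split=> //.
have up k : (k <= m)%N -> (g (minn n (k * v)))%:~R <= s * (minn n (k * v))%:R + 6 * eta * n%:R.
  move=> km; set u := minn n (k * v); have un : (u <= n)%N by rewrite geq_minl.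
  pose l := (absz (g u) %/ d)%N.
  have gu : (absz (g u))%:Z = g u by rewrite gez0_abs // g0.
  have l1 : (l * d)%N%:Z <= g u by rewrite -gu lez_nat leq_divM.
  have l2 : g u <= (l * d)%N%:Z + d%:Z by rewrite -gu -PoszD lez_nat addnC -mulSn ltnW // ltn_ceil.
  have lL : (l < L)%N.
    rewrite ltn_divLR // -ltz_nat gu -(ltr_int R) (_ : (L * d)%N%:~R = L%:R * d%:R :> R); last exact: natrM.
    apply: le_lt_trans Ld.
    apply: le_trans gn; rewrite ler_int; exact: track_le g1 _ _ _.
  have := H k l km lL; rewrite /slow /= -/u => nh.
  have : (s * (n - u)%:R - eta * n%:R) <= (g n - (l * d)%N%:Z)%:~R.
    rewrite leNgt; apply/negP => lt; apply: nh; right.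
    exists (fun t => g (t + u)%N - (l * d)%N%:Z); split.
    - apply/track_shift; rewrite add0n subnK //; apply: track_eq (track_sub g1 (leq0n _) (leqnn _)) => t ht.
      by rewrite subnK ?subrK //; case/andP: ht.
    - by rewrite add0n subr_ge0.
    - by rewrite subnK // floor_ge_int ltW.
  rewrite intrB natrB // => h5.
  have h6 : (g u)%:~R <= (l * d)%N%:~R + d%:R :> R by rewrite -[d%:R]/(d%:Z%:~R) -intrD ler_int.
  lra.
have low k : (k <= m)%N -> s * (minn n (k * v))%:R - eta * n%:R <= (g (minn n (k * v)))%:~R.
  move=> km; set u := minn n (k * v); have un : (u <= n)%N by rewrite geq_minl.
  have L0 : (0 < L)%N.
    rewrite -(ltr0n R); have : 0 < L%:R * d%:R :> R.
      by apply: (le_lt_trans _ Ld); rewrite mulr_ge0 //; lra.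
    by rewrite pmulr_lgt0 // ltr0n.
  have := H k 0%N km L0; rewrite /slow /= -/u => nh.
  rewrite leNgt; apply/negP => lt; apply: nh; left; exists g; split=> //; first by apply: track_sub g1 _ _.
  by rewrite floor_ge_int ltW.
move=> t tn; rewrite add0n (_ : 0%:~R = 0 :> R) // add0r; pose k := (t %/ v)%N.
have k1 : (k * v <= t)%N by rewrite leq_divM.
have k2 : (t < k.+1 * v)%N by rewrite ltn_ceil.
have u1 : minn n (k * v) = (k * v)%N by apply/minn_idPr/(leq_trans k1).
have km : (k < m)%N || (t == n) && (k == m).
  have [tn'|tn'] := eqVneq t n.
    have : (k <= m)%N by rewrite -ltnS ltn_divLR // tn' (leq_ltn_trans nmv) // mulSn; clear -v0; lia.
    by clear; lia.
  by rewrite ltn_divLR // (leq_trans _ nmv) // ltn_neqAle tn' tn.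
have kt : (k * v)%:R <= t%:R :> R by rewrite ler_nat.
have tk : t%:R <= (k * v)%:R + v%:R :> R by rewrite -natrD ler_nat addnC -mulSn ltnW.
have km0 : (k <= m)%N by clear -km; lia.
have := low k km0; rewrite u1 => h1.
have h2 : (g (k * v)%N)%:~R <= (g t)%:~R :> R by rewrite ler_int; apply: track_le g1 _ _ _.
have s1 : s * t%:R <= s * (k * v)%:R + s * v%:R by rewrite -mulrDr ler_wpM2l.
have s2 : s * (k * v)%:R <= s * t%:R by rewrite ler_wpM2l.
have h3 : (g t)%:~R <= s * t%:R + s * v%:R + 6 * eta * n%:R.
  have [km'|/negP km'] := boolP (k < m)%N; last first.
    have ktn : t = n by clear -km km'; lia.
    have := up k km0; rewrite u1 => h.
    have kvn : (k * v)%N = n.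
      by have ekm : k = m by [clear -km km'; lia]; rewrite ekm in u1 k1 *; clear -u1 k1 nmv ktn; lia.
    rewrite kvn in h; rewrite ktn; have : 0 <= s * v%:R by rewrite mulr_ge0.
    lra.
  have h := up k.+1 km'; have u2 : (t <= minn n (k.+1 * v))%N by rewrite leq_min tn ltnW.
  have h4 : (g t)%:~R <= (g (minn n (k.+1 * v)))%:~R :> R.
    by rewrite ler_int; apply: track_le g1 _ _ _ => //; exact: geq_minl.
  have h5 : s * (minn n (k.+1 * v))%:R <= s * (t%:R + v%:R).
    rewrite ler_wpM2l // -natrD ler_nat; apply: leq_trans (geq_minr _ _) _.
    by rewrite mulSn addnC leq_add2r.
  lra.
rewrite ler_norml; apply/andP; split; lra.
Qed.

Theorem line_lim (d : R) : 0 < d -> exists n0, forall n, (n0 <= n)%N ->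
  P w (fun x => ~ Ln e 0 0 n s (d * n%:R) x) <= d.
Proof.
move=> d0; have s0 : 0 <= s := slope_ge0 hp hq mu_le.
pose eta := d / 8; have eta0 : 0 < eta by rewrite divr_gt0.
have [m hm] := ex_nat_gt (2 * (s + eta) / eta); have {hm} hm := hm _ (leqnn m).
have [L hL] := ex_nat_gt ((s + 3 * eta) / eta); have {hL} hL := hL _ (leqnn L).
have m0 : 2 <= m%:R :> R.
  by apply: le_trans hm; rewrite -mulrA ler_peMr // ler_pdivlMr //; lra.
(* The number of events in the union bound: two for each grid pair and one for the end point.
   Neither [m] nor [L] depends on [n]. *)
pose M : R := (m.+1 * L)%:R * 2 + 1.
have M0 : 0 < M by rewrite /M ltr_wpDl // mulr_ge0.
pose d' := d / M; have d'0 : 0 < d' by rewrite divr_gt0.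
have [n1 h1] := low_lim_unif hp hq mu_le mu_sup eta0 d'0.
have e20 : 0 < eta / 2 by lra.
have [n2 h2] := up_lim hp hq mu_le mu_sup eta0 d'0.
have [n3 h3] := ex_nat_gt (1 / eta); have [n4 h4] := ex_nat_gt (m%:R * s / eta).
exists (maxn (maxn n1 n2) (maxn (maxn n3 n4) m)) => n; rewrite !geq_max => /andP[/andP[N1 N2] /andP[/andP[N3 N4] N5]].
have {}h3 : 1 <= eta * n%:R by have := h3 n N3; rewrite ler_pdivrMr // mulrC.
have mn : m%:R <= n%:R :> R by rewrite ler_nat.
have n0 : 0 < n%:R :> R by lra.
pose v := (n %/ m).+1; pose dd := (Num.truncn (eta * n%:R)).+1.
have mp : (0 < m)%N by rewrite -(ltr0n R); lra.
have nv : (n <= m * v)%N by rewrite mulnC ltnW // ltn_ceil.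
have vs : v%:R * s <= eta * n%:R.
  have v1 : v%:R * m%:R <= 2 * n%:R :> R.
    have : (n %/ m)%:R * m%:R <= n%:R :> R by rewrite -natrM ler_nat leq_divM.
    have : v%:R = (n %/ m)%:R + 1 :> R by rewrite natr1.
    by move=> ->; lra.
  have : v%:R * (2 * (s + eta)) <= v%:R * (eta * m%:R).
    by rewrite ler_wpM2l // -ler_pdivrMl // mulrC.
  have v0 : 0 <= v%:R * eta by rewrite mulr_ge0 // ltW.
  have : eta * (v%:R * m%:R) <= eta * (2 * n%:R) by rewrite ler_wpM2l // ltW.
  lra.
have en0 : 0 <= eta * n%:R by lra.
have dd1 : dd%:R <= eta * n%:R + 1 by rewrite /dd -natr1 lerD2r; case/andP: (truncn_itv en0).
have dd2 : eta * n%:R < dd%:R by exact: truncnS_gt.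
have Ldd : (s + 2 * eta) * n%:R < L%:R * dd%:R.
  have : (s + 3 * eta) * n%:R <= L%:R * (eta * n%:R).
    by rewrite mulrA ler_wpM2r ?(ltW n0) // -ler_pdivrMr.
  have : L%:R * (eta * n%:R) <= L%:R * dd%:R by rewrite ler_wpM2l // ltW.
  have : 0 < eta * n%:R by lra.
  lra.
pose I := [seq (k, l) | k <- iota 0 m.+1, l <- iota 0 L].
have fU : finP (reach e n (Num.floor ((s + 2 * eta) * n%:R))) by apply: reach_fin.
have fI : finP (fun x => exists2 kl, kl \in I & slow eta n v dd kl x).
  by apply: finP_bigU => kl _; apply: slow_fin.
apply: (@le_trans _ _ (P w (fun x => (exists2 kl, kl \in I & slow eta n v dd kl x) \/
    ~ reach e n (Num.floor ((s + 2 * eta) * n%:R)) x))).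
  apply: (P_sub hw); [by apply: finP_not; apply: Ln_fin|by apply: finP_or => //; apply: finP_not|move=> x nl].
  apply: contrapT => /not_orP[h5 /contrapT h6]; apply: nl.
  have -> : d * n%:R = 8 * eta * n%:R by rewrite /eta; field.
  apply: (@slow_line eta n m v dd L) => //.
  move=> k l km lL hs; apply: h5; exists (k, l) => //.
  by apply/allpairsP; exists (k, l); rewrite !mem_iota /= !add0n ltnS.
apply: le_trans (P_or hw fI (finP_not fU)) _.
have b1 : P w (fun x => ~ reach e n (Num.floor ((s + 2 * eta) * n%:R)) x) <= d'.
  rewrite P_not //; have := h2 n N2 (Num.floor ((s + 2 * eta) * n%:R)).
  have : (s + eta) * n%:R <= (Num.floor ((s + 2 * eta) * n%:R))%:~R.
    by have := floorD1_gt ((s + 2 * eta) * n%:R); rewrite intrD; lra.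
  by move=> h /(_ h); lra.
have b2 : P w (fun x => exists2 kl, kl \in I & slow eta n v dd kl x) <= (size I)%:R * (d' + d').
  apply: (P_bigU hw); first by move=> kl _; apply: slow_fin.
  move=> [k l] _; apply: le_trans (P_or hw _ _) _; [exact: reach_fin|exact: finP_shift (reach_fin _ _ _)|].
  have un : (minn n (k * v) <= n)%N by rewrite geq_minl.
  apply: lerD.
    by apply: (h1 n N1) => //=; apply: floor_le.
  rewrite (P_shift p q (l * dd)%N%:Z (minn n (k * v))%:Z (reach_fin e _ _)).
  by apply: (h1 n N1); [rewrite leq_subr|apply: floor_le].
have sI : size I = (m.+1 * L)%N by rewrite size_allpairs !size_iota.
apply: le_trans (lerD b2 b1) _; rewrite sI.
have : M * d' = d by rewrite /d' mulrC divfK // gt_eqF.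
rewrite /M; lra.
Qed.

End LineExists.

(** * Crossing and merging tracks *)

Section Crossing.

(** At the first time where the order is reversed the tracks cross inside one step, and
    [step_planar] lets them exchange their continuations there. *)
Lemma track_cross2 e x t0 t1 s0 s1 u v (g h : nat -> int) : track e x t0 t1 g -> track e x s0 s1 h ->
  (t0 <= u)%N -> (s0 <= u)%N -> (u < v)%N -> (v <= t1)%N -> (v <= s1)%N -> g u <= h u -> h v <= g v ->
  exists m, [/\ (u <= m < v)%N, track e x t0 s1 (splice m g h) & track e x s0 t1 (splice m h g)].
Proof.
move=> hg hh u0 u0' uv v1 v1' guh hgv.
have ex : exists k : nat, h (u + k)%N <= g (u + k)%N by exists (v - u)%N; rewrite subnKC // ltnW.
case: (ex_minnP ex) => k hk kmin.
have kv : (u + k <= v)%N.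
  have := kmin (v - u)%N; rewrite (subnKC (ltnW uv)) => /(_ hgv); lia.
case: k hk kmin kv => [|k] hk kmin kv.
  rewrite addn0 in hk; have gh : g u = h u by apply/le_anti/andP.
  exists u; rewrite leqnn uv; split=> //; apply: track_cat (track_sub _ _ _) (track_sub _ _ _) _; try eassumption; lia.
have gh : g (u + k)%N <= h (u + k)%N by rewrite leNgt; apply/negP => /ltW/kmin; lia.
have [k0 k1 k2] : [/\ (t0 <= u + k < t1)%N, (s0 <= u + k < s1)%N & (u + k.+1 = (u + k).+1)%N] by split; lia.
rewrite k2 in hk kv; have [p1 p2] := step_planar gh hk (hg _ k0) (hh _ k1).
exists (u + k)%N; split; first by lia.
  move=> t ht; rewrite /splice; have [tu|tu|->] := ltngtP t (u + k)%N; first by apply: hg; lia.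
    by apply: hh; lia.
  by [].
move=> t ht; rewrite /splice; have [tu|tu|->] := ltngtP t (u + k)%N; first by apply: hh; lia.
  by apply: hg; lia.
by [].
Qed.

(** A passage from [G] to [A] along an auxiliary track [H], which overtakes [G] between [u] and [v]
    and [A] between [u2] and [v2]. In the first alternative both happen in one window, [A] being to
    the right of [G] at [u]. *)
Lemma merge x a0 b0 a1 b1 w u v u2 v2 (G H A : nat -> int) :
  track true x a0 b0 G -> track true x u w H -> track true x a1 b1 A ->
  (a0 <= u < v)%N -> (v <= b0)%N -> (v <= v2 <= w)%N -> (a1 <= u2 < v2)%N -> (v2 <= b1)%N ->
  H u <= G u -> G v <= H v -> (u2 = u /\ G u <= A u) \/ ((v <= u2)%N /\ H u2 <= A u2) -> A v2 <= H v2 ->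
  exists G', [/\ track true x a0 b1 G', forall t, (v2 <= t)%N -> G' t = A t &
    forall t, [\/ (t < v)%N /\ G' t = G t, (u <= t < v2)%N /\ G' t = H t | (u2 <= t)%N /\ G' t = A t]].
Proof.
move=> hG hH hA /andP[i1 i2] i3 /andP[i4 i5] /andP[i6 i7] i8 c1 c2 c3 c4.
have vw : (v <= w)%N by apply: leq_trans i5.
have [m1 [/andP[m1u m1v] _ hS]] := track_cross2 hH hG (leqnn u) i1 i2 vw i3 c1 c2.
set S := splice m1 G H in hS.
have Sv2 : S v2 = H v2 by rewrite /S /splice ifF //; lia.
have au2 : (a0 <= u2)%N by case: c3 => -[]; lia.
have Su2 : S u2 <= A u2.
  by case: c3 => -[h1 h2]; rewrite /S /splice; [rewrite h1 m1u|rewrite ifF //; lia].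
rewrite -Sv2 in c4.
have [m2 [/andP[m2u m2v] hT _]] := track_cross2 hS hA au2 i6 i7 i5 i8 Su2 c4.
exists (splice m2 S A); split=> // t.
  by move=> vt; rewrite /splice ifF //; lia.
rewrite /splice; have [tm|tm] := leqP t m2; last by constructor 3; split=> //; lia.
rewrite /S /splice; have [tm1|tm1] := leqP t m1; first by constructor 1; split=> //; lia.
by constructor 2; split=> //; lia.
Qed.

End Crossing.

Lemma LnE (R : realType) e z t0 n (s r : R) x : Ln e z t0 n s r x <-> exists g, track e x t0 (t0 + n) g /\
  forall t, (t0 <= t <= t0 + n)%N -> `|(g t)%:~R - (z%:~R + s * (t%:R - t0%:R))| <= r.
Proof.
split=> -[g [g1 g2]]; exists g; split=> // t.
  by move=> /andP[t1 t2]; have := g2 (t - t0)%N; rewrite subnKC // natrB // leq_subLR; apply.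
by move=> tn; have := g2 (t0 + t)%N; rewrite leq_addr leq_add2l natrD addrAC subrr add0r; apply.
Qed.

(** * One step of the bypass construction *)

Section Staircase.
Context {R : realType}.
Variables (s sigma r gam : R) (h theta m : nat) (D J : int).
Hypotheses (s0 : 0 <= s) (sigma2 : sigma <= 2) (gam0 : 0 < gam) (hgam : gam <= sigma - s) (r1 : 1 <= r)
  (rh : 24 * r <= gam * h%:R) (D1 : s * h%:R + 2 * r <= D%:~R) (D2 : D%:~R <= s * h%:R + 3 * r)
  (J1 : s * h%:R + 2 * sigma * h%:R <= 3 * D%:~R + J%:~R)
  (J2 : 3 * D%:~R + J%:~R <= s * h%:R + 2 * sigma * h%:R + 1)
  (thr : 8 * r <= gam * theta%:R) (mh : (m * theta <= h)%N).
Implicit Types (x : coord -> bool) (c : int) (j k l v : nat).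

(** Consecutive pieces share a time interval of length [h], in which their axes are between [2 * r]
    and [3 * r] apart by the choice of [D]: the next piece lies to the right. *)
Definition piece c j := Ln true (c + j%:Z * D) (j * h) (2 * h) s r.
(** It starts [5 * r] to the left of the axis of piece [j], hence to the left of piece [j - 1], and
    gains at least [8 * r] on the pieces over [theta], which brings it to the right of piece [j].
    The index [v] runs over disjoint time windows. *)
Definition short c j v := Ln false (c + j%:Z * D + Num.floor (s * (v * theta)%:R - 5 * r)) (j * h + v * theta) theta sigma r.
(** It leaves piece [k] in its second half and bypasses the next two pieces. At time [(k + 3) * h]
    it is near the start of piece [k + 3] of the family shifted by [J]; this defines [J]. *)
Definition long c k := Ln false (c + k%:Z * D + Num.floor (s * h%:R - r - gam / 8 * h%:R)) (k.+1 * h) (3 * h) sigma (gam / 8 * h%:R).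

Definition tail (K : R) (a0 l : nat) c x := exists g, [/\ track true x a0 (l.+2 * h) g,
  forall t, (a0 <= t <= l.+2 * h)%N -> `|(g t)%:~R - D%:~R / h%:R * t%:R| <= K &
  forall t, (l.+1 * h <= t <= l.+2 * h)%N -> `|(g t)%:~R - ((c + l%:Z * D)%:~R + s * (t%:R - (l * h)%:R))| <= r].

Let h0 : 0 < h%:R :> R.
Proof.
have : 0 < gam * h%:R by move: rh r1; lra.
by rewrite pmulr_rgt0. Qed.

Let gam2 : gam * h%:R <= 2 * h%:R.
Proof. by apply: ler_wpM2r; [exact: ltW|move: s0 sigma2 hgam; lra]. Qed.
Let sh2 : 0 <= s * h%:R <= 2 * h%:R.
Proof.
rewrite mulr_ge0 ?(ltW h0) //=; apply: ler_wpM2r; [exact: ltW|move: gam0 sigma2 hgam; lra].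
Qed.

Let slope3 : 0 <= (D%:~R / h%:R : R) <= 3.
Proof.
have /andP[a b] := sh2; have c := gam2.
by rewrite ler_pdivlMr // ler_pdivrMr // mul0r; apply/andP; split; move: r1 rh D1 D2; lra.
Qed.

Lemma sigma_le (u t n : nat) : (u <= t <= u + n)%N -> 0 <= sigma * (t%:R - u%:R) <= 2 * n%:R.
Proof.
move=> /andP[ut tn]; have k4 : 0 <= t%:R - u%:R :> R by rewrite subr_ge0 ler_nat.
have k5 : t%:R - u%:R <= n%:R :> R by rewrite lerBlDl -natrD ler_nat.
have k6 : 0 <= sigma by move: s0 gam0 hgam; lra.
by rewrite mulr_ge0 //=; apply: ler_pM.
Qed.

Lemma axis_le c l (y : int) (t d : nat) (a K : R) : `|c%:~R| + a + 3 * d%:R * h%:R <= K -> (l * h <= t <= (l + d) * h)%N ->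
  `|y%:~R - (c + l%:Z * D)%:~R| <= a -> `|y%:~R - D%:~R / h%:R * t%:R| <= K.
Proof.
move=> hK /andP[t1 t2] ya; have /andP[S0 S3] := slope3.
have E : D%:~R / h%:R * t%:R - l%:R * D%:~R = D%:~R / h%:R * (t%:R - l%:R * h%:R) :> R.
  by field; rewrite gt_eqF.
have T0 : 0 <= t%:R - l%:R * h%:R :> R by rewrite subr_ge0 -natrM ler_nat.
have T1 : t%:R - l%:R * h%:R <= d%:R * h%:R :> R by rewrite lerBlDl -mulrDl -natrD -natrM ler_nat.
have B : `|l%:R * D%:~R - D%:~R / h%:R * t%:R| <= 3 * d%:R * h%:R :> R.
  rewrite distrC E ger0_norm; last exact: mulr_ge0.
  by rewrite -[leRHS]mulrA; apply: ler_pM.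
have -> : y%:~R - D%:~R / h%:R * t%:R = (y%:~R - (c + l%:Z * D)%:~R) + (c%:~R + (l%:R * D%:~R - D%:~R / h%:R * t%:R)) :> R.
  rewrite intrD intrM -[l%:~R]/(l%:R : R); ring.
apply: le_trans (ler_normD _ _) _; apply: le_trans (lerD ya (ler_normD _ _)) _; lra.
Qed.

Lemma piece_off (y C : R) a t : (a * h <= t <= a.+2 * h)%N -> `|y - (C + s * (t%:R - (a * h)%:R))| <= r ->
  `|y - C| <= 5 * h%:R.
Proof.
move=> ht; have e2 : (a * h + 2 * h = a.+2 * h)%N by rewrite -mulnDl addn2.
rewrite !ler_norml => /andP[b1 b2].
have st : 0 <= s * (t%:R - (a * h)%:R) <= 4 * h%:R.
  have t0 : 0 <= t%:R - (a * h)%:R :> R by rewrite subr_ge0 ler_nat; case/andP: ht.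
  have t2 : t%:R - (a * h)%:R <= 2 * h%:R :> R.
    by rewrite lerBlDl -natrM -natrD ler_nat e2; case/andP: ht.
  rewrite mulr_ge0 //=; apply: (@le_trans _ _ (2 * (2 * h%:R))); last by lra.
  by apply: ler_pM => //; move: s0 sigma2 gam0 hgam; lra.
have g2h := gam2.
move: st => /andP[st1 st2]; apply/andP; split; move: r1 rh; lra.
Qed.

Lemma tail_base c a K x : `|c%:~R| + 11 * h%:R <= K -> piece c a x -> tail K (a * h) a c x.
Proof.
move=> hK /LnE[g [g1 g2]]; have e2 : (a * h + 2 * h = a.+2 * h)%N by rewrite -mulnDl addn2.
rewrite e2 in g1 g2; exists g; split=> // t ht; last first.
  by apply: g2; case/andP: ht => h1 ->; rewrite (leq_trans _ h1) // leq_mul2r leqnSn orbT.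
apply: (@axis_le c a (g t) t 2 (5 * h%:R)); [lra|by rewrite addn2|].
exact: piece_off ht (g2 t ht).
Qed.

(** Both overtakings occur in the window of length [theta] of the short line, so the first
    alternative of [merge] applies. *)
Lemma tail_short K a0 l c v x : `|c%:~R| + 24 * h%:R <= K -> (a0 <= l.+1 * h)%N -> (v < m)%N ->
  tail K a0 l c x -> piece c l.+1 x -> short c l.+1 v x -> tail K a0 l.+1 c x.
Proof.
move=> hK a0l vm [G [G1 G2 G3]] hp /LnE[H [/track_on H1 H2]].
move: hp => /LnE[A [A1 A2]].
set u := (l.+1 * h + v * theta)%N in H1 H2.
have vth : (v * theta + theta <= h)%N by apply: leq_trans mh; rewrite addnC -mulSn leq_mul2r vm orbT.
have th0 : (0 < theta)%N.
  have : 0 < gam * theta%:R by move: thr r1; lra.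
  by rewrite pmulr_rgt0 // ltr0n.
have e2 : (l.+2 * h = l.+1 * h + h)%N by rewrite mulSn addnC.
have e3 : (l.+1 * h + 2 * h = l.+3 * h)%N by rewrite -mulnDl addn2.
have e4 : (l.+3 * h = l.+1 * h + h + h)%N by rewrite mulSn e2 addnC.
rewrite e3 in A1 A2.
have f1 := floor_le (s * (v * theta)%:R - 5 * r); have f2 := floorD1_gt (s * (v * theta)%:R - 5 * r).
move: H2; rewrite intrD in f2 *; set fl := (Num.floor _)%:~R in f1 f2 * => H2.
have lD : (c + l.+1%:Z * D)%:~R = (c + l%:Z * D)%:~R + D%:~R :> R by rewrite -intrD; congr (_%:~R); rewrite -addn1 PoszD; ring.
have lh : (l.+1 * h)%:R = (l * h)%:R + h%:R :> R by rewrite mulSn natrD addrC.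
have uR : u%:R - (l.+1 * h)%:R = (v * theta)%:R :> R by rewrite /u natrD; ring.
have uv : (u + theta)%:R = u%:R + theta%:R :> R by rewrite natrD.
have [y1 y2 y3 y4] : [/\ (l.+1 * h <= u)%N, (u <= u + theta)%N, (u + theta <= l.+2 * h)%N & (u < u + theta)%N].
  by split; [exact: leq_addr|exact: leq_addr|rewrite e2 -addnA leq_add2l|rewrite -addn1 leq_add2l].
have y5 : (l.+2 * h <= l.+3 * h)%N by rewrite leq_mul2r leqnSn orbT.
have z1 : (l.+1 * h <= u <= l.+2 * h)%N by rewrite y1 (leq_trans y2 y3).
have z2 : (l.+1 * h <= u + theta <= l.+2 * h)%N by rewrite y3 (leq_trans y1 y2).
have z3 : (l.+1 * h <= u <= l.+3 * h)%N by case/andP: z1 => -> /leq_trans; apply.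
have z4 : (l.+1 * h <= u + theta <= l.+3 * h)%N by case/andP: z2 => -> /leq_trans; apply.
have Gu := G3 u z1; have Gv := G3 (u + theta)%N z2; have Au := A2 u z3; have Av := A2 (u + theta)%N z4.
have Hu := H2 u; have Hv := H2 (u + theta)%N; rewrite leqnn y2 in Hu; rewrite y2 leqnn in Hv.
move: (Hu isT) (Hv isT) Gu Gv Au Av => {Hu Hv}; rewrite uv !ler_norml => /andP[Hu1 Hu2] /andP[Hv1 Hv2].
move=> /andP[Gu1 Gu2] /andP[Gv1 Gv2] /andP[Au1 Au2] /andP[Av1 Av2].
have gt : gam * theta%:R <= (sigma - s) * theta%:R by apply: ler_wpM2r.
have sE : s * (u%:R - (l.+1 * h)%:R) = s * (v * theta)%:R by rewrite uR.
have [|||||||||G' [T1 T2 T3]] := @merge x a0 (l.+2 * h) (l.+1 * h) (l.+3 * h) (u + theta) u (u + theta) u (u + theta) G H A G1 H1 (track_on A1).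
- by rewrite (leq_trans a0l y1).
- by [].
- by rewrite leqnn.
- by rewrite y1.
- by case/andP: z4.
- by rewrite -(ler_int R); clear -D2 Hu2 f1 Gu1 lD sE s0 sigma2 gam0 hgam r1 rh D1 D2 J1 J2 thr mh h0 gam2 sh2 slope3; move: D2; lra.
- by rewrite -(ler_int R); clear -D1 r1 thr gt Hv1 f2 Gv2 lD sE uv s0 sigma2 gam0 hgam r1 rh D1 D2 J1 J2 thr mh h0 gam2 sh2 slope3; move: D1 r1 thr; lra.
- by left; split=> //; rewrite -(ler_int R); clear -D1 Gu2 Au1 lD sE s0 sigma2 gam0 hgam r1 rh D1 D2 J1 J2 thr mh h0 gam2 sh2 slope3; move: D1; lra.
- by rewrite -(ler_int R); clear -r1 thr gt Hv1 f2 Av2 sE uv s0 sigma2 gam0 hgam r1 rh D1 D2 J1 J2 thr mh h0 gam2 sh2 slope3; move: r1 thr; lra.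
exists G'; split=> // t ht; last first.
  rewrite T2; last by apply: leq_trans y3 _; case/andP: ht.
  by apply: A2; case/andP: ht => h1 ->; rewrite (leq_trans _ h1) // leq_mul2r leqnSn orbT.
case/andP: ht => h1 h2; case: (T3 t) => -[q1 ->].
- by apply: G2; rewrite h1 (leq_trans (ltnW q1) y3).
- case/andP: q1 => q1 q2; apply: (@axis_le c l.+1 (H t) t 1 (5 * h%:R)); first by clear -hK s0 sigma2 gam0 hgam r1 rh D1 D2 J1 J2 thr mh h0 gam2 sh2 slope3; move: h0; lra.
    by rewrite (leq_trans y1 q1) addn1 (leq_trans (ltnW q2) y3).
  have := H2 t; rewrite q1 ltnW // => /(_ isT); rewrite !ler_norml => /andP[k1 k2].
  have k3 : 0 <= sigma * (t%:R - u%:R) <= 2 * h%:R.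
    apply: sigma_le; rewrite q1 /= ltnW // (leq_trans q2) // leq_add2l (leq_trans _ vth) //; exact: leq_addl.
  have k7 : 0 <= s * (v * theta)%:R <= 2 * h%:R.
    rewrite mulr_ge0 //=; apply: ler_pM => //; first by clear -s0 sigma2 gam0 hgam r1 rh D1 D2 J1 J2 thr mh h0 gam2 sh2 slope3; move: sigma2 gam0 hgam; lra.
    by rewrite ler_nat (leq_trans _ vth) ?leq_addr.
  case/andP: k3 => k31 k32; case/andP: k7 => k71 k72; have g2 := gam2.
  clear -k1 k2 k31 k32 k71 k72 f1 f2 g2 s0 sigma2 gam0 hgam r1 rh D1 D2 J1 J2 thr mh h0 gam2 sh2 slope3.
  by apply/andP; split; move: r1 rh; lra.
have ht : (l.+1 * h <= t <= l.+3 * h)%N by rewrite h2 (leq_trans y1 q1).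
apply: (@axis_le c l.+1 (A t) t 2 (5 * h%:R)); [by clear -hK s0 sigma2 gam0 hgam r1 rh D1 D2 J1 J2 thr mh h0 gam2 sh2 slope3; move: h0; lra|by rewrite addn2|].
exact: piece_off ht (A2 t ht).
Qed.

(** The bypass overtakes the old piece between times [(k + 1) * h] and [(k + 2) * h], and the new
    one between [(k + 3) * h] and [(k + 4) * h]. *)
Lemma tail_long K a0 k c x : `|c%:~R| + `|(c + J)%:~R| + 40 * h%:R <= K -> (a0 <= k.+1 * h)%N ->
  tail K a0 k c x -> piece (c + J) k.+3 x -> long c k x -> tail K a0 k.+3 (c + J) x.
Proof.
move=> hK a0l [G [G1 G2 G3]] /LnE[A [A1 A2]] /LnE[H [/track_on H1 H2]].
have e2 : (k.+2 * h = k.+1 * h + h)%N by rewrite mulSn addnC.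
have e3 : (k.+1 * h + 3 * h = k.+4 * h)%N by rewrite -mulnDl addn3.
have e4 : (k.+3 * h + 2 * h = k.+3.+2 * h)%N by rewrite -mulnDl addn2.
rewrite e4 in A1 A2.
have f1 := floor_le (s * h%:R - r - gam / 8 * h%:R); have f2 := floorD1_gt (s * h%:R - r - gam / 8 * h%:R).
move: H2; rewrite intrD in f2 *; set fl := (Num.floor _)%:~R in f1 f2 * => H2.
rewrite e3 in H1 H2.
have hp : (0 < h)%N by rewrite -(ltr0n R); exact: h0.
have lD : (c + J + k.+3%:Z * D)%:~R = (c + k%:Z * D)%:~R + (3 * D%:~R + J%:~R) :> R.
  rewrite (_ : c + J + k.+3%:Z * D = c + k%:Z * D + (3 * D + J)); first by rewrite [LHS]intrD; congr (_ + _); rewrite intrD intrM.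
  by rewrite -addn3 PoszD; ring.
have m1 i j : (i <= j)%N -> (i * h <= j * h)%N by move=> ij; rewrite leq_mul2r ij orbT.
have m2 i j : (i < j)%N -> (i * h < j * h)%N by move=> ij; rewrite ltn_mul2r hp ij.
have rR i : (i.+1 * h)%:R = (i * h)%:R + h%:R :> R by rewrite mulSn natrD addrC.
have Gu := G3 (k.+1 * h)%N; have Gv := G3 (k.+2 * h)%N; have Hu := H2 (k.+1 * h)%N; have Hv := H2 (k.+2 * h)%N.
have Hu2 := H2 (k.+3 * h)%N; have Hv2 := H2 (k.+4 * h)%N; have Au := A2 (k.+3 * h)%N; have Av := A2 (k.+4 * h)%N.
have [m3 m4] : (k.+1 <= k.+3)%N /\ (k.+1 <= k.+4)%N by clear; split; lia.
have [m5 m6] : (k.+2 <= k.+4)%N /\ (k.+3 <= k.+3.+2)%N by clear; split; lia.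
rewrite !m1 // in Gu Gv Hu Hv Hu2 Hv2 Au Av.
move: (Gu isT) (Gv isT) (Hu isT) (Hv isT) (Hu2 isT) (Hv2 isT) (Au isT) (Av isT) => {Gu Gv Hu Hv Hu2 Hv2 Au Av}.
rewrite !rR !ler_norml lD.
move=> /andP[Gu1 Gu2] /andP[Gv1 Gv2] /andP[Hu1 Hu2] /andP[Hv1 Hv2] /andP[Hw1 Hw2] /andP[Hx1 Hx2] /andP[Au1 Au2] /andP[Av1 Av2].
have gt : gam * h%:R <= (sigma - s) * h%:R by apply: ler_wpM2r => //; exact: ltW.
have [|||||||||G' [T1 T2 T3]] := @merge x a0 (k.+2 * h) (k.+3 * h) (k.+3.+2 * h) (k.+4 * h) (k.+1 * h) (k.+2 * h) (k.+3 * h) (k.+4 * h) G H A G1 H1 (track_on A1).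
- by rewrite a0l m2.
- by [].
- rewrite leqnn andbT; apply: m1; exact: leqW (leqnSn _).
- by rewrite leqnn m2.
- by rewrite m1.
- by rewrite -(ler_int R); clear -Hu2 f1 Gu1 s0 sigma2 gam0 hgam r1 rh D1 D2 J1 J2 thr mh h0 gam2 sh2 slope3; move: r1; lra.
- by rewrite -(ler_int R); clear -r1 rh gt Hv1 f2 Gv2 s0 sigma2 gam0 hgam r1 rh D1 D2 J1 J2 thr mh h0 gam2 sh2 slope3; move: r1 rh; lra.
- by right; split; [rewrite m1|rewrite -(ler_int R); clear -J1 Hw2 f1 Au1 s0 sigma2 gam0 hgam r1 rh D1 D2 J1 J2 thr mh h0 gam2 sh2 slope3; move: J1; lra].
- by rewrite -(ler_int R); clear -J2 r1 rh gt Hx1 f2 Av2 s0 sigma2 gam0 hgam r1 rh D1 D2 J1 J2 thr mh h0 gam2 sh2 slope3; move: J2 r1 rh; lra.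
exists G'; split=> // t ht; last first.
  by rewrite T2; [apply: A2|]; case/andP: ht => i1 i2 //; rewrite i2 (leq_trans _ i1) // m1.
case/andP: ht => h1 h2; case: (T3 t) => -[q1 ->].
- by apply: G2; rewrite h1 ltnW.
- case/andP: q1 => q1 q2; apply: (@axis_le c k (H t) t 4 (10 * h%:R)).
  + clear -hK s0 sigma2 gam0 hgam r1 rh D1 D2 J1 J2 thr mh h0 gam2 sh2 slope3; have := normr_ge0 ((c + J)%:~R : R); move: h0; lra.
  + by rewrite (leq_trans _ q1) ?m1 // addn4 ltnW.
  have := H2 t; rewrite q1 ltnW // => /(_ isT); rewrite !ler_norml => /andP[k1 k2].
  have k3 : 0 <= sigma * (t%:R - (k.+1 * h)%:R) <= 2 * (3 * h)%:R.
    by apply: sigma_le; rewrite q1 /= e3 ltnW.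
  rewrite natrM in k3; case/andP: k3 => k31 k32; have g2 := gam2; have /andP[sh0 sh3] := sh2.
  rewrite rR in k31 k32 k1 k2.
  clear -k1 k2 k31 k32 sh0 sh3 f1 f2 g2 s0 sigma2 gam0 hgam r1 rh D1 D2 J1 J2 thr mh h0 gam2 sh2 slope3.
  by apply/andP; split; move: r1 rh; lra.
have ht : (k.+3 * h <= t <= k.+3.+2 * h)%N by rewrite h2 q1.
apply: (@axis_le (c + J) k.+3 (A t) t 2 (5 * h%:R)).
- by clear -hK s0 sigma2 gam0 hgam r1 rh D1 D2 J1 J2 thr mh h0 gam2 sh2 slope3; have := normr_ge0 (c%:~R : R); move: h0; lra.
- by rewrite addn2.
exact: piece_off ht (A2 t ht).
Qed.

Lemma tail_chain K a0 l n c x : `|c%:~R| + 24 * h%:R <= K -> (a0 <= l.+1 * h)%N -> tail K a0 l c x ->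
  (forall j, (l < j <= l + n)%N -> piece c j x /\ exists2 v, v \in iota 0 m & short c j v x) -> tail K a0 (l + n) c x.
Proof.
move=> hK al hT; elim: n => [|n IH] H; first by rewrite addn0.
have [|hp [v]] := H (l + n).+1; first by rewrite ltnS leq_addr addnS leqnn.
rewrite mem_iota add0n => /andP[_ vm] hs; rewrite addnS; apply: (tail_short hK _ vm _ hp hs).
  by apply: leq_trans al _; rewrite leq_mul2r ltnS leq_addr orbT.
by apply: IH => j /andP[j1 j2]; apply: H; rewrite j1 addnS leqW.
Qed.

Lemma tail_Ln K a0 l c n x : (a0 <= 3 * h)%N -> (n + 3 <= l.+2)%N -> tail K a0 l c x ->
  Ln true (3 * D) (3 * h) (n * h) (D%:~R / h%:R) K x.
Proof.
move=> ah nl [g [g1 g2 _]]; have nh : (3 * h + n * h <= l.+2 * h)%N by rewrite -mulnDl leq_mul2r addnC nl orbT.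
apply/LnE; exists g; split; first exact: track_sub g1 _ _.
move=> t /andP[t1 t2]; have := g2 t; rewrite (leq_trans ah t1) (leq_trans t2 nh) => /(_ isT).
by congr (`|_ - _| <= _); rewrite intrM natrM; field; rewrite gt_eqF.
Qed.

Variables (t N : nat).
Hypotheses (t0 : (0 < t)%N).
(** The first component numbers [t] parallel families at distance [h], whose bypasses are
    independent; the second tells whether the bypass has been taken. *)
Definition center (ib : nat * bool) : int := (ib.1 * h)%N%:Z + (if ib.2 then J else 0).
Definition ibs : seq (nat * bool) := [seq (i, b) | i <- iota 0 t, b <- [:: false; true]].
Definition bad j x := exists2 ib, ib \in ibs & ~ piece (center ib) j x.
Definition junction ib j x := exists2 v, v \in iota 0 m & short (center ib) j v x.
Definition bridge k x := exists2 i, i \in iota 0 t & long (i * h)%N k x.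

Let J5 : `|J%:~R| <= 5 * h%:R :> R.
Proof.
have /andP[a b] := sh2; have c := gam2; have h0' := h0.
have e1 : 0 <= sigma * h%:R by apply: mulr_ge0; [move: s0 gam0 hgam; lra|exact: ltW].
have e2 : sigma * h%:R <= 2 * h%:R by apply: ler_wpM2r; [exact: ltW|].
by rewrite ler_norml; apply/andP; split; move: r1 rh D1 D2 J1 J2; lra.
Qed.

(** The family to follow is the one whose bypass exists at the bad place; as this is not known
    beforehand, an index is declared bad as soon as one piece of any family fails there. Before the
    bad indices the unshifted family is followed, after them the shifted one. *)
Lemma staircase_line x : (forall j j', (j' < N)%N -> (j.+2 <= j')%N -> ~ (bad j x /\ bad j' x)) ->
  (forall ib j, ib \in ibs -> (0 < j < N)%N -> junction ib j x) ->
  (forall k, (k < N)%N -> bridge k x) -> (6 < N)%N ->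
  Ln true (3 * D) (3 * h) ((N - 6) * h) (D%:~R / h%:R) ((2 * t + 45)%:R * h%:R : R) x.
Proof.
move=> h1 h2 h3 N6; set K : R := _ * h%:R; have h0' := h0.
have KE : K = 2 * t%:R * h%:R + 45 * h%:R by rewrite /K natrD natrM; ring.
have th0 : 0 <= t%:R * h%:R :> R by rewrite mulr_ge0 // ltW.
have K0 i : (i < t)%N -> `|(i * h)%N%:~R| <= t%:R * h%:R :> R.
  by move=> it; rewrite ger0_norm ?ler0z // -[_%:~R]/((i * h)%:R : R) -natrM ler_nat leq_mul2r ltnW ?orbT.
have ib_in i b : (i < t)%N -> (i, b) \in ibs.
  by move=> it; apply/allpairsP; exists (i, b); rewrite mem_iota it /=; case: b; rewrite !inE.
have good j ib : ~ bad j x -> ib \in ibs -> piece (center ib) j x.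
  by move=> nb hib; apply: contrapT => np; apply: nb; exists ib.
have c0 : center (0, false) = 0 by rewrite /center /= mul0n.
have chain a l n ib : ib \in ibs -> `|(center ib)%:~R| + 24 * h%:R <= K -> (a <= l.+1 * h)%N -> (l + n < N)%N -> tail K a l (center ib) x ->
    (forall j, (l < j <= l + n)%N -> ~ bad j x) -> tail K a (l + n) (center ib) x.
  move=> hib hK al lN hT hb; apply: tail_chain => // j jl; split; first by apply: good => //; apply: hb.
  by apply: h2 => //; clear -jl lN; lia.
(* [k] is the first bad index, or [N] if there is none; then only [k] and [k + 1] can be bad, and a
   bypass jumps over two pieces. *)
have [k [k1 k2 k3]] : exists k, [/\ (k <= N)%N, forall j, (j < k)%N -> ~ bad j x & forall j, (k.+2 <= j < N)%N -> ~ bad j x].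
  have [[j [jN hj]]|nb] := pselect (exists j, (j < N)%N /\ bad j x); last first.
    by exists N; split=> // j jN hj; [|clear -jN; lia]; apply: nb; exists j.
  have ex : exists j, `[< bad j x >] by exists j; apply/asboolP.
  case: (ex_minnP ex) => k /asboolP hk kmin; exists k; split.
  - by apply: leq_trans (kmin j _) (ltnW jN); apply/asboolP.
  - by move=> i ik /asboolP /kmin; rewrite leqNgt ik.
  - by move=> i /andP[ki iN] hi; apply: (h1 k i iN ki).
have cz : `|(center (0, false))%:~R| + 24 * h%:R <= K by rewrite c0 normr0 add0r KE; lra.
have NE : ((N - 6) + 6 = N)%N by rewrite subnK // ltnW.
have [k0|kpos] := posnP k.
  apply: (@tail_Ln K (2 * h) (2 + (N - 3)) (center (0, false))).
  - by rewrite leq_mul2r orbT.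
  - by clear -NE; lia.
  apply: chain; [exact: ib_in|exact: cz|by rewrite leq_mul2r orbT|by clear -N6; lia| |].
    apply: tail_base; first by rewrite c0 normr0 add0r KE; lra.
    by apply: good; [apply: k3; rewrite k0; clear -N6; lia|exact: ib_in].
  by move=> j hj; apply: k3; rewrite k0; clear -hj N6; lia.
have base i : (i < t)%N -> tail K (0 * h) (0 + (k - 1)) (center (i, false)) x.
  move=> it; have ci : `|(center (i, false))%:~R| <= t%:R * h%:R :> R by rewrite /center /= addr0; apply: K0.
  apply: chain; [exact: ib_in|by rewrite KE; lra|by []|by clear -kpos k1; lia| |].
    by apply: tail_base; [rewrite KE; lra|apply: good; [exact: k2|exact: ib_in]].
  by move=> j hj; apply: k2; clear -hj kpos; lia.
have [kN|kN] := leqP (N - 2) k.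
  by apply: tail_Ln (base 0%N t0); [rewrite mul0n|clear -kN N6; lia].
have k1N : (k.-1 < N)%N by clear -kN N6; lia.
have [i it hl] := h3 k.-1 k1N; rewrite mem_iota add0n in it; case/andP: it => _ it.
have ci : `|(center (i, false))%:~R| <= t%:R * h%:R :> R by rewrite /center /= addr0; apply: K0.
have cj : `|(center (i, true))%:~R| <= t%:R * h%:R + 5 * h%:R :> R.
  by rewrite /center /= intrD; apply: le_trans (ler_normD _ _) (lerD _ J5); apply: K0.
have cE : center (i, true) = center (i, false) + J by rewrite /center /= addr0.
have kE : (k.-1.+3 = k.+2)%N by rewrite prednK.
have T : tail K (0 * h) k.+2 (center (i, true)) x.
  rewrite cE -kE; apply: tail_long.
  - by rewrite -cE KE; lra.
  - by [].
  - by have := base i it; rewrite add0n subn1.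
  - by rewrite -cE kE; apply: good; [apply: k3; clear -kN; lia|exact: ib_in].
  - by rewrite /center /= addr0.
have NE2 : (k.+2 + (N - k.+3) = N.-1)%N by clear -kN N6; lia.
apply: (@tail_Ln K (0 * h) (k.+2 + (N - k.+3)) (center (i, true))); [by []|by clear -NE2 NE; lia|].
apply: chain; [exact: ib_in|by rewrite KE; lra|by []|by clear -kN N6; lia|exact: T|].
by move=> j hj; apply: k3; clear -hj kN; lia.
Qed.

Variables (p q f : R).
Hypotheses (hp : 0 <= p <= 1) (hq : 0 <= q <= 1).
Notation w := (hom p q).
Let hw : prob_weight w := hom_prob hp hq.
Hypotheses (pf : P w (fun x => ~ Ln true 0 0 (2 * h) s r x) <= f)
  (ps : P w (fun x => ~ Ln false 0 0 theta sigma r x) <= 1 / 2)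
  (pl : P w (fun x => ~ Ln false 0 0 (3 * h) sigma (gam / 8 * h%:R) x) <= 1 / 2).

Let P_nLn e z a n (s' r' : R) : P w (fun x => ~ Ln e z a n s' r' x) = P w (fun x => ~ Ln e 0 0 n s' r' x).
Proof. by rewrite !P_not ?P_Ln //; apply: Ln_fin. Qed.

Let fin_np c j : finP (fun x => ~ piece c j x). Proof. by apply: finP_not; apply: Ln_fin. Qed.
Let bad_fin j : finP (bad j). Proof. by apply: finP_bigU => ib _; apply: fin_np. Qed.

Let size_ibs : size ibs = (t * 2)%N. Proof. by rewrite size_allpairs size_iota. Qed.

Let bad_le j : P w (bad j) <= (t * 2)%:R * f.
Proof.
rewrite -size_ibs; apply: (P_bigU hw) => ib _; first exact: fin_np.
by rewrite P_nLn.
Qed.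

Let bad_dep j : depP (bad j) (slab (j * h) (j.+2 * h)).
Proof.
move=> x y xy [ib hib np]; exists ib => // hp'; apply: np.
apply: (Ln_slab (t0 := j * h) (n := 2 * h)) hp' => i hi; rewrite xy //.
by move: hi; rewrite -mulnDl addn2.
Qed.

Let pair_le j j' : P w (fun x => (j.+2 <= j')%N /\ (bad j x /\ bad j' x)) <= ((t * 2)%:R * f) ^+ 2.
Proof.
have [jj|jj] := leqP j.+2 j'; last first.
  rewrite (_ : P w _ = 0) ?sqr_ge0 // -(E_cst w 0); apply: E_eq => x; by rewrite ind_f // => -[].
rewrite (P_eq w (B := fun x => bad j x /\ bad j' x)); last by move=> x; split=> [[_]|].
rewrite (P_indep w (bad_fin _) (bad_fin _) (@bad_dep j) (@bad_dep j')).
  by rewrite expr2; apply: ler_pM => //; exact: P_ge0.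
have : (j.+2 * h <= j' * h)%N by rewrite leq_mul2r jj orbT.
by move=> le [v|u] /=; clear -le; lia.
Qed.

Let short_le c j : P w (fun x => forall v, v \in iota 0 m -> ~ short c j v x) <= (1 / 2) ^+ m.
Proof.
rewrite -[in leRHS](size_iota 0 m); apply: (P_all_indep hw (A := fun v x => ~ short c j v x)
  (D := fun v => slab (j * h + v * theta) (j * h + v * theta + theta))).
- exact: iota_uniq.
- by move=> v _; apply: finP_not; apply: Ln_fin.
- by move=> v _; apply: depP_not; apply: Ln_slab.
- move=> v v' i _ _ vv; have : (v.+1 * theta <= v' * theta)%N \/ (v'.+1 * theta <= v * theta)%N.
    by have [e|e|//] := ltngtP v v'; [left|right]; rewrite leq_mul2r e orbT.
  by case: i => [u|u] /= h1; rewrite !mulSn in h1; clear -h1; lia.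
- lra.
- by move=> v _; rewrite P_nLn.
Qed.

Let long_le k : P w (fun x => forall i, i \in iota 0 t -> ~ long (i * h)%N k x) <= (1 / 2) ^+ t.
Proof.
have /andP[a b] := sh2; have c := gam2; have h0' := h0.
rewrite -[in leRHS](size_iota 0 t); set z := Num.floor (s * h%:R - r - gam / 8 * h%:R).
apply: (P_all_indep hw (A := fun i x => ~ long (i * h)%N k x)
  (D := fun i : nat => lnzone false ((i * h)%N%:Z + k%:Z * D + z) (k.+1 * h) (3 * h) sigma (gam / 8 * h%:R))).
- exact: iota_uniq.
- by move=> v _; apply: finP_not; apply: Ln_fin.
- by move=> v _; apply: depP_not; apply: Ln_dep.
- have sg : 0 <= sigma <= 2 by apply/andP; split; move: s0 gam0 hgam sigma2; lra.
  have h12 : 12 <= h%:R :> R by move: r1 rh; lra.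
  have key (i j : nat) (y : R) (u : nat) : (i < j)%N ->
     y <= ((i * h)%N%:Z + k%:Z * D + z)%:~R + sigma * u.+1%:R + gam / 8 * h%:R ->
     ((j * h)%N%:Z + k%:Z * D + z)%:~R + sigma * u%:R - gam / 8 * h%:R <= y -> False.
    move=> ij; rewrite !intrD -[(i * h)%N%:~R]/((i * h)%:R : R) -[(j * h)%N%:~R]/((j * h)%:R : R).
    have : (i * h)%:R + h%:R <= (j * h)%:R :> R by rewrite -natrD ler_nat addnC -mulSn leq_mul2r ij orbT.
    rewrite -natr1; case/andP: sg => sg0 sg2; move: c h12 sg2; lra.
  move=> i j [v|u] _ _ ij /=; last by case.
  move=> [u [u1 u2 /andP[u3 u4]]] [u' [v1 v2 /andP[v3 v4]]].
  have e : u = u' by clear -u2 v2; lia.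
  rewrite -e in v3 v4; have [ij'|ij'|//] := ltngtP i j; first exact: key ij' u4 v3.
  exact: key ij' v4 u3.
- lra.
- by move=> v _; rewrite P_nLn.
Qed.

(** Indices at distance 2 or more read disjoint slabs, long edges included, so two bad ones cost
    [f ^ 2] up to constants: this squaring drives the multiscale construction. Junctions and
    bypasses use no long edge and are repeated independent trials. *)
Lemma staircase_fail : (6 < N)%N ->
  P w (fun x => ~ Ln true 0 0 ((N - 6) * h) (D%:~R / h%:R) ((2 * t + 45)%:R * h%:R : R) x) <=
  (N ^ 2)%:R * ((t * 2)%:R * f) ^+ 2 + (t * 2 * N)%:R * (1 / 2) ^+ m + N%:R * (1 / 2) ^+ t.
Proof.
move=> N6; rewrite -(P_nLn true (3 * D) (3 * h)).
pose I1 := [seq (j, j') | j <- iota 0 N, j' <- iota 0 N].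
pose I2 := [seq (ib, j) | ib <- ibs, j <- iota 0 N].
pose B1 x := exists2 jj, jj \in I1 & (jj.1.+2 <= jj.2)%N /\ (bad jj.1 x /\ bad jj.2 x).
pose B2 x := exists2 ij, ij \in I2 & forall v, v \in iota 0 m -> ~ short (center ij.1) ij.2 v x.
pose B3 x := exists2 k, k \in iota 0 N & forall i, i \in iota 0 t -> ~ long (i * h)%N k x.
have g1 jj : finP (fun x => (jj.1.+2 <= jj.2)%N /\ (bad jj.1 x /\ bad jj.2 x)).
  by apply: finP_and; [exact: finP_cst|apply: finP_and; apply: bad_fin].
have g2 ij : finP (fun x => forall v, v \in iota 0 m -> ~ short (center ij.1) ij.2 v x).
  by apply: (finP_bigI (A := fun v x => ~ short (center ij.1) ij.2 v x)) => v _; apply: finP_not; apply: Ln_fin.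
have g3 k : finP (fun x => forall i, i \in iota 0 t -> ~ long (i * h)%N k x).
  by apply: (finP_bigI (A := fun i x => ~ long (i * h)%N k x)) => v _; apply: finP_not; apply: Ln_fin.
have F1 : finP B1 by apply: finP_bigU => jj _; apply: g1.
have F2 : finP B2 by apply: finP_bigU => jj _; apply: g2.
have F3 : finP B3 by apply: finP_bigU => jj _; apply: g3.
apply: (@le_trans _ _ (P w (fun x => (B1 x \/ B2 x) \/ B3 x))).
  apply: (P_sub hw); [by apply: finP_not; apply: Ln_fin|by apply: finP_or => //; apply: finP_or|move=> x nL].
  apply: contrapT => /not_orP[/not_orP[n1 n2] n3]; apply: nL; apply: staircase_line => //.
  - move=> j j' jN jj [b1 b2]; apply: n1; exists (j, j') => //.
    by apply/allpairsP; exists (j, j'); rewrite !mem_iota !add0n jN; split=> //=; apply: leq_trans jN; apply: leq_trans jj; exact: leqW.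
  - move=> ib j hib /andP[_ jN]; apply: contrapT => nj; apply: n2; exists (ib, j) => /=.
      by apply/allpairsP; exists (ib, j); rewrite mem_iota add0n.
    by move=> v hv hs; apply: nj; exists v.
  - move=> k kN; apply: contrapT => nj; apply: n3; exists k; first by rewrite mem_iota.
    by move=> i hi hl; apply: nj; exists i.
apply: le_trans (P_or hw (finP_or F1 F2) F3) _; apply: lerD; last first.
  by rewrite -[in N%:R](size_iota 0 N); apply: (P_bigU hw).
apply: le_trans (P_or hw F1 F2) _; apply: lerD.
  rewrite (_ : (N ^ 2)%N = size I1); first by apply: (P_bigU hw) => // jj _; apply: pair_le.
  by rewrite size_allpairs !size_iota.
rewrite (_ : (t * 2 * N)%N = size I2); first by apply: (P_bigU hw) => // jj _; apply: short_le.
by rewrite size_allpairs size_ibs size_iota.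
Qed.

End Staircase.

(** * Failure probabilities below every power *)

Section SuperPolynomial.
Context {R : realType}.

Lemma poly_exp (k : nat) : exists B0, forall B, (B0 <= B)%N -> (B ^ k <= 2 ^ (B %/ 2))%N.
Proof.
pose c := (4 * k.+1)%N; exists (4 * c ^ k.+1)%N => B hB.
have B0 : (0 < B)%N by apply: leq_trans hB; rewrite muln_gt0 expn_gt0.
apply: (@leq_trans (B ^ k.+1)); first by rewrite leq_pexp2l.
have h1 : (B <= c * 2 ^ (B %/ c))%N.
  apply: (@leq_trans (c * (B %/ c).+1)); first by rewrite mulnC ltnW // ltn_ceil.
  by rewrite leq_mul2l ltn_expl // orbT.
apply: (@leq_trans ((c * 2 ^ (B %/ c)) ^ k.+1)); first by rewrite leq_exp2r.
rewrite expnMn -expnM; apply: (@leq_trans (2 ^ (B %/ 4) * 2 ^ (B %/ 4))).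
  apply: leq_mul; last first.
    rewrite leq_pexp2l // leq_divRL //; apply: leq_trans (leq_divM B c).
    by rewrite -mulnA [(k.+1 * 4)%N]mulnC.
  apply: leq_trans (ltnW (ltn_expl _ (isT : 1 < 2)%N)) _.
  by rewrite leq_pexp2l // leq_divRL // mulnC.
by rewrite -expnD leq_pexp2l //; lia.
Qed.

Variables (p q sigma gam : R) (C n0 : nat).
Hypotheses (hp : 0 <= p <= 1) (hq : 0 <= q <= 1) (sigma2 : sigma <= 2) (gam0 : 0 < gam) (Cg : 24 <= C%:R * gam)
  (hoff : forall n, (n0 <= n)%N -> P (hom p q) (fun x => ~ Ln false 0 0 n sigma (gam / 24 * n%:R) x) <= 1 / 2).
Notation w := (hom p q).
Let hw : prob_weight w := hom_prob hp hq.

(** The exponent [B] measures both the failure probability [2 ^ -B] and the aspect ratio: the line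
    is at least [C * B] times longer than wide, which makes room for the [2 * B] trials of a
    junction. *)
Definition state B (h : nat) (s r : R) := [/\ (C * B)%:R * r <= h%:R, 1 <= r, n0%:R <= r &
  P w (fun x => ~ Ln true 0 0 (2 * h) s r x) <= (1 / 2) ^+ B].

(** Squaring would double the exponent; half of [B] is given up to absorb the polynomial prefactor
    of [staircase_fail]. *)
Definition grow B := (B + B %/ 2)%N.
(** The new width is [(4 * B + 45) * h], so the new length must be [C * grow B] times as much. *)
Definition ratio B := (C * grow B * (4 * B + 45))%N.

Lemma ratio_le B : (C <= B)%N -> (45 <= B)%N -> (ratio B <= 10 * B ^ 3)%N.
Proof.
move=> h1 h2; rewrite /ratio; apply: (@leq_trans (B * (2 * B) * (5 * B))).
  by apply: leq_mul; [apply: leq_mul => //; rewrite /grow|]; lia.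
by rewrite !expnS expn0 muln1; lia.
Qed.

Lemma fail_num B : (C <= B)%N -> (45 <= B)%N -> (B ^ 11 <= 2 ^ (B %/ 2))%N ->
  let N := (2 * ratio B + 6)%N in (N ^ 2 * (2 * B * 2) ^ 2 + 2 * B * 2 * N + N <= 2 ^ (2 * B - grow B))%N.
Proof.
move=> h1 h2 h3; cbv zeta; set N := (2 * ratio B + 6)%N; have NB : (N <= 21 * B ^ 3)%N.
  have := ratio_le h1 h2; have : (6 <= B ^ 3)%N.
    by apply: leq_trans (_ : B ^ 1 <= _)%N; [lia|rewrite leq_pexp2l //; lia].
  rewrite /N; move: (B ^ 3)%N (ratio B); clear; lia.
apply: (@leq_trans (B ^ 11)); last first.
  apply: leq_trans h3 _; rewrite leq_pexp2l // /grow; lia.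
have B1 : (0 < B)%N by lia.
have e8 : (B ^ 11 = B ^ 3 * B ^ 8)%N by rewrite -expnD.
have b3 : (45 ^ 3 <= B ^ 3)%N by rewrite leq_exp2r.
have t1 : (N ^ 2 * (2 * B * 2) ^ 2 <= 7056 * B ^ 8)%N.
  apply: (@leq_trans ((21 * B ^ 3) ^ 2 * (2 * B * 2) ^ 2)); first by rewrite leq_mul2r leq_exp2r // NB orbT.
  by rewrite (_ : (B ^ 8 = (B ^ 3) ^ 2 * B ^ 2)%N) -?expnM -?expnD // -!mulnn; apply: eq_leq; ring.
have t2 : (2 * B * 2 * N <= 84 * B ^ 8)%N.
  apply: (@leq_trans (2 * B * 2 * (21 * B ^ 3))); first by rewrite leq_mul2l NB orbT.
  apply: (@leq_trans (84 * B ^ 4)); first by rewrite expnS; apply: eq_leq; ring.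
  by rewrite leq_mul2l leq_pexp2l // orbT.
have t3 : (N <= 21 * B ^ 8)%N.
  by apply: leq_trans NB _; rewrite leq_mul2l leq_pexp2l // orbT.
rewrite e8; apply: (@leq_trans (45 ^ 3 * B ^ 8)); last by rewrite leq_mul2r b3 orbT.
by apply: leq_trans (leq_add (leq_add t1 t2) t3) _; rewrite -!mulnDl leq_mul2r orbT.
Qed.

(** One use of [staircase_fail] with [2 * B] families, [2 * B] trials per junction and [f = 2 ^ -B].
    The new slope [D / h] exceeds [s] by at most [3 * r / h], hence by [3 / (C * B)]. *)
Lemma state_step B h s r : (C <= B)%N -> (45 <= B)%N -> (B ^ 11 <= 2 ^ (B %/ 2))%N -> 0 <= s -> gam <= sigma - s ->
  state B h s r -> exists s', [/\ s <= s', s' <= s + 3 / (C * B)%:R &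
    state (grow B) (ratio B * h) s' ((4 * B + 45)%:R * h%:R)].
Proof.
have num : 1 / 2 * 2 = 1 :> R by lra.
move=> CB B45 BE s0 gs [h1 r1 rn hf].
have sg2 := sigma2; have g0 := gam0; have cg := Cg.
have Bp : (0 < B)%N by apply: leq_trans B45.
have B1 : 1 <= B%:R :> R by rewrite ler1n.
have g2 : gam <= 2 by lra.
have C12 : 12 <= C%:R :> R by have : C%:R * gam <= C%:R * 2; [rewrite ler_wpM2l|lra].
have C0 : 0 < C%:R :> R by lra.
have CBr : C%:R * B%:R * r <= h%:R by rewrite -natrM.
have rC : 24 * r * B%:R <= gam * h%:R.
  have : gam * (C%:R * B%:R * r) <= gam * h%:R by rewrite ler_pM2l.
  have : 24 * (B%:R * r) <= C%:R * gam * (B%:R * r) by rewrite ler_wpM2r // mulr_ge0 //; lra.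
  lra.
have rB : r <= r * B%:R by rewrite ler_peMr //; lra.
have r24 : 24 * r <= gam * h%:R by apply: le_trans rC; lra.
have hR : 0 < h%:R :> R by apply: lt_le_trans CBr; rewrite !mulr_gt0 //; lra.
have gh : gam * h%:R <= 2 * h%:R by rewrite ler_wpM2r // ltW.
have rh : r <= h%:R by lra.
have r0 : 0 <= r := le_trans ler01 r1.
have g2r : gam <= 2 * r by lra.
have gr : gam * r <= 8 * r by rewrite ler_wpM2r //; lra.
have CB0 : 0 < C%:R * B%:R :> R by rewrite mulr_gt0 // ltr0n.
pose D := Num.ceil (s * h%:R + 2 * r).
have /andP[D2 D1] := ceil_itv (s * h%:R + 2 * r); rewrite -/D intrB in D1 D2.
have D2' : D%:~R <= s * h%:R + 3 * r by lra.
pose JJ := Num.ceil (s * h%:R + 2 * sigma * h%:R).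
have /andP[J2 J1] := ceil_itv (s * h%:R + 2 * sigma * h%:R); rewrite -/JJ intrB in J1 J2.
pose J := JJ - 3 * D.
have JE : 3 * D%:~R + J%:~R = JJ%:~R :> R by rewrite /J intrB intrM; lra.
(* The least number of steps in which a difference of slopes [gam] surely makes up for [8 * r]. *)
pose theta := (Num.truncn (8 * r / gam)).+1.
have q0 : 0 <= 8 * r / gam by rewrite divr_ge0 ?(ltW gam0) //; lra.
have /andP[th1 th2] := truncn_itv q0; rewrite -/theta in th2.
have th3 : theta%:R <= 8 * r / gam + 1 by rewrite /theta -natr1 lerD2r.
have th4 : 8 * r <= gam * theta%:R.
  have := ler_wpM2l (ltW gam0) (ltW th2); rewrite mulrCA mulfV ?gt_eqF // mulr1 => h2; exact: h2.
have th5 : gam * theta%:R <= 8 * r + gam.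
  have := ler_wpM2l (ltW gam0) th3; rewrite mulrDr mulrCA mulfV ?gt_eqF // !mulr1 => h2; exact: h2.
have mh : (2 * B * theta <= h)%N.
  rewrite -(ler_nat R) -(ler_pM2l gam0) natrM [(2 * B)%:R]natrM.
  have : B%:R * (gam * theta%:R) <= B%:R * (8 * r + gam) by rewrite ler_wpM2l //; lra.
  have : B%:R * gam <= B%:R * (2 * r) by rewrite ler_wpM2l.
  lra.
have thn : (n0 <= theta)%N.
  rewrite -(ler_nat R); apply: le_trans rn _; rewrite -(ler_pM2l gam0); apply: le_trans th4.
  exact: gr.
have hn : (n0 <= 3 * h)%N.
  rewrite -(ler_nat R) natrM; apply: le_trans rn _; apply: le_trans rh _.
  by rewrite ler_peMl // ler1n.
have ps : P w (fun x => ~ Ln false 0 0 theta sigma r x) <= 1 / 2.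
  apply: le_trans (hoff thn); apply: (P_sub hw); try (by apply: finP_not; apply: Ln_fin).
  move=> x nl hl; apply: nl; apply: Ln_le hl => t _; rewrite subrr mul0r normr0.
  have := th5; lra.
have pl : P w (fun x => ~ Ln false 0 0 (3 * h) sigma (gam / 8 * h%:R) x) <= 1 / 2.
  apply: le_trans (hoff hn); apply: (P_sub hw); try (by apply: finP_not; apply: Ln_fin).
  move=> x nl hl; apply: nl; apply: Ln_le hl => t _; rewrite subrr mul0r normr0 natrM; lra.
exists (D%:~R / h%:R); split.
- by rewrite ler_pdivlMr //; apply: le_trans D1; rewrite lerDl mulr_ge0.
- rewrite ler_pdivrMr // mulrDl; apply: le_trans D2' _; rewrite lerD2l natrM.
  by rewrite mulrAC ler_pdivlMr // mulrAC -mulrA ler_pM2l // mulrC.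
pose N := (2 * ratio B + 6)%N; have N6 : (6 < N)%N.
  rewrite /N; suff : (0 < ratio B)%N by clear; lia.
  by rewrite /ratio /grow !muln_gt0 -(ltr0n R) C0 /= addn_gt0 Bp addnC.
have J1' : s * h%:R + 2 * sigma * h%:R <= 3 * D%:~R + J%:~R by rewrite JE.
have J2' : 3 * D%:~R + J%:~R <= s * h%:R + 2 * sigma * h%:R + 1 by rewrite JE -lerBlDr ltW.
have t0 : (0 < 2 * B)%N by rewrite muln_gt0.
have := staircase_fail s0 sigma2 gam0 gs r1 r24 D1 D2' J1' J2' th4 mh t0 hp hq hf ps pl N6.
have -> : (N - 6)%N = (2 * ratio B)%N by rewrite /N addnK.
have -> : (2 * (2 * B) + 45)%N = (4 * B + 45)%N by rewrite mulnA.
move=> fail; split.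
- by rewrite /ratio -!natrM ler_nat !mulnA.
- apply: le_trans (_ : 1 * h%:R <= _); last by rewrite ler_wpM2r ?(ltW hR) // ler1n addnC.
  by rewrite mul1r; apply: le_trans r1 rh.
- apply: le_trans rn _; apply: le_trans (_ : 1 * h%:R <= _); last by rewrite ler_wpM2r ?(ltW hR) // ler1n addnC.
  by rewrite mul1r.
rewrite mulnA; apply: le_trans fail _.
have fn := fail_num CB B45 BE; cbv zeta in fn; rewrite -/N -(ler_nat R) in fn.
have gB : (grow B <= 2 * B)%N by rewrite /grow; clear; lia.
have e1 : (1 / 2 : R) ^+ (2 * B) * (2 ^ (2 * B - grow B))%:R = (1 / 2) ^+ grow B.
  rewrite natrX -[X in (1 / 2) ^+ X * _](subnK gB) exprD mulrAC -exprMn.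
  by rewrite num expr1n mul1r.
have half0 : 0 <= (1 / 2 : R) ^+ (2 * B) by rewrite exprn_ge0 // divr_ge0.
rewrite -e1; apply: le_trans (ler_wpM2l half0 fn).
rewrite !natrD !natrM.
rewrite (_ : (1 / 2 : R) ^+ (2 * B) = ((1 / 2) ^+ B) ^+ 2); last by rewrite -exprM mulnC.
by rewrite le_eqVlt; apply/orP; left; apply/eqP; ring.
Qed.

(** As [grow B] is at least [4 * B / 3], the increments [3 / (C * B)] are dominated by a geometric
    series of ratio [3 / 4], of sum [12 / (C * B)]. What is left of this sum after one step covers
    the steps to come. *)
Lemma slope_budget B : (3 <= B)%N -> 12 / (C * grow B)%:R <= 9 / (C * B)%:R :> R.
Proof.
move=> B3; have cg := Cg; have B0 : 0 < B%:R :> R by rewrite ltr0n; apply: leq_trans B3.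
have C0 : 0 < C%:R :> R.
  by rewrite ltr0n lt0n; apply/eqP => C0; move: cg; rewrite C0 mul0r; lra.
have g0 : 0 < (grow B)%:R :> R by rewrite /grow ltr0n addn_gt0 -(ltr0n R) B0.
have g1 : 4 * B%:R <= 3 * (grow B)%:R :> R by rewrite -!natrM ler_nat /grow; clear -B3; lia.
rewrite !natrM ler_pdivrMr ?mulr_gt0 // mulrAC ler_pdivlMr ?mulr_gt0 //.
have : C%:R * (4 * B%:R) <= C%:R * (3 * (grow B)%:R) :> R by rewrite ler_pM2l.
lra.
Qed.

Variable alpha : R.
Hypotheses (alpha0 : 0 <= alpha) (ga : alpha + gam <= sigma - gam)
  (hon : forall d, 0 < d -> exists n1, forall n, (n1 <= n)%N -> P w (fun x => ~ Ln true 0 0 n alpha (d * n%:R) x) <= d).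

(** [B] grows geometrically while the length is multiplied by at most [B ^ 4] at each step; the
    length is thus subexponential in [B], and [2 ^ -B] beats all its powers. *)
Theorem super_polynomial (kappa n1 : nat) (d : R) : 0 < d -> exists h s r,
  [/\ (n1 <= h)%N, (0 < h)%N, alpha <= s <= alpha + d, 0 <= r <= d * h%:R &
    P w (fun x => ~ Ln true 0 0 (2 * h) s r x) * (h ^ kappa)%:R <= 1].
Proof.
move=> d0; have cg := Cg; have gp := gam0.
have C0 : 0 < C%:R :> R.
  by rewrite ltr0n lt0n; apply/eqP => C0; move: cg; rewrite C0 mul0r; lra.
have C1 : (0 < C)%N by rewrite -(ltr0n R).
pose dd := Num.min d gam; have dd0 : 0 < dd by rewrite lt_min d0 gam0.
have [E1 hE1] := poly_exp 11; have [E2 hE2] := poly_exp (8 * kappa).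
have [E3 hE3] := @ex_nat_gt R (12 / dd); have [E4 hE4] := @ex_nat_gt R (1 / d).
pose B0 := (C + 45 + E1 + E2 + E3 + E4 + n1)%N.
have big B : (B0 <= B)%N -> [/\ (C <= B)%N, (45 <= B)%N, (E1 <= B)%N, (E2 <= B)%N & [/\ (E3 <= B)%N, (E4 <= B)%N & (n1 <= B)%N]].
  by rewrite /B0; clear; move=> ?; split; [..|split]; lia.
have [b1 b2 _ _ [b5 _ _]] := big B0 (leqnn _).
have CB0 : 0 < (C * B0)%:R :> R by rewrite natrM mulr_gt0 // ltr0n; apply: leq_trans b2.
have e12 : 12 / (C * B0)%:R <= dd.
  rewrite ler_pdivrMr //; have := hE3 B0 b5; rewrite ler_pdivrMr // => h1.
  rewrite natrM; have : dd * B0%:R <= dd * (C%:R * B0%:R); last by lra.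
  by rewrite ler_pM2l // ler_peMl // ler1n.
pose dl := Num.min (1 / (2 * (C * B0)%:R)) ((1 / 2) ^+ B0 : R).
have dl0 : 0 < dl by rewrite lt_min divr_gt0 ?mulr_gt0 //= exprn_gt0 //; lra.
have [m hm] := hon dl0; have [m' hm'] := @ex_nat_gt R ((1 + n0%:R) / dl).
pose h0 := (m + m' + 1)%N.
have init : state B0 h0 alpha (dl * (2 * h0)%:R).
  have h1 : 1 + n0%:R <= dl * (2 * h0)%:R.
    have := hm' (2 * h0)%N; rewrite ler_pdivrMr // [_ * dl]mulrC; apply; rewrite /h0; clear; lia.
  have n00 : 0 <= n0%:R :> R by [].
  split; [|lra|lra|].
  - have : (C * B0)%:R * dl <= 1 / 2.
      apply: (@le_trans _ _ ((C * B0)%:R * (1 / (2 * (C * B0)%:R)))); first by rewrite ler_pM2l // ge_min lexx.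
      by rewrite mulrA mulr1 ler_pdivrMr ?mulr_gt0 //; lra.
    rewrite natrM => h2; have := ler_wpM2r (ler0n R (2 * h0)) h2; rewrite natrM; lra.
  - apply: le_trans (hm (2 * h0)%N _) _; first by rewrite /h0; clear; lia.
    by rewrite ge_min lexx orbT.
have seqs n : exists B h s r, [/\ (B0 + n <= B)%N, state B h s r, alpha <= s,
    s + 12 / (C * B)%:R <= alpha + 12 / (C * B0)%:R & (h ^ (2 * kappa) <= h0 ^ (2 * kappa) * 2 ^ B)%N].
  elim: n => [|n [B [h [s [r [hB hs as1 as2 hh]]]]]].
    exists B0, h0, alpha, (dl * (2 * h0)%:R); split=> //; first by rewrite addn0.
    by rewrite -[leqLHS]muln1 leq_mul2l expn_gt0 orbT.
  have BB : (B0 <= B)%N by apply: leq_trans hB; rewrite leq_addr.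
  have [c1 c2 c3 c4 _] := big B BB.
  have s0 : 0 <= s by apply: le_trans as1.
  have CB : 0 < 12 / (C * B)%:R :> R by rewrite divr_gt0 // natrM mulr_gt0 // ltr0n; apply: leq_trans c2.
  have ddg : dd <= gam by rewrite ge_min lexx orbT.
  have gs : gam <= sigma - s by have := ga; lra.
  have [s' [t1 t2 t3]] := state_step c1 c2 (hE1 B c3) s0 gs hs.
  exists (grow B), (ratio B * h)%N, s', ((4 * B + 45)%:R * h%:R); split=> //.
  - by rewrite /grow; clear -hB c2; lia.
  - exact: le_trans t1.
  - have := @slope_budget B (leq_trans _ c2) => /(_ isT).
    have -> : 9 / (C * B)%:R = 12 / (C * B)%:R - 3 / (C * B)%:R :> R by lra.
    lra.
  rewrite expnMn mulnC; apply: (@leq_trans (h0 ^ (2 * kappa) * 2 ^ B * (B ^ 4) ^ (2 * kappa))).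
    apply: leq_mul => //; case: (kappa) => [//|k]; rewrite leq_exp2r //.
    by apply: leq_trans (ratio_le c1 c2) _; rewrite [(B ^ 4)%N]expnS leq_mul2r (leq_trans _ c2) // orbT.
  rewrite -mulnA leq_mul2l /grow expnD; apply/orP; right; rewrite leq_mul2l; apply/orP; right.
  by rewrite -expnM mulnA; apply: hE2.
(* Once [B] exceeds [h0 ^ (2 * kappa)], this initial factor is itself below [2 ^ B], and the
   invariant gives [h ^ (2 * kappa) <= 2 ^ (2 * B)]. *)
have [B [h [s [r [hB [s1 s2 s3 s4] as1 as2 hh]]]]] := seqs (h0 ^ (2 * kappa))%N.
have BB : (B0 <= B)%N by apply: leq_trans hB; rewrite leq_addr.
have [c1 c2 c3 c4 [c5 c6 c7]] := big B BB.
have B1 : 1 <= B%:R :> R by rewrite ler1n; apply: leq_trans c2.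
have BCr : B%:R * r <= h%:R.
  apply: le_trans s1; rewrite natrM -mulrA ler_peMl ?mulr_ge0 ?ler1n //; lra.
have Bh : (B <= h)%N by rewrite -(ler_nat R); apply: le_trans BCr; rewrite ler_peMr //; lra.
exists h, s, r; split.
- exact: leq_trans c7 Bh.
- by apply: leq_trans Bh; apply: leq_trans c2.
- rewrite as1 /=; have : dd <= d by rewrite ge_min lexx.
  have : 0 <= 12 / (C * B)%:R :> R by rewrite divr_ge0.
  lra.
- apply/andP; split; first by lra.
  have := hE4 B c6; rewrite ler_pdivrMr // => h1.
  have : 1 * r <= B%:R * d * r by rewrite ler_wpM2r //; lra.
  have : d * (B%:R * r) <= d * h%:R by rewrite ler_pM2l.
  lra.
apply: le_trans (ler_wpM2r (ler0n _ _) s4) _.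
rewrite expr_div_n expr1n mul1r mulrC ler_pdivrMr ?exprn_gt0 // mul1r -natrX ler_nat.
have [-> //|k0] := posnP kappa; first by rewrite expn0 expn_gt0.
rewrite -(leq_exp2r _ _ (isT : 0 < 2)%N) -!expnM mulnC; apply: leq_trans hh _.
rewrite muln2 -addnn expnD leq_mul2r; apply/orP; right.
apply: leq_trans (ltnW (ltn_expl _ (isT : 1 < 2)%N)) _; rewrite leq_pexp2l //.
by apply: leq_trans hB; rewrite leq_addl.
Qed.

End SuperPolynomial.

(** * Quenched environments *)

Section Quenched.
Context {R : realType}.
Implicit Types (x y : coord -> bool) (env : nat -> bool).

(** The environment is indexed by natural numbers through [absz]; it is only consulted at
    nonnegative times by the tracks considered. *)
Definition mix env x : coord -> bool :=
  fun i => match i with inl _ => x i | inr u => env (absz u) end.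

Lemma step_mix env x t a b : step false (mix env x) t a b <-> step false x t a b.
Proof. by split=> -[|[]//]; left. Qed.

Lemma track_mix env x t0 t1 g : track false (mix env x) t0 t1 g <-> track false x t0 t1 g.
Proof.
split=> h t ht; [exact: (iffLR (step_mix env x t _ _) (h t ht))|exact: (iffRL (step_mix env x t _ _) (h t ht))].
Qed.

Lemma finP_mix env A : finP A -> finP (fun x => A (mix env x)).
Proof. by move=> [M h]; exists M => x y xy; apply: h => -[v|u] hi //; exact: (xy (inl v)). Qed.

Lemma depP_mix env A D : depP A D -> depP (fun x => A (mix env x)) D.
Proof. by move=> h x y xy; apply: h => -[v|u] hi //; exact: (xy (inl v)). Qed.

Lemma E_box (w : coord -> R) f M b : dep f (inbox M) -> E w f = Ex w (boxl M) f b.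
Proof.
move=> d; have hf : fin f by exists M.
have [h|h] := leqP (rad f) M.
  by rewrite -(E_Ex w (s := boxl M) b hf) //; apply: (cover_le (@cover_boxl M)).
by apply: (eq_Ex_coord _ _ _ d) => i hi; apply: cover_boxl => //; apply: inbox_le hi; exact: ltnW.
Qed.

Lemma P_box (w : coord -> R) A M b : depP A (inbox M) -> P w A = Pr w (boxl M) A b.
Proof. by move=> d; apply: E_box; apply: dep_ind. Qed.

Variable w : coord -> R.
Hypothesis hw : prob_weight w.

(** The joint failure probability is the mean, over the past [F x], of the conditional one; Markov's
    inequality then makes the conditional one at most [eps] outside a set of pasts of probability
    [eps]. *)
Lemma markov_fubini (St : Type) (F : (coord -> bool) -> St) (Z : St -> (coord -> bool) -> Prop)
    (D1 D2 : coord -> Prop) M (eps : R) : 0 < eps ->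
  (forall i, D1 i -> inbox M i) -> (forall i, D2 i -> inbox M i) -> (forall i, D1 i -> D2 i -> False) ->
  (forall x y, (forall i, D1 i -> x i = y i) -> F x = F y) -> (forall S, depP (Z S) D2) ->
  P w (fun x => ~ Z (F x) x) <= eps ^+ 2 -> P w (fun x => ~ (1 - eps <= P w (Z (F x)))) <= eps.
Proof.
move=> e0 s1 s2 dd dF dZ.
have dA : depP (fun x => ~ Z (F x) x) (inbox M).
  apply: depP_not => x y xy; rewrite (dF x y) => [|i /s1]; last exact: xy.
  by apply: dZ => i /s2; exact: xy.
have dZM S : depP (fun x => ~ Z S x) (inbox M) by apply: depP_not; apply: depP_sub (dZ S).
have nZ S : P w (fun x => ~ Z S x) = 1 - P w (Z S).
  by rewrite P_not //; exists M; apply: depP_sub (dZ S).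
pose h x := P w (fun y => ~ Z (F x) y).
have hd : dep h (inbox M) by move=> x y xy; rewrite /h (dF x y) // => i /s1; exact: xy.
have -> : P w (fun x => ~ Z (F x) x) = E w h.
  rewrite (P_box w xfalse dA) (E_box w xfalse hd) /Pr (Ex_fubini _ _ _ D1).
  apply: eq_Ex => x; rewrite /h (P_box w xfalse (dZM (F x))); apply: eq_Ex => y.
  have e : F (glue D1 x y) = F x by apply: dF => i Di; rewrite glue_in.
  congr (nat_of_bool _)%:R; rewrite e; apply: asbool_equiv_eq.
  split=> H1 H2; apply: H1; apply: dZ H2 => i Di; rewrite glue_out // => D1i; exact: (dd i).
move=> hE; set B := fun x => _.
have fB : finP B.
  exists M => x y xy nb b1; apply: nb; move: b1; rewrite (dF x y) // => i /s1; exact: xy.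
have : eps * P w B <= E w h.
  have fh : fin h by exists M.
  rewrite -(EZ w eps (fin_ind fB)); apply: (E_le hw) => //.
    by apply: (@fin2 _ (fun a b => a * b)); [exact: fin_cst|exact: fin_ind].
  move=> x; have [b|b] := pselect (B x); last by rewrite ind_f // mulr0 P_ge0.
  rewrite ind_t // mulr1 /h nZ; move/negP: b; rewrite -ltNge; lra.
move=> h1; rewrite -(ler_pM2l e0) -expr2; exact: le_trans h1 hE.
Qed.

End Quenched.

Section ReachedSets.
Implicit Types (x y : coord -> bool) (X Y : int -> Prop).

Definition reached y t0 t1 X : int -> Prop := fun b => exists g, [/\ track true y t0 t1 g, X (g t0) & g t1 = b].

Lemma reached_sub y t0 t1 X Y b : (forall a, X a -> Y a) -> reached y t0 t1 X b -> reached y t0 t1 Y b.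
Proof. by move=> h [g [g1 g2 g3]]; exists g; split=> //; apply: h. Qed.

Lemma reached_add y t0 t1 t2 X b : (t0 <= t1)%N -> (t1 <= t2)%N ->
  reached y t1 t2 (reached y t0 t1 X) b -> reached y t0 t2 X b.
Proof.
move=> h1 h2 [g [g1 [f [f1 f2 f3]] g3]]; exists (splice t1 f g); split.
- exact: track_cat f1 g1 f3.
- by rewrite /splice h1.
- rewrite /splice; case: leqP => // h; have e : t2 = t1 by apply/eqP; rewrite eqn_leq h h2.
  by rewrite e f3 -g3 e.
Qed.

Lemma reached_dep x y t0 t1 X : (forall i, slab t0 t1 i -> x i = y i) -> reached x t0 t1 X = reached y t0 t1 X.
Proof.
have H x' y' : (forall i, slab t0 t1 i -> x' i = y' i) -> forall b, reached x' t0 t1 X b -> reached y' t0 t1 X b.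
  move=> xy b [g [g1 g2 g3]]; exists g; split=> // t ht; apply: step_dep (g1 t ht) => [k _|k _|_]; apply: xy => /=; lia.
by move=> xy; apply: funext => b; apply: propext; split; apply: H => // i /xy.
Qed.

End ReachedSets.

(** * Averaging over the environment *)

Section Annealing.
Context {R : realType}.

Definition env_law (q : R) : seq (R * bool) := [:: (q, true); (1 - q, false)].

Lemma Ex_keep (I : eqType) (w : I -> R) s (f : (I -> bool) -> R) b i : i \notin s ->
  Ex w s f b = Ex w s (fun x => f (upd x i (b i))) b.
Proof.
elim: s b => [|j s IH] b /=.
  by move=> _; congr f; apply: funext => k; rewrite /upd; case: eqP => [->|].
rewrite inE negb_or => /andP[ij hs].
have e c : upd b j c i = b i by rewrite /upd (negbTE ij).
by rewrite !(IH (upd b j _) hs) !e.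
Qed.

Lemma Ex_env (w : coord -> R) (q : R) k m (h : seq bool -> R) b : (forall t, w (inr t) = q) ->
  Ex w [seq inr t%:Z | t <- iota k m] (fun x => h [seq x (inr t%:Z) | t <- iota k m]) b = AE (env_law q) m h.
Proof.
move=> hw; elim: m k h b => [|m IH] k h b //=.
rewrite big_cons big_seq1 /= hw.
have ni : inr k%:Z \notin [seq (inr t%:Z : coord) | t <- iota k.+1 m].
  by apply/mapP => -[t]; rewrite mem_iota => ht [] ?; lia.
have e c : Ex w [seq inr t%:Z | t <- iota k.+1 m] (fun x => h (x (inr k%:Z) :: [seq x (inr t%:Z) | t <- iota k.+1 m]))
    (upd b (inr k%:Z) c) = AE (env_law q) m (fun es => h (c :: es)).
  rewrite (Ex_keep _ _ _ ni) -(IH k.+1 _ (upd b (inr k%:Z) c)); apply: eq_Ex => x.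
  rewrite {1 2}/upd !eqxx; congr (h (_ :: _)); apply/eq_in_map => t; rewrite mem_iota => ht.
  by rewrite /upd; case: eqP => // -[]; lia.
by rewrite !e.
Qed.

Definition envdom (m : nat) (i : coord) : Prop := match i with inl _ => True | inr u => 0 <= u < m%:Z end.

(** Conditioning on the first [m] bits of long edges, drawn as the letters of a finite law so that
    [AE_read] can regroup them into layers and runs. *)
Lemma anneal (p q : R) B m : finP B -> depP B (envdom m) ->
  P (hom p q) B = AE (env_law q) m (fun es => P (hom p q) (fun x => B (mix (nth false es) x))).
Proof.
move=> [M0 h0] hB; pose M := maxn M0 m; pose w := hom p q.
have hM : depP B (inbox M) by apply: depP_sub h0 => i; apply: inbox_le; exact: leq_maxl.
pose D (i : coord) : Prop := if i is inr _ then True else False.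
pose h es := P w (fun x => B (mix (nth false es) x)).
rewrite -[RHS]/(AE _ m h) -(@Ex_env w q 0 m h xfalse) // (P_box _ xfalse hM) /Pr (Ex_fubini _ _ _ D).
have -> : Ex w [seq inr t%:Z | t <- iota 0 m] (fun x => h [seq x (inr t%:Z) | t <- iota 0 m]) xfalse =
    Ex w (boxl M) (fun x => h [seq x (inr t%:Z) | t <- iota 0 m]) xfalse.
  apply: (@eq_Ex_coord _ _ _ _ _ _ (fun i => i \in [seq (inr t%:Z : coord) | t <- iota 0 m])) => //.
    by move=> x y xy; congr h; apply/eq_in_map => t ht; apply: xy; apply: map_f.
  move=> i /mapP[t]; rewrite mem_iota => ht ->; apply: cover_boxl => /=.
  by have := leq_maxr M0 m; rewrite -/M; move: ht; clear; lia.
apply: eq_Ex => x; rewrite /h (P_box _ xfalse (depP_mix hM)); apply: eq_Ex => y.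
have e i : envdom m i -> glue D x y i = mix (nth false [seq x (inr t%:Z) | t <- iota 0 m]) y i.
  case: i => [v|u] /= hu; first by rewrite glue_out.
  rewrite glue_in // (nth_map 0%N) ?size_iota ?nth_iota; [|lia|lia].
  by congr (x (inr _)); lia.
congr (nat_of_bool _)%:R; apply: asbool_equiv_eq; split; apply: hB => i hi; rewrite e //.
Qed.

End Annealing.

Section RowLaw.
Context {R : realType} {T : Type} (good : pred T) (L : seq (R * T)) (beta v lr : R) (rho : nat -> R).
Hypotheses (hL : nneg L) (mL : mass L = 1) (hb : \sum_(p <- L | ~~ good p.2) p.1 <= beta).
Notation z := ((v^-1) ^+ 10).
Hypotheses (v01 : 0 < v <= 1) (lr01 : 0 < lr <= 1) (hz : beta * z <= 1 / 2) (htau : 2 * beta * z * (lr^-1) ^+ 10 <= tauL 10)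
  (r0 : 1 - tauL 10 <= rho 0%N <= 1) (rS : forall b, rho b.+1 = v ^+ b.+1 * lr).

Let bad_ge0 : 0 <= \sum_(p <- L | ~~ good p.2) p.1.
Proof.
rewrite big_mkcond; elim: (L) hL => [|p L' IH]; first by rewrite big_nil.
by move=> /andP[h1 h2]; rewrite big_cons addr_ge0 ?IH //; case: ifP.
Qed.
Let b0 : 0 <= beta := le_trans bad_ge0 hb.
Let z1 : 1 <= z.
Proof. by case/andP: v01 => h1 h2; rewrite exprn_ege1 // invr_ge1 ?unitfE ?gt_eqF. Qed.
Let z0 : 0 <= z := le_trans ler01 z1.

Let sum_if (f c : R) : 0 <= c -> \sum_(p <- L) p.1 * (if good p.2 then f else c) <=
  f * \sum_(p <- L | good p.2) p.1 + c * beta.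
Proof.
move=> c0; rewrite (bigID (fun p => good p.2)) /= mulr_sumr.
apply: lerD.
  by rewrite le_eqVlt; apply/orP; left; apply/eqP; apply: eq_bigr => p ->; rewrite mulrC.
rewrite (eq_bigr (fun p => c * p.1)) => [|p /negbTE ->]; last by rewrite mulrC.
by rewrite -mulr_sumr ler_wpM2l.
Qed.

Let good_le1 : \sum_(p <- L | good p.2) p.1 <= 1.
Proof. by have := mL; rewrite /mass (bigID (fun p => good p.2)) /= => h; have := bad_ge0; lra. Qed.

(** Each bad letter contributes the factor [beta * z <= 1 / 2], so the whole series is at most twice
    the term [z] of a single good letter. *)
Lemma SR_size_sum J : \sum_(q <- SR good L J) q.1 * z ^+ size q.2 <= 2 * z.
Proof.
elim: J => [|J IH]; first by rewrite big_nil mulr_ge0.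
rewrite (sum_SR good L J (fun q => z ^+ size q)) /=.
have s0 : 0 <= \sum_(q <- SR good L J) q.1 * z ^+ (size q.2).+1.
  have hS := nneg_SR good J hL; elim: (SR good L J) hS => [|q S IHS]; first by rewrite big_nil.
  by move=> /andP[h1 h2]; rewrite big_cons addr_ge0 ?IHS // mulr_ge0 // exprn_ge0.
apply: le_trans (sum_if (z ^+ 1) s0) _; rewrite expr1.
have -> : \sum_(q <- SR good L J) q.1 * z ^+ (size q.2).+1 = z * \sum_(q <- SR good L J) q.1 * z ^+ size q.2.
  by rewrite mulr_sumr; apply: eq_bigr => q _; rewrite exprS mulrCA.
have h1 := ler_wpM2l z0 good_le1; have h2 := ler_wpM2l (mulr_ge0 b0 z0) IH.
have h3 := ler_wpM2r (mulr_ge0 (ler0n R 2) z0) hz.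
move: h1 h2 h3; set S := \sum_(q <- _) _; rewrite mulr1 => h1 h2 h3.
by rewrite [z * S * beta]mulrAC [z * beta]mulrC; lra.
Qed.

Lemma SR_bad_sum J : \sum_(q <- SR good L J) q.1 * (if (size q.2 <= 1)%N then 0 else z ^+ (size q.2).-1) <= 2 * beta * z.
Proof.
case: J => [|J]; first by rewrite big_nil; apply: mulr_ge0 => //; apply: mulr_ge0.
rewrite (sum_SR good L J (fun q => if (size q <= 1)%N then 0 else z ^+ (size q).-1)) /=.
set S := \sum_(q <- SR _ _ _) _.
have hS : S <= 2 * z.
  apply: le_trans (SR_size_sum J); apply: (ler_sum_nneg (F := fun q => if (size q < 1)%N then 0 else z ^+ size q)
    (G := fun q => z ^+ size q) (nneg_SR good J hL)) => q.
  by case: ifP => // _; rewrite exprn_ge0.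
have S0 : 0 <= S.
  rewrite /S; have hS' := nneg_SR good J hL; elim: (SR good L J) hS' => [|q S' IHS]; first by rewrite big_nil.
  by move=> /andP[h1 h2]; rewrite big_cons addr_ge0 ?IHS // mulr_ge0 //; case: ifP => // _; rewrite exprn_ge0.
apply: le_trans (sum_if 0 S0) _; rewrite mul0r add0r.
by have := ler_wpM2r b0 hS; lra.
Qed.

(** A run of bad layers and the good layer closing it make up a single row, whose density depends
    only on the number of bad layers. *)
Definition rows J : seq (R * R) := [seq (q.1, rho (size q.2).-1) | q <- SR good L J].

Lemma row_rate b : 0 < rho b <= 1.
Proof.
case: b => [|b].
  have /andP[a0 a1] := z_small (R := R) (leqnn 10); case/andP: r0 => h1 ->; rewrite andbT; apply: lt_le_trans h1.
  by rewrite subr_gt0 /tauL exprn_ilt1 ?ltW //; lra.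
rewrite rS; case/andP: v01 => h1 h2; case/andP: lr01 => h3 h4; rewrite mulr_gt0 ?exprn_gt0 //=.
by rewrite mulr_ile1 ?exprn_ile1 ?exprn_ge0 // ltW.
Qed.

Let beta1 : 0 <= beta <= 1.
Proof. by rewrite b0; have := ler_wpM2l b0 z1; rewrite mulr1; have := hz; lra. Qed.

Let mass_rows J : mass (rows J) = mass (SR good L J).
Proof. by rewrite /mass big_map. Qed.

Lemma rows_mass J : 1 - beta ^+ J <= mass (rows J) <= 1.
Proof.
rewrite mass_rows; have h : 1 - 0 <= mass L by rewrite mL; lra.
have m1 : mass L <= 1 by rewrite mL.
have /andP[h1 h2] := SR_deficit J hL m1 h (lexx 0) hb beta1.
by apply/andP; split; move: h1 h2; rewrite mulr0 add0r; lra.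
Qed.

Let pow_inv m : ((v ^+ m * lr)^-1) ^+ 10 = (lr^-1) ^+ 10 * z ^+ m.
Proof. by rewrite invfM exprMn mulrC -exprVn -[X in _ * X = _]exprM -[X in _ = _ * X]exprM mulnC. Qed.

Lemma rows_cls J : cls 10 (rows J).
Proof.
split.
- by rewrite /nneg all_map; apply: sub_all (nneg_SR good J hL) => q.
- by rewrite all_map; elim: (SR good L J) => //= q S ->; rewrite row_rate.
- by case/andP: (rows_mass J).
rewrite big_map big_mkcond /=.
apply: le_trans htau; rewrite -[leRHS]mulrC.
apply: le_trans (ler_wpM2l _ (SR_bad_sum J)); last by case/andP: lr01 => h _; rewrite exprn_ge0 // invr_ge0 ltW.
rewrite mulr_sumr; have lr0 : 0 <= (lr^-1) ^+ 10 by case/andP: lr01 => h _; rewrite exprn_ge0 // invr_ge0 ltW.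
elim: (SR good L J) (nneg_SR good J hL) => [|[c e] S IH]; first by rewrite !big_nil.
move=> /andP[/= c0 hS]; rewrite !big_cons /=; apply: lerD; last exact: IH.
rewrite [leRHS]mulrCA; case: ifP => [|_]; last by rewrite mulr_ge0 // mulr_ge0 //; case: ifP => // _; rewrite exprn_ge0.
case: e => [|l [|l' e]] /=; rewrite /nrm; [by case/andP: r0 => ->|by case/andP: r0 => ->|].
by move=> _; rewrite rS pow_inv.
Qed.

Lemma rows_surv K : exists J, 1 / 2 <= surv (rows J) K [:: 0].
Proof.
have d0 : 0 < (4^-1 : R) by lra.
have [eta e0 h] := surv_bound K (leqnn 10) d0.
have bh : beta <= 2^-1 by have := ler_wpM2l b0 z1; rewrite mulr1; have := hz; lra.
have [J hJ] : exists J : nat, 2^-1 ^+ J <= eta.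
  have [J hJ] : exists J : nat, eta^-1 < J%:R by exists (Num.truncn eta^-1).+1; rewrite truncnS_gt.
  exists J; rewrite exprVn -[leRHS]invrK lef_pV2 ?posrE ?invr_gt0 ?exprn_gt0 //.
  apply: le_trans (ltW hJ) _; rewrite -natrX ler_nat; exact: ltnW (ltn_expl _ _).
exists J; have /andP[z0' z1'] := z_small (R := R) (leqnn 10).
apply: le_trans (h _ (rows_cls J) _); first by lra.
case/andP: (rows_mass J) => h1 _; apply: le_trans h1; rewrite lerB //; apply: le_trans hJ.
by rewrite lerXn2r ?nnegrE //; rewrite invr_ge0.
Qed.

End RowLaw.

(** * Crossing a layer *)

Section Zones.
Context {R : realType}.
Implicit Types (x y : coord -> bool) (z : int) (s r : R) (a b m u : R).

Lemma lin_interp a b m u r : `|a| <= r -> `|a + b * m| <= r -> 0 <= u <= m -> `|a + b * u| <= r.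
Proof.
rewrite !ler_norml => /andP[a1 a2] /andP[b1 b2] /andP[u0 um].
have [b0|b0] := leP 0 b.
  have := mulr_ge0 b0 u0; have := ler_wpM2l b0 um => h1 h2; apply/andP; split; lra.
have b0' : 0 <= - b by lra.
have := mulr_ge0 b0' u0; have := ler_wpM2l b0' um => h1 h2; apply/andP; split; lra.
Qed.

Lemma sub_split (x y z v u : R) : x - (y + v) = (x - (z + u)) + ((z - y) + (u - v)).
Proof. by ring. Qed.

Lemma lnzone_box e z t0 n s r : exists M, forall i, lnzone e z t0 n s r i -> inbox M i.
Proof.
have [M h] := zone_fin e t0 (t0 + n) (lnlo z t0 s r) (lnhi z t0 s r).
exists M => -[v|u] hi; apply: h; move: hi => /=.
  move=> [t [tn hv hz]]; exists (t0 + t)%N; rewrite leq_addr ltn_add2l tn; split=> //.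
  by rewrite /lnlo /lnhi ceil_le_int floor_ge_int -addnS !addKn.
by move=> [he hu]; split=> //; exists (absz u); split; lia.
Qed.

Lemma lnzone_sub z z' t0 t0' n n' s s' r r' i : (t0' <= t0)%N -> (t0 + n <= t0' + n')%N ->
  `|z%:~R - (z'%:~R + s' * (t0%:R - t0'%:R))| <= r' - r ->
  `|z%:~R - (z'%:~R + s' * (t0%:R - t0'%:R)) + (s - s') * n%:R| <= r' - r ->
  lnzone false z t0 n s r i -> lnzone false z' t0' n' s' r' i.
Proof.
move=> h1 h2 d1 d2; case: i => [v|u] /=; last by case.
move=> [t [tn hv /andP[z1 z2]]]; have h3 : (t0' + (t0 - t0' + t))%N = (t0 + t)%N by lia.
exists (t0 - t0' + t)%N; rewrite h3; split=> //; first by lia.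
have t1 : 0 <= (t%:R : R) <= n%:R by rewrite ler0n ler_nat ltnW.
have t2 : 0 <= (t.+1%:R : R) <= n%:R by rewrite ler0n ler_nat.
have := lin_interp d1 d2 t1; have := lin_interp d1 d2 t2; rewrite !ler_norml => /andP[k1 k2] /andP[k3 k4].
rewrite -addnS !natrD natrB //; apply/andP; split; lra.
Qed.

Lemma lnzone_slab e z t0 n s r i : lnzone e z t0 n s r i -> slab t0 (t0 + n) i.
Proof. by case: i => [v|u] /=; [move=> [t [t1 t2 _]]; lia|case]. Qed.

Definition tracked e y z t0 n s r g := track e y t0 (t0 + n) g /\
  forall t, (t <= n)%N -> `|(g (t0 + t)%N)%:~R - (z%:~R + s * t%:R)| <= r.

Lemma tracked_dep e x y z t0 n s r g : (forall i, lnzone e z t0 n s r i -> x i = y i) ->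
  tracked e x z t0 n s r g -> tracked e y z t0 n s r g.
Proof.
move=> xy [h1 h2]; split=> //.
apply: (@track_dep _ x y _ _ (lnlo z t0 s r) (lnhi z t0 s r)) h1 => [i hi|].
  apply: xy; case: i hi => [v|u] /=.
    move=> [t [ht hv]]; rewrite /lnlo /lnhi ceil_le_int floor_ge_int => h.
    exists (t - t0)%N; rewrite subnKC; last by lia.
    by split=> //; [lia|rewrite -subSn //; lia].
  by move=> [he [t [ht ->]]]; split=> //; lia.
move=> t ht; have := h2 (t - t0)%N; rewrite subnKC; last by lia.
by move=> /(_ _)/[!ler_distl]; rewrite /lnlo /lnhi ceil_le_int floor_ge_int; apply; lia.
Qed.

End Zones.

Section Layer.
Context {R : realType}.
Variables (p q : R) (n U : nat) (s sigma eps : R).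
Hypotheses (hp : 0 <= p <= 1) (hq : 0 <= q <= 1) (n0 : (0 < n)%N) (s0 : 0 <= s) (ss : s <= sigma) (sigma2 : sigma <= 2)
  (G1 : 30 * U%:R <= 16 * ((sigma - s) * n%:R)) (G2 : 16 * ((sigma - s) * n%:R) <= 30 * U%:R + 30)
  (U1000 : 1000 <= U%:R :> R) (eps0 : 0 < eps).
Notation w := (hom p q).
Let hw : prob_weight w := hom_prob hp hq.
Implicit Types (x y : coord -> bool) (X Y : int -> Prop) (c : int) (T : nat).

(** In the frame of the axis, a layer of [32 * n] times shifts a line of slope [sigma] to the right,
    and one of slope [s] to the left, by [16 * (sigma - s) * n], which is [30 * U] up to 30. All
    positions in a cell follow from this. *)
Let ax : R := (s + sigma) / 2.
Let N := (32 * n)%N.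
Let D : int := Num.floor (ax * N%:R).
Let rho : R := U%:R / 8.

(* Cells are translates of the strip [0, 32 U] along the axis of slope [ax]. [zev] provides a path that uses no long
   edge, starts from [X] in the middle of the cell and overtakes every line of slope [s] started at [31 U]. *)
Definition zev X c T y := exists g, [/\ track false y T (T + 12 * n) g, X (g T), c + 13 * U%:Z <= g T <= c + 19 * U%:Z,
  c%:~R + 22 * U%:R + ax * (12 * n)%:R <= (g (T + 12 * n)%N)%:~R &
  forall t, (t <= 12 * n)%N -> `|(g (T + t)%N)%:~R - ((c + 16 * U%:Z)%:~R + ax * t%:R)| <= 15 * U%:R].

(** Both are the starting points of lines of slope [sigma] with a prescribed end. The right one ends
    [30 * U] from the axis, which is [14 * U] in the cell on the right; the left one at [2 * U],
    which is [18 * U] in the cell on the left. Both are in the starting range of [zev]. They start,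
    at times [14 * n] and [31 * n], just early enough to be left of the line of slope [s], which
    descends from [31 * U] to [U]. *)
Definition zR c : int := c + D + 30 * U%:Z - Num.ceil ((18 * n)%:R * sigma).
Definition zL c : int := c + D + 2 * U%:Z - Num.ceil (n%:R * sigma).
Definition YR c T y b := exists h, tracked false y (zR c) (T + 14 * n) (18 * n) sigma rho h /\ h (T + N)%N = b.
Definition YL c T y b := exists h, tracked false y (zL c) (T + 31 * n) n sigma rho h /\ h (T + N)%N = b.

(** The reached set [X] is frozen and only sites above time [T] are averaged over. Thus [rich] is a
    deterministic property of the past, as required of the states in [transfer]. *)
Definition rich X c T := 1 - eps <= P w (zev X c T).

Lemma zev_sub X Y c T y : (forall a, X a -> Y a) -> zev X c T y -> zev Y c T y.
Proof. by move=> XY [g [g1 g2 g3 g4 g5]]; exists g; split=> //; apply: XY. Qed.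

Lemma zev_tracked X c T y : zev X c T y <-> exists g, [/\ tracked false y (c + 16 * U%:Z) T (12 * n) ax (15 * U%:R) g, X (g T),
  c + 13 * U%:Z <= g T <= c + 19 * U%:Z & c%:~R + 22 * U%:R + ax * (12 * n)%:R <= (g (T + 12 * n)%N)%:~R].
Proof. by split=> [[g [g1 g2 g3 g4 g5]]|[g [[g1 g2] g3 g4 g5]]]; exists g; split. Qed.

Lemma zev_dep X c T : depP (zev X c T) (lnzone false (c + 16 * U%:Z) T (12 * n) ax (15 * U%:R)).
Proof.
move=> x y xy /zev_tracked[g [g1 g2 g3 g4]]; apply/zev_tracked; exists g; split=> //.
exact: tracked_dep g1.
Qed.

Lemma zev_fin X c T : finP (zev X c T).
Proof. exact: finP_dep (@zev_dep X c T) (lnzone_box _ _ _ _ _ _). Qed.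

Lemma zev_slab X c T : depP (zev X c T) (slab T (T + 12 * n)).
Proof. by apply: depP_sub (@zev_dep X c T) => i; apply: lnzone_slab. Qed.

Lemma rich_sub X Y c T : (forall a, X a -> Y a) -> rich X c T -> rich Y c T.
Proof.
move=> XY h; apply: le_trans h _; apply: (P_sub hw); [exact: zev_fin|exact: zev_fin|].
by move=> x; apply: zev_sub.
Qed.

Let nR k : (k * n)%:R = k%:R * n%:R :> R. Proof. exact: natrM. Qed.
Let D1 : D%:~R <= ax * N%:R. Proof. exact: floor_le. Qed.
Let D2 : ax * N%:R < D%:~R + 1.
Proof. by have := floorD1_gt (ax * N%:R); rewrite intrD. Qed.
Let axE m : ax * m = (s * m + sigma * m) / 2. Proof. by rewrite /ax; field. Qed.

Let zRE c : c%:~R + ax * N%:R + 30 * U%:R - (18 * n)%:R * sigma - 2 <= (zR c)%:~R <=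
  c%:~R + ax * N%:R + 30 * U%:R - (18 * n)%:R * sigma.
Proof.
have := D1; have := D2; rewrite /zR; have /andP[] := ceil_itv ((18 * n)%:R * sigma).
rewrite !intrB !intrD intrM -[U%:~R]/(U%:R : R) => h1 h2 h3 h4; apply/andP; split; lra.
Qed.

Let zLE c : c%:~R + ax * N%:R + 2 * U%:R - n%:R * sigma - 2 <= (zL c)%:~R <= c%:~R + ax * N%:R + 2 * U%:R - n%:R * sigma.
Proof.
have := D1; have := D2; rewrite /zL; have /andP[] := ceil_itv (n%:R * sigma).
rewrite !intrB !intrD intrM -[U%:~R]/(U%:R : R) => h1 h2 h3 h4; apply/andP; split; lra.
Qed.

Let zR_off c : `|(zR c)%:~R + sigma * (18 * n)%:R - (c + D + 16 * U%:Z + 16 * U%:Z)%:~R| <= 2 * U%:R + 2.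
Proof.
have /andP[z1 z2] := zRE c; have d1 := D1; have d2 := D2; have g := U1000.
move: z1 z2; move: (zR c) => z z1 z2.
rewrite !intrD !intrM -[U%:~R]/(U%:R : R) ler_norml; apply/andP; split; lra.
Qed.

Let zL_off c : `|(zL c)%:~R + sigma * n%:R - (c + D - 16 * U%:Z + 16 * U%:Z)%:~R| <= 2 * U%:R + 2.
Proof.
have /andP[z1 z2] := zLE c; have d1 := D1; have d2 := D2; have g := U1000.
move: z1 z2; move: (zL c) => z z1 z2.
rewrite subrK intrD ler_norml; apply/andP; split; lra.
Qed.

Let drift a b t : `|a| <= b -> (t <= 12 * n)%N -> `|a + (sigma - ax) * t%:R| <= b + 45 / 4 * (U%:R + 1).
Proof.
move=> ab tn; have g1 := G1; have g2 := G2; have g3 := U1000.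
apply: (@lin_interp _ a (sigma - ax) (12 * n)%:R); last by rewrite ler0n ler_nat.
  by apply: le_trans ab _; lra.
apply: le_trans (ler_normD _ _) (lerD ab _).
rewrite mulrBl axE nR ger0_norm; lra.
Qed.

Let slack : rho + (2 * U%:R + 2 + 45 / 4 * (U%:R + 1)) <= 15 * U%:R.
Proof. by have g := U1000; rewrite /rho; lra. Qed.

(** The path of [zev] overtakes the line [A] within [12 * n] times and jumps onto it; later [H],
    starting to the left of [A], overtakes it and carries the path away. *)
Lemma link X c T y tau (A H : nat -> int) : zev X c T y -> tracked true y (c + 31 * U%:Z) T N s rho A ->
  track false y tau (T + N) H -> (T + 12 * n <= tau < T + N)%N -> H tau <= A tau -> A (T + N)%N <= H (T + N)%N ->
  reached y T (T + N) X (H (T + N)%N).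
Proof.
move=> [z [/track_on z1 z2 z3 z4 _]] [A1 A2] /track_on hH /andP[t1 t2] c1 c2.
have A0 := A2 0%N isT; have A12 := A2 (12 * n)%N; rewrite addn0 in A0.
have nN : (12 * n <= N)%N by rewrite leq_mul2r orbT.
have {}A12 := A12 nN; have nn : (T < T + 12 * n)%N by rewrite -[X in (X < _)%N]addn0 ltn_add2l muln_gt0.
move: A0 A12; rewrite !ler_norml mulr0 addr0 nR => /andP[a1 a2] /andP[b1 b2].
have g1 := G1; have g3 := U1000.
have k1 : z T <= A T.
  rewrite -(ler_int R); case/andP: z3 => _; rewrite -(ler_int R) !intrD intrM -[U%:~R]/(U%:R : R).
  move: a1; rewrite intrD intrM -[U%:~R]/(U%:R : R) /rho; lra.
have k2 : A (T + 12 * n)%N <= z (T + 12 * n)%N.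
  rewrite -(ler_int R); apply: le_trans z4; move: b2; rewrite axE nR intrD intrM -[U%:~R]/(U%:R : R) /rho; lra.
have TN : (T + 12 * n <= T + N)%N by rewrite leq_add2l.
have [m [/andP[m1 m2] S1 _]] := track_cross2 z1 A1 (leqnn T) (leqnn T) nn (leqnn _) TN k1 k2.
set S := splice m z A in S1.
have St t : (T + 12 * n <= t)%N -> S t = A t by move=> ht; rewrite /S /splice leqNgt (leq_trans m2 ht).
have S0 : S T = z T by rewrite /S /splice m1.
have Ttau : (T <= tau)%N by apply: leq_trans t1; exact: leq_addr.
have c1' : H tau <= S tau by rewrite St.
have c2' : S (T + N)%N <= H (T + N)%N by rewrite St.
have [m' [/andP[m1' m2'] _ S2]] := track_cross2 hH S1 (leqnn tau) Ttau t2 (leqnn _) (leqnn _) c1' c2'.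
exists (splice m' S H); split=> //.
- by rewrite /splice (leq_trans Ttau m1') S0.
- by rewrite /splice leqNgt m2'.
Qed.

Lemma reach_R X c T y b : zev X c T y -> Ln true (c + 31 * U%:Z) T N s rho y -> YR c T y b -> reached y T (T + N) X b.
Proof.
move=> hz [A hA] [H [[H1 H2] <-]].
have e : (T + 14 * n + 18 * n = T + N)%N by rewrite -addnA -mulnDl.
rewrite e in H1; have [_ A2] := hA.
have i1 : (14 * n <= N)%N by rewrite leq_mul2r orbT.
have := A2 _ i1; have := A2 _ (leqnn N); have := H2 0%N isT; have := H2 _ (leqnn _).
rewrite e addn0 mulr0 addr0 !ler_norml => /andP[a1 a2] /andP[b1 b2] /andP[k1 k2] /andP[l1 l2].
have /andP[z1 z2] := zRE c; have g1 := G1; have g3 := U1000.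
rewrite /N !nR in a1 a2 b1 b2 k1 k2 l1 l2 z1 z2; rewrite axE in z1 z2.
rewrite !intrD !intrM -![U%:~R]/(U%:R : R) in k1 k2 l1 l2.
rewrite /rho in a1 a2 b1 b2 k1 k2 l1 l2.
apply: (link hz hA H1).
- by rewrite leq_add2l ltn_add2l /N leq_mul2r orbT ltn_mul2r n0.
- rewrite -(ler_int R); lra.
- rewrite -(ler_int R); lra.
Qed.

Lemma reach_L X c T y b : zev X c T y -> Ln true (c + 31 * U%:Z) T N s rho y -> YL c T y b -> reached y T (T + N) X b.
Proof.
move=> hz [A hA] [H [[H1 H2] <-]].
have e : (T + 31 * n + n = T + N)%N by rewrite -addnA -mulSnr.
rewrite e in H1; have [_ A2] := hA.
have i1 : (31 * n <= N)%N by rewrite leq_mul2r orbT.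
have := A2 _ i1; have := A2 _ (leqnn N); have := H2 0%N isT; have := H2 _ (leqnn _).
rewrite e addn0 mulr0 addr0 !ler_norml => /andP[a1 a2] /andP[b1 b2] /andP[k1 k2] /andP[l1 l2].
have /andP[z1 z2] := zLE c; have g1 := G1; have g2 := G2; have g3 := U1000.
rewrite /N !nR in a1 a2 b1 b2 k1 k2 l1 l2 z1 z2; rewrite axE in z1 z2.
rewrite !intrD !intrM -![U%:~R]/(U%:R : R) in k1 k2 l1 l2.
rewrite /rho in a1 a2 b1 b2 k1 k2 l1 l2.
apply: (link hz hA H1).
- by rewrite leq_add2l ltn_add2l /N leq_mul2r orbT ltn_mul2r n0.
- rewrite -(ler_int R); lra.
- rewrite -(ler_int R); lra.
Qed.

(** One and the same line serves twice: its first [18 * n] times bring the path to the end of the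
    layer, its last [12 * n] times are the departure asked for in the next cell. *)
Lemma zev_R c T y : Ln false (zR c) (T + 14 * n) (30 * n) sigma rho y -> zev (YR c T y) (c + D + 16 * U%:Z) (T + N) y.
Proof.
move=> [g [g1 g2]]; have e : (T + N = T + 14 * n + 18 * n)%N by rewrite -addnA -mulnDl.
have e2 : (T + 14 * n + 30 * n = T + N + 12 * n)%N by rewrite -addnA -mulnDl /N -addnA -mulnDl.
have g2' t : (t <= 12 * n)%N -> `|(g (T + N + t)%N)%:~R - ((zR c)%:~R + sigma * (18 * n)%:R + sigma * t%:R)| <= rho.
  move=> tn; have := g2 (18 * n + t)%N; rewrite addnA -e natrD mulrDr addrA; apply.
  by rewrite (_ : (30 = 18 + 12)%N) // mulnDl leq_add2l.
rewrite e2 in g1.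
have /andP[z1 z2] := zRE c; have g11 := G1; have g12 := G2; have g13 := U1000.
have d1 := D1; have d2 := D2.
rewrite /N !nR in z1 z2 d1 d2; rewrite !axE in z1 z2 d1 d2.
have := g2' 0%N isT; rewrite addn0 mulr0 addr0 ler_norml nR => /andP[a1 a2].
have := g2' (12 * n)%N (leqnn _); rewrite ler_norml !nR => /andP[b1 b2].
rewrite /rho in a1 a2 b1 b2.
exists g; split.
- by apply: track_sub g1 _ (leqnn _); rewrite leq_add2l leq_mul2r orbT.
- exists g; split; [split|by []]; first by apply: track_sub g1 (leqnn _) _; rewrite -e leq_addr.
  by move=> t tn; apply: g2; apply: leq_trans tn _; rewrite leq_mul2r orbT.
- by apply/andP; split; rewrite -(ler_int R) !intrD !intrM -![U%:~R]/(U%:R : R); lra.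
- rewrite !intrD intrM -[U%:~R]/(U%:R : R) axE nR; lra.
move=> t tn; have := g2' t tn.
have kk := drift (zR_off c) tn => hh.
rewrite (sub_split _ _ ((zR c)%:~R + sigma * (18 * n)%:R) _ (sigma * t%:R)) -mulrBl.
exact: le_trans (ler_normD _ _) (le_trans (lerD hh kk) slack).
Qed.

Lemma zev_L c T y : Ln false (zL c) (T + 31 * n) (13 * n) sigma rho y -> zev (YL c T y) (c + D - 16 * U%:Z) (T + N) y.
Proof.
move=> [g [g1 g2]]; have e : (T + N = T + 31 * n + n)%N by rewrite -addnA -mulSnr.
have e2 : (T + 31 * n + 13 * n = T + N + 12 * n)%N by rewrite -addnA -mulnDl /N -addnA -mulnDl.
have g2' t : (t <= 12 * n)%N -> `|(g (T + N + t)%N)%:~R - ((zL c)%:~R + sigma * n%:R + sigma * t%:R)| <= rho.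
  move=> tn; have := g2 (n + t)%N; rewrite addnA -e natrD mulrDr addrA; apply.
  by rewrite mulSn leq_add2l.
rewrite e2 in g1.
have /andP[z1 z2] := zLE c; have g11 := G1; have g12 := G2; have g13 := U1000.
have d1 := D1; have d2 := D2.
rewrite /N !nR in z1 z2 d1 d2; rewrite !axE in z1 z2 d1 d2.
have := g2' 0%N isT; rewrite addn0 mulr0 addr0 ler_norml => /andP[a1 a2].
have := g2' (12 * n)%N (leqnn _); rewrite ler_norml !nR => /andP[b1 b2].
rewrite /rho in a1 a2 b1 b2.
exists g; split.
- by apply: track_sub g1 _ (leqnn _); rewrite leq_add2l leq_mul2r orbT.
- exists g; split; [split|by []]; first by apply: track_sub g1 (leqnn _) _; rewrite -e leq_addr.
  by move=> t tn; apply: g2; apply: leq_trans tn _; rewrite leq_pmull.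
- by apply/andP; split; rewrite -(ler_int R) !intrD mulrNz !intrM -![U%:~R]/(U%:R : R); lra.
- rewrite !intrD mulrNz intrM -[U%:~R]/(U%:R : R) axE nR; lra.
move=> t tn; have := g2' t tn.
have kk := drift (zL_off c) tn => hh.
rewrite (sub_split _ _ ((zL c)%:~R + sigma * n%:R) _ (sigma * t%:R)) -mulrBl.
exact: le_trans (ler_normD _ _) (le_trans (lerD hh kk) slack).
Qed.

Lemma YR_dep c T x y : (forall i, lnzone false (zR c) (T + 14 * n) (18 * n) sigma rho i -> x i = y i) -> YR c T x = YR c T y.
Proof.
move=> xy; apply: funext => b; apply: propext; split=> -[h [h1 h2]]; exists h; split=> //.
  exact: tracked_dep xy h1.
by apply: tracked_dep h1 => i /xy.
Qed.

Lemma YL_dep c T x y : (forall i, lnzone false (zL c) (T + 31 * n) n sigma rho i -> x i = y i) -> YL c T x = YL c T y.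
Proof.
move=> xy; apply: funext => b; apply: propext; split=> -[h [h1 h2]]; exists h; split=> //.
  exact: tracked_dep xy h1.
by apply: tracked_dep h1 => i /xy.
Qed.

Hypotheses (pR : P w (fun x => ~ Ln false 0 0 (30 * n) sigma rho x) <= eps ^+ 2)
  (pL : P w (fun x => ~ Ln false 0 0 (13 * n) sigma rho x) <= eps ^+ 2).

Let P_nLn e z a m s' r' : P w (fun x => ~ Ln e z a m s' r' x) = P w (fun x => ~ Ln (R := R) e 0 0 m s' r' x).
Proof. by rewrite !P_not ?P_Ln //; apply: Ln_fin. Qed.

Let RR c T x := rich (YR c T x) (c + D + 16 * U%:Z) (T + N).
Let RL c T x := rich (YL c T x) (c + D - 16 * U%:Z) (T + N).

(** [markov_fubini] with the end of the present layer as past and the first [12 * n] times of the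
    next layer as future; a single line realises both, by [zev_R]. *)
Lemma prob_RR c T : P w (fun x => ~ RR c T x) <= eps.
Proof.
have [M1 h1] := lnzone_box false (zR c) (T + 14 * n) (18 * n) sigma rho.
have [M2 h2] := lnzone_box false (c + D + 16 * U%:Z + 16 * U%:Z) (T + N) (12 * n) ax (15 * U%:R).
apply: (@markov_fubini _ w hw _ (YR c T) (fun S => zev S (c + D + 16 * U%:Z) (T + N))
  (lnzone false (zR c) (T + 14 * n) (18 * n) sigma rho)
  (lnzone false (c + D + 16 * U%:Z + 16 * U%:Z) (T + N) (12 * n) ax (15 * U%:R)) (maxn M1 M2)) => //.
- by move=> i /h1; apply: inbox_le; rewrite leq_maxl.
- by move=> i /h2; apply: inbox_le; rewrite leq_maxr.
- move=> i /lnzone_slab a /lnzone_slab; move: a; have e : (T + 14 * n + 18 * n = T + N)%N by rewrite -addnA -mulnDl.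
  by rewrite e; clear; case: i => [v|u] /=; lia.
- by move=> x y; apply: YR_dep.
- by move=> S; apply: zev_dep.
apply: le_trans pR; rewrite -(P_nLn false (zR c) (T + 14 * n)); apply: (P_sub hw).
- exists (maxn M1 M2) => x y xy nz hz; apply: nz; rewrite (@YR_dep c T x y).
    by apply: zev_dep hz => i /h2 hi; rewrite xy //; apply: inbox_le hi; rewrite leq_maxr.
  by move=> i /h1 hi; rewrite xy //; apply: inbox_le hi; rewrite leq_maxl.
- by apply: finP_not; apply: Ln_fin.
by move=> x nz hl; apply: nz; apply: zev_R.
Qed.

Lemma prob_RL c T : P w (fun x => ~ RL c T x) <= eps.
Proof.
have [M1 h1] := lnzone_box false (zL c) (T + 31 * n) n sigma rho.
have [M2 h2] := lnzone_box false (c + D - 16 * U%:Z + 16 * U%:Z) (T + N) (12 * n) ax (15 * U%:R).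
apply: (@markov_fubini _ w hw _ (YL c T) (fun S => zev S (c + D - 16 * U%:Z) (T + N))
  (lnzone false (zL c) (T + 31 * n) n sigma rho)
  (lnzone false (c + D - 16 * U%:Z + 16 * U%:Z) (T + N) (12 * n) ax (15 * U%:R)) (maxn M1 M2)) => //.
- by move=> i /h1; apply: inbox_le; rewrite leq_maxl.
- by move=> i /h2; apply: inbox_le; rewrite leq_maxr.
- move=> i /lnzone_slab a /lnzone_slab; move: a; have e : (T + 31 * n + n = T + N)%N by rewrite -addnA -mulSnr.
  by rewrite e; clear; case: i => [v|u] /=; lia.
- by move=> x y; apply: YL_dep.
- by move=> S; apply: zev_dep.
apply: le_trans pL; rewrite -(P_nLn false (zL c) (T + 31 * n)); apply: (P_sub hw).
- exists (maxn M1 M2) => x y xy nz hz; apply: nz; rewrite (@YL_dep c T x y).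
    by apply: zev_dep hz => i /h2 hi; rewrite xy //; apply: inbox_le hi; rewrite leq_maxr.
  by move=> i /h1 hi; rewrite xy //; apply: inbox_le hi; rewrite leq_maxl.
- by apply: finP_not; apply: Ln_fin.
by move=> x nz hl; apply: nz; apply: zev_L.
Qed.

Definition crossing env c T X x := (zev X c T x /\ (RR c T x /\ RL c T x)) /\ Ln true (c + 31 * U%:Z) T N s rho (mix env x).

(** The half width is below [16 * U], so cells whose corners are [32 * U] apart read disjoint sites,
    with a margin for the length of a step. *)
Definition strip c T (sl : R) i := lnzone false (c + 16 * U%:Z) T N sl (31 / 2 * U%:R) i.

Let strip_z c T i : lnzone false (c + 16 * U%:Z) T (12 * n) ax (15 * U%:R) i -> strip c T ax i.
Proof.
have u0 : 0 <= U%:R :> R by [].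
apply: lnzone_sub => //; first by rewrite leq_add2l leq_mul2r orbT.
  by rewrite !subrr mulr0 addr0 subrr normr0; lra.
by rewrite !subrr mulr0 mul0r !addr0 subrr normr0; lra.
Qed.

Let strip_R c T i : lnzone false (zR c) (T + 14 * n) (18 * n) sigma rho i -> strip c T ax i.
Proof.
have e : (T + 14 * n + 18 * n = T + N)%N by rewrite -addnA -mulnDl.
have /andP[z1 z2] := zRE c; have g1 := G1; have g2 := G2; have g3 := U1000; have d1 := D1; have d2 := D2.
rewrite /N !nR in z1 z2 d1 d2; rewrite !axE in z1 z2 d1 d2.
apply: lnzone_sub; [exact: leq_addr|by rewrite e| |];
  rewrite natrD [T%:R + _]addrC addrK ?mulrBl !axE !nR intrD intrM -[U%:~R]/(U%:R : R) /rho ler_norml; apply/andP; split; lra.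
Qed.

Let strip_L c T i : lnzone false (zL c) (T + 31 * n) n sigma rho i -> strip c T ax i.
Proof.
have e : (T + 31 * n + n = T + N)%N by rewrite -addnA -mulSnr.
have /andP[z1 z2] := zLE c; have g1 := G1; have g2 := G2; have g3 := U1000; have d1 := D1; have d2 := D2.
rewrite /N !nR in z1 z2 d1 d2; rewrite !axE in z1 z2 d1 d2.
apply: lnzone_sub; [exact: leq_addr|by rewrite e| |];
  rewrite natrD [T%:R + _]addrC addrK ?mulrBl !axE !nR intrD intrM -[U%:~R]/(U%:R : R) /rho ler_norml; apply/andP; split; lra.
Qed.

Let strip_T c T i : lnzone false (c + 31 * U%:Z) T N s rho i -> strip c T ax i.
Proof.
have g1 := G1; have g2 := G2; have g3 := U1000.
apply: lnzone_sub; [by []|by []| |];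
  rewrite subrr mulr0 addr0 ?mulrBl ?axE /N ?nR !intrD !intrM -[U%:~R]/(U%:R : R) /rho ler_norml; apply/andP; split; lra.
Qed.

Let RR_dep c T : depP (RR c T) (lnzone false (zR c) (T + 14 * n) (18 * n) sigma rho).
Proof. by move=> x y xy; rewrite /RR (YR_dep xy). Qed.
Let RL_dep c T : depP (RL c T) (lnzone false (zL c) (T + 31 * n) n sigma rho).
Proof. by move=> x y xy; rewrite /RL (YL_dep xy). Qed.
Let RR_fin c T : finP (RR c T). Proof. exact: finP_dep (@RR_dep c T) (lnzone_box _ _ _ _ _ _). Qed.
Let RL_fin c T : finP (RL c T). Proof. exact: finP_dep (@RL_dep c T) (lnzone_box _ _ _ _ _ _). Qed.

Lemma Ln_mix_dep env c T : depP (fun x => Ln true (c + 31 * U%:Z) T N s rho (mix env x)) (lnzone false (c + 31 * U%:Z) T N s rho).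
Proof.
move=> x y xy; apply: Ln_dep => -[v|u] hi //; exact: (xy (inl v)).
Qed.

Lemma crossing_dep env c T X : depP (crossing env c T X) (strip c T ax).
Proof.
move=> x y xy [[h1 [h2 h3]] h4]; split; [split; [|split]|].
- by apply: zev_dep h1 => i /strip_z; apply: xy.
- by apply: RR_dep h2 => i /strip_R; apply: xy.
- by apply: RL_dep h3 => i /strip_L; apply: xy.
by apply: Ln_mix_dep h4 => i /strip_T; apply: xy.
Qed.

Lemma crossing_fin env c T X : finP (crossing env c T X).
Proof. exact: finP_dep (@crossing_dep env c T X) (lnzone_box _ _ _ _ _ _). Qed.

(** The departure reads the times up to [12 * n] and the exits those after [14 * n], so they are
    independent. The line with long edges shares sites with both and is dealt with by a union
    bound. *)
Lemma prob_crossing env c T X (del : R) : P w (fun x => ~ Ln true (c + 31 * U%:Z) T N s rho (mix env x)) <= del ->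
  P w (zev X c T) * (1 - 2 * eps) - del <= P w (crossing env c T X).
Proof.
move=> hd; pose C x := RR c T x /\ RL c T x; pose B x := Ln true (c + 31 * U%:Z) T N s rho (mix env x).
have fC : finP C by apply: finP_and; [exact: RR_fin|exact: RL_fin].
have fB : finP B := finP_mix env (Ln_fin true (c + 31 * U%:Z) T N s rho).
have fA := zev_fin X c T.
have pC : 1 - 2 * eps <= P w C.
  have : P w (fun x => ~ C x) <= 2 * eps.
    apply: (@le_trans _ _ (P w (fun x => ~ RR c T x \/ ~ RL c T x))).
      apply: (P_sub hw); [exact: finP_not|by apply: finP_or; apply: finP_not; [exact: RR_fin|exact: RL_fin]|].
      by move=> x /not_andP.
    apply: le_trans (P_or hw _ _) _; [apply: finP_not; exact: RR_fin|apply: finP_not; exact: RL_fin|].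
    apply: le_trans (lerD (prob_RR c T) (prob_RL c T)) _; by rewrite [leRHS]mulr_natl mulr2n.
  by rewrite P_not // lerBlDr -lerBlDl.
have AC : P w (fun x => zev X c T x /\ C x) = P w (zev X c T) * P w C.
  apply: (P_indep w fA fC (@zev_slab X c T) (D' := slab (T + 14 * n) (T + N))).
    move=> x y xy [h1 h2]; split.
      apply: RR_dep h1 => i hi; apply: xy; have := lnzone_slab hi.
      by rewrite -addnA -mulnDl.
    apply: RL_dep h2 => i hi; apply: xy; have := lnzone_slab hi.
    have e : (T + 31 * n + n = T + N)%N by rewrite -addnA -mulSnr.
    have e2 : (T + 14 * n <= T + 31 * n)%N by rewrite leq_add2l leq_mul2r orbT.
    by rewrite e; case: (i) => [v|u] /=; move: e2; clear; lia.
  have e2 : (T + 12 * n <= T + 14 * n)%N by rewrite leq_add2l leq_mul2r orbT.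
  by move=> [v|u] /=; move: e2; clear; lia.
have fAC : finP (fun x => zev X c T x /\ C x) by apply: finP_and.
have hd' : P w (fun x => ~ B x) <= del := hd.
have h1 : P w (fun x => zev X c T x /\ C x) <= P w (crossing env c T X) + P w (fun x => ~ B x).
  apply: le_trans (P_or hw (crossing_fin _ _ _ _) (finP_not fB)).
  apply: (P_sub hw) => //; first by apply: finP_or; [exact: crossing_fin|exact: finP_not].
  by move=> x h; have [b|b] := pselect (B x); [left|right].
have h2 : P w (zev X c T) * (1 - 2 * eps) <= P w (zev X c T) * P w C by rewrite ler_wpM2l // P_ge0.
rewrite AC in h1; apply: le_trans (lerB h2 hd') _; rewrite lerBlDr; exact: h1.
Qed.

Lemma crossing_rich env c T X x : crossing env c T X x ->
  rich (reached (mix env x) T (T + N) X) (c + D + 16 * U%:Z) (T + N) /\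
  rich (reached (mix env x) T (T + N) X) (c + D - 16 * U%:Z) (T + N).
Proof.
move=> [[h1 [h2 h3]] h4].
have zm : zev X c T (mix env x).
  by case: h1 => g [g1 g2 g3 g4 g5]; exists g; split=> //; apply/track_mix.
have tm z t0 m g : tracked false x z t0 m sigma rho g -> tracked false (mix env x) z t0 m sigma rho g.
  by move=> [t1 t2]; split=> //; apply/track_mix.
split; [apply: rich_sub h2 => b [h [k1 k2]]|apply: rich_sub h3 => b [h [k1 k2]]].
  by apply: reach_R zm h4 _; exists h; split=> //; apply: tm.
by apply: reach_L zm h4 _; exists h; split=> //; apply: tm.
Qed.

Variables (a : int) (v del : R).
Hypotheses (eps1 : eps < 1) (v0 : 0 <= v).

(* The bad layers are crossed along the fixed vector [(a, N)]. *)
Definition vec (o : int) T y := exists g, [/\ tracked false y o T N sigma (U%:R / 4) g, g T = o & g (T + N)%N = o + a].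
Hypothesis (pv : v <= P w (vec 0 0)).

Definition inner (c o : int) := c + 13 * U%:Z <= o <= c + 19 * U%:Z.

Lemma vec_zev c T o y : inner c o -> vec o T y -> zev (eq o) c T y.
Proof.
move=> /andP[i1 i2] [g [[h1 h2] h3 h4]]; exists g.
have g1 := G1; have g2 := G2; have g3 := U1000.
have nN : (12 * n <= N)%N by rewrite leq_mul2r orbT.
have j1 := i1; have j2 := i2; rewrite -(ler_int R) !intrD !intrM -![U%:~R]/(U%:R : R) in j1.
rewrite -(ler_int R) !intrD !intrM -![U%:~R]/(U%:R : R) in j2.
split.
- by apply: track_sub h1 _ _; rewrite ?leq_add2l.
- by rewrite h3.
- by rewrite h3; apply/andP.
- by have := h2 _ nN; rewrite ler_norml axE nR => /andP[k1 k2]; lra.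
move=> t tn; have hh := h2 t (leq_trans tn nN).
have e1 : o%:~R - (c + 16 * U%:Z)%:~R = o%:~R - (c%:~R + 16 * U%:R) :> R by rewrite intrD intrM.
have q1 : `|o%:~R - (c + 16 * U%:Z)%:~R| <= 3 * U%:R :> R.
  by rewrite e1 ler_norml; apply/andP; split; lra.
have kk := drift q1 tn.
rewrite (sub_split _ _ o%:~R _ (sigma * t%:R)) -mulrBl.
apply: le_trans (ler_normD _ _) _; apply: le_trans (lerD hh kk) _; lra.
Qed.

Lemma vec_dep o T : depP (vec o T) (lnzone false o T N sigma (U%:R / 4)).
Proof. by move=> x y xy [g [h1 h2 h3]]; exists g; split=> //; apply: tracked_dep h1. Qed.

Lemma vec_fin o T : finP (vec o T).
Proof. exact: finP_dep (@vec_dep o T) (lnzone_box _ _ _ _ _ _). Qed.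

Lemma P_vec o T : P w (vec o T) = P w (vec 0 0).
Proof.
rewrite -(P_shift p q o T%:Z (vec_fin 0 0)); apply: P_eq => x; split.
  move=> [g [[h1 h2] h3 h4]]; exists (fun t => g (t + T)%N - o); split.
  - split.
      apply/track_shift; rewrite !add0n [(N + T)%N]addnC; apply: track_eq h1 => t ht.
      by rewrite subnK ?subrK //; case/andP: ht.
    by move=> t tn; have := h2 t tn; rewrite add0n addnC intrB; congr (`|_| <= _); rewrite (_ : 0%:~R = 0 :> R) //; ring.
  - by rewrite add0n h3 subrr.
  - by rewrite add0n add0r addnC h4 addrC addKr.
move=> [g [[h1 h2] h3 h4]]; exists (fun t => g (t - T)%N + o); split.
- split; first by move/track_shift: h1; rewrite !add0n [(N + T)%N]addnC.
  by move=> t tn; have := h2 t tn; rewrite addKn intrD !add0n; congr (`|_| <= _); rewrite (_ : 0%:~R = 0 :> R) //; ring.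
- by rewrite subnn h3 add0r.
- by rewrite addKn -[N]add0n h4 add0r addrC.
Qed.

Lemma strip_vec c T o i : inner c o -> lnzone false o T N sigma (U%:R / 4) i -> strip c T sigma i.
Proof.
move=> /andP[]; rewrite -!(ler_int R) !intrD !intrM -![U%:~R]/(U%:R : R) => j1 j2; have g3 := U1000.
by apply: lnzone_sub => //; rewrite subrr ?mul0r mulr0 !addr0 intrD intrM -[U%:~R]/(U%:R : R) ler_norml;
  apply/andP; split; lra.
Qed.

Fixpoint transit env b c T (o : int) y : Prop := if b is b'.+1 then vec o T y /\ transit env b' (c + a) (T + N)%N (o + a) y
  else crossing env c T (eq o) y.

Fixpoint region b c T i : Prop := if b is b'.+1 then strip c T sigma i \/ region b' (c + a) (T + N)%N i
  else strip c T ax i.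

Lemma inner_add c o : inner c o -> inner (c + a) (o + a).
Proof. by rewrite /inner ![c + a + _]addrAC !lerD2r. Qed.

Lemma transit_dep env b c T o : inner c o -> depP (transit env b c T o) (region b c T).
Proof.
elim: b c T o => [|b IH] c T o hi; first exact: crossing_dep.
move=> x y xy [h1 h2]; split.
  by apply: vec_dep h1 => i /(strip_vec hi) hs; apply: xy; left.
by apply: (IH _ _ _ (inner_add hi)) h2 => i hs; apply: xy; right.
Qed.

Lemma region_slab b c T i : region b c T i -> slab T (T + b.+1 * N) i.
Proof.
elim: b c T => [|b IH] c T /=; first by rewrite mul1n; apply: lnzone_slab.
rewrite mulSn addnA; case=> [/lnzone_slab|/IH]; case: i {IH} => [u|u] /=; move: (b.+1 * N)%N; clear; lia.
Qed.

Lemma region_box b c T : exists M, forall i, region b c T i -> inbox M i.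
Proof.
elim: b c T => [|b IH] c T; first exact: lnzone_box.
have [M1 h1] := lnzone_box false (c + 16 * U%:Z) T N sigma (31 / 2 * U%:R).
have [M2 h2] := IH (c + a) (T + N)%N; exists (maxn M1 M2) => i /= [/h1|/h2]; apply: inbox_le.
  by rewrite leq_maxl.
by rewrite leq_maxr.
Qed.

Lemma strip_disjoint c c' T sl i : 0 <= sl <= 2 -> c + 32 * U%:Z <= c' -> strip c T sl i -> strip c' T sl i -> False.
Proof.
move=> /andP[l1 l2] cc; case: i => [u|u]; last by case.
move=> [t [t1 t2 /andP[_ t3]]] [t' [u1 u2 /andP[u3 _]]]; have e : t = t' by clear -t2 u2; lia.
rewrite -e in u3; move: cc; rewrite -(ler_int R) => cc; have g3 := U1000.
by move: t3 u3 cc; rewrite !intrD !intrM -natr1 -![U%:~R]/(U%:R : R); lra.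
Qed.

Lemma region_disjoint b c c' T i : c + 32 * U%:Z <= c' -> region b c T i -> region b c' T i -> False.
Proof.
have sg : 0 <= sigma <= 2 by have := s0; have := ss; have := sigma2 => *; apply/andP; split; lra.
elim: b c c' T => [|b IH] c c' T cc /=.
  apply: strip_disjoint => //; have := s0; have := ss; have := sigma2; rewrite /ax => *; apply/andP; split; lra.
case=> [h|h] [k|k].
- exact: strip_disjoint cc h k.
- have := lnzone_slab h; have := region_slab k; case: i {h k IH} => [u|u] /=; move: (b.+1 * N)%N; clear; lia.
- have := lnzone_slab k; have := region_slab h; case: i {h k IH} => [u|u] /=; move: (b.+1 * N)%N; clear; lia.
by apply: IH h k; rewrite addrAC lerD2r.
Qed.

Definition layer_fail env T := P w (fun x => ~ Ln true 0 T N s rho (mix env x)).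

Lemma layer_fail_shift env c T : P w (fun x => ~ Ln true c T N s rho (mix env x)) = layer_fail env T.
Proof.
have f c' : finP (fun x => ~ Ln true c' T N s rho (mix env x)).
  exact (finP_not (finP_mix env (Ln_fin true c' T N s rho))).
rewrite /layer_fail -(P_shift p q c 0 (f 0)); apply: P_eq => x.
have -> : mix env (x \o sh c 0) = mix env x \o sh c 0.
  by apply: funext => -[u|u] /=; rewrite ?mulr0 ?addr0.
suff H y : Ln true c T N s rho y <-> Ln true 0 T N s rho (y \o sh c 0) by split=> h1 h2; apply: h1; apply/H.
rewrite -(Ln_shift true c T) -(Ln_shift true 0 T).
have -> // : y \o sh c T%:Z = (y \o sh c 0) \o sh 0 T%:Z.
by apply: funext => -[u|u] /=; congr y; congr (inl (_, _)) || congr inr; ring.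
Qed.

Definition last_rate := v * (1 - 2 * eps) - del.

Lemma transit_prob env b c T o : inner c o -> 0 <= 1 - 2 * eps -> layer_fail env (T + b * N) <= del ->
  v ^+ b * last_rate <= P w (transit env b c T o).
Proof.
move=> hi e2; elim: b c T o hi => [|b IH] c T o hi hd.
  rewrite expr0 mul1r /=; rewrite mul0n addn0 in hd.
  apply: le_trans (prob_crossing (eq o) _); last by rewrite layer_fail_shift; exact: hd.
  rewrite lerD2r ler_wpM2r //; apply: le_trans pv _; rewrite -(P_vec o T).
  by apply: (P_sub hw); [exact: vec_fin|exact: zev_fin|move=> y; apply: vec_zev].
have hi' := inner_add hi.
have d1 : depP (vec o T) (slab T (T + N)) by apply: depP_sub (@vec_dep o T) => i; apply: lnzone_slab.
have d2 : depP (transit env b (c + a) (T + N) (o + a)) (slab (T + N) (T + N + b.+1 * N)).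
  by apply: depP_sub (@transit_dep env b _ _ _ hi') => i; apply: region_slab.
have f2 : finP (transit env b (c + a) (T + N) (o + a)).
  exact: finP_dep (@transit_dep env b _ _ _ hi') (region_box _ _ _).
rewrite [P w _](P_indep w (vec_fin o T) f2 d1 d2); last first.
  by move=> [u|u] /=; move: (b.+1 * N)%N; clear; lia.
have hv : v <= P w (vec o T) by rewrite P_vec.
have hI := IH _ (T + N)%N _ hi'; rewrite -addnA -mulSn in hI; have {}hI := hI hd.
rewrite exprS -mulrA; have [l0|l0] := leP 0 last_rate.
  by apply: ler_pM => //; rewrite mulr_ge0 ?exprn_ge0.
apply: (@le_trans _ _ 0); last by rewrite mulr_ge0 ?P_ge0.
by rewrite mulrA mulr_ge0_le0 ?mulr_ge0 ?exprn_ge0 // ltW.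
Qed.

Lemma transit_rich env b c T o y : transit env b c T o y ->
  let T' := (T + b.+1 * N)%N in let c' := c + b%:Z * a + D in
  rich (reached (mix env y) T T' (eq o)) (c' + 16 * U%:Z) T' /\ rich (reached (mix env y) T T' (eq o)) (c' - 16 * U%:Z) T'.
Proof.
elim: b c T o => [|b IH] c T o /=.
  by rewrite mul1n mul0r addr0; apply: crossing_rich.
move=> [[g [[h1 h2] h3 h4]] ht]; have := IH _ _ _ ht => /=; rewrite -addnA -mulSn.
have -> : c + a + b%:Z * a + D = c + b.+1%:Z * a + D by rewrite -addn1 PoszD; ring.
have H z : reached (mix env y) (T + N) (T + b.+2 * N) (eq (o + a)) z -> reached (mix env y) T (T + b.+2 * N) (eq o) z.
  move=> hz; apply: (@reached_add _ _ (T + N)) => //; [exact: leq_addr|by rewrite leq_add2l mulSn leq_addr|].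
  apply: reached_sub hz => u <-; exists g; split=> //; apply: track_on; exact/track_mix.
by move=> [r1 r2]; split; [apply: rich_sub r1|apply: rich_sub r2].
Qed.

Lemma rich_point X c T : rich X c T -> exists2 o, X o & inner c o.
Proof.
move=> hr; apply: contrapT => nx; move: hr; rewrite /rich (_ : P w _ = 0).
  by rewrite subr_le0 leNgt eps1.
rewrite -(E_cst w 0); apply: E_eq => y; rewrite ind_f // => -[g [_ g1 g2 _ _]]; apply: nx; by exists (g T).
Qed.

Definition rate b : R := if b is 0 then (1 - eps) * (1 - 2 * eps) - del else v ^+ b * last_rate.

Lemma superrow_event env b c T X : rich X c T -> 0 <= 1 - 2 * eps -> layer_fail env (T + b * N) <= del -> exists A,
  [/\ depP A (region b c T), rate b <= P w A & forall y, A y ->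
    let T' := (T + b.+1 * N)%N in let c' := c + b%:Z * a + D in
    rich (reached (mix env y) T T' X) (c' + 16 * U%:Z) T' /\ rich (reached (mix env y) T T' X) (c' - 16 * U%:Z) T'].
Proof.
move=> hr e2 hd; case: b hd => [|b] hd.
  exists (crossing env c T X); split.
  - exact: crossing_dep.
  - apply: le_trans (prob_crossing X _); last by rewrite layer_fail_shift; rewrite mul0n addn0 in hd; exact: hd.
    by rewrite lerD2r ler_wpM2r.
  - by move=> y; rewrite /= mul1n mul0r addr0; apply: crossing_rich.
have [o Xx hi] := rich_point hr; exists (transit env b.+1 c T o); split.
- exact: transit_dep.
- exact: transit_prob.
move=> y /transit_rich[r1 r2] /=.
by split; [apply: rich_sub r1|apply: rich_sub r2] => z; apply: reached_sub => u <-.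
Qed.

(** * All layers in a fixed environment *)

Section Cascade.
Variables (env : nat -> bool) (bs : nat -> nat) (K : nat) (rr : nat -> R).

Fixpoint tm j : nat := if j is j'.+1 then (tm j' + (bs j').+1 * N)%N else 0%N.
Fixpoint ofs j : int := if j is j'.+1 then ofs j' + (bs j')%:Z * a + D else 0.
Definition corner j (k : int) : int := ofs j + (2 * k - (odd j)%:Z) * (16 * U%:Z).
Definition start := inner 0.

Lemma tm_le i j : (i <= j)%N -> (tm i <= tm j)%N.
Proof. by move=> /subnKC <-; elim: (j - i)%N => [|m IH]; rewrite ?addn0 // addnS (leq_trans IH) //= leq_addr. Qed.

Lemma run_reached n' i x X b : run (fun j x X => reached (mix env x) (tm j) (tm j.+1) X) i n' x X b ->
  reached (mix env x) (tm i) (tm (i + n')) X b.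
Proof.
elim: n' i X b => [|m IH] i X b /=.
  rewrite addn0 => hX; exists (fun=> b); split=> // t; by rewrite ltnNge andbN.
by move=> /IH; rewrite addSnnS; apply: reached_add; apply: tm_le; [exact: leqnSn|rewrite addnS ltnS leq_addr].
Qed.

Lemma cascade_box : exists M, forall j k i, (j < K)%N -> `|k| <= j%:Z -> region (bs j) (corner j k) (tm j) i -> inbox M i.
Proof.
have [f hf] := choice (fun jk : nat * int => region_box (bs jk.1) (corner jk.1 jk.2) (tm jk.1)).
exists (\max_(j < K) \max_(m < (2 * K).+1) f (val j, (m%:Z - K%:Z)%R)) => j k i jK kj hi.
have hm : (absz (k + K%:Z)%R < (2 * K).+1)%N by move: jK kj; clear; lia.
have hk : (Ordinal hm)%:Z - K%:Z = k by rewrite /=; move: jK kj; clear; lia.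
apply: inbox_le (hf (j, k) i hi).
apply: leq_trans (leq_bigmax (F := fun j : 'I_K => \max_(m < (2 * K).+1) f (val j, (m%:Z - K%:Z)%R)) (Ordinal jK)).
apply: leq_trans (leq_bigmax (F := fun m : 'I_(2 * K).+1 => f (j, (m%:Z - K%:Z)%R)) (Ordinal hm)).
by rewrite hk.
Qed.

Lemma corner_sep j k l : k < l -> corner j k + 32 * U%:Z <= corner j l.
Proof.
move=> kl; rewrite /corner -subr_ge0.
have -> : ofs j + (2 * l - (odd j)%:Z) * (16 * U%:Z) - (ofs j + (2 * k - (odd j)%:Z) * (16 * U%:Z) + 32 * U%:Z) =
  32 * U%:Z * (l - k - 1) by ring.
by rewrite mulr_ge0 // subr_ge0 -subr_ge0; move: kl; clear; lia.
Qed.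

Lemma corner_next j k l : l \in spr j k -> let c' := corner j k + (bs j)%:Z * a + D in
  corner j.+1 l = c' + 16 * U%:Z \/ corner j.+1 l = c' - 16 * U%:Z.
Proof.
by rewrite in_spr /corner /=; case: (odd j) => /= /orP[] /eqP ->; [left|right|right|left]; ring.
Qed.

Hypotheses (e2 : 0 <= 1 - 2 * eps) (hrr : unit_par rr) (hK : forall j, (j < K)%N -> rr j <= rate (bs j))
  (hd : forall j, (j < K)%N -> layer_fail env (tm j + bs j * N) <= del) (hs : rich start 0 0).

(** [transfer] in a fixed environment: the state at level [j] is the set reached at time [tm j], and
    a cell is occupied if this set is rich there. *)
Lemma cascade B : finP B -> (forall y b, reached y 0 (tm K) start b -> B y) ->
  QS rr K 0 [:: 0] <= P w (fun x => B (mix env x)).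
Proof.
move=> [M0 h0] hB; have [M1 h1] := cascade_box; pose M := maxn M0 M1.
have dB : depP (fun x => B (mix env x)) (inbox M).
  by apply: depP_mix; apply: depP_sub h0 => i; apply: inbox_le; exact: leq_maxl.
rewrite (P_box w xfalse dB).
pose next j x X := reached (mix env x) (tm j) (tm j.+1) X.
pose occ j X k := `|k| <= j%:Z /\ rich X (corner j k) (tm j).
apply: (le_trans (@transfer _ _ w (boxl M) xfalse (fun j => slab (tm j) (tm j.+1)) _ next occ
  (fun X => exists b, X b) rr K K 0%N start [:: 0] hw hrr _ _ (add0n K) _ _ _)).
- have H j k l : (j < k)%N -> slab (tm j) (tm j.+1) l -> slab (tm k) (tm k.+1) l -> False.
    by move=> jk; move: (tm j) (tm j.+1) (tm k) (tm k.+1) (tm_le jk); clear; case: l => [u|u] /=; lia.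
  by move=> j k l /eqP; rewrite neq_ltn => /orP[] h a1 a2; [apply: H h a1 a2|apply: H h a2 a1].
- by move=> j X x y xy; apply: reached_dep => -[v'|u] hi //; exact: (xy (inl v')).
- move=> j X Y jK hY.
  have hA k : exists A, k \in Y -> [/\ depP A (region (bs j) (corner j k) (tm j)), rate (bs j) <= P w A & forall y, A y ->
    let T' := (tm j + (bs j).+1 * N)%N in let c' := corner j k + (bs j)%:Z * a + D in
    rich (reached (mix env y) (tm j) T' X) (c' + 16 * U%:Z) T' /\ rich (reached (mix env y) (tm j) T' X) (c' - 16 * U%:Z) T'].
    have [kY|kY] := boolP (k \in Y); last by exists (fun=> True).
    by have [_ hr] := hY k kY; have [A h] := superrow_event hr e2 (hd jK); exists A.
  have [A {}hA] := choice hA; exists A, (fun k => region (bs j) (corner j k) (tm j)); split.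
  + by move=> k /hA[].
  + move=> k l i _ _ /eqP; rewrite neq_lt => /orP[] kl r1 r2.
      exact: region_disjoint (corner_sep _ kl) r1 r2.
    exact: region_disjoint (corner_sep _ kl) r2 r1.
  + move=> k kY; have [hk _] := hY k kY; have [d1 d2 _] := hA k kY; apply: le_trans (hK jK) _; apply: le_trans d2 _.
    rewrite (@P_box _ w (A k) M xfalse) //; apply: depP_sub d1 => i hi.
    by apply: inbox_le (h1 _ _ _ jK hk hi); exact: leq_maxr.
  move=> x k l kY Ax hl; have [hk _] := hY k kY; have [_ _ d3] := hA k kY; have [r1 r2] := d3 x Ax; split.
    by move: hl hk; rewrite in_spr; case: (odd j) => /orP[] /eqP ->; clear; lia.
  by case: (corner_next hl) => ->.
- by move=> X k [_ /rich_point[o]]; exists o.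
- by move=> k; rewrite inE => /eqP ->; split=> //; rewrite /corner /= mulr0 subrr mul0r addr0.
by apply: Pr_sub => // x [b /run_reached]; rewrite add0n; apply: hB.
Qed.

End Cascade.

Section RowSurvival.
Hypotheses (del0 : 0 < del).

Definition good_layer (es : seq bool) : bool := `[< layer_fail (nth false es) 0 <= del >].

Notation layers := (pow_law (env_law q) N).

Lemma layer_fail_ext env env' T : (forall t, (T <= t < T + N)%N -> env t = env' t) -> layer_fail env T = layer_fail env' T.
Proof.
move=> h; apply: P_eq => x; suff H e1 e2 : (forall t, (T <= t < T + N)%N -> e1 t = e2 t) ->
    Ln true 0 T N s rho (mix e1 x) -> Ln true 0 T N s rho (mix e2 x).
  by split=> h1 h2; apply: h1; apply: H h2 => // t ht; rewrite h.
move=> h'; apply: Ln_dep => -[//|u] [_ hu] /=; apply: h'; move: hu; clear; lia.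
Qed.

Lemma layer_fail_time env T : layer_fail env T = layer_fail (fun t => env (T + t)%N) 0.
Proof.
pose env' t := env (T + t)%N.
have f : finP (fun x => ~ Ln true 0 0 N s rho (mix env' x)) by exact (finP_not (finP_mix env' (Ln_fin true 0 0 N s rho))).
rewrite /layer_fail -(P_shift p q 0 T%:Z f); apply: P_eq => x.
have H : Ln true 0 0 N s rho (mix env' (x \o sh 0 T%:Z)) <-> Ln true 0 0 N s rho (mix env x \o sh 0 T%:Z).
  have e i : lnzone true 0 0 N s rho i -> mix env' (x \o sh 0 T%:Z) i = (mix env x \o sh 0 T%:Z) i.
    by case: i => [//|u] [_ hu] /=; rewrite /env'; congr (env _); move: hu; clear; lia.
  by split; apply: Ln_dep => i /e.
by split=> h1 h2; apply: h1; [apply/(Ln_shift true 0 T)/H|apply/H/(Ln_shift true 0 T)].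
Qed.

(** Markov's inequality for the quenched failure probability, whose mean over the environment is the
    annealed one. *)
Lemma bad_layers : \sum_(l <- layers | ~~ good_layer l.2) l.1 <= P w (fun x => ~ Ln true 0 0 N s rho x) / del.
Proof.
rewrite ler_pdivlMr //.
have hB : depP (fun x => ~ Ln true 0 0 N s rho x) (envdom N).
  by apply: depP_not; apply: depP_sub (@Ln_dep _ true 0 0 N s rho) => -[v'|u] //= [_]; rewrite add0n.
have fB : finP (fun x => ~ Ln true 0 0 N s rho x) by exact (finP_not (Ln_fin true 0 0 N s rho)).
rewrite (anneal p q fB hB) -sum_pow mulr_suml [leLHS]big_mkcond.
have hL : nneg layers by apply: nneg_pow; case/andP: hq => q0 q1; rewrite /nneg /= q0 subr_ge0 q1.
elim: (pow_law _ _) hL => [|l L IH]; first by rewrite !big_nil.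
move=> /andP[l0 hL]; rewrite !big_cons lerD ?IH //; case: ifP => [/asboolPn hl|_]; last by rewrite mulr_ge0 ?P_ge0.
by rewrite ler_wpM2l // ltW // ltNge; apply/negP.
Qed.

Lemma layers_mass : nneg layers /\ mass layers = 1.
Proof.
split; first by apply: nneg_pow; case/andP: hq => q0 q1; rewrite /nneg /= q0 subr_ge0 q1.
by rewrite mass_pow /mass big_cons big_seq1 /= addrC subrK expr1n.
Qed.

Lemma layers_size : all (fun l => size l.2 == N) layers.
Proof.
apply: sub_all (supp_pow (Q := xpredT) N (L := env_law q) _) => [l /andP[]//|]; exact: all_predT.
Qed.

Lemma start_rich : rich start 0 0.
Proof.
have g1 := G1; have g2 := G2; have g3 := U1000.
have h : P w (Ln false (14 * U%:Z) 0 (13 * n) sigma rho) <= P w (zev start 0 0).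
  apply: (P_sub hw); [exact: Ln_fin|exact: zev_fin|].
  move=> y [g [h1 h2]]; exists g; have n13 : (12 * n <= 13 * n)%N by rewrite leq_mul2r orbT.
  have h0 := h2 0%N isT; have h12 := h2 _ n13.
  rewrite !add0n mulr0 addr0 in h0 h12.
  rewrite ler_norml intrM -[U%:~R]/(U%:R : R) /rho in h0; case/andP: h0 => a1 a2.
  rewrite ler_norml intrM -[U%:~R]/(U%:R : R) /rho nR in h12; case/andP: h12 => b1 b2.
  have inn : inner 0 (g 0%N).
    by rewrite /inner !add0r; apply/andP; split; rewrite -(ler_int R) !intrM -![U%:~R]/(U%:R : R); lra.
  split=> //.
  - by apply: track_sub h1 _ _ => //; rewrite !add0n.
  - by rewrite add0n add0r axE nR; lra.
  move=> t tn; have hh := h2 t (leq_trans tn n13).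
  have q1 : `|(14 * U%:Z)%:~R - (0 + 16 * U%:Z)%:~R| <= 2 * U%:R + 2 :> R.
    rewrite (_ : _ - _ = - (2 * U%:R) :> R); first by rewrite normrN ger0_norm ?mulr_ge0 // lerDl.
    by rewrite add0r !intrM -![U%:~R]/(U%:R : R); ring.
  have kk := drift q1 tn.
  rewrite (sub_split _ _ (14 * U%:Z)%:~R _ (sigma * t%:R)) -mulrBl.
  exact: le_trans (ler_normD _ _) (le_trans (lerD hh kk) slack).
apply: le_trans h; have := pL; rewrite -(P_nLn false (14 * U%:Z) 0) P_not; last exact: Ln_fin.
have e1' := eps1; have e0' := eps0.
have : eps ^+ 2 <= eps by rewrite expr2 ler_piMl // ltW.
lra.
Qed.

Lemma SR_shape (T : Type) (good Q : pred T) (L : seq (R * T)) J (d : T) : all (fun l => Q l.2) L ->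
  all (fun e => [&& (0 < size e.2)%N, all Q e.2 & good (last d e.2)]) (SR good L J).
Proof.
move=> hL; elim: J => //= J IH; rewrite all_cat all_map all_filter; apply/andP; split.
  by apply: sub_all hL => l h /=; apply/implyP => ->; rewrite h.
apply: (all_allpairs (P1 := fun l => Q l.2)) IH _; first by rewrite all_filter; apply: sub_all hL => l h /=; apply/implyP.
by move=> l [c [//|l' e]] /= h1 /andP[/andP[h2 h3] h4]; rewrite h1 h2 h3.
Qed.

Section Shape.
Variables (ess : seq (seq (seq bool))) (K : nat).
Hypotheses (sz : size ess = K)
  (hess : all (fun e => [&& (0 < size e)%N, all (fun l => size l == N) e & good_layer (last [::] e)]) ess).
Notation bs := (fun j => (size (nth [::] ess j)).-1).

Let hj j : (j < K)%N -> [/\ (0 < size (nth [::] ess j))%N, all (fun l => size l == N) (nth [::] ess j) &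
  good_layer (last [::] (nth [::] ess j))].
Proof. by move=> jK; have /(all_nthP [::])/(_ j) := hess; rewrite sz => /(_ jK)/and3P[]. Qed.

Lemma size_layers (e : seq (seq bool)) : all (fun l => size l == N) e -> size (flatten e) = (size e * N)%N.
Proof. by elim: e => //= l e IH /andP[/eqP h1 /IH h2]; rewrite size_cat h1 h2 mulSn. Qed.

Lemma size_before j : (j <= K)%N -> size (flatten (flatten (take j ess))) = tm bs j.
Proof.
elim: j => [|j IH] jK; first by rewrite take0.
have [h1 h2 _] := hj jK.
rewrite (take_nth [::]) ?sz // flatten_rcons flatten_cat size_cat IH ?(ltnW jK) // size_layers //=.
by rewrite prednK.
Qed.

Lemma good_at j : (j < K)%N -> layer_fail (nth false (flatten (flatten ess))) (tm bs j + bs j * N) <= del.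
Proof.
move=> jK; have [h1 h2 /asboolP h3] := hj jK; rewrite layer_fail_time; apply: le_trans h3.
set e := nth [::] ess j in h1 h2 *.
rewrite le_eqVlt; apply/orP; left; apply/eqP; apply: layer_fail_ext => t ht.
have [e' [l el]] : exists e' l, e = rcons e' l by case/lastP: (e) h1 => // e' l _; exists e', l.
rewrite el last_rcons; rewrite el all_rcons in h2; case/andP: h2 => /eqP hl h2.
rewrite -{1}(cat_take_drop j ess) (drop_nth [::]) ?sz // -/e el flatten_cat flatten_cat /=.
rewrite flatten_cat -cats1 flatten_cat /= cats0 -!catA nth_cat size_before ?(ltnW jK) //.
rewrite -addnA ltnNge leq_addr /= addKn nth_cat size_layers //.
rewrite size_cat addn1 /= ltnNge leq_addr /= addKn.
by rewrite nth_cat hl; move: ht; rewrite add0n => /andP[_ ->].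
Qed.

Lemma take_env (u : nat) : (u < N * K)%N -> nth false (flatten (take K (flatten ess))) u = nth false (flatten (flatten ess)) u.
Proof.
move=> hu; have hall : all (fun l => size l == N) (flatten ess).
  by elim: (ess) hess => //= e es IH /andP[/and3P[_ h _] /IH]; rewrite all_cat h.
have hK : (K <= size (flatten ess))%N.
  rewrite -sz; elim: (ess) hess => //= e es IH /andP[/and3P[h _ _] /IH h']; rewrite size_cat -add1n; exact: leq_add.
rewrite -[in RHS](cat_take_drop K (flatten ess)) flatten_cat nth_cat size_layers ?size_takel //; first by rewrite mulnC hu.
by move: hall; rewrite -{1}(cat_take_drop K (flatten ess)) all_cat => /andP[].
Qed.

End Shape.

Hypotheses (e2 : 0 <= 1 - 2 * eps) (v1 : 0 < v <= 1) (lr01 : 0 < last_rate <= 1)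
  (r0 : 1 - tauL 10 <= rate 0 <= 1).
Let beta := P w (fun x => ~ Ln true 0 0 N s rho x) / del.
Hypotheses (hz : beta * (v^-1) ^+ 10 <= 1 / 2) (htau : 2 * beta * (v^-1) ^+ 10 * (last_rate^-1) ^+ 10 <= tauL 10).

(** The environment is averaged last. Its bits are read as layers, the layers as runs closed by a
    good one, and [cascade] is applied for each sample of [m] runs; the rates obtained form a law to
    which the lattice result at scale 10 applies. *)
Theorem layer_surv B m : finP B -> depP B (envdom m) ->
  (forall y b T, (m <= T)%N -> reached y 0 T start b -> B y) -> 1 / 2 <= P w B.
Proof.
move=> fB dB hB; have [hL mL] := layers_mass.
have N0 : (0 < N)%N by rewrite muln_gt0.
have [J hJ] := rows_surv hL mL bad_layers v1 lr01 hz htau r0 (fun b => erefl) m.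
apply: le_trans hJ _.
have dB' : depP B (envdom (N * m)).
  apply: depP_sub dB => -[//|u] /= hu; have : (m <= N * m)%N by rewrite leq_pmull.
  by move: hu; clear; lia.
rewrite (anneal p q fB dB') -(AE_pow (env_law q) N m (fun es => P w (fun x => B (mix (nth false es) x)))).
have mL1 : mass layers <= 1 by rewrite mL.
apply: le_trans (AE_read good_layer J hL mL1 _ (leqnn m)); last by move=> es; exact: P_ge0.
rewrite /surv /rows (AE_map (fun e : seq (seq bool) => rate (size e).-1)).
have hS := @SR_shape _ good_layer (fun l => size l == N) layers J [::] layers_size.
apply: (AE_le_supp (Q := fun e => [&& (0 < size e)%N, all (fun l => size l == N) e & good_layer (last [::] e)])
  (nneg_SR good_layer J hL) hS) => ess sz hess.
pose env := nth false (flatten (flatten ess)).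
have -> : P w (fun x => B (mix (nth false (flatten (take m (flatten ess)))) x)) = P w (fun x => B (mix env x)).
  apply: P_eq => x; have e i : envdom (N * m) i -> mix (nth false (flatten (take m (flatten ess)))) x i = mix env x i.
    by case: i => [//|u] hu /=; apply: (take_env sz hess); move: hu => /=; clear; lia.
  by split; apply: dB' => i /e.
pose bs j := (size (nth [::] ess j)).-1.
apply: (@cascade env bs m _ e2) => //.
- apply: unit_nth; apply/allP => r /mapP[e _ ->]; exact: (row_rate v1 lr01 r0 (fun b => erefl)).
- by move=> j jm; rewrite (nth_map [::]) ?sz.
- by move=> j jm; exact: (good_at sz hess jm).
- exact: start_rich.
move=> y b; apply: hB; elim: (m) => //= k IH.
by rewrite -addn1; apply: leq_add => //; apply: leq_trans N0 _; rewrite leq_pmull.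
Qed.

End RowSurvival.
End Layer.

(** * Numerical conditions on the rates *)

Section Rates.
Context {R : realType}.
Implicit Types (tau v X A W L i : R).

(** To be read with [i], [A], [W] equal to [v ^ -1], [v ^ -10], [v ^ 21] and [L] the tenth power of
    the inverse of [last_rate]. The letters hide high powers from the arithmetic. *)
Lemma bad_rate tau v i A W X L : 0 < tau <= 1024^-1 -> 0 < v -> 0 < i -> v * i = 1 -> 1 <= A -> W * (i * (A * A)) = 1 ->
  0 <= X <= tau ^+ 2 / 8192 * W -> L <= 1024 * A ->
  X / (v * tau / 4) * A <= 1 / 2 /\ 2 * (X / (v * tau / 4)) * A * L <= tau.
Proof.
move=> /andP[t0 t1] v0 i0 vi A1 e /andP[X0 X1] hL.
have A0 : 0 <= A by apply: le_trans A1.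
have pos : 0 <= i * (A * A) by rewrite !mulr_ge0 // ltW.
have hX : X * (i * (A * A)) <= tau ^+ 2 / 8192.
  by have := ler_wpM2r pos X1; rewrite -[leRHS]mulrA e mulr1.
have hXA : X * (i * A) <= tau ^+ 2 / 8192.
  by apply: le_trans hX; rewrite ler_wpM2l // ler_wpM2l ?(ltW i0) // ler_peMl.
have ti : 0 <= 8192 * tau^-1 by rewrite mulr_ge0 // invr_ge0 ltW.
have dE : X / (v * tau / 4) = 4 / tau * (X * i).
  have vn : v != 0 by rewrite gt_eqF.
  have -> : i = v^-1 by apply: (mulfI vn); rewrite vi mulfV.
  by field; rewrite !gt_eqF.
have tE : 8192 * tau^-1 * (tau ^+ 2 / 8192) = tau by field; rewrite gt_eqF.
rewrite dE; split.
  have := ler_wpM2l ti hXA; rewrite tE => h.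
  have -> : 4 / tau * (X * i) * A = 8192 * tau^-1 * (X * (i * A)) / 2048 by field; rewrite gt_eqF.
  by rewrite ler_pdivrMr //; apply: le_trans h _; apply: le_trans t1 _; clear; lra.
have p0 : 0 <= 2 * (4 / tau * (X * i)) * A by rewrite !mulr_ge0 ?invr_ge0 ?(ltW t0) ?(ltW i0).
apply: le_trans (ler_wpM2l p0 hL) _.
have := ler_wpM2l ti hX; rewrite tE; apply: le_trans.
rewrite le_eqVlt; apply/orP; left; apply/eqP; field; rewrite gt_eqF //.
Qed.

(** The exponent 21 is [1 + 10 + 10]: one power of [v] from dividing by [del], ten for a bad layer
    and ten for the layer closing the run, since [last_rate] is at least [v / 2]. *)
Lemma rate_bounds tau v X (eps := tau / 8) (del := v * tau / 4) : 0 < tau <= 1024^-1 -> 0 < v <= 1 ->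
  0 <= X <= tau ^+ 2 / 8192 * v ^+ 21 ->
  [/\ 0 < last_rate eps v del <= 1, 1 - tau <= rate eps v del 0 <= 1, X / del * v^-1 ^+ 10 <= 1 / 2 &
   2 * (X / del) * v^-1 ^+ 10 * (last_rate eps v del)^-1 ^+ 10 <= tau].
Proof.
move=> ht hv hX; have [t0 t1] : 0 < tau /\ tau <= 1024^-1 by case/andP: ht.
have [v0 v1] : 0 < v /\ v <= 1 by case/andP: hv.
have vi : v * v^-1 = 1 by rewrite mulfV // gt_eqF.
have i1 : 1 <= v^-1 by rewrite invr_ge1 ?unitfE ?gt_eqF.
have i0 : 0 < v^-1 by rewrite invr_gt0.
have e : v ^+ 21 * (v^-1 * (v^-1 ^+ 10 * v^-1 ^+ 10)) = 1 by rewrite -exprD -exprS -exprMn vi expr1n.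
have lr : v / 2 <= last_rate eps v del <= v /\ 1 - tau <= rate eps v del 0 <= 1.
  move: t0 t1 v0 v1; clear; rewrite /last_rate /rate /eps /del => t0 t1 v0 v1.
  have vt1 : v * tau <= tau by rewrite ler_piMl // ltW.
  have vt0 : 0 <= v * tau by rewrite mulr_ge0 // ltW.
  have vt2 : v * tau <= v / 1024 by rewrite ler_wpM2l // ltW.
  have tt0 : 0 <= tau * tau by rewrite mulr_ge0 // ltW.
  have tt1 : tau * tau <= tau by rewrite ler_piMl ?(ltW t0) //; lra.
  by split; apply/andP; split; lra.
case: lr => /andP[lr1 lr2] hr.
have lr0 : 0 < last_rate eps v del by apply: lt_le_trans lr1; rewrite divr_gt0.
have lri : (last_rate eps v del)^-1 ^+ 10 <= 1024 * v^-1 ^+ 10.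
  rewrite -two10 -exprMn lerXn2r ?nnegrE ?invr_ge0 ?mulr_ge0 ?(ltW lr0) ?(ltW i0) //.
  by rewrite -[2 * _]invrK lef_pV2 ?posrE ?invr_gt0 ?mulr_gt0 // invfM invrK mulrC.
have [h1 h2] := bad_rate ht v0 i0 vi (exprn_ege1 10 i1) e hX lri.
by split=> //; rewrite lr0; apply: le_trans lr2 v1.
Qed.

(** [v] is of order [h ^ -2], hence [v ^ 21] of order [h ^ -42]; the exponent 43 leaves a factor [h]
    to beat all constants. *)
Lemma large_power (G : R) : 0 < G -> exists h0, forall h n, (h0 <= h)%N -> (0 < n)%N -> (16 * n <= h)%N ->
  2 * (h ^ 43)%:R^-1 <= G * ((240 * (32 * n)%:R ^+ 2)^-1) ^+ 21 :> R.
Proof.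
move=> G0; have [c c0 cE] : exists2 c : R, 0 < c & (960^-1) ^+ 21 = c by exists ((960^-1) ^+ 21); rewrite // exprn_gt0 // invr_gt0.
have [h0 hh0] := ex_nat_gt (2 / (G * c)); exists h0 => h n /hh0; rewrite ler_pdivrMr ?mulr_gt0 // => hc n0 nh.
have hp' : 0 < (h%:R : R) by rewrite ltr0n; apply: leq_trans nh; rewrite muln_gt0.
have e1 : (960 * (h%:R : R) ^+ 2)^-1 <= (240 * (32 * n)%:R ^+ 2)^-1.
  have n1 : 0 < ((32 * n)%:R : R) by rewrite ltr0n muln_gt0.
  have n2 : ((32 * n)%:R : R) <= 2 * h%:R by rewrite -natrM ler_nat (_ : (32 * n = 2 * (16 * n))%N) ?leq_mul2l // mulnA.
  rewrite lef_pV2 ?posrE ?mulr_gt0 ?exprn_gt0 //.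
  have : ((32 * n)%:R : R) ^+ 2 <= (2 * h%:R) ^+ 2 by rewrite lerXn2r ?nnegrE ?(ltW n1) // mulr_ge0.
  have e4 : (2 : R) ^+ 2 = 4 by rewrite -natrX.
  by rewrite exprMn e4; move: ((32 * n)%:R ^+ 2) (h%:R ^+ 2 : R) => u b hu; lra.
have e2 : 2 * (h ^ 43)%:R^-1 <= G * ((960 * (h%:R : R) ^+ 2)^-1) ^+ 21.
  have -> : ((960 * (h%:R : R) ^+ 2)^-1) ^+ 21 = c * h%:R * ((h ^ 43)%:R)^-1.
    rewrite natrX invfM exprMn cE -mulrA; congr (_ * _).
    by field; rewrite gt_eqF.
  rewrite [leRHS]mulrA ler_wpM2r ?invr_ge0 //; move: hc; by rewrite mulrC -mulrA.
apply: le_trans e2 _; rewrite ler_wpM2l ?(ltW G0) // lerXn2r ?nnegrE ?invr_ge0 ?mulr_ge0 ?exprn_ge0 //; exact: ltW.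
Qed.

End Rates.

(** * The two slopes and the fixed vector *)

Section Slopes.
Context {R : realType}.
Variables (p q : R).
Hypotheses (hp : 0 <= p <= 1) (hq : 0 <= q <= 1).
Notation w := (hom p q).
Let hw : prob_weight w := hom_prob hp hq.

Lemma slope_ex e (c : R) : (forall K N, mu p q e K N <= c * N%:R) -> exists s,
  [/\ s <= c, forall K N, mu p q e K N <= s * N%:R & forall eta, 0 < eta -> exists K N, (s - eta) * N%:R < mu p q e K N].
Proof.
move=> hc; pose S := [set r : R | exists K N, (0 < N)%N /\ r = mu p q e K N / N%:R]%classic.
have ubS : ubound S c.
  by move=> _ [K [N [N0 ->]]]; rewrite ler_pdivrMr ?ltr0n.
have S0 : S (mu p q e 0 1 / 1%:R) by exists 0%N, 1%N.
have hS : has_sup S by split; [exists (mu p q e 0 1 / 1%:R)|exists c].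
exists (sup S); split.
- by apply: ge_sup => //; exists (mu p q e 0 1 / 1%:R).
- move=> K [|N]; first by have := hc K 0%N; rewrite !mulr0.
  rewrite -ler_pdivrMr ?ltr0n //; apply: sup_upper_bound => //; by exists K, N.+1.
move=> eta eta0; have [_ [K [N [N0 ->]]] h] := sup_adherent eta0 hS.
by exists K, N; rewrite -ltr_pdivlMr ?ltr0n.
Qed.

Lemma mu_le_add e K j n : mu p q e K n <= mu p q e (K + j) n.
Proof.
elim: j => [|j IH]; first by rewrite addn0.
apply: le_trans IH _; rewrite addnS !mu_sum big_ord_recr /= lerDl subr_ge0; exact: P_le1.
Qed.

(** The gain of [gain_mu] holds at all large truncation levels and does not depend on them; since
    the truncated means increase with the level, it passes to the suprema. *)
Lemma slope_gap : 0 < p < 1 -> 0 < q -> (forall K N, mu p q false K N <= 2 * N%:R) -> exists sigma alpha c : R,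
  [/\ 0 < c, sigma <= 2, 0 <= alpha & alpha + c <= sigma] /\
  (forall d, 0 < d -> exists n0, forall n, (n0 <= n)%N -> P w (fun x => ~ Ln false 0 0 n sigma (d * n%:R) x) <= d) /\
  (forall d, 0 < d -> exists n0, forall n, (n0 <= n)%N -> P w (fun x => ~ Ln true 0 0 n alpha (d * n%:R) x) <= d).
Proof.
move=> /andP[p0 p1] q0 hmu; have [sigma [s2 s_le s_sup]] := slope_ex hmu.
pose c := q * ((1 - p) * p) / 4.
have c0 : 0 < c by rewrite divr_gt0 // !mulr_gt0 // subr_gt0.
have hmu' K N : mu p q true K N <= (sigma - c) * N%:R.
  have [K1 hK1] := reach_half hp hq N p0 (@divr_gt0 R 1 2 ltr01 (ltr0n R 2)).
  have hK : 1 / 2 <= P w (reach false N (K + K1)%N%:Z).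
    have : P w (reach false N K1%:Z) <= P w (reach false N (K + K1)%N%:Z).
      by apply: (P_sub hw); [exact: reach_fin|exact: reach_fin|move=> x; apply: reach_le; lia].
    by move=> h; lra.
  have g := gain_mu hp hq hK; have m1 := mu_le_add true K (K1 + (K + K1)).+1 N.
  have m2 := s_le (K + K1 + (K + K1)).+1 N.
  rewrite addnS addnA in m1; rewrite -/c in g; lra.
have [alpha [a2 a_le a_sup]] := slope_ex hmu'.
exists sigma, alpha, c; split; first by split; [|by []|exact: (slope_ge0 hp hq a_le)|lra].
split=> d d0; exact: line_lim.
Qed.

Lemma mem_grid (N : nat) (u v : int) : - N%:Z <= u <= N%:Z -> - (4 * N%:Z) <= v <= 4 * N%:Z ->
  (u, v) \in [seq (z%:Z - N%:Z, a%:Z - 4 * N%:Z) | z <- iota 0 (2 * N).+1, a <- iota 0 (8 * N).+1].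
Proof.
move=> h1 h2; apply/allpairsP; exists (absz (u + N%:Z), absz (v + 4 * N%:Z)); split; rewrite ?mem_iota /=; [lia|lia|].
by congr (_, _); lia.
Qed.

(** Pigeonhole over the starting point and the displacement: there are at most [27 * N ^ 2] pairs
    with [N = 32 * n], and [27 / 120] is less than one half. *)
Lemma vec_large (n U : nat) (sigma : R) : 0 <= sigma <= 2 -> (0 < n)%N -> (U <= 2 * n)%N ->
  1 / 2 <= P w (Ln false 0 0 (32 * n) sigma (U%:R / 8)) ->
  exists a, (120 * (32 * n)%:R ^+ 2)^-1 <= P w (vec n U sigma a 0 0).
Proof.
move=> /andP[sg0 sg2] n0 Un hL; apply: contrapT => hno; pose N := (32 * n)%N.
have N0 : 0 < (N%:R : R) by rewrite ltr0n muln_gt0.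
pose c : R := (120 * N%:R ^+ 2)^-1.
have N2 : 0 < 120 * (N%:R : R) ^+ 2 by rewrite mulr_gt0 // exprn_gt0.
have lt a : P w (vec n U sigma a 0 0) <= c.
  by rewrite leNgt; apply/negP => h; apply: hno; exists a; rewrite ltW.
pose I := [seq (z%:Z - N%:Z, a%:Z - 4 * N%:Z) | z <- iota 0 (2 * N).+1, a <- iota 0 (8 * N).+1].
have hU : P w (Ln false 0 0 N sigma (U%:R / 8)) <= P w (fun x => exists2 j, j \in I & vec n U sigma j.2 j.1 0 x).
  apply: (P_sub hw); [exact: Ln_fin|by apply: finP_bigU => j _; exact: vec_fin|move=> x [g [h1 h2]]].
  have h0 := h2 0%N isT; have hN := h2 N (leqnn N).
  have UN : U%:R <= (N%:R : R) / 16.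
    by have : U%:R <= ((2 * n)%:R : R) by [rewrite ler_nat]; rewrite /N !natrM; lra.
  have U0 : 0 <= (U%:R : R) by [].
  have sN : 0 <= sigma * N%:R <= 2 * N%:R by rewrite mulr_ge0 //= ler_wpM2r.
  rewrite !add0n mulr0 addr0 subr0 ler_norml in h0; rewrite !add0n add0r ler_norml in hN.
  case/andP: h0 => a1 a2; case/andP: hN => b1 b2; case/andP: sN => s1 s2.
  exists (g 0%N, g N - g 0%N).
    have z1 : - N%:Z <= g 0%N <= N%:Z.
      by apply/andP; split; rewrite -(ler_int R) ?intrN -[N%:~R]/(N%:R : R); lra.
    have z2 : - (4 * N%:Z) <= g N - g 0%N <= 4 * N%:Z.
      by apply/andP; split; rewrite -(ler_int R) ?intrN intrB intrM -[N%:~R]/(N%:R : R); lra.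
    exact: mem_grid.
  exists g; split=> //=; last by rewrite addrC subrK.
  split=> // t tn; rewrite add0n.
  have := h2 t tn; rewrite add0n add0r => ht.
  have -> : (g t)%:~R - ((g 0%N)%:~R + sigma * t%:R) = ((g t)%:~R - sigma * t%:R) - (g 0%N)%:~R by ring.
  apply: le_trans (ler_normB _ _) _.
  have h0 : `|(g 0%N)%:~R| <= U%:R / 8 :> R by rewrite ler_norml; apply/andP; split.
  by apply: le_trans (lerD ht h0) _; lra.
have hI : (size I)%:R * c <= 27 / 120.
  have -> : size I = ((2 * N).+1 * (8 * N).+1)%N by rewrite size_allpairs !size_iota.
  rewrite /c ler_pdivrMr //.
  have key (r : R) : 1 <= r -> (2 * r + 1) * (8 * r + 1) <= 27 / 120 * (120 * r ^+ 2).
    by move=> r1; have : r <= r * r by [rewrite ler_peMl //; lra]; rewrite expr2; lra.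
  have e1 k : k.+1%:R = k%:R + 1 :> R by rewrite -natr1.
  rewrite natrM (e1 (2 * N)%N) (e1 (8 * N)%N) (natrM _ 2 N) (natrM _ 8 N); apply: key; by rewrite ler1n -(ltr0n R).
have := P_bigU hw (r := I) (A := fun j => vec n U sigma j.2 j.1 0) (c := c).
have h1 : forall j, j \in I -> finP (vec n U sigma j.2 j.1 0) by move=> j _; exact: vec_fin.
have h2 : forall j, j \in I -> P w (vec n U sigma j.2 j.1 0) <= c by move=> j _; rewrite P_vec.
by move=> /(_ h1 h2); lra.
Qed.


Lemma Ln_short e z t0 m n s (r r' : R) x : (m <= n)%N -> r <= r' -> Ln e z t0 n s r x -> Ln e z t0 m s r' x.
Proof.
move=> mn rr [g [h1 h2]]; exists g; split; first by apply: track_sub h1 _ _; rewrite ?leq_add2l.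
by move=> t tm; apply: le_trans (h2 t (leq_trans tm mn)) rr.
Qed.

Lemma P_nLn_short e m n s (r r' : R) : (m <= n)%N -> r <= r' ->
  P w (fun x => ~ Ln e 0 0 m s r' x) <= P w (fun x => ~ Ln e 0 0 n s r x).
Proof.
move=> mn rr; apply: (P_sub hw); [by apply: finP_not; exact: Ln_fin|by apply: finP_not; exact: Ln_fin|].
by move=> x h1 h2; apply: h1; apply: Ln_short h2.
Qed.

End Slopes.
(** All inputs of [layer_surv] are probabilities of finitely many events of finite range. They are
    obtained at [p] with a factor 2 to spare, so they persist at [p - d] for some [d > 0]. *)
Theorem survival_below {R : realType} (p q : R) : 0 <= p <= 1 -> 0 <= q <= 1 -> 0 < p < 1 -> 0 < q -> (forall K N, mu p q false K N <= 2 * N%:R) -> exists (p1 : R) (U : nat),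
  0 <= p1 < p /\ forall B m, finP B -> depP B (envdom m) ->
    (forall y b T, (m <= T)%N -> reached y 0 T (fun o => start U o) b -> B y) -> 1 / 2 <= P (hom p1 q) B.
Proof.
move=> hp hq p01 q0 hmu; have hw := hom_prob hp hq; pose w := hom p q.
have [sigma [alpha [c [[c0 sg2 al0 gap] [off on]]]]] := slope_gap hp hq p01 q0 hmu.
have [tau [tau0 tau1 tauE]] : exists tau : R, [/\ 0 < tau, tau <= 1024^-1 & tauL 10 = tau].
  exists (tauL 10); have /andP[z0 z1] := z_small (R := R) (leqnn 10); rewrite /tauL; split=> //.
    exact: exprn_gt0.
  have z2 : zz 10 <= 1 :> R by apply: le_trans z1 _; rewrite invf_le1 // ler1n.
  by rewrite exprS; apply: le_trans z1; rewrite ler_piMr ?(ltW z0) // exprn_ile1 ?(ltW z0).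
have [eps [eps0 epsE]] : exists eps : R, 0 < eps /\ eps = tau / 8 by exists (tau / 8); rewrite divr_gt0.
have eps18 : eps <= 1 / 8 by rewrite epsE; clear -tau1; lra.
have ee0 : 0 < eps ^+ 2 / 2 by rewrite divr_gt0 // exprn_gt0.
have ee1 : eps ^+ 2 / 2 <= 1 / 2.
  rewrite ler_pM2r ?invr_gt0 // exprn_ile1 ?(ltW eps0) //; apply: le_trans eps18 _; clear; lra.
have gam0 : 0 < c / 2 by rewrite divr_gt0.
have [C /(_ C (leqnn C)) hC] := ex_nat_gt (24 / (c / 2)); rewrite ler_pdivrMr // in hC.
pose dm e := Num.min e (eps ^+ 2 / 2).
have dm0 e : 0 < e -> 0 < dm e by move=> h; rewrite lt_min h.
have offU e : 0 < e -> exists n0, forall m (r : R), (n0 <= m)%N -> e * m%:R <= r ->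
    P w (fun x => ~ Ln false 0 0 m sigma r x) <= eps ^+ 2 / 2.
  move=> he; have [n0 h] := off _ (dm0 e he); exists n0 => m r hm hr.
  apply: le_trans (P_nLn_short hp hq false sigma (leqnn m) (_ : dm e * m%:R <= r)) _.
    by apply: le_trans hr; rewrite ler_wpM2r // ge_min lexx.
  by apply: le_trans (h m hm) _; rewrite ge_min lexx orbT.
have [m0 hm0] := offU (c / 2 / 24) (divr_gt0 gam0 (ltr0n R 24)).
have hoff n : (m0 <= n)%N -> P w (fun x => ~ Ln false 0 0 n sigma (c / 2 / 24 * n%:R) x) <= 1 / 2.
  by move=> hn; apply: le_trans (hm0 n _ hn (lexx _)) ee1.
(* For lines of length at most [32 * n] this width is at most [c * n / 40], hence at most [U / 8]
   since [U] will be at least [c * n / 5]. *)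
have [m1 hm1] := offU (c / 1280) (divr_gt0 c0 (ltr0n R 1280)).
(* It makes [c * n] at least 6000, hence [U] at least 1000. *)
have [n2 hn2] := ex_nat_gt (60 * 100 / c).
have G0 : 0 < tau ^+ 2 / 8192 by rewrite divr_gt0 // exprn_gt0.
have [h0 hh0] := large_power G0.
have d0 : 0 < c / 2000 by rewrite divr_gt0.
have ga : alpha + c / 2 <= sigma - c / 2 by clear -gap; lra.
have [h [s [r [hh hpos /andP[sa1 sa2] /andP[r0 r1] hX]]]] :=
  super_polynomial hp hq sg2 gam0 hC hoff al0 ga on 43 (16 * (maxn (maxn m1 n2) h0).+1)%N d0.
pose n := (h %/ 16)%N.
have nbig : (maxn (maxn m1 n2) h0 < n)%N by rewrite /n leq_divRL // mulnC.
have nh : (16 * n <= h)%N by rewrite mulnC leq_divM.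
have hn : (h < 16 * n.+1)%N by rewrite mulnC ltn_ceil.
have [nm1 [nn2 nh0]] : (m1 < n)%N /\ (n2 < n)%N /\ (h0 < n)%N by move: nbig; rewrite !gtn_max => /andP[/andP[-> ->] ->].
have npos : (0 < n)%N by exact: leq_ltn_trans nm1.
have N1 : 1 <= (n%:R : R) by rewrite ler1n.
have cn : 60 * 100 <= c * n%:R by have := hn2 n (ltnW nn2); rewrite ler_pdivrMr // [leRHS]mulrC.
have hR : (h%:R : R) <= 32 * n%:R.
  have : (h%:R : R) <= (16 * n.+1)%:R by rewrite ler_nat ltnW.
  by rewrite natrM -natr1; clear -N1; lra.
clearbody n.
have s0 : 0 <= s by apply: le_trans sa1.
pose g := (sigma - s) * n%:R.
have g1 : 1999 / 2000 * (c * n%:R) <= g.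
  have : (1999 / 2000 * c) * n%:R <= g by rewrite ler_wpM2r //; clear -sa2 gap; lra.
  by rewrite -mulrA.
have g2 : g <= 2 * n%:R by rewrite ler_wpM2r //; clear -s0 sg2; lra.
have gg0 : 0 <= 16 * g / 30 by clear -g1 cn; lra.
(* The unit of width for which a layer shifts lines by [30 * U] relative to the axis. *)
pose U := Num.truncn (16 * g / 30).
have /andP[U1 U2] := truncn_itv gg0; rewrite -/U -natr1 in U1 U2.
have UR : c * n%:R / 5 <= U%:R by clear -g1 cn U2; lra.
have rU : r <= U%:R / 8.
  have : c / 2000 * h%:R <= c / 2000 * (32 * n%:R) by apply: ler_wpM2l hR; rewrite divr_ge0 // (ltW c0).
  by move=> h3; clear -h3 r1 UR cn; lra.
have U2n : (U <= 2 * n)%N by rewrite -(ler_nat R) natrM; clear -U1 g2 N1; lra.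
have lnf (k : nat) : (0 < k)%N -> (k <= 32)%N -> P w (fun x => ~ Ln false 0 0 (k * n) sigma (U%:R / 8) x) <= eps ^+ 2 / 2.
  move=> k0 k32; apply: hm1; first by apply: leq_trans (ltnW nm1) _; rewrite leq_pmull.
  have : (k%:R : R) * (c * n%:R) <= 32 * (c * n%:R) by rewrite ler_wpM2r ?ler_nat // mulr_ge0 // ltW.
  by rewrite natrM => h3; rewrite [_ * (k%:R * _)](_ : _ = k%:R * (c * n%:R) / 1280); [clear -h3 UR; lra|ring].
have sg02 : 0 <= sigma <= 2 by rewrite sg2 andbT; clear -gap al0 c0; lra.
have hLn : 1 / 2 <= P w (Ln false 0 0 (32 * n) sigma (U%:R / 8)).
  by have := lnf 32%N isT isT; rewrite P_not; [move: ee1; clear; lra|exact: Ln_fin].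
have [a ha] := vec_large hp hq sg02 npos U2n hLn.
(* Half of what [vec_large] gives at [p]; the other half is spent on continuity. *)
pose v : R := (240 * (32 * n)%:R ^+ 2)^-1.
have N2 : 1 <= ((32 * n)%:R : R) ^+ 2 by rewrite exprn_ege1 // ler1n muln_gt0.
have v0 : 0 < v by rewrite invr_gt0 mulr_gt0 //; apply: lt_le_trans N2.
have v1 : v <= 1 by rewrite invf_le1; [move: N2; clear; lra|rewrite mulr_gt0 //; apply: lt_le_trans N2].
have vE : (120 * (32 * n)%:R ^+ 2)^-1 = 2 * v.
  rewrite /v; move: N2; move: (_ ^+ 2) => u hu; field; rewrite gt_eqF //; apply: lt_le_trans hu; exact: ltr01.
have h43 : 0 < (h ^ 43)%:R^-1 :> R by rewrite invr_gt0 ltr0n expn_gt0 hpos.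
have X0 : P w (fun x => ~ Ln true 0 0 (32 * n) s (U%:R / 8) x) <= (h ^ 43)%:R^-1.
  have n2h : (32 * n <= 2 * h)%N by rewrite (_ : (32 * n = 2 * (16 * n))%N) ?leq_mul2l // mulnA.
  apply: le_trans (P_nLn_short hp hq true s n2h rU) _.
  by rewrite -[leRHS]mul1r ler_pdivlMr // -invr_gt0.
have fR := finP_not (Ln_fin false 0 0 (30 * n) sigma (U%:R / 8)).
have fL := finP_not (Ln_fin false 0 0 (13 * n) sigma (U%:R / 8)).
have fX := finP_not (Ln_fin true 0 0 (32 * n) s (U%:R / 8)).
have [d1 d10 c1] := P_cont hp hq fR ee0.
have [d2 d20 c2] := P_cont hp hq fL ee0.
have [d3 d30 c3] := P_cont hp hq (vec_fin n U sigma a 0 0) v0.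
have [d4 d40 c4] := P_cont hp hq fX h43.
have p0 : 0 < p by case/andP: p01.
have [d [dpos dd1 dd2 [dd3 dd4 ddp]]] : exists d, [/\ 0 < d, d <= d1, d <= d2 & [/\ d <= d3, d <= d4 & d <= p]].
  exists (Num.min (Num.min d1 d2) (Num.min (Num.min d3 d4) p)).
  by rewrite !lt_min d10 d20 d30 d40 p0 !ge_min !lexx !orbT; split=> //; split.
exists (p - d), U; split; first by apply/andP; split; clear -dpos ddp; lra.
have hp1 : 0 <= p - d <= 1 by apply/andP; case/andP: hp => _ pp; split; clear -dpos ddp pp; lra.
have nd : `|p - (p - d)| = d by rewrite opprB addrC subrK gtr0_norm.
have {}c1 := c1 _ hp1; have {}c2 := c2 _ hp1; have {}c3 := c3 _ hp1; have {}c4 := c4 _ hp1.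
rewrite nd in c1 c2 c3 c4; move: (c1 dd1) (c2 dd2) (c3 dd3) (c4 dd4) => {c1 c2 c3 c4}.
rewrite !ler_norml => /andP[c1 _] /andP[c2 _] /andP[_ c3] /andP[c4 _].
have pR : P (hom (p - d) q) (fun x => ~ Ln false 0 0 (30 * n) sigma (U%:R / 8) x) <= eps ^+ 2.
  by have := lnf 30%N isT isT; move: c1; clear; lra.
have pL : P (hom (p - d) q) (fun x => ~ Ln false 0 0 (13 * n) sigma (U%:R / 8) x) <= eps ^+ 2.
  by have := lnf 13%N isT isT; move: c2; clear; lra.
have pv : v <= P (hom (p - d) q) (vec n U sigma a 0 0) by rewrite vE in ha; move: ha c3; clear; lra.
have pX : 0 <= P (hom (p - d) q) (fun x => ~ Ln true 0 0 (32 * n) s (U%:R / 8) x) <= tau ^+ 2 / 8192 * v ^+ 21.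
  rewrite P_ge0 /=; last exact: hom_prob.
  have h0h : (h0 <= h)%N by apply: leq_trans (ltnW nh0) _; apply: leq_trans nh; rewrite leq_pmull.
  apply: le_trans (hh0 h n h0h npos nh); move: X0 c4; clear; lra.
have tau01 : 0 < tau <= 1024^-1 by rewrite tau0.
have v01 : 0 < v <= 1 by rewrite v0.
have := rate_bounds tau01 v01 pX; cbv zeta; rewrite -epsE => -[b1 b2 b3 b4].
have ss : s <= sigma by clear -sa2 gap c0; lra.
have eps1 : eps < 1 by apply: le_lt_trans eps18 _; clear; lra.
have e2 : 0 <= 1 - 2 * eps by clear -eps18; lra.
have del0 : 0 < v * tau / 4 by rewrite divr_gt0 // mulr_gt0.
rewrite -tauE in b1 b2 b3 b4 del0.
have G1 : 30 * U%:R <= 16 * ((sigma - s) * n%:R) by rewrite -/g; clear -U1; lra.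
have G2 : 16 * ((sigma - s) * n%:R) <= 30 * U%:R + 30 by rewrite -/g; clear -U2; lra.
have U1000 : 1000 <= U%:R :> R by clear -UR cn; lra.
move=> B m fB dB hB.
exact (layer_surv hp1 hq npos s0 ss sg2 G1 G2 U1000 eps0 pR pL eps1 (ltW v0) pv del0 e2 v01 b1 b2 b3 b4 fB dB hB).
Qed.

(** * From tracks back to percolation *)

Section LongPaths.
Implicit Types (x y : coord -> bool).

Lemma vp_right b n x (a c r : int) : a <= c -> vp b n x (a, r) -> (forall k, a <= k <= c -> x (inl (k, r))) ->
  exists2 m, (n <= m)%N & vp b m x (c, r).
Proof.
move=> ac hv; have -> : c = a + (absz (c - a))%:Z by lia.
elim: (absz (c - a)) => [|d IH] h; first by exists n; rewrite // addr0.
have [m nm hm] : exists2 m, (n <= m)%N & vp b m x (a + d%:Z, r) by apply: IH => k hk; apply: h; lia.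
exists m.+1; first exact: leqW.
split; first by apply: h; lia.
by constructor 1; rewrite (_ : (a + d.+1%:Z, r).1 - 1 = a + d%:Z) //=; lia.
Qed.

Lemma track_vp x t g : track true x 0 t g -> g 0%N = 0 -> exists2 n, (t <= n)%N & vp true n x (g t, 2 * t%:Z).
Proof.
move=> + g0; elim: t => [|t IH] hg; first by exists 0%N; rewrite //= g0.
have [n tn hv] : exists2 n, (t <= n)%N & vp true n x (g t, 2 * t%:Z).
  by apply: IH => u /andP[u0 ut]; apply: hg; rewrite ltnS u0 ltnW.
have e1 : 2 * t.+1%:Z = 2 * t%:Z + 2 by lia.
rewrite e1; have := hg t; rewrite leq0n ltnSn => /(_ isT)[].
  move=> [c [/andP[ac cb] h1 h2]].
  have v1 : vp true n.+1 x (g t, 2 * t%:Z + 1).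
    by split; [apply: h1; rewrite lexx|constructor 2; rewrite /= addrK].
  have [m nm hm] := vp_right ac v1 h1.
  have v2 : vp true m.+1 x (c, 2 * t%:Z + 2).
    by split; [apply: h2; rewrite lexx|constructor 2; rewrite /= (_ : _ - 1 = 2 * t%:Z + 1) //; lia].
  by have [m' mm hm'] := vp_right cb v2 h2; exists m' => //; lia.
move=> [_ [he [ab h2]]].
have v1 : vp true n.+1 x (g t, 2 * t%:Z + 2).
  split; first by apply: h2; rewrite lexx.
  by constructor 3; rewrite /= addrK; split=> //; exists t%:Z.
by have [m' mm hm'] := vp_right ab v1 h2; exists m' => //; lia.
Qed.

Lemma perc_le b n x : perc b n.+1 x -> perc b n x.
Proof. by move=> [v [_ [h|h|[_ h _]]]]; [exists (v.1 - 1, v.2)|exists (v.1, v.2 - 1)|exists (v.1, v.2 - 2)]. Qed.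

Lemma perc_leq b m n x : (m <= n)%N -> perc b n x -> perc b m x.
Proof. by move=> /subnKC <-; elim: (n - m)%N => [|d IH]; rewrite ?addn0 // addnS => /perc_le. Qed.

Lemma perc_env b n : depP (perc b n) (envdom n).
Proof.
move=> x y xy [v hv]; exists v; have [m mn] : exists m, (m <= n)%N by exists n.
suff H k : (k <= n)%N -> forall v, vp b k x v -> vp b k y v by apply: H.
elim: k => [|k IH] kn [l r] // hw; have := vp_bound hw; move: hw => /= [h1 h2] [b1 b2 b3].
split; first by rewrite -(xy (inl (l, r))).
case: h2 => [h|h|[hb h [u [hu xu]]]]; [constructor 1|constructor 2|constructor 3]; try by apply: IH => //; lia.
have := vp_bound h => /= -[c1 c2 _]; split=> //; first by apply: IH => //; lia.
by exists u; split=> //; rewrite -(xy (inr u)) //=; lia.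
Qed.

End LongPaths.

Section BelowCritical.
Context {R : realType}.
Implicit Types (p q c : R).

(** The renormalised process starts from some point of the base of a cell, between 0 and [19 * U]. A
    union bound over these points and translation invariance bring the start to the origin. *)
Lemma perc_below p q : 0 <= p <= 1 -> 0 <= q <= 1 -> 0 < p < 1 -> 0 < q -> (forall K N, mu p q false K N <= 2 * N%:R) ->
  exists p1 c, [/\ 0 <= p1 < p, 0 < c & forall n, c <= P (hom p1 q) (perc true n)].
Proof.
move=> hp hq p01 q0 hmu; have [p1 [U [hp1 h]]] := survival_below hp hq p01 q0 hmu.
have hp1' : 0 <= p1 <= 1.
  by case/andP: hp1 => h1 h2; case/andP: hp => _ h3; rewrite h1 /=; apply: ltW; apply: lt_le_trans h2 h3.
have hw := hom_prob hp1' hq.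
pose I := [seq k%:Z | k <- iota 0 (19 * U).+1].
exists p1, (2 * (size I)%:R)^-1; split=> // [|n]; first by rewrite invr_gt0 mulr_gt0 // ltr0n size_map size_iota.
have sI : 0 < (size I)%:R :> R by rewrite ltr0n size_map size_iota.
pose B x := exists2 z, z \in I & perc true n (x \o sh z 0).
have fz z : finP (fun x => perc true n (x \o sh z 0)) by apply: finP_shift; exact: perc_fin.
have fB : finP B by apply: finP_bigU => z _; exact: fz.
have dB : depP B (envdom n).
  move=> x y xy [z zI hz]; exists z => //; apply: perc_env hz => -[v|u] hu; apply: xy => //=.
  by rewrite addr0.
have := h B n fB dB; have hU : P (hom p1 q) B <= (size I)%:R * P (hom p1 q) (perc true n).
  apply: (P_bigU hw) => [z _|z _]; first exact: fz.
  by rewrite (P_shift p1 q z 0 (perc_fin true n)).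
move=> hB; have {hB} : 1 / 2 <= P (hom p1 q) B.
  apply: hB => y b T nT [g [g1 g2 _]]; exists (g 0%N).
    move: g2; rewrite /start /inner !add0r => /andP[g2 g3].
    apply/mapP; exists (absz (g 0%N)); last by move: g2; clear; lia.
    by rewrite mem_iota; move: g2 g3; clear; lia.
  have g1' : track true (y \o sh (g 0%N) 0%N%:Z) 0 T (fun t => g t - g 0%N).
    by apply/track_shift; rewrite !addn0; apply: track_eq g1 => t _; rewrite subn0 subrK.
  have [m Tm hv] := track_vp g1' (subrr _).
  by apply: (perc_leq (leq_trans nT Tm)); exists ((g T - g 0%N), 2 * T%:Z).
move=> hB; rewrite invfM -ler_pdivlMr ?invr_gt0 // invrK mulrC.
by apply: le_trans hU; apply: le_trans hB; rewrite div1r.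
Qed.

(** Otherwise [low_tail] would make a displacement of slope 2 exponentially unlikely, against
    [reach_perc]. *)
Lemma mu_perc p q c : 0 <= p <= 1 -> 0 <= q <= 1 -> 0 < c -> (forall n, c <= P (hom p q) (perc false n)) ->
  forall K N, mu p q false K N <= 2 * N%:R.
Proof.
move=> hp hq c0 hc K N; rewrite leNgt; apply/negP => hlt; have hw := hom_prob hp hq.
have g0 : 0 < mu p q false K N - 2 * N%:R by rewrite subr_gt0.
have [M /(_ M (leqnn M)) hM] := ex_nat_gt ((mu p q false K N - 2 * N%:R)^-1).
have M0 : (0 < M)%N by rewrite -(ltr0n R); apply: lt_le_trans hM; rewrite invr_gt0.
have [rho [rho01 hrho]] : exists rho : R, 0 <= rho < 1 /\
    forall k, P (hom p q) (reach false (k * (M * N)) (k * (2 * (M * N)))%N) <= rho ^+ k.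
  apply: (low_tail hp hq (K := K)).
  have : 1 <= M%:R * (mu p q false K N - 2 * N%:R) by rewrite -ler_pdivrMr // div1r.
  by rewrite !natrM mulrBr mulrCA; lra.
have c2 : 0 < c / 4 by rewrite divr_gt0.
have [k /(_ k (leqnn k)) hk] := geo_small rho01 c2.
have := reach_perc (k * (M * N)) hp hq; have := hc (4 * (k * (M * N)))%N; have := hrho k.
have -> : (k * (2 * (M * N)))%N%:Z = 2 * (k * (M * N))%N%:Z by rewrite mulnCA PoszM.
lra.
Qed.

(** At fixed [K] and [N] the mean is a finite sum of probabilities of events of finite range, so the
    bound passes to the limit from above although percolation may be lost there. *)
Lemma mu_right_cont p q : 0 <= p < 1 -> 0 <= q <= 1 ->
  (forall p', p < p' <= 1 -> forall K N, mu p' q false K N <= 2 * N%:R) -> forall K N, mu p q false K N <= 2 * N%:R.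
Proof.
move=> /andP[p0 p1] hq h K N; have hp : 0 <= p <= 1 by rewrite p0 ltW.
apply/ler_addgt0Pr => e e0; pose e' := e / K.+1%:R.
have e0' : 0 < e' by rewrite divr_gt0.
have [d d0 hd] : exists2 d, 0 < d & forall p', 0 <= p' <= 1 -> `|p - p'| <= d -> forall j : nat, (j < K)%N ->
    `|P (hom p q) (reach false N j) - P (hom p' q) (reach false N j)| <= e'.
  elim: (K) => [|k [d d0 IH]]; first by exists 1.
  have [d' d0' hd'] := P_cont hp hq (reach_fin false N k) e0'.
  exists (Num.min d d'); first by rewrite lt_min d0.
  move=> p' hp'; rewrite le_min => /andP[h1 h2] j; rewrite ltnS leq_eqVlt => /orP[/eqP ->|]; first exact: hd'.
  exact: IH.
pose p' := p + Num.min d (1 - p).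
have m0 : 0 < Num.min d (1 - p) by rewrite lt_min d0 subr_gt0.
have m1 : Num.min d (1 - p) <= 1 - p by rewrite ge_min lexx orbT.
have m2 : Num.min d (1 - p) <= d by rewrite ge_min lexx.
have hp' : 0 <= p' <= 1 by rewrite /p'; apply/andP; split; lra.
have hpp : p < p' <= 1 by rewrite /p'; apply/andP; split; lra.
have nd : `|p - p'| <= d by rewrite distrC /p' addrAC subrr add0r gtr0_norm.
have := h p' hpp K N; rewrite !mu_sum => hN.
apply: le_trans (lerD hN (lexx e)).
have Ke : K%:R * e' <= e.
  rewrite /e' mulrCA ler_piMr ?(ltW e0) // ler_pdivrMr ?mul1r ?ler_nat //.
apply: le_trans (lerD (lexx _) Ke).
have -> : K%:R * e' = \sum_(j < K) e' by rewrite sumr_const card_ord mulr_natl.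
rewrite -big_split /=; apply: ler_sum => j _.
by have := hd p' hp' nd j (ltn_ord j); rewrite ler_norml => /andP[h1 _]; lra.
Qed.

(** With all sites closed the displacement truncated at 3 equals 3. The slope bound thus fails at
    [p = 0], which makes the critical value positive. *)
Lemma mu_zero q : 0 <= q <= 1 -> 2 * 1%:R < mu 0 q false 3 1.
Proof.
move=> hq; have hp : 0 <= (0 : R) <= 1 by rewrite lexx ler01.
have hw := hom_prob hp hq.
have z (j : nat) : P (hom 0 q) (reach false 1 j) = 0.
  apply/eqP; rewrite eq_le P_ge0 ?andbT //.
  pose I := [seq k%:Z | k <- iota 0 j.+1].
  have f (k : int) : finP (fun x : coord -> bool => x (inl (k, 2))) by exact: finP_coord.
  apply: (@le_trans _ _ (P (hom 0 q) (fun x => exists2 k, k \in I & x (inl (k, 2))))).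
    apply: (P_sub hw); [exact: reach_fin|by apply: finP_bigU|].
    move=> x [g [h1 h2 h3]]; exists (g 1%N); last by have := step_open_end (h1 0%N isT).
    have h4 : g 0%N <= g 1%N := step_le (h1 0%N isT).
    apply/mapP; exists (absz (g 1%N)); last by move: h2 h4; clear; lia.
    by rewrite mem_iota; move: h2 h3 h4; clear; lia.
  apply: le_trans (P_bigU hw (c := 0) _ _) _; [by []| |by rewrite mulr0].
  move=> k _; have e0 := P_all_open hp hq (r := [:: inl (k, 2)]) isT.
  rewrite big_seq1 /= in e0; rewrite -[leRHS]e0; apply: (P_sub hw) => //.
    by exists (absz k + 2)%N => x y xy hx i; rewrite inE => /eqP ->; rewrite -xy; [apply: hx; rewrite inE|move=> /=; lia].
  by move=> x hx i; rewrite inE => /eqP ->.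
rewrite mu_sum (eq_bigr (fun=> 1)) => [|j _]; last by rewrite z subr0.
by rewrite sumr_const card_ord mulr1 ltr_nat.
Qed.

End BelowCritical.

(** * Percolation at high density *)

Section HighDensity.
Context {R : realType}.
Implicit Types (x y : coord -> bool).

Lemma AE_single (T : Type) (e : T) n (f : seq T -> R) : AE [:: (1, e)] n f = f (nseq n e).
Proof. by elim: n f => //= n IH f; rewrite big_seq1 mul1r IH. Qed.

(** Row [j] is the antidiagonal of vertices whose coordinates add up to [j], numbered so that the
    two unit edges out of a vertex are those of [spr]. *)
Definition vtx (j : nat) (k : int) : int * int := ((j./2)%:Z + k, (uphalf j)%:Z - k).

Definition sweep (j : nat) x (X : int -> Prop) : int -> Prop := fun l => exists k, [/\ X k, x (inl (vtx j k)) & l \in spr j k].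

(** Site [k] of row [j] has a parent reached by an open path; its own state has not been read
    yet. *)
Definition fed j x k := if j is i.+1 then exists v, vp false i x v /\ (vtx j k = (v.1 + 1, v.2) \/ vtx j k = (v.1, v.2 + 1))
  else k = 0.

Lemma sweep_fed j x X l : (forall k, X k -> fed j x k) -> sweep j x X l -> fed j.+1 x l.
Proof.
move=> h [k [/h hk hx hl]]; exists (vtx j k); split.
  case: j hk hx {h hl} => [/= ->|i [v [hv e]] hx]; first by rewrite /vtx.
  split=> //; case: e => ->; [constructor 1|constructor 2]; rewrite /= addrK; by case: (v) hv.
move: hl; rewrite in_spr /vtx /=; case oj : (odd j) => /orP[] /eqP ->; [left|right|right|left];
  congr (_, _); move: oj; clear; lia.
Qed.

Lemma run_fed i m x X l : (forall k, X k -> fed i x k) -> run sweep i m x X l -> fed (i + m) x l.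
Proof.
elim: m i X => [|m IH] i X h /=; first by rewrite addn0; apply: h.
by rewrite -addSnnS; apply: IH => k; apply: sweep_fed.
Qed.

(** A law with one point of density [1 - tauL 10] belongs to the class at scale 10, so the result
    for random rows also shows that the critical value is below 1. *)
Lemma perc_high (q : R) : 0 <= q <= 1 -> exists p : R, 0 <= p < 1 /\ forall n, 1 / 2 <= P (hom p q) (perc false n).
Proof.
move=> hq; pose p : R := 1 - tauL 10; have /andP[z0 z1] := z_small (R := R) (leqnn 10).
have t0 : 0 < tauL 10 :> R by rewrite /tauL exprn_gt0.
have t1 : tauL 10 < 1 :> R by rewrite /tauL exprn_ilt1 ?ltW //; lra.
have hp : 0 <= p <= 1 by rewrite /p; apply/andP; split; lra.
have p0 : 0 < p by rewrite /p; lra.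
exists p; split=> [|n]; first by rewrite /p; apply/andP; split; lra.
have hL : cls 10 [:: (1 : R, p)].
  split; rewrite /nneg /= ?ler01 ?p0 /mass ?big_seq1 //; first by case/andP: hp => _ ->.
  by rewrite big_cons big_nil /nrm lexx /=; apply: ltW.
have mL : mass [:: (1 : R, p)] = 1 by rewrite /mass big_seq1.
pose N := n.+1; have := surv_half N (leqnn 10) hL mL; rewrite /surv AE_single => hS; apply: le_trans hS _.
rewrite (@QS_ext _ _ (fun=> p)); last by move=> j; rewrite add0n nth_nseq => /andP[_ ->].
pose w := hom p q; have hw : prob_weight w := hom_prob hp hq; pose M := (2 * N)%N.
have dP : depP (perc false n) (inbox M).
  by move=> x y xy [v hv]; exists v; apply: vp_dep hv => i hi; apply: xy; apply: inbox_le hi; rewrite leq_mul2l leqnSn orbT.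
rewrite (P_box w xfalse dP).
pose occ (j : nat) (X : int -> Prop) (k : int) := `|k| <= j%:Z /\ X k.
apply: (le_trans (@transfer _ _ w (boxl M) xfalse (fun j i => exists k, i = inl (vtx j k)) _ sweep occ
  (fun X => exists k, X k) (fun=> p) N N 0%N (fun k => k = 0) [:: 0] hw _ _ _ (add0n N) _ _ _)).
- by move=> j.
- by move=> j k l jk [a ->] [b []]; rewrite /vtx => e1 e2; apply: jk; move: e1 e2; clear; lia.
- move=> j X x y xy; apply: funext => l; apply: propext; split=> -[k [h1 h2 h3]]; exists k; split=> //.
    by rewrite -xy //; exists k.
  by rewrite xy //; exists k.
- move=> j X Y jN hY; exists (fun k x => x (inl (vtx j k))), (fun k i => i = inl (vtx j k)); split.
  + by move=> k _ x y xy; rewrite xy.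
  + by move=> k l i _ _ kl -> [e _]; apply: kl; move: e; clear; lia.
  + move=> k kY; have [hk _] := hY k kY; rewrite (Pr_open hw) //; apply: cover_boxl.
    by rewrite /= /vtx /M; move: hk jN; clear; lia.
  move=> x k l kY hx hl; have [hk hX] := hY k kY; split; last by exists k.
  by move: hl hk; rewrite in_spr; case: (odd j) => /orP[] /eqP ->; clear; lia.
- by move=> X k [_ hX]; exists k.
- by move=> k; rewrite inE => /eqP ->; split.
apply: Pr_sub => // x [l hl].
have : fed N x l by apply: (run_fed (i := 0) (X := fun k => k = 0)) hl.
by move=> [v [hv _]]; exists v.
Qed.

End HighDensity.

From mathcomp Require Import ereal topology normedtype sequences measure.
Import numFieldNormedType.Exports.
Local Open Scope classical_set_scope.

(** * Critical values *)

Section Cylinders.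
Context {R : realType} {I : countType} (w : I -> R).
Hypothesis w01 : forall i, 0 <= w i <= 1.
Implicit Types (A : set (config I)) (J s : seq I) (e : I -> bool).

Let law := bernoulli_productP w01.

Lemma measurable_coord (i : I) b : measurable [set x : config I | x i = b].
Proof.
have ht : measurable [set x : config I | x i = true] by apply: sub_sigma_algebra; exists i.
case: b => //; rewrite (_ : [set x : config I | _] = ~` [set x : config I | x i = true]); first exact: measurableC.
by apply/seteqP; split=> x /=; case: (x i).
Qed.

Definition agree J e : set (config I) := [set x | forall i, i \in J -> x i = e i].

Lemma measurable_agree J e : measurable (agree J e).
Proof.
elim: J => [|i J IH].
  by rewrite (_ : agree _ _ = setT); [exact: measurableT|apply/seteqP; split].
rewrite (_ : agree _ _ = [set x : config I | x i = e i] `&` agree J e); first by apply: measurableI => //; exact: measurable_coord.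
apply/seteqP; split=> x /=; first by move=> h; split=> [|j jJ]; apply: h; rewrite inE ?eqxx // jJ orbT.
by move=> [h1 h2] j; rewrite inE => /orP[/eqP ->|/h2].
Qed.

(** The coordinates of [s] move one by one to the prescribed list [J], in the order in which [Ex]
    draws them; when none is left, [A] holds on all of the cylinder or nowhere on it. *)
Lemma cylinder J s e A : uniq (J ++ s) -> depP A (fun i => i \in J ++ s) -> measurable (agree J e `&` A) /\
  bernoulli_product w (agree J e `&` A) = ((\prod_(i <- J) if e i then w i else 1 - w i) * Ex w s (ind A) e)%:E.
Proof.
elim: s J e => [|i s IH] J e.
  rewrite cats0 => uJ dA; have [Ae|Ae] := pselect (A e).
    rewrite (_ : _ `&` A = agree J e); last first.
      by apply/seteqP; split=> [x []//|x hx]; split=> //; apply: dA Ae => j jJ; rewrite hx.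
    by split; [exact: measurable_agree|rewrite /= ind_t // mulr1; exact: law].
  rewrite (_ : _ `&` A = set0); last first.
    by apply/seteqP; split=> // x [hx Ax]; apply: Ae; apply: dA Ax => j jJ; rewrite hx.
  by rewrite measure0 /= ind_f // mulr0.
move=> uJ dA; pose e' b := upd e i b.
have uJ' : uniq ((i :: J) ++ s) by rewrite -(perm_uniq (_ : perm_eq (J ++ i :: s) _)) // perm_catC /= perm_cons perm_catC.
have dA' : depP A (fun j => j \in (i :: J) ++ s).
  by apply: depP_sub dA => j; rewrite !mem_cat !inE => /or3P[] ->; rewrite ?orbT.
have iJ : i \notin J by move: uJ'; rewrite /= mem_cat => /andP[/norP[]].
have E : agree J e `&` A = (agree (i :: J) (e' true) `&` A) `|` (agree (i :: J) (e' false) `&` A).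
  apply/seteqP; split=> x.
    move=> [hx Ax]; case xi : (x i); [left|right]; split=> // j;
      by rewrite inE /e' /upd; case: eqP => [->//|_] /= /hx.
  have H b : (agree (i :: J) (e' b) `&` A) x -> (agree J e `&` A) x.
    move=> [hx Ax]; split=> // j jJ; rewrite hx ?inE ?jJ ?orbT // /e' /upd.
    by case: eqP => // ji; rewrite -ji jJ in iJ.
  by case=> /H.
have [mt et] := IH (i :: J) (e' true) uJ' dA'; have [mf ef] := IH (i :: J) (e' false) uJ' dA'.
have pe b : \prod_(j <- i :: J) (if e' b j then w j else 1 - w j) =
    (if b then w i else 1 - w i) * \prod_(j <- J) (if e j then w j else 1 - w j).
  rewrite big_cons /e' {1}/upd eqxx; congr (_ * _); rewrite big_seq [RHS]big_seq; apply: eq_bigr => j jJ.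
  by rewrite /upd; case: eqP => // ji; rewrite -ji jJ in iJ.
rewrite E; split; first exact: measurableU.
have mU : bernoulli_product w ((agree (i :: J) (e' true) `&` A) `|` (agree (i :: J) (e' false) `&` A)) =
    (bernoulli_product w (agree (i :: J) (e' true) `&` A) + bernoulli_product w (agree (i :: J) (e' false) `&` A))%E.
  apply: measureU => //; apply/seteqP; split=> // x [[h1 _] [h2 _]]; have := h1 i; have := h2 i; rewrite inE eqxx /e' /upd eqxx.
  by move=> -> // /(_ isT).
rewrite mU et ef -EFinD; congr (_%:E); rewrite !pe /=; ring.
Qed.

Lemma law_dep s A b : depP A (fun i => i \in s) -> measurable A /\ bernoulli_product w A = (Ex w s (ind A) b)%:E.
Proof.
move=> dA; have dA' : depP A (fun i => i \in [::] ++ undup s) by apply: depP_sub dA => i; rewrite mem_undup.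
have e : agree [::] b `&` A = A by apply/seteqP; split=> [x []//|x Ax]; split.
have [] := @cylinder [::] (undup s) b A (undup_uniq s) dA'; rewrite e big_nil mul1r => mA ->; split=> //.
congr (_%:E); apply: (eq_Ex_coord _ _ _ (dep_ind dA)) => i //; by rewrite mem_undup.
Qed.

End Cylinders.

(** * Infinite paths and paths of every length *)

Section Koenig.
Implicit Types (x : vertex + int -> bool) (u v : vertex).

Fixpoint ext n x v : Prop := if n is n'.+1 then exists u, [/\ enhanced_open_edge x v u, x (inl u) & ext n' x u] else True.

Lemma ext_le n x v : ext n.+1 x v -> ext n x v.
Proof. by elim: n v => // n IH v [u [h1 h2 h3]]; exists u; split=> //; apply: IH. Qed.

Lemma ext_leq m n x v : (m <= n)%N -> ext n x v -> ext m x v.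
Proof. by move=> /subnKC <-; elim: (n - m)%N => [|d IH]; rewrite ?addn0 // addnS => /ext_le. Qed.

Lemma vp_edge m x v : vp true m.+1 x v -> x (inl v) /\ exists2 u, vp true m x u & enhanced_open_edge x u v.
Proof.
case: v => [k l] [hx h]; split=> //; case: h => /= [h|h|[_ h [u [hu xu]]]].
- by exists (k - 1, l) => //; left; left; rewrite /= subrK.
- by exists (k, l - 1) => //; left; right; rewrite /= subrK.
exists (k, l - 2) => //; right; exists u; split=> //; split; rewrite /= ?hu //; lia.
Qed.

Lemma ext_vp m k x v : vp true m x v -> ext k x v -> ext (m + k) x (0, 0).
Proof.
elim: m k v => [|m IH] k v; first by move=> /= ->.
by move=> /vp_edge[hx [u hu huv]] hk; rewrite addSnnS; apply: (IH k.+1 u hu); exists v.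
Qed.

Lemma edge_vp m x u v : vp true m x u -> enhanced_open_edge x u v -> x (inl v) -> vp true m.+1 x v.
Proof.
case: u => a b hu [[|]|[n [xn [/= h]]]] /= -> hv; split=> //.
- by constructor 1; rewrite /= addrK.
- by constructor 2; rewrite /= addrK.
by constructor 3; split=> //=; [rewrite addrK -h|exists n].
Qed.

(** A vertex has three possible successors. If each of them failed at some depth, a path from [v]
    longer than the sum [N] of these depths could not exist. *)
Lemma ext_next x v : (forall n, ext n x v) ->
  exists u, [/\ enhanced_open_edge x v u, x (inl u) & forall n, ext n x u].
Proof.
move=> hv; apply: contrapT => hno.
have [u|f hf] := @choice vertex nat (fun u n => enhanced_open_edge x v u -> x (inl u) -> ~ ext n x u).
  have [h|h] := pselect (forall n, ext n x u).
    by exists 0%N => h1 h2; exfalso; apply: hno; exists u.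
  by have /existsNP[n hn] := h; exists n.
pose N := (f (v.1 + 1, v.2)%R + f (v.1, v.2 + 1)%R + f (v.1, v.2 + 2)%R)%N.
have [u [h1 h2 h3]] := hv N.+1; apply: (hf u h1 h2); apply: ext_leq h3; rewrite /N.
case: h1 => [[->|->]|[n [_ [<- ->]]]]; last exact: leq_addl.
  by rewrite -addnA leq_addr.
exact: leq_trans (leq_addl _ _) (leq_addr _ _).
Qed.

Lemma koenig x : enhanced_percolation x <-> forall n, perc true n x.
Proof.
split=> [[g [g0 hg]] n|h].
  exists (g n); elim: n => [|n IH]; first by rewrite g0.
  by have [h1 h2] := hg n; apply: edge_vp h1 h2.
have e0 n : ext n x (0, 0) by have [v hv] := h n; rewrite -[n]addn0; apply: (ext_vp (k := 0) hv).
have [v|f hf] := @choice vertex vertex (fun v u => (forall n, ext n x v) ->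
    [/\ enhanced_open_edge x v u, x (inl u) & forall n, ext n x u]).
  have [hv|hv] := pselect (forall n, ext n x v); last by exists v => /hv.
  by have [u hu] := ext_next hv; exists u.
have hi i : forall n, ext n x (iter i f (0, 0)) by elim: i => //= i IH; have [] := hf _ IH.
by exists (fun i => iter i f (0, 0)); split=> // i; have [] := hf _ (hi i).
Qed.

End Koenig.

Section Positivity.
Context {R : realType}.

(** Continuity from above: the limit of a decreasing sequence is positive exactly when the sequence
    has a positive lower bound. *)
Lemma bigcap_pos (I : countType) (w : I -> R) (B : nat -> set (config I)) (a : nat -> R) :
  (forall n, measurable (B n) /\ bernoulli_product w (B n) = (a n)%:E) -> (forall n, B n.+1 `<=` B n) ->
  (0 < bernoulli_product w (\bigcap_n B n))%E <-> exists2 c, 0 < c & forall n, c <= a n.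
Proof.
move=> hB dB; have mB n : measurable (B n) by case: (hB n).
have eB n : bernoulli_product w (B n) = (a n)%:E by case: (hB n).
have mI : measurable (\bigcap_n B n) by apply: bigcap_measurable => // n _.
have fI : bernoulli_product w (\bigcap_n B n) \is a fin_num.
  by apply: fin_num_measure.
split=> [h|[c c0 hc]].
  exists (fine (bernoulli_product w (\bigcap_n B n))); first by rewrite fine_gt0 // h ltey_eq fI.
  move=> n; rewrite -lee_fin fineK // -eB; apply: le_measure; rewrite ?inE //.
  exact: bigcap_inf.
have niB : nonincreasing_seq B.
  apply/nonincreasing_seqP => n; apply/subsetPset; exact: dB.
have hcv : bernoulli_product w \o B @ \oo --> bernoulli_product w (\bigcap_n B n).
  apply: nonincreasing_cvg_mu => //; apply: le_lt_trans (probability_le1 _ (mB 0%N)) _; exact: ltry.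
apply: (@lt_le_trans _ _ c%:E); first by rewrite lte_fin.
rewrite -(cvg_lim _ hcv) //; apply: lime_ge; first by apply/cvg_ex; exists (bernoulli_product w (\bigcap_n B n)).
by apply: nearW => n; rewrite /= eB lee_fin.
Qed.

End Positivity.

(** * Critical values through finite events *)

Section CriticalValues.
Context {R : realType}.
Implicit Types (p q : R).

Definition percolates p q := exists2 c, 0 < c & forall n, c <= P (hom p q) (perc true n).

Lemma enhanced_pos p q : 0 <= p <= 1 -> 0 <= q <= 1 -> (0 < enhanced_law p q enhanced_percolation)%E <-> percolates p q.
Proof.
move=> hp hq.
have -> : enhanced_percolation = \bigcap_n [set x : enhanced_config | perc true n x].
  by apply/seteqP; split=> x; [move=> /koenig h n _; exact: h|move=> h; apply/koenig => n; exact: h].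
apply: (bigcap_pos (a := fun n => P (hom p q) (perc true n))) => [n|n x]; last exact: perc_le.
have d : depP (perc true n) (inbox (2 * n)) by move=> x y xy [v hv]; exists v; apply: vp_dep hv.
have hw : forall i : vertex + int, 0 <= (if i is inl _ then p else q) <= 1 by case.
rewrite (P_box (hom p q) xfalse d).
have [|h1 h2] := law_dep hw (A := [set x : enhanced_config | perc true n x]) (s := boxl (2 * n)) xfalse.
  by apply: depP_sub d; exact: cover_boxl.
by split.
Qed.

Lemma AE_env0 m (f : seq bool -> R) : AE (env_law 0) m f = f (nseq m false).
Proof. by elim: m f => //= m IH f; rewrite big_cons big_seq1 /= mul0r add0r subr0 mul1r IH. Qed.

Definition no_edges (x : vertex -> bool) : vertex + int -> bool := fun i => if i is inl v then x v else false.

Definition sites M : seq vertex := pmap (fun i : coord => if i is inl v then Some v else None) (boxl M).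

(** Under [hom p 0] all long edges are almost surely closed, so the law of the sites alone suffices;
    this connects the enhanced law at [q = 0] with the classical model. *)
Lemma perc_no_edges p n b : P (hom p 0) (perc true n) =
  Ex (fun=> p) (sites (2 * n)) (ind (fun x => perc true n (no_edges x))) b.
Proof.
have d : depP (perc true n) (inbox (2 * n)) by move=> x y xy [v hv]; exists v; apply: vp_dep hv.
rewrite (anneal p 0 (perc_fin true n) (@perc_env true n)) AE_env0.
have dm : depP (fun x => perc true n (mix (nth false (nseq n false)) x)) (inbox (2 * n)) by exact: depP_mix.
rewrite (P_box _ (no_edges b) dm).
have e x : mix (nth false (nseq n false)) x = no_edges (x \o inl).
  by apply: funext => -[v|u] //=; rewrite nth_nseq if_same.
have hi : injective (inl : vertex -> coord) by move=> u v [].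
have -> : b = no_edges b \o inl by [].
rewrite -(Ex_shift (hom p 0) (sites (2 * n)) (ind (fun x => perc true n (no_edges x))) (no_edges b) hi).
have sE v : (v \in sites (2 * n)) = (inl v \in boxl (2 * n)).
  rewrite mem_pmap; apply/mapP/idP => [[[u|u] hu []// ->]//|h]; by exists (inl v).
rewrite /Pr; transitivity (Ex (hom p 0) (boxl (2 * n)) (fun x => ind (fun x => perc true n (no_edges x)) (x \o inl)) (no_edges b)).
  by apply: eq_Ex => x; rewrite /ind e.
apply: (@eq_Ex_coord _ _ _ _ _ _ (fun i => inbox (2 * n) i /\ if i is inr _ then False else True)).
- move=> x y xy; apply: dep_ind (_ : depP (fun x => perc true n (no_edges x)) (fun v => inbox (2 * n) (inl v))) _ _ _.
    by move=> x' y' xy' /=; apply: d => -[v|u] //=; exact: xy'.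
  by move=> v hv; apply: (xy (inl v)).
- by move=> i [hi' _]; apply: cover_boxl.
by move=> [v|u] [hi' h] //; apply: map_f; rewrite sE; apply: cover_boxl.
Qed.

Lemma oriented_pos p : 0 <= p <= 1 -> (0 < oriented_law p oriented_percolation)%E <-> percolates p 0.
Proof.
move=> hp.
have -> : oriented_percolation = \bigcap_n [set x : config vertex | perc true n (no_edges x)].
  have H x : oriented_percolation x <-> enhanced_percolation (no_edges x).
    split=> -[g [g0 hg]]; exists g; split=> // i; have [h1 h2] := hg i; split=> //; first by left.
    by case: h1 => // -[u []].
  by apply/seteqP; split=> x; [move=> /H/koenig h n _; exact: h|move=> h; apply/H/koenig => n; exact: h].
apply: (bigcap_pos (a := fun n => P (hom p 0) (perc true n))) => [n|n x]; last exact: perc_le.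
have d : depP (perc true n) (inbox (2 * n)) by move=> x y xy [v hv]; exists v; apply: vp_dep hv.
rewrite (perc_no_edges p n xfalse).
apply: law_dep => [//|x y xy]; apply: d => -[v|u] //= hv; apply: xy.
by rewrite mem_pmap; apply/mapP; exists (inl v) => //; apply: cover_boxl.
Qed.

Lemma percolates_incr p p' q : 0 <= p <= 1 -> 0 <= p' <= 1 -> 0 <= q <= 1 -> p <= p' -> percolates p q -> percolates p' q.
Proof.
move=> hp hp' hq pp [c c0 hc]; exists c => // n; apply: le_trans (hc n) _.
apply: P_incr (hom_prob hp hq) (hom_prob hp' hq) _ (@perc_incr true n) => -[v|u] //=.
Qed.

Lemma perc_off_le p q n : 0 <= p <= 1 -> 0 <= q <= 1 -> P (hom p 0) (perc true n) <= P (hom p q) (perc false n).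
Proof.
move=> hp hq; have h00 : 0 <= (0 : R) <= 1 by rewrite lexx ler01.
apply: (@le_trans _ _ (P (hom p 0) (perc false n))); last first.
  by apply: P_incr (hom_prob hp h00) (hom_prob hp hq) _ (@perc_incr false n) => -[v|u] //=; by case/andP: hq.
rewrite (anneal p 0 (perc_fin true n) (@perc_env true n)) AE_env0.
apply: (P_sub (hom_prob hp h00)); [exact: finP_mix (perc_fin _ _)|exact: perc_fin|].
have env0 u : nth false (nseq n false) u = false by rewrite nth_nseq if_same.
move: (nth false _) env0 => env env0 x [v hv]; exists v.
elim: n v hv => //= m IH v [hv h]; split=> //.
by case: h => [/IH h|/IH h|[_ _ [u [_]]]]; [constructor 1|constructor 2|rewrite env0].
Qed.

Lemma perc_on n x : perc false n x -> perc true n x.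
Proof.
move=> [v hv]; exists v; elim: n v hv => //= m IH v [hv h]; split=> //.
by case: h => [/IH h|/IH h|[]//]; [constructor 1|constructor 2].
Qed.

Lemma pcE q : 0 <= q <= 1 -> pc q = inf [set p | 0 <= p <= 1 /\ percolates p q].
Proof.
move=> hq; congr inf; apply/seteqP; split=> p [hp h]; split=> //; by apply/(enhanced_pos hp hq).
Qed.

End CriticalValues.

Theorem theorem5 (R : realType) (q : R) (hq : 0 < q <= 1) :
  pc q < pc (0 : R) /\ pc (0 : R) = pc_oriented R.
Proof.
have h00 : 0 <= (0 : R) <= 1 by rewrite lexx ler01.
have hq' : 0 <= q <= 1 by case/andP: hq => h1 h2; rewrite ltW.
have q0 : 0 < q by case/andP: hq.
split; last first.
  by rewrite pcE //; congr inf; apply/seteqP; split=> p [hp h]; split=> //; apply/(oriented_pos hp).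
pose S (r : R) := [set p : R | 0 <= p <= 1 /\ percolates p r].
have lbS r : lbound (S r) 0 by move=> p [/andP[]].
rewrite !pcE // -/(S q) -/(S 0); set p0 := inf (S 0).
have [ph [/andP[ph0 ph1] hph]] := perc_high h00.
have Sph : S 0 ph.
  have hp : 0 <= ph <= 1 by rewrite ph0 ltW.
  split=> //; exists (1 / 2); first by rewrite divr_gt0.
  move=> n; apply: le_trans (hph n) _.
  by apply: (P_sub (hom_prob hp h00)); [exact: perc_fin|exact: perc_fin|exact: perc_on].
have iS : has_inf (S 0) by split; [exists ph|exists 0].
have p01 : p0 < 1 by apply: le_lt_trans ph1; apply: ge_inf => //; exists 0.
have p00 : 0 <= p0 by apply: lb_le_inf; [exists ph|].
(* Above the infimum there is percolation, which bounds the means; continuity carries the bound to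
   [p0], where percolation is not assumed. *)
have hmu : forall K N, mu p0 q false K N <= 2 * N%:R.
  apply: mu_right_cont; [by rewrite p00|by []|move=> p' /andP[pp p1]].
  have hp' : 0 <= p' <= 1 by rewrite p1 andbT ltW // (le_lt_trans p00).
  have [p2 [hp2 h2] lt2] : exists2 p2, S 0 p2 & p2 < p'.
    have e0 : 0 < p' - p0 by rewrite subr_gt0.
    have [p2 h2 lt2] := inf_adherent e0 iS; exists p2 => //.
    by move: lt2; rewrite -/p0 addrC subrK.
  have [c c0 hc] := percolates_incr hp2 hp' h00 (ltW lt2) h2.
  by apply: (mu_perc hp' hq' c0) => n; apply: le_trans (hc n) (perc_off_le n hp' hq').
(* The gain from long edges has the factor [(1 - p) * p], so the critical value must be strictly
   between 0 and 1. *)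
have p0_gt0 : 0 < p0.
  rewrite lt_def p00 andbT; apply/eqP => e; have := hmu 3%N 1%N; rewrite e leNgt.
  by rewrite mu_zero.
have hp0 : 0 <= p0 <= 1 by rewrite p00 ltW.
have hp01 : 0 < p0 < 1 by rewrite p0_gt0.
have [p1 [c [/andP[p10 p1p] c0 hc]]] := perc_below hp0 hq' hp01 q0 hmu.
apply: (le_lt_trans _ p1p); apply: ge_inf; first by exists 0.
split; last by exists c.
by rewrite p10 ltW // (lt_trans p1p p01).
Qed.
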